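(* Let $\mathbf{w}$ be an invertible polynomial in two variables with an admissible group of symmetries $\Gamma\subseteq\Gamma_{\mathbf{w}}$ of index $\ell$, and let $\check{\mathbf{w}}$ be its Berglund--Hübsch transpose. Then $\mathrm{mf}(\mathbb{C}^2,\Gamma,\mathbf{w})$ has a tilting object of length $$\frac{\mu(\check{\mathbf{w}})-1}{\ell}+\ell,$$ where $\mu(\check{\mathbf w})$ is the Milnor number of $\check{\mathbf w}$ at the origin. The same holds for $\mathrm{mf}(\mathbb{C}^2,\Gamma,\mathbf{w}_{\vec\varepsilon})$ for every deformation $\mathbf{w}_{\vec\varepsilon}=\mathbf{w}+\sum_{i=1}^N\varepsilon_ig_i$, $\vec\varepsilon\in\mathbb{C}^N$, which has only an isolated singularity, located at the origin; here $g_1,\dots,g_N$ are the monomials in $\mathrm{Jac}\,\mathbf{w}$ which have the same $\Gamma$-degree as $\mathbf{w}$.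
   Context: For a $2\times2$ matrix $A=(a_{ij})$ with non-negative integer entries, invertible over $\mathbb{Q}$, put $\mathbf{w}=\sum_i x_1^{a_{i1}}x_2^{a_{i2}}$ (with $x=x_1,y=x_2$); its Berglund--Hübsch transpose $\check{\mathbf{w}}$ is the polynomial associated to $A^T$. $\mathbf{w}$ is invertible if both $\mathbf{w}$ and $\check{\mathbf{w}}$ define isolated singularities at the origin. $\mathbf{w}$ is quasi-homogeneous: $\mathbf{w}(t^{d_1}x_1,t^{d_2}x_2)=t^h\mathbf{w}(x_1,x_2)$, $d_i>0$. The maximal symmetry group is $\Gamma_{\mathbf{w}}=\{(t_1,t_2,t_3)\in(\mathbb{C}^* )^3:t_1^{a_{11}}t_2^{a_{12}}=t_1^{a_{21}}t_2^{a_{22}}=t_3\}$; a subgroup $\Gamma\subseteq\Gamma_{\mathbf{w}}$ is admissible if it contains the image of $\mathbb{C}^*\to\Gamma_{\mathbf w}$, $t\mapsto(t^{d_1},t^{d_2},t^h)$. $\mathrm{mf}(\mathbb{C}^2,\Gamma,f)$ is the ($\mathbb{Z}$-graded) dg-category of $\Gamma$-equivariant matrix factorisations of $f$, where $f$ has degree given by the character $t_3|_\Gamma$. $\mathrm{Jac}\,\mathbf{w}=\mathbb{C}[x,y]/(\partial_x\mathbf{w},\partial_y\mathbf{w})$, and $N=\dim_{\mathbb C}\mathrm{HH}^2(\mathbb{C}^2,\Gamma,\mathbf{w})$, the second Hochschild cohomology of $\mathrm{mf}(\mathbb{C}^2,\Gamma,\mathbf{w})$. An object $\mathcal{E}$ of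 a pre-triangulated $A_\infty$/dg-category is tilting if $\mathrm{End}^i(\mathcal{E})=0$ for all $i\neq0$ (at the level of cohomology), and $\hom^\bullet(\mathcal{E},Y)=0$ (acyclic) implies $Y\simeq0$ for every object $Y$. When $\mathcal{E}$ is a direct sum of exceptional objects, its length is the length of the full strong exceptional collection formed by these objects. *)

(* Defs.v *)
(* MathComp, with R[i] over an arbitrary R : realType as the complex numbers. *)
From HB Require Import structures.
From mathcomp Require Import all_boot all_order all_algebra.
From mathcomp Require Import complex reals mpoly.

Set Implicit Arguments.
Unset Strict Implicit.
Unset Printing Implicit Defensive.

Import Order.TTheory GRing.Theory Num.Theory.
Local Open Scope ring_scope.

Notation "'poly2' R" := {mpoly R[i][2]} (at level 10, R at level 8).

(** ** Subquotients of vector spaces *)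

(* The classes of b_0, ..., b_(n-1) form a K-basis of Z / B. The action of K is
   an argument so that rings containing K need no separate module structure. *)
Definition subquot_basis (K : nzRingType) (V : zmodType) (scale : K -> V -> V)
    (Z B : V -> Prop) (n : nat) (b : 'I_n -> V) : Prop :=
  [/\ forall i, Z (b i),
      forall v, Z v -> exists c : 'I_n -> K, B (v - \sum_(i < n) scale (c i) (b i))
    & forall c : 'I_n -> K, B (\sum_(i < n) scale (c i) (b i)) ->
        forall i, c i = 0].

(** ** Plane hypersurface singularities *)

Definition origin (R : realType) : 'I_2 -> R[i] := fun=> 0.

Definition singular_at (R : realType) (f : poly2 R) (z : 'I_2 -> R[i]) : Prop :=
  f.@[z] = 0 /\ forall j : 'I_2, (f^`M(j)).@[z] = 0.

Definition isolated_singularity (R : realType) (f : poly2 R)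
    (z : 'I_2 -> R[i]) : Prop :=
  singular_at f z /\
  exists2 r : R[i], 0 < r &
    forall z' : 'I_2 -> R[i], singular_at f z' ->
      (forall j, `|z' j - z j| < r) -> z' =1 z.

Definition only_isolated_singularity_origin (R : realType) (f : poly2 R) : Prop :=
  isolated_singularity f (origin R) /\
  forall z : 'I_2 -> R[i], singular_at f z -> z =1 origin R.

Definition jacobian_ideal (R : realType) (f p : poly2 R) : Prop :=
  exists a : 'I_2 -> poly2 R, p = \sum_(j < 2) a j * f^`M(j).

Definition local_ring (R : realType) (z : 'I_2 -> R[i])
    (x : {fraction poly2 R}) : Prop :=
  exists p q : poly2 R, q.@[z] != 0 /\ x = tofrac p / tofrac q.

Definition local_jacobian_ideal (R : realType) (f : poly2 R)
    (z : 'I_2 -> R[i]) (x : {fraction poly2 R}) : Prop :=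
  exists a : 'I_2 -> {fraction poly2 R},
    (forall j, local_ring z (a j)) /\ x = \sum_(j < 2) a j * tofrac f^`M(j).

Definition is_milnor_number (R : realType) (f : poly2 R)
    (z : 'I_2 -> R[i]) (mu : nat) : Prop :=
  exists b : 'I_mu -> {fraction poly2 R},
    subquot_basis (fun (c : R[i]) x => tofrac c%:MP * x)
      (local_ring z) (local_jacobian_ideal f z) b.

(** ** Invertible polynomials and their symmetries *)

Definition poly_of_matrix (R : realType) (A : 'M[nat]_2) : poly2 R :=
  \sum_(i < 2) \prod_(j < 2) 'X_j ^+ A i j.

Definition invertible_polynomial (R : realType) (A : 'M[nat]_2) : Prop :=
  [/\ map_mx (fun n : nat => n%:R : rat) A \in unitmx,
      isolated_singularity (poly_of_matrix R A) (origin R)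
    & isolated_singularity (poly_of_matrix R A^T) (origin R)].

(* Points (t_1, t_2, t_3) of C^3, multiplied coordinatewise; (C^* )^3 is the set
   of units. *)
Definition tpoint (R : realType) : comUnitRingType := (R[i] * R[i] * R[i])%type.

Definition subgroup (R : realType) (G : tpoint R -> Prop) : Prop :=
  [/\ forall t, G t -> t \is a GRing.unit,
      G 1 & forall s t, G s -> G t -> G (s / t)].

Definition has_index (R : realType) (G H : tpoint R -> Prop) (l : nat) : Prop :=
  exists r : 'I_l -> tpoint R,
    (forall i, G (r i)) /\ forall t, G t -> exists! i, H (t / r i).

(* (t . p)(x, y) = p (t_1 x, t_2 y) *)
Definition torus_act (R : realType) (t : tpoint R) (p : poly2 R) : poly2 R :=
  p \mPo [tuple t.1.1 *: 'X_0; t.1.2 *: 'X_1].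

Definition quasi_homogeneous (R : realType) (f : poly2 R) (d1 d2 h : nat) : Prop :=
  [/\ (0 < d1)%N, (0 < d2)%N
    & forall u : R[i], u != 0 ->
        torus_act (u ^+ d1, u ^+ d2, u ^+ h) f = u ^+ h *: f].

Definition max_symmetry_group (R : realType) (A : 'M[nat]_2) (t : tpoint R) : Prop :=
  [/\ t \is a GRing.unit,
      t.1.1 ^+ A 0 0 * t.1.2 ^+ A 0 1 = t.2
    & t.1.1 ^+ A 1 0 * t.1.2 ^+ A 1 1 = t.2].

Definition admissible (R : realType) (A : 'M[nat]_2) (d1 d2 h : nat)
    (G : tpoint R -> Prop) : Prop :=
  [/\ subgroup G,
      forall t, G t -> max_symmetry_group A t
    & forall u : R[i], u != 0 -> G (u ^+ d1, u ^+ d2, u ^+ h)].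

(* Every algebraic character of a closed subgroup of (C^* )^3 is the restriction
   of a character t |-> t_1^m1 t_2^m2 t_3^m3. Weights are therefore kept as
   exponent vectors, and only their restrictions to the group are compared. *)
Definition weight : zmodType := (int * int * int)%type.

Definition eval_weight (R : realType) (m : weight) (t : tpoint R) : R[i] :=
  t.1.1 ^ m.1.1 * t.1.2 ^ m.1.2 * t.2 ^ m.2.

Definition chi : weight := (0, 0, 1).

Definition has_weight (R : realType) (G : tpoint R -> Prop) (m : weight)
    (p : poly2 R) : Prop :=
  forall t, G t -> torus_act t p = eval_weight m t *: p.

(* The monomials 'X_[g 0], ..., 'X_[g (N-1)] form a basis of the part of Jac w
   of the same G-degree as w. Their number N is determined by w and G: it is the
   dimension of that part, to which HH^2 of the matrix factorisations of w is
   isomorphic. *)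
Definition jacobian_monomials (R : realType) (G : tpoint R -> Prop) (w : poly2 R)
    (N : nat) (g : 'I_N -> 'X_{1..2}) : Prop :=
  subquot_basis (fun (c : R[i]) (p : poly2 R) => c *: p)
    (has_weight G chi) (jacobian_ideal w) (fun i => 'X_[g i] : poly2 R).

(** ** Equivariant matrix factorisations *)

(* A matrix factorisation P_0 -> P_1 -> P_0(chi) is unrolled to the sequence of
   free equivariant modules K^n with K^(2k) = P_0(k chi), K^(2k+1) = P_1(k chi),
   so that K^(n+2) = K^n(chi). A basis of such a sequence consists of generators
   e_j, of weight [wt j], in K^(pos j). Then e_j also generates a summand of
   K^(pos j + 2k), where its weight is [wt j - k chi]. *)
Record grbasis := GrBasis {
  rk : nat;
  pos : 'I_rk -> int;
  wt : 'I_rk -> weight }.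

(* Equivariant maps K^n -> K'^(n+m) compatible with the periodicity, as matrices
   acting on columns. *)
Definition hom_deg (R : realType) (G : tpoint R -> Prop) (m : int)
    (P Q : grbasis) (phi : 'M[poly2 R]_(rk Q, rk P)) : Prop :=
  forall i j, phi i j = 0 \/
    exists k : int, pos j + m = pos i + k *+ 2 /\
      has_weight G (wt j - wt i + chi *~ k) (phi i j).
Arguments hom_deg {R} G m P Q phi.

Record mf (R : realType) (G : tpoint R -> Prop) (f : poly2 R) := MF {
  mf_basis :> grbasis;
  mf_d : 'M[poly2 R]_(rk mf_basis);
  mf_d_hom : hom_deg G 1 mf_basis mf_basis mf_d;
  mf_d_sq : mf_d *m mf_d = f%:M }.

Section Category.
Context {R : realType} {G : tpoint R -> Prop} {f : poly2 R}.
Implicit Types X Y E : mf G f.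

Definition hom_d (m : int) X Y (phi : 'M[poly2 R]_(rk Y, rk X))
    : 'M[poly2 R]_(rk Y, rk X) :=
  mf_d Y *m phi - (-1) ^+ `|m|%N *: (phi *m mf_d X).
Arguments hom_d m X Y phi : clear implicits.

Definition closed_hom (m : int) X Y (phi : 'M[poly2 R]_(rk Y, rk X)) : Prop :=
  hom_deg G m X Y phi /\ hom_d m X Y phi = 0.
Arguments closed_hom m X Y phi : clear implicits.

Definition exact_hom (m : int) X Y (phi : 'M[poly2 R]_(rk Y, rk X)) : Prop :=
  exists2 psi : 'M[poly2 R]_(rk Y, rk X),
    hom_deg G (m - 1) X Y psi & phi = hom_d (m - 1) X Y psi.
Arguments exact_hom m X Y phi : clear implicits.

(* H^m (Hom (X, Y)) = 0 *)
Definition hom_coh0 (m : int) X Y : Prop :=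
  forall phi : 'M[poly2 R]_(rk Y, rk X),
    closed_hom m X Y phi -> exact_hom m X Y phi.

Definition homotopy_equivalent X Y : Prop :=
  exists (u : 'M[poly2 R]_(rk Y, rk X)) (v : 'M[poly2 R]_(rk X, rk Y)),
    [/\ closed_hom 0 X Y u, closed_hom 0 Y X v,
        exact_hom 0 X X (v *m u - 1%:M)
      & exact_hom 0 Y Y (u *m v - 1%:M)].

Lemma hom_deg0 m (P Q : grbasis) : hom_deg G m P Q 0.
Proof. by move=> i j; left; rewrite mxE. Qed.

Definition zero_basis : grbasis := @GrBasis 0 (fun=> 0) (fun=> 0).

Lemma zero_d_sq : (0 : 'M_(rk zero_basis)) *m 0 = f%:M.
Proof. by apply/matrixP=> -[]. Qed.

Definition mf_zero : mf G f := MF (@hom_deg0 1 zero_basis zero_basis) zero_d_sq.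

Definition shift_basis (P : grbasis) : grbasis :=
  GrBasis (fun j : 'I_(rk P) => pos j - 1) (@wt P).

Definition sum_basis (P Q : grbasis) : grbasis :=
  GrBasis
    (fun j => match split j with inl a => pos a | inr b => pos b end)
    (fun j : 'I_(rk P + rk Q) =>
       match split j with inl a => wt a | inr b => wt b end).

Lemma has_weightN m (p : poly2 R) : has_weight G m p -> has_weight G m (- p).
Proof. by move=> hp t Gt; rewrite /torus_act raddfN /= [_ \mPo _]hp // scalerN. Qed.

Lemma shift_d_hom (P : grbasis) (D : 'M[poly2 R]_(rk P)) :
  hom_deg G 1 P P D -> hom_deg G 1 (shift_basis P) (shift_basis P) (- D).
Proof.
move=> hD i j; rewrite mxE; have [->|[k [e hk]]] := hD i j.
  by left; rewrite oppr0.
right; exists k; split; last exact: has_weightN.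
by rewrite /= addrAC e addrAC.
Qed.

Lemma shift_d_sq X : (- mf_d X) *m (- mf_d X) = f%:M.
Proof. by rewrite mulNmx mulmxN opprK mf_d_sq. Qed.

(* X[1] *)
Definition mf_shift X : mf G f :=
  @MF R G f (shift_basis X) _ (shift_d_hom (mf_d_hom (m := X))) (shift_d_sq X).

Lemma block_hom (P Q : grbasis) (a : 'M[poly2 R]_(rk P)) (b : 'M[poly2 R]_(rk Q))
    (c : 'M[poly2 R]_(rk Q, rk P)) :
  hom_deg G 1 P P a -> hom_deg G 1 Q Q b -> hom_deg G 1 P Q c ->
  hom_deg G 1 (sum_basis P Q) (sum_basis P Q) (block_mx a 0 c b).
Proof.
move=> ha hb hc i j; rewrite /= /block_mx /col_mx /row_mx !mxE.
case: (split i) => i'; rewrite mxE; case: (split j) => j' /=.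
- exact: ha.
- by left; rewrite mxE.
- exact: hc.
- exact: hb.
Qed.

Lemma cone_d_hom X Y (phi : 'M[poly2 R]_(rk Y, rk X)) : closed_hom 0 X Y phi ->
  hom_deg G 1 (sum_basis (shift_basis X) Y) (sum_basis (shift_basis X) Y)
    (block_mx (- mf_d X) 0 phi (mf_d Y)).
Proof.
case=> hphi _; apply: (@block_hom (shift_basis X) Y).
- exact/shift_d_hom/mf_d_hom.
- exact: mf_d_hom.
move=> i j; have [->|[k [e hk]]] := hphi i j; first by left.
by right; exists k; split => //; rewrite /= subrK -e addr0.
Qed.

Lemma cone_d_sq X Y (phi : 'M[poly2 R]_(rk Y, rk X)) : closed_hom 0 X Y phi ->
  block_mx (- mf_d X) 0 phi (mf_d Y) *m block_mx (- mf_d X) 0 phi (mf_d Y) = f%:M.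
Proof.
case=> _; rewrite /hom_d expr0 scale1r => /eqP; rewrite subr_eq0 => /eqP e.
rewrite mulmx_block !mul0mx !mulmx0 !addr0 !add0r shift_d_sq mf_d_sq.
by rewrite mulmxN e addNr -scalar_mx_block.
Qed.

(* The cone X[1] (+) Y of phi : X -> Y *)
Definition mf_cone X Y (phi : 'M[poly2 R]_(rk Y, rk X))
    (hphi : closed_hom 0 X Y phi) : mf G f :=
  @MF R G f (sum_basis (shift_basis X) Y) _ (cone_d_hom hphi) (cone_d_sq hphi).

Lemma sum_d_sq X Y :
  block_mx (mf_d X) 0 0 (mf_d Y) *m block_mx (mf_d X) 0 0 (mf_d Y) = f%:M.
Proof.
by rewrite mulmx_block !mul0mx !mulmx0 !addr0 !add0r !mf_d_sq -scalar_mx_block.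
Qed.

Definition mf_sum X Y : mf G f :=
  @MF R G f (sum_basis X Y) _
    (block_hom (mf_d_hom (m := X)) (mf_d_hom (m := Y)) (@hom_deg0 1 X Y))
    (sum_d_sq X Y).

(* The smallest full triangulated subcategory of the homotopy category that is
   closed under isomorphism and contains S *)
Inductive generated (S : mf G f -> Prop) : mf G f -> Prop :=
| gen_base X : S X -> generated S X
| gen_zero : generated S mf_zero
| gen_shift X : generated S X -> generated S (mf_shift X)
| gen_unshift X : generated S (mf_shift X) -> generated S X
| gen_cone X Y (phi : 'M[poly2 R]_(rk Y, rk X)) (hphi : closed_hom 0 X Y phi) :
    generated S X -> generated S Y -> generated S (mf_cone hphi)
| gen_iso X Y : homotopy_equivalent X Y -> generated S X -> generated S Y.

Definition exceptional E : Prop :=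
  [/\ forall m, m != 0 -> hom_coh0 m E E,
      ~ exact_hom 0 E E 1%:M
    & forall phi : 'M[poly2 R]_(rk E), closed_hom 0 E E phi ->
        exists c : R[i], exact_hom 0 E E (phi - (c%:MP)%:M)].

Definition full_strong_exceptional (n : nat) (E : 'I_n -> mf G f) : Prop :=
  [/\ forall i, exceptional (E i),
      forall i j : 'I_n, (i < j)%N -> forall m, hom_coh0 m (E j) (E i),
      forall (i j : 'I_n) m, m != 0 -> hom_coh0 m (E i) (E j)
    & forall X, generated (fun Y => exists i, Y = E i) X].

Definition tilting E : Prop :=
  (forall m, m != 0 -> hom_coh0 m E E) /\
  (forall Y, (forall m, hom_coh0 m E Y) -> homotopy_equivalent Y mf_zero).

End Category.

Definition has_tilting_of_length (R : realType) (G : tpoint R -> Prop)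
    (f : poly2 R) (n : nat) : Prop :=
  exists E : 'I_n -> mf G f,
    full_strong_exceptional E /\ tilting (\big[mf_sum/mf_zero]_(i < n) E i).

(* Main.v *)
(* A monomial x^s y^t has trivial G-weight iff (s, t) is a multiple of (P, -Q),
   where the exponents of w are x^(a + l P) y^b and x^a y^(b + l Q) with a, b <= 1
   and l is the index of G. Every form f of the weight of w with only an isolated
   singularity is c x^al y^be prod (x^P - lam y^Q), with al, be <= 1 and distinct
   lam <> 0. A factorisation f = l_0 ... l_(r-1) yields rank-one matrix
   factorisations B_k = (l_0 ... l_(k-1), l_k ... l_(r-1)).

   If one factor has the weight of x (or, symmetrically, of y), twists of the B_k
   by powers of y form a full strong exceptional collection. Otherwise w is of
   Fermat type with P, Q > 1; one then adds Koszul factorisations on (x, y^t), and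
   has to replace one of the B_k by the cone of a map into two others.

   A finite exceptional collection generates as soon as its right orthogonal is
   zero, because the maps out of it can be coned off one at a time. For Y in the
   orthogonal, vanishing of Hom (B_k, Y) says that Y is exact modulo l_0 ... l_(k-1);
   the sequences 0 -> S/I' -> S/J -> S/I -> 0 propagate exactness from these
   ideals to (x, y) in all weights, and then Y is contractible. *)
Require Import Defs.
From HB Require Import structures.
From mathcomp Require Import all_boot all_order all_algebra.
From mathcomp Require Import complex reals mpoly boolp.
From mathcomp Require Import cyclic separable cyclotomic.
From mathcomp Require Import zify ring.

Set Implicit Arguments.
Unset Strict Implicit.
Unset Printing Implicit Defensive.

Import Order.TTheory GRing.Theory Num.Theory.
Local Open Scope ring_scope.

(** * Weights *)

(** Modulo chi and the relation (P, -Q) the weights form a finite group: of order PM + Q if chi is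
    (1, M) in the coordinates of x and y, of order PM if it is (0, M). Detection has to reach every
    class of this group by exact sequences, which forces the twists to run over long intervals;
    strongness forbids longer ones, because a difference of twists must stay below one period. The
    constants [topA], [uN] and the bounds Q and M - 1 on the twists come from this balance. Coning
    off needs total Hom spaces of finite dimension. Positivity of a degree on the variables bounds
    them from below and makes each degree finite-dimensional; that f has no repeated factor bounds
    them from above, since high-degree forms lie in (g, h) when f = g h with g and h coprime.
    Homotopies are always sought as plain polynomial matrices and projected to the right degree
    afterwards, so the linear algebra can ignore the grading. *)

Section Weights.
Context {R : realType} (G : tpoint R -> Prop).
Local Notation S := (poly2 R).
Implicit Types (p q : S) (m : 'X_{1..2}) (t : tpoint R) (u v : weight).

Definition mchar t m : R[i] := t.1.1 ^+ m 0%R * t.1.2 ^+ m 1%R.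

Definition mon_weight u m := forall t, G t -> mchar t m = eval_weight u t.

Lemma mcharD t m m' : mchar t (m + m')%MM = mchar t m * mchar t m'.
Proof. by rewrite /mchar !mnmDE !exprD; ring. Qed.

Lemma torus_actX t m : torus_act t 'X_[m] = mchar t m *: 'X_[m].
Proof.
rewrite /torus_act comp_mpolyX big_ord_recl big_ord1 /tnth /= !exprZn.
rewrite -scalerAl -scalerAr scalerA /mchar; congr (_ *: _); last first.
  by rewrite [RHS]mpolyXE_id big_ord_recl big_ord1.
by congr (_ * _ ^+ m _); apply: val_inj.
Qed.

Lemma mcoeff_torus t p m : (torus_act t p)@_m = mchar t m * p@_m.
Proof.
have -> : torus_act t p = \sum_(m' <- msupp p) p@_m' *: torus_act t 'X_[m'].
  by rewrite [in LHS]/torus_act {1}[p]mpolyE raddf_sum /=; apply: eq_bigr => m' _; rewrite comp_mpolyZ.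
have -> : p@_m = \sum_(m' <- msupp p) p@_m' * (m' == m)%:R.
  by rewrite {1}[p]mpolyE raddf_sum /=; apply: eq_bigr => m' _; rewrite mcoeffZ mcoeffX.
rewrite raddf_sum mulr_sumr; apply: eq_bigr => m' _ /=.
rewrite torus_actX !mcoeffZ mcoeffX.
by case: eqP => [->|_]; rewrite !(mulr0, mulr1, mul0r) // mulrC.
Qed.

(** The torus acts diagonally on monomials, so the condition can be read off one coefficient at a
    time. *)
Lemma has_weightP u p :
  has_weight G u p <-> forall m, m \in msupp p -> mon_weight u m.
Proof.
split=> [hp m mp t Gt|hp t Gt].
  have := congr1 (mcoeff m) (hp t Gt); rewrite mcoeff_torus mcoeffZ.
  by apply: mulIf; rewrite mcoeff_eq0 mp.
apply/mpolyP => m; rewrite mcoeff_torus mcoeffZ.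
case: (boolP (m \in msupp p)) => [/hp ->//|/memN_msupp_eq0 ->].
by rewrite !mulr0.
Qed.

Lemma has_weight0 u : has_weight G u 0.
Proof. by apply/has_weightP => m; rewrite msupp0. Qed.

Lemma has_weightX u m : has_weight G u 'X_[m] <-> mon_weight u m.
Proof.
rewrite has_weightP; split=> h; first by apply: h; rewrite msuppX inE.
by move=> m'; rewrite msuppX inE => /eqP ->.
Qed.

Lemma has_weightD u p q :
  has_weight G u p -> has_weight G u q -> has_weight G u (p + q).
Proof.
by move=> hp hq t Gt; rewrite /torus_act raddfD /= [p \mPo _]hp // [q \mPo _]hq // scalerDr.
Qed.

Lemma has_weightZ u c p : has_weight G u p -> has_weight G u (c *: p).
Proof.
move=> /has_weightP hp; apply/has_weightP => m /msuppZ_le; exact: hp.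
Qed.

Lemma has_weight_sum (I : Type) (r : seq I) (P : pred I) (F : I -> S) u :
  (forall i, P i -> has_weight G u (F i)) -> has_weight G u (\sum_(i <- r | P i) F i).
Proof. by move=> h; elim/big_ind: _ => //; [exact: has_weight0|exact: has_weightD]. Qed.

Hypothesis Gsub : subgroup G.

Lemma subgroup_neq0 t : G t -> [/\ t.1.1 != 0, t.1.2 != 0 & t.2 != 0].
Proof.
case: Gsub => h _ _ /h/mulrV e.
have e11 := congr1 (fun x : tpoint R => x.1.1) e.
have e12 := congr1 (fun x : tpoint R => x.1.2) e.
have e2 := congr1 (fun x : tpoint R => x.2) e.
split; apply/eqP => z; [move: e11|move: e12|move: e2]; rewrite /= z mul0r => /eqP;
  by rewrite eq_sym oner_eq0.
Qed.

Lemma eval_weightD u v t : G t ->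
  eval_weight (u + v) t = eval_weight u t * eval_weight v t.
Proof.
case/subgroup_neq0 => h1 h2 h3; rewrite /eval_weight /= !expfzDr // [RHS]mulrACA; congr (_ * _).
by rewrite [RHS]mulrACA.
Qed.

Lemma eval_weight_neq0 u t : G t -> eval_weight u t != 0.
Proof.
by case/subgroup_neq0 => h1 h2 h3; rewrite !mulf_neq0 // expfz_neq0.
Qed.

Lemma has_weightM u v p q :
  has_weight G u p -> has_weight G v q -> has_weight G (u + v) (p * q).
Proof.
move=> hp hq t Gt; rewrite /torus_act rmorphM /= [p \mPo _]hp // [q \mPo _]hq //.
by rewrite -scalerAl -scalerAr scalerA eval_weightD.
Qed.

Lemma has_weightC c : has_weight G 0 c%:MP.
Proof.
move=> t Gt; rewrite /torus_act comp_mpolyC /eval_weight /= !expr0z !mulr1.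
by rewrite scale1r.
Qed.

Lemma has_weight1 : has_weight G 0 1.
Proof. by rewrite -mpolyC1; exact: has_weightC. Qed.

(** Projection to one isotypic component. Whether a monomial belongs to it is a statement about all
    points of G, hence the classical truth value. *)
Definition wproj u p : S :=
  \sum_(m <- msupp p | `[< mon_weight u m >]) p@_m *: 'X_[m].

Lemma mcoeff_wproj u p m :
  (wproj u p)@_m = if `[< mon_weight u m >] then p@_m else 0.
Proof.
rewrite /wproj raddf_sum /= big_mkcond /=.
have [mp|mp] := boolP (m \in msupp p).
  rewrite (bigD1_seq m) ?msupp_uniq //= big1 ?addr0 => [|m' nm].
    by rewrite mcoeffZ mcoeffX eqxx mulr1.
  by case: ifP => // _; rewrite mcoeffZ mcoeffX (negPf nm) mulr0.
rewrite big_seq big1 => [|m' m'p]; first by rewrite (memN_msupp_eq0 mp) if_same.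
case: ifP => // _; rewrite mcoeffZ mcoeffX.
by case: eqP m'p mp => [->->|]; rewrite ?mulr0.
Qed.

Lemma wproj_weight u p : has_weight G u (wproj u p).
Proof.
apply: has_weight_sum => m /asboolP h.
exact/has_weightZ/has_weightX.
Qed.

Lemma wprojE u p : has_weight G u p <-> wproj u p = p.
Proof.
split=> [/has_weightP h|<-]; last exact: wproj_weight.
apply/mpolyP => m; rewrite mcoeff_wproj; case: ifP => // /asboolP nh.
by case: (boolP (m \in msupp p)) => [/h//|/memN_msupp_eq0 ->].
Qed.

Lemma wproj_is_linear u : linear (wproj u).
Proof.
move=> c p q; apply/mpolyP => m; rewrite mcoeffD mcoeffZ !mcoeff_wproj mcoeffD mcoeffZ.
by case: ifP; rewrite // mulr0 addr0.
Qed.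

HB.instance Definition _ u :=
  GRing.isLinear.Build R[i] S S _ (wproj u) (wproj_is_linear u).

Lemma mon_weightD u v m m' :
  mon_weight u m -> mon_weight v m' <-> mon_weight (u + v) (m + m')%MM.
Proof.
move=> h; split=> h' t Gt; move: (h' t Gt); rewrite mcharD eval_weightD // (h t Gt).
  by move=> ->.
by move/mulfI; apply; exact: eval_weight_neq0.
Qed.

(** Characters take nonzero values on G, so for m of weight u the product m m' has weight u + v
    exactly when m' has weight v. *)
Lemma wprojMl u v p q : has_weight G u p -> wproj (u + v) (p * q) = p * wproj v q.
Proof.
move=> /has_weightP hp; rewrite [p in LHS]mpolyE [p in RHS]mpolyE.
rewrite [q in LHS]mpolyE [q in RHS]mpolyE !raddf_sum /=.
rewrite big_distrlr /= raddf_sum big_distrlr /=.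
rewrite [LHS]big_seq [RHS]big_seq; apply: eq_bigr => m /hp hm.
rewrite raddf_sum; apply: eq_bigr => m' _ /=.
rewrite -scalerAl -scalerAr scalerA -mpolyXD 2!linearZ /= -scalerAl -scalerAr scalerA; congr (_ *: _).
have e w k : wproj w 'X_[k] = if `[< mon_weight w k >] then 'X_[k] else 0.
  apply/mpolyP => k'; rewrite mcoeff_wproj.
  case: (eqVneq k k') => [->|/negPf ne]; first by case: ifP; rewrite ?mcoeff0.
  by case: ifP; case: ifP; rewrite ?mcoeff0 // mcoeffX ne.
rewrite !e mpolyXD; have [h1 h2] := mon_weightD v m' hm.
case: asboolP => h; case: asboolP => h'; rewrite ?mulr0 //.
  by case: h'; apply: h2.
by case: h; apply: h1.
Qed.

End Weights.

(** * Projection of matrices to a given degree *)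

Section Degrees.
Context {R : realType} (G : tpoint R -> Prop).
Local Notation S := (poly2 R).
Hypothesis Gsub : subgroup G.
Implicit Types (P Q T : grbasis) (m n : int).

(** The integer k of [hom_deg] is forced to be d / 2, and an odd d leaves only the zero entry. This
    makes homogeneity the fixed-point equation of a linear projection. *)
Definition entry_proj m P Q (i : 'I_(rk Q)) (j : 'I_(rk P)) (p : S) : S :=
  let d := pos j + m - pos i in
  if (2 %| d)%Z then wproj G (wt j - wt i + chi *~ (d %/ 2)%Z) p else 0.

Definition mproj m P Q (phi : 'M[S]_(rk Q, rk P)) : 'M[S]_(rk Q, rk P) :=
  \matrix_(i, j) entry_proj m i j (phi i j).

Lemma entry_proj_is_linear m P Q (i : 'I_(rk Q)) (j : 'I_(rk P)) :
  linear (@entry_proj m P Q i j).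
Proof.
move=> c p q; rewrite /entry_proj; case: ifP => _; first by rewrite linearP.
by rewrite scaler0 addr0.
Qed.

HB.instance Definition _ m P Q i j :=
  GRing.isLinear.Build R[i] S S _ (@entry_proj m P Q i j) (@entry_proj_is_linear m P Q i j).

Lemma mproj_is_additive m P Q :
  {morph @mproj m P Q : phi psi / phi + psi}.
Proof. by move=> phi psi; apply/matrixP => i j; rewrite !mxE raddfD. Qed.

Lemma mprojN m P Q phi : @mproj m P Q (- phi) = - mproj m phi.
Proof. by apply/matrixP => i j; rewrite !mxE raddfN. Qed.

Lemma mprojB m P Q phi psi : @mproj m P Q (phi - psi) = mproj m phi - mproj m psi.
Proof. by rewrite mproj_is_additive mprojN. Qed.

Lemma parity_div (a b k : int) : a = b + k *+ 2 ->
  ((2 %| a - b)%Z = true) * (((a - b) %/ 2)%Z = k).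
Proof.
move=> ->; have -> : b + k *+ 2 - b = k * 2 by lia.
by rewrite dvdz_mull // mulzK.
Qed.

Lemma parityD (b d : int) : (2 %| b * 2 + d)%Z = (2 %| d)%Z.
Proof. lia. Qed.

Lemma subr_telescope (V : zmodType) (x y z a b : V) :
  x - z + (a + b) = y - z + a + (x - y + b).
Proof.
by rewrite [RHS]addrACA; congr (_ + _); rewrite [RHS]addrC addrA subrK.
Qed.

Lemma hom_degP m P Q phi i j : hom_deg G m P Q phi -> phi i j = entry_proj m i j (phi i j).
Proof.
move=> /(_ i j)[->|[k [e /wprojE hk]]]; first by rewrite raddf0.
by rewrite /entry_proj !(parity_div e) hk.
Qed.

Lemma hom_degE m P Q phi : hom_deg G m P Q phi <-> mproj m phi = phi.
Proof.
split=> h; first by apply/matrixP => i j; rewrite mxE -hom_degP.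
move=> i j; rewrite -h mxE /entry_proj; case: ifP => [|_]; last by left.
set d := pos j + m - pos i => /dvdzP[k hk]; right; exists k.
rewrite hk mulzK //; split; last exact: wproj_weight.
by move: hk; rewrite /d; lia.
Qed.

Lemma hom_deg_proj m P Q phi : hom_deg G m P Q (mproj m phi).
Proof.
apply/hom_degE/matrixP => i j; rewrite !mxE /entry_proj; case: ifP => // ->.
exact/wprojE/wproj_weight.
Qed.

Lemma hom_degD m P Q phi psi :
  hom_deg G m P Q phi -> hom_deg G m P Q psi -> hom_deg G m P Q (phi + psi).
Proof. by rewrite !hom_degE mproj_is_additive => -> ->. Qed.

Lemma hom_degN m P Q phi : hom_deg G m P Q phi -> hom_deg G m P Q (- phi).
Proof. by rewrite !hom_degE mprojN => ->. Qed.

Lemma hom_degB m P Q phi psi :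
  hom_deg G m P Q phi -> hom_deg G m P Q psi -> hom_deg G m P Q (phi - psi).
Proof. by move=> h1 h2; apply: hom_degD => //; apply: hom_degN. Qed.

Lemma hom_degZ m P Q (c : R[i]) phi :
  hom_deg G m P Q phi -> hom_deg G m P Q (c%:MP *: phi).
Proof.
rewrite !hom_degE => h; apply/matrixP => i j; rewrite -{2}h !mxE.
by rewrite mul_mpolyC linearZ /= mul_mpolyC.
Qed.

Lemma hom_deg_scale m P Q (a : nat) phi :
  hom_deg G m P Q phi -> hom_deg G m P Q ((-1) ^+ a *: phi).
Proof.
rewrite -signr_odd; case: (odd a) => h; rewrite ?expr1 ?expr0 ?scale1r // scaleN1r.
exact: hom_degN.
Qed.

Lemma hom_deg1 P : hom_deg G 0 P P 1%:M.
Proof.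
move=> i j; rewrite mxE; case: eqP => [->|_]; last by left.
right; exists 0; split; first by rewrite mul0rn.
by rewrite subrr mulr0z addr0; exact: has_weight1.
Qed.

Lemma hom_deg_mul m n P Q T phi psi :
  hom_deg G m P Q phi -> hom_deg G n Q T psi -> hom_deg G (n + m) P T (psi *m phi).
Proof.
move=> h1 h2; apply/hom_degE/matrixP => i j; rewrite !mxE raddf_sum.
apply: eq_bigr => k _; have [->|[a [ea ha]]] := h1 k j; first by rewrite mulr0 raddf0.
have [->|[b [eb hb]]] := h2 i k; first by rewrite mul0r raddf0.
have e : pos j + (n + m) = pos i + (b + a) *+ 2.
  by move: ea eb; lia.
rewrite /= /entry_proj !(parity_div e) mulrzDr (subr_telescope (wt j) (wt k)).
exact/wprojE/has_weightM.
Qed.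

(** Together with [mproj_mulr] this makes the projection commute with the differential of Hom, so
    that homogeneous linear equations solvable over S are solvable in the right degree. *)
Lemma mproj_mull m n P Q T (psi : 'M[S]_(rk T, rk Q)) (phi : 'M[S]_(rk Q, rk P)) :
  hom_deg G n Q T psi -> mproj (n + m) (psi *m phi) = psi *m mproj m phi :> 'M_(rk T, rk P).
Proof.
move=> h; apply/matrixP => i j; rewrite [LHS]mxE [X in entry_proj _ _ _ X]mxE [RHS]mxE.
rewrite raddf_sum; apply: eq_bigr => k _; rewrite mxE /=; have [->|[b [eb hb]]] := h i k; first by rewrite !mul0r raddf0.
have e : pos j + (n + m) - pos i = b * 2 + (pos j + m - pos k) by lia.
have -> : entry_proj (n + m) i j = if (2 %| pos j + m - pos k)%Z then wproj G (wt j - wt i + chi *~ (b + ((pos j + m - pos k) %/ 2)%Z)) else fun=> 0.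
  apply: funext => p; rewrite /entry_proj e divzMDl // parityD; by case: ifP.
rewrite /entry_proj.
case: ifP => [_|_]; last by rewrite mulr0.
by rewrite -(wprojMl Gsub _ _ hb) mulrzDr (subr_telescope (wt j) (wt k)).
Qed.

Lemma mproj_mulr m n P Q T (psi : 'M[S]_(rk T, rk Q)) (phi : 'M[S]_(rk Q, rk P)) :
  hom_deg G n P Q phi -> mproj (m + n) (psi *m phi) = mproj m psi *m phi :> 'M_(rk T, rk P).
Proof.
move=> h; apply/matrixP => i j; rewrite [LHS]mxE [X in entry_proj _ _ _ X]mxE [RHS]mxE.
rewrite raddf_sum; apply: eq_bigr => k _; rewrite mxE /=; have [->|[b [eb hb]]] := h k j; first by rewrite !mulr0 raddf0.
have e : pos j + (m + n) - pos i = b * 2 + (pos k + m - pos i) by lia.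
have -> : entry_proj (m + n) i j = if (2 %| pos k + m - pos i)%Z then wproj G (wt j - wt i + chi *~ (b + ((pos k + m - pos i) %/ 2)%Z)) else fun=> 0.
  apply: funext => p; rewrite /entry_proj e divzMDl // parityD; by case: ifP.
rewrite /entry_proj.
case: ifP => [_|_]; last by rewrite mul0r.
rewrite [b + _]addrC mulrzDr (subr_telescope (wt j) (wt k)) addrC mulrC [in RHS]mulrC.
exact: wprojMl.
Qed.

End Degrees.

(** * Shifts and cones *)

Section Blocks.
Context (K : comNzRingType) (x y z : nat).
Implicit Types (s : K).

(** The component on X carries the opposite sign because X enters the cone shifted by one. *)
Lemma row_block_diff s (dX : 'M[K]_x) (dY : 'M_y) (dZ : 'M_z) phi
    (a : 'M_(z, x)) (b : 'M_(z, y)) :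
  dZ *m row_mx a b - s *: (row_mx a b *m block_mx (- dX) 0 phi dY)
  = row_mx (dZ *m a - - s *: (a *m dX) - s *: (b *m phi))
           (dZ *m b - s *: (b *m dY)).
Proof.
rewrite mul_mx_row mul_row_block mulmx0 add0r mulmxN scale_row_mx opp_row_mx add_row_mx.
by rewrite scaleNr opprK scalerDr scalerN opprD opprK addrA.
Qed.

Lemma col_block_diff s (dX : 'M[K]_x) (dY : 'M_y) (dZ : 'M_z) phi
    (a : 'M_(x, z)) (b : 'M_(y, z)) :
  block_mx (- dX) 0 phi dY *m col_mx a b - s *: (col_mx a b *m dZ)
  = col_mx (- (dX *m a - - s *: (a *m dZ)))
           (phi *m a + (dY *m b - s *: (b *m dZ))).
Proof.
rewrite mul_block_col mul_col_mx mul0mx addr0 mulNmx scale_col_mx opp_col_mx add_col_mx.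
by rewrite scaleNr opprK opprD addrA.
Qed.

End Blocks.

(** * Closed and exact maps *)

Section Homotopy.
Context {R : realType} (G : tpoint R -> Prop) (f : poly2 R).
Local Notation S := (poly2 R).
Hypothesis Gsub : subgroup G.
Implicit Types (X Y Z W : mf G f) (m n : int).

Definition sgn (m : int) : S := (-1) ^+ `|m|%N.

Lemma sgnD m n : sgn (m + n) = sgn m * sgn n.
Proof.
rewrite /sgn -exprD -signr_odd -[in RHS]signr_odd; congr (_ ^+ _).
by congr nat_of_bool; lia.
Qed.

Lemma sgnV m : sgn m * sgn m = 1.
Proof. by rewrite /sgn -expr2 sqrr_sign. Qed.

Lemma sgnS m : sgn (m + 1) = - sgn m.
Proof. by rewrite sgnD /sgn expr1 mulrN1. Qed.

Lemma sgnP m : sgn (m - 1) = - sgn m.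
Proof. by rewrite sgnD (_ : sgn (-1) = -1) ?mulrN1 // /sgn expr1. Qed.

Lemma sgn0 : sgn 0 = 1. Proof. by []. Qed.

Lemma hom_dE m X Y (phi : 'M[S]_(rk Y, rk X)) :
  hom_d m phi = mf_d Y *m phi - sgn m *: (phi *m mf_d X).
Proof. by []. Qed.

Opaque hom_d.

Lemma hom_d_deg m X Y (phi : 'M[S]_(rk Y, rk X)) :
  hom_deg G m X Y phi -> hom_deg G (m + 1) X Y (hom_d m phi).
Proof.
move=> h; apply: hom_degB; last apply: hom_deg_scale.
- rewrite addrC; apply: (hom_deg_mul Gsub h); exact: mf_d_hom.
- apply: (hom_deg_mul Gsub _ h); exact: mf_d_hom.
Qed.

Lemma hom_dN m X Y (phi : 'M[S]_(rk Y, rk X)) : hom_d m (- phi) = - hom_d m phi.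
Proof. by rewrite !hom_dE mulmxN mulNmx scalerN opprD opprK. Qed.

Lemma hom_dD m X Y (phi psi : 'M[S]_(rk Y, rk X)) :
  hom_d m (phi + psi) = hom_d m phi + hom_d m psi.
Proof. by rewrite !hom_dE mulmxDr mulmxDl scalerDr opprD addrACA. Qed.

Lemma hom_dB m X Y (phi psi : 'M[S]_(rk Y, rk X)) :
  hom_d m (phi - psi) = hom_d m phi - hom_d m psi.
Proof. by rewrite hom_dD hom_dN. Qed.

Lemma hom_dZ m X Y c (phi : 'M[S]_(rk Y, rk X)) : hom_d m (c *: phi) = c *: hom_d m phi.
Proof.
by rewrite !hom_dE -scalemxAr -scalemxAl scalerA mulrC -scalerA scalerBr.
Qed.

Lemma hom_d0 m X Y : hom_d m (0 : 'M[S]_(rk Y, rk X)) = 0.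
Proof. by rewrite hom_dE mulmx0 mul0mx scaler0 subrr. Qed.

Lemma hom_dd m X Y (phi : 'M[S]_(rk Y, rk X)) : hom_d m (hom_d (m - 1) phi) = 0.
Proof.
rewrite !hom_dE sgnP scaleNr opprK mulmxDr mulmxDl -scalemxAr -scalemxAl.
rewrite scalerDr scalerA sgnV scale1r !mulmxA opprD addrA addrK.
by rewrite mf_d_sq -mulmxA mf_d_sq mul_scalar_mx mul_mx_scalar subrr.
Qed.

Lemma hom_dM n m X Y Z (psi : 'M[S]_(rk Z, rk Y)) (phi : 'M[S]_(rk Y, rk X)) :
  hom_d (n + m) (X := X) (Y := Z) (psi *m phi)
  = hom_d n psi *m phi + sgn n *: (psi *m hom_d m phi).
Proof.
rewrite !hom_dE sgnD mulmxBl mulmxBr scalerBr -scalemxAl -scalemxAr scalerA -!mulmxA.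
by rewrite addrA subrK.
Qed.

Lemma hom_dM0 n X Y Z (psi : 'M[S]_(rk Z, rk Y)) (phi : 'M[S]_(rk Y, rk X)) :
  closed_hom 0 phi -> hom_d n (X := X) (Y := Z) (psi *m phi) = hom_d n psi *m phi.
Proof. by case=> _ e; rewrite -{1}[n]addr0 hom_dM e mulmx0 scaler0 addr0. Qed.

Lemma hom_d0M n X Y Z (psi : 'M[S]_(rk Z, rk Y)) (phi : 'M[S]_(rk Y, rk X)) :
  closed_hom 0 psi -> hom_d n (X := X) (Y := Z) (psi *m phi) = psi *m hom_d n phi.
Proof. by case=> _ e; rewrite -{1}[n]add0r hom_dM e mul0mx sgn0 scale1r add0r. Qed.

(** Projecting [psi] to degree m - 1 does not change its differential, which is already homogeneous
    of degree m. *)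
Lemma exact_any m X Y (phi psi : 'M[S]_(rk Y, rk X)) :
  hom_deg G m X Y phi -> phi = hom_d (m - 1) psi -> exact_hom m phi.
Proof.
move=> /hom_degE h e; exists (mproj G (m - 1) psi : 'M_(rk Y, rk X)).
  exact: hom_deg_proj.
have hY := mf_d_hom (m := Y); have hX := mf_d_hom (m := X).
rewrite -{1}h {1}e !hom_dE mprojB; congr (_ - _).
  by rewrite -(@mproj_mull _ _ Gsub (m - 1) 1 X Y Y _ psi hY) addrC subrK.
rewrite -(@mproj_mulr _ _ Gsub (m - 1) 1 X X Y psi _ hX) subrK /sgn -signr_odd.
by case: odd; rewrite ?expr1 ?expr0 ?scale1r // !scaleN1r mprojN.
Qed.

Lemma exact_deg m X Y (phi : 'M[S]_(rk Y, rk X)) :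
  exact_hom m phi -> hom_deg G m X Y phi.
Proof. by case=> psi h ->; rewrite -{1}(subrK 1 m); apply: hom_d_deg. Qed.

Lemma exact_closed m X Y (phi : 'M[S]_(rk Y, rk X)) :
  exact_hom m phi -> closed_hom m phi.
Proof.
by move=> h; split; [exact: exact_deg|case: h => psi _ ->; exact: hom_dd].
Qed.

Lemma exact0 m X Y : exact_hom m (0 : 'M[S]_(rk Y, rk X)).
Proof. by exists 0; [exact: hom_deg0|rewrite hom_d0]. Qed.

Lemma exactD m X Y (phi psi : 'M[S]_(rk Y, rk X)) :
  exact_hom m phi -> exact_hom m psi -> exact_hom m (phi + psi).
Proof.
case=> a ha -> [b hb ->]; exists (a + b); first exact: hom_degD.
by rewrite hom_dD.
Qed.

Lemma exactN m X Y (phi : 'M[S]_(rk Y, rk X)) : exact_hom m phi -> exact_hom m (- phi).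
Proof. by case=> a ha ->; exists (- a); [exact: hom_degN|rewrite hom_dN]. Qed.

Lemma exactB m X Y (phi psi : 'M[S]_(rk Y, rk X)) :
  exact_hom m phi -> exact_hom m psi -> exact_hom m (phi - psi).
Proof. by move=> h1 h2; apply/exactD/exactN. Qed.

Lemma exactZ m X Y (c : R[i]) (phi : 'M[S]_(rk Y, rk X)) :
  exact_hom m phi -> exact_hom m (c%:MP *: phi).
Proof. by case=> a ha ->; exists (c%:MP *: a); [exact: hom_degZ|rewrite hom_dZ]. Qed.

Lemma exact_sgn m n X Y (phi : 'M[S]_(rk Y, rk X)) :
  exact_hom m phi -> exact_hom m (sgn n *: phi).
Proof.
rewrite /sgn -signr_odd; case: odd => h; last by rewrite expr0 scale1r.
rewrite expr1 scaleN1r; exact: exactN.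
Qed.

Lemma closed0 m X Y : closed_hom m (0 : 'M[S]_(rk Y, rk X)).
Proof. exact/exact_closed/exact0. Qed.

Lemma closedD m X Y (phi psi : 'M[S]_(rk Y, rk X)) :
  closed_hom m phi -> closed_hom m psi -> closed_hom m (phi + psi).
Proof.
case=> h1 e1 [h2 e2]; split; first exact: hom_degD.
by rewrite hom_dD e1 e2 addr0.
Qed.

Lemma closedN m X Y (phi : 'M[S]_(rk Y, rk X)) : closed_hom m phi -> closed_hom m (- phi).
Proof. by case=> h e; split; [exact: hom_degN|rewrite hom_dN e oppr0]. Qed.

Lemma closedB m X Y (phi psi : 'M[S]_(rk Y, rk X)) :
  closed_hom m phi -> closed_hom m psi -> closed_hom m (phi - psi).
Proof. by move=> h1 h2; apply/closedD/closedN. Qed.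

Lemma closedZ m X Y (c : R[i]) (phi : 'M[S]_(rk Y, rk X)) :
  closed_hom m phi -> closed_hom m (c%:MP *: phi).
Proof. by case=> h e; split; [exact: hom_degZ|rewrite hom_dZ e scaler0]. Qed.

Lemma closed1 X : closed_hom 0 (1%:M : 'M[S]_(rk X, rk X)).
Proof.
by split; [exact: hom_deg1|rewrite hom_dE mulmx1 mul1mx scale1r subrr].
Qed.

Lemma closedM n m X Y Z (psi : 'M[S]_(rk Z, rk Y)) (phi : 'M[S]_(rk Y, rk X)) :
  closed_hom n psi -> closed_hom m phi -> closed_hom (n + m) (X := X) (Y := Z) (psi *m phi).
Proof.
case=> h1 e1 [h2 e2]; split; first exact: hom_deg_mul.
by rewrite hom_dM e1 e2 mul0mx mulmx0 scaler0 addr0.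
Qed.

Lemma exactMl n m X Y Z (psi : 'M[S]_(rk Z, rk Y)) (phi : 'M[S]_(rk Y, rk X)) :
  exact_hom n psi -> closed_hom m phi -> exact_hom (n + m) (X := X) (Y := Z) (psi *m phi).
Proof.
move=> hpsi [hphi e]; have [a _ ea] := hpsi.
apply: (exact_any (psi := a *m phi)); first exact: hom_deg_mul (exact_deg hpsi).
by rewrite addrAC hom_dM e mulmx0 scaler0 addr0 ea.
Qed.

Lemma exactMr n m X Y Z (psi : 'M[S]_(rk Z, rk Y)) (phi : 'M[S]_(rk Y, rk X)) :
  closed_hom n psi -> exact_hom m phi -> exact_hom (n + m) (X := X) (Y := Z) (psi *m phi).
Proof.
move=> [hpsi e] hphi; have [a _ ea] := hphi.
apply: (exact_any (psi := sgn n *: (psi *m a))).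
  exact: hom_deg_mul (exact_deg hphi) hpsi.
by rewrite hom_dZ -addrA hom_dM e mul0mx add0r scalerA sgnV scale1r ea.
Qed.

Lemma closedM0 n X Y Z (psi : 'M[S]_(rk Z, rk Y)) (phi : 'M[S]_(rk Y, rk X)) :
  closed_hom n psi -> closed_hom 0 phi -> closed_hom n (X := X) (Y := Z) (psi *m phi).
Proof. by move=> h1 h2; rewrite -[n]addr0; exact: closedM. Qed.

Lemma closed0M n X Y Z (psi : 'M[S]_(rk Z, rk Y)) (phi : 'M[S]_(rk Y, rk X)) :
  closed_hom 0 psi -> closed_hom n phi -> closed_hom n (X := X) (Y := Z) (psi *m phi).
Proof. by move=> h1 h2; rewrite -[n]add0r; exact: closedM. Qed.

Lemma exactM0 n X Y Z (psi : 'M[S]_(rk Z, rk Y)) (phi : 'M[S]_(rk Y, rk X)) :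
  exact_hom n psi -> closed_hom 0 phi -> exact_hom n (X := X) (Y := Z) (psi *m phi).
Proof. by move=> h1 h2; rewrite -[n]addr0; exact: exactMl. Qed.

Lemma exact0M n X Y Z (psi : 'M[S]_(rk Z, rk Y)) (phi : 'M[S]_(rk Y, rk X)) :
  closed_hom 0 psi -> exact_hom n phi -> exact_hom n (X := X) (Y := Z) (psi *m phi).
Proof. by move=> h1 h2; rewrite -[n]add0r; exact: exactMr. Qed.

Definition contractible X := exact_hom 0 (1%:M : 'M[S]_(rk X, rk X)).

Lemma contractible_zero X : contractible X -> homotopy_equivalent X mf_zero.
Proof.
move=> hX; exists 0, 0; split; try exact: closed0.
  by rewrite mul0mx sub0r; apply: exactN.
by rewrite (_ : _ - _ = 0); [exact: exact0|apply/matrixP => -[[]]].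
Qed.

Lemma split_lshift a b (i : 'I_a) : split (lshift b i) = inl i.
Proof. exact: (unsplitK (inl i)). Qed.

Lemma split_rshift a b (i : 'I_b) : split (rshift a i) = inr i.
Proof. exact: (unsplitK (inr i)). Qed.

(** * Maps out of and into a cone *)

Section Cone.
Variables (X Y : mf G f) (phi : 'M[S]_(rk Y, rk X)) (hphi : closed_hom 0 phi).
Let C := mf_cone hphi.

Lemma hom_deg_row n Z (a : 'M[S]_(rk Z, rk X)) (b : 'M[S]_(rk Z, rk Y)) :
  hom_deg G n C Z (row_mx a b) <-> hom_deg G (n - 1) X Z a /\ hom_deg G n Y Z b.
Proof.
split=> [h|[ha hb]].
  split=> i j; [have := h i (lshift _ j)|have := h i (rshift _ j)].
    by rewrite row_mxEl /= split_lshift addrAC addrA.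
  by rewrite row_mxEr /= split_rshift.
move=> i j; rewrite /= mxE; case: split => k; last exact: hb.
by have := ha i k; rewrite /= addrA addrAC.
Qed.

Lemma hom_deg_col n W (a : 'M[S]_(rk X, rk W)) (b : 'M[S]_(rk Y, rk W)) :
  hom_deg G n W C (col_mx a b) <-> hom_deg G (n + 1) W X a /\ hom_deg G n W Y b.
Proof.
have E (p q k : int) : p + (n + 1) = q + k *+ 2 <-> p + n = q - 1 + k *+ 2 by split; lia.
split=> [h|[ha hb]].
  split=> i j; [have := h (lshift _ i) j|have := h (rshift _ i) j].
    rewrite col_mxEu /= split_lshift => -[->|[k [/E e1 e2]]]; [by left|right; by exists k].
  by rewrite col_mxEd /= split_rshift.
move=> i j; rewrite /= mxE; case: split => k; last exact: hb.
by have [->|[l [/E e1 e2]]] := ha k j; [left|right; exists l].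
Qed.

Lemma hom_d_row n Z (a : 'M[S]_(rk Z, rk X)) (b : 'M[S]_(rk Z, rk Y)) :
  hom_d n (X := C) (row_mx a b) = row_mx (hom_d (n - 1) a - sgn n *: (b *m phi)) (hom_d n b).
Proof.
by rewrite !hom_dE sgnP; exact: row_block_diff.
Qed.

Lemma hom_d_col n W (a : 'M[S]_(rk X, rk W)) (b : 'M[S]_(rk Y, rk W)) :
  hom_d n (Y := C) (col_mx a b) = col_mx (- hom_d (n + 1) a) (phi *m a + hom_d n b).
Proof.
by rewrite !hom_dE sgnS; exact: col_block_diff.
Qed.

(** The chase in the long exact sequence of Hom (-, Z): once the restriction to Y is null-homotopic,
    the rest comes from X in degree n - 1, and there it is killed if it factors through [phi]. *)
Lemma cone_from_local n Z (a : 'M[S]_(rk Z, rk X)) (b : 'M[S]_(rk Z, rk Y)) :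
  closed_hom n (X := C) (row_mx a b) -> exact_hom n b ->
  (forall a' : 'M[S]_(rk Z, rk X), closed_hom (n - 1) a' ->
     exists2 b' : 'M[S]_(rk Z, rk Y), closed_hom (n - 1) b'
       & exact_hom (n - 1) (a' - b' *m phi)) ->
  exact_hom n (X := C) (row_mx a b).
Proof.
case=> /hom_deg_row[ha hb]; rewrite hom_d_row => e [c hc eb] H.
have {e} e : hom_d (n - 1) a = sgn n *: (b *m phi).
  by apply/eqP; rewrite -subr_eq0; move/eqP: e; rewrite -row_mx0 => /eqP/eq_row_mx[->].
(* The component [a] is not closed by itself; subtracting the homotopy [c] of [b], composed with
   [phi], makes it closed. *)
have hcp : hom_deg G (n - 1) X Z (c *m phi).
  by rewrite -[n - 1]addr0; apply: hom_deg_mul hc; case: hphi.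
have [|b' [hb' eb'] [t ht et]] := H (a - sgn n *: (c *m phi)).
  split; first exact/hom_degB/hom_deg_scale.
  by rewrite hom_dB hom_dZ e hom_dM0 // -eb subrr.
exists (row_mx t (c + sgn n *: b')).
  apply/hom_deg_row; split=> //; apply: hom_degD => //; exact: hom_deg_scale.
rewrite hom_d_row -et sgnP hom_dD hom_dZ eb' scaler0 addr0 eb.
have -> // : a - sgn n *: (c *m phi) - b' *m phi - - sgn n *: ((c + sgn n *: b') *m phi) = a.
rewrite mulmxDl scaleNr opprK scalerDr -scalemxAl scalerA sgnV scale1r addrA.
by rewrite [X in X + _]addrAC subrK subrK.
Qed.

Lemma cone_from n Z : hom_coh0 n Y Z ->
  (forall a' : 'M[S]_(rk Z, rk X), closed_hom (n - 1) a' ->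
     exists2 b' : 'M[S]_(rk Z, rk Y), closed_hom (n - 1) b'
       & exact_hom (n - 1) (a' - b' *m phi)) ->
  hom_coh0 n C Z.
Proof.
move=> hY hX th hth; rewrite -[th]hsubmxK in hth *.
apply: cone_from_local => //; apply: hY.
case: hth => /hom_deg_row[_ hb]; rewrite hom_d_row => e; split=> //.
by move: e; rewrite -row_mx0 => /eq_row_mx[].
Qed.

Lemma cone_from0 n Z : hom_coh0 n Y Z -> hom_coh0 (n - 1) X Z -> hom_coh0 n C Z.
Proof.
move=> hY hX; apply: cone_from => // a ha; exists 0; first exact: closed0.
by rewrite mul0mx subr0; apply: hX.
Qed.

(** A null-homotopy of the component in X[1] deforms the map into the subobject Y of the cone. *)
Lemma cone_to_local n W (th : 'M[S]_(rk C, rk W)) :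
  closed_hom n (Y := C) th -> exact_hom (n + 1) (usubmx th : 'M_(rk X, rk W)) ->
  exists2 b : 'M[S]_(rk Y, rk W), closed_hom n b
    & exact_hom n (Y := C) (th - col_mx 0 b : 'M_(rk C, rk W)).
Proof.
rewrite -[th]vsubmxK; move: (usubmx th) (dsubmx th) => a b; rewrite col_mxKu.
case=> /hom_deg_col[ha hb]; rewrite hom_d_col => e [c]; rewrite addrK => hc ea.
have ephi : closed_hom 0 phi by [].
exists (b + phi *m c).
  split; first by apply: hom_degD => //; rewrite -[n]add0r; apply: hom_deg_mul hc _; case: hphi.
  rewrite hom_dD hom_d0M // addrC -ea.
  by move: e; rewrite -col_mx0 => /eq_col_mx[].
exists (col_mx (- c) 0).
  by apply/hom_deg_col; rewrite subrK; split; [exact: hom_degN|exact: hom_deg0].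
rewrite hom_d_col subrK hom_dN opprK hom_d0 addr0 mulmxN opp_col_mx add_col_mx.
by rewrite -ea oppr0 addr0 opprD addrA subrr sub0r.
Qed.

Lemma closed_inr n W (b : 'M[S]_(rk Y, rk W)) :
  closed_hom n b -> closed_hom n (Y := C) (col_mx 0 b : 'M_(rk C, rk W)).
Proof.
case=> hb e; split; first by apply/hom_deg_col; split=> //; exact: hom_deg0.
by rewrite hom_d_col e mulmx0 addr0 hom_d0 oppr0 col_mx0.
Qed.

Lemma exact_inr n W (b : 'M[S]_(rk Y, rk W)) :
  exact_hom n b -> exact_hom n (Y := C) (col_mx 0 b : 'M_(rk C, rk W)).
Proof.
case=> c hc ->; exists (col_mx 0 c); first by apply/hom_deg_col; split=> //; exact: hom_deg0.
by rewrite hom_d_col mulmx0 add0r hom_d0 oppr0.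
Qed.

(** The composite of two consecutive maps of a triangle is null-homotopic; the homotopy is [b]
    placed in the component X. *)
Lemma exact_inr_phi n W (b : 'M[S]_(rk X, rk W)) :
  closed_hom n b -> exact_hom n (Y := C) (col_mx 0 (phi *m b) : 'M_(rk C, rk W)).
Proof.
case=> hb e; exists (col_mx b 0).
  by apply/hom_deg_col; rewrite subrK; split=> //; exact: hom_deg0.
by rewrite hom_d_col subrK e oppr0 hom_d0 addr0.
Qed.

Lemma cone_to n W : hom_coh0 (n + 1) W X -> hom_coh0 n W Y -> hom_coh0 n W C.
Proof.
move=> hX hY th hth.
have [|b hb hex] := cone_to_local hth.
  apply: hX; rewrite -[th]vsubmxK col_mxKu in hth *.
  case: hth => /hom_deg_col[ha _]; rewrite hom_d_col -col_mx0 => /eq_col_mx[e _].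
  by split=> //; rewrite -[LHS]opprK e oppr0.
rewrite -[th](subrK (col_mx 0 b)); apply: exactD => //.
exact/exact_inr/hY.
Qed.

Lemma cone_usub n W (th : 'M[S]_(rk C, rk W)) :
  closed_hom n (Y := C) th -> closed_hom (n + 1) (usubmx th : 'M_(rk X, rk W)).
Proof.
rewrite -[th]vsubmxK col_mxKu.
case=> /hom_deg_col[ha _]; rewrite hom_d_col -col_mx0 => /eq_col_mx[e _].
by split=> //; rewrite -[LHS]opprK e oppr0.
Qed.

Lemma cone_rsub n Z (th : 'M[S]_(rk Z, rk C)) :
  closed_hom n (X := C) th -> closed_hom n (rsubmx th : 'M_(rk Z, rk Y)).
Proof.
rewrite -[th]hsubmxK row_mxKr.
case=> /hom_deg_row[_ ha]; rewrite hom_d_row -row_mx0 => /eq_row_mx[_ e].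
by split.
Qed.

End Cone.
End Homotopy.

Lemma cone_proj_blocks (K : comNzRingType) (x y : nat) (dX : 'M[K]_x) (dY : 'M_y) phi :
  - dX *m row_mx 1%:M 0 - row_mx 1%:M 0 *m block_mx (- dX) 0 phi dY = 0.
Proof.
rewrite mul_mx_row mul_row_block mulmx0 !mul1mx !mul0mx !addr0 mulmx1.
by rewrite subrr.
Qed.

(** * Rotation of a triangle in block matrices *)

Section RotateBlocks.
Context (K : comNzRingType) (e x : nat) (dE : 'M[K]_e) (dX : 'M[K]_x) (phi : 'M[K]_(x, e)).
Hypothesis hphi : dX *m phi = phi *m dE.

Let dC := block_mx (- dE) 0 phi dX.
Let dP : 'M[K]_(e + x + e) := block_mx (- dC) 0 (row_mx 1%:M 0) (- dE).
Let u : 'M[K]_(e + x + e, x) := col_mx (col_mx 0 1%:M) 0.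
Let v : 'M[K]_(x, e + x + e) := row_mx (row_mx 0 1%:M) phi.
Let h : 'M[K]_(e + x + e) := block_mx 0 (col_mx (- 1%:M) 0) 0 0.

Lemma rotate_du : dP *m u = u *m - dX.
Proof.
rewrite /dP /u mul_block_col mulNmx /dC mul_block_col !mulmx0 !mul0mx !mulmx1.
rewrite mul_row_col !mulmx0 mul0mx !addr0 !add0r !mul_col_mx !mul0mx mul1mx.
by rewrite opp_col_mx oppr0.
Qed.

Lemma rotate_vd : v *m dP = - dX *m v.
Proof.
rewrite /dP /v mul_row_block mulmxN mul_row_block !mul0mx !mul1mx !mulmx0 !add0r mul_mx_row.
rewrite mulmx1 mulmx0 opp_row_mx add_row_mx addNr addr0.
by rewrite !mul_mx_row mulmx0 mulmx1 mulmxN mulNmx hphi.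
Qed.

Lemma rotate_vu : v *m u = 1%:M.
Proof. by rewrite /u /v !mul_row_col mulmx1 !mulmx0 add0r addr0. Qed.

Lemma rotate_uv : u *m v - 1%:M = dP *m h + h *m dP.
Proof.
have -> : u *m v = block_mx (col_mx 0 (row_mx 0 1%:M)) (col_mx 0 phi) 0 0.
  rewrite /u /v mul_col_row !mul0mx mul_col_row !mul0mx !mul1mx.
  by rewrite mul_col_mx mul0mx mul1mx /block_mx !row_mx0.
have -> : dP *m h = block_mx 0 (col_mx (- dE) phi) 0 (- 1%:M).
  rewrite /dP /h mulmx_block !mulmx0 ?mul0mx !addr0 mulNmx /dC mul_block_col.
  by rewrite mul_row_col ?mulmx0 ?mul0mx ?addr0 !mulmxN !mulmx1 opp_col_mx ?opprK.
have -> : h *m dP = block_mx (col_mx (row_mx (- 1%:M) 0) 0) (col_mx dE 0) 0 0.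
  rewrite /dP /h mulmx_block ?mulmx0 ?mul0mx ?addr0 ?add0r !mul_col_mx !mul0mx.
  by rewrite mulNmx mul1mx opp_row_mx oppr0 mulNmx mul1mx opprK.
rewrite add_block_mx !add0r !addr0 add_col_mx addNr addr0.
rewrite (@scalar_mx_block _ (e + x) e) (@scalar_mx_block _ e x).
rewrite opp_block_mx add_block_mx !oppr0 !addr0 add0r; congr block_mx.
by rewrite /block_mx opp_col_mx !opp_row_mx !oppr0 add_col_mx add0r add_row_mx addr0 subrr row_mx0.
Qed.

End RotateBlocks.

(** * Shifts by arbitrary integers and the third term of a triangle *)

Section Generation.
Context {R : realType} (G : tpoint R -> Prop) (f : poly2 R).
Local Notation S := (poly2 R).
Hypothesis Gsub : subgroup G.
Implicit Types (X Y Z W E : mf G f) (m n k : int).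

Opaque hom_d.

Definition shiftn_basis k (P : grbasis) : grbasis :=
  GrBasis (fun j : 'I_(rk P) => pos j - k) (@wt P).

Lemma hom_deg_shl m k (P Q : grbasis) (phi : 'M[S]_(rk Q, rk P)) :
  hom_deg G m (shiftn_basis k P) Q phi <-> hom_deg G (m - k) P Q phi.
Proof.
by split=> h i j; have := h i j; rewrite /= -addrA [_ + m]addrC.
Qed.

Lemma hom_deg_shr m k (P Q : grbasis) (phi : 'M[S]_(rk Q, rk P)) :
  hom_deg G m P (shiftn_basis k Q) phi <-> hom_deg G (m + k) P Q phi.
Proof.
have E (p q l : int) : p + m = q - k + l *+ 2 <-> p + (m + k) = q + l *+ 2 by split; lia.
by split=> h i j; have [->|[l [/E e1 e2]]] := h i j; [left|right; exists l|left|right; exists l].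
Qed.

Lemma shiftn_hom k X : hom_deg G 1 (shiftn_basis k X) (shiftn_basis k X) (sgn k *: mf_d X).
Proof.
by apply: hom_deg_scale => //; apply/hom_deg_shl/hom_deg_shr; rewrite subrK; exact: mf_d_hom.
Qed.

Lemma shiftn_sq k X : (sgn k *: mf_d X) *m (sgn k *: mf_d X) = f%:M.
Proof. by rewrite -scalemxAl -scalemxAr scalerA sgnV scale1r mf_d_sq. Qed.

(* X[k] *)
Definition shiftn k X : mf G f :=
  @MF R G f (shiftn_basis k X) _ (@shiftn_hom k X) (shiftn_sq k X).

Lemma sgnN k : sgn (- k) = sgn k :> S.
Proof. by rewrite /sgn abszN. Qed.

Lemma hom_d_shl m k X Y (phi : 'M[S]_(rk Y, rk X)) :
  hom_d m (X := shiftn k X) phi = hom_d (m - k) phi.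
Proof.
by rewrite !hom_dE /= -scalemxAr scalerA sgnD sgnN.
Qed.

Lemma hom_d_shr m k X Y (phi : 'M[S]_(rk Y, rk X)) :
  hom_d m (Y := shiftn k Y) phi = sgn k *: hom_d (m + k) phi.
Proof.
by rewrite !hom_dE /= -scalemxAl scalerBr scalerA sgnD [sgn m * _]mulrC mulrA sgnV mul1r.
Qed.

Lemma sgn_scale_eq0 k a b (A : 'M[S]_(a, b)) : sgn k *: A = 0 -> A = 0.
Proof. by move=> /(congr1 ( *:%R (sgn k))); rewrite scalerA sgnV scale1r scaler0. Qed.

Lemma closed_shl m k X Y (phi : 'M[S]_(rk Y, rk X)) :
  closed_hom m (X := shiftn k X) phi <-> closed_hom (m - k) phi.
Proof.
by split=> -[h e]; (split; [exact/hom_deg_shl|move: e; rewrite hom_d_shl; exact: id]).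
Qed.

Lemma closed_shr m k X Y (phi : 'M[S]_(rk Y, rk X)) :
  closed_hom m (Y := shiftn k Y) phi <-> closed_hom (m + k) phi.
Proof.
split=> -[h e]; (split; first exact/hom_deg_shr); move: e; rewrite hom_d_shr => e.
  exact: sgn_scale_eq0 e.
by rewrite e scaler0.
Qed.

Lemma exact_shl m k X Y (phi : 'M[S]_(rk Y, rk X)) :
  exact_hom m (X := shiftn k X) phi <-> exact_hom (m - k) phi.
Proof.
have E : m - 1 - k = m - k - 1 by lia.
split=> -[psi h ->]; exists psi; rewrite ?hom_d_shl ?E.
- by move/hom_deg_shl: h; rewrite E.
- by [].
- by apply/hom_deg_shl; rewrite E.
- by [].
Qed.

Lemma exact_shr m k X Y (phi : 'M[S]_(rk Y, rk X)) :
  exact_hom m (Y := shiftn k Y) phi <-> exact_hom (m + k) phi.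
Proof.
have E : m - 1 + k = m + k - 1 by lia.
split=> -[psi h ->]; exists (sgn k *: psi).
- by apply: hom_deg_scale => //; move/hom_deg_shr: h; rewrite E.
- by rewrite hom_d_shr E hom_dZ.
- by apply: hom_deg_scale => //; apply/hom_deg_shr; rewrite E.
- by rewrite hom_d_shr E hom_dZ scalerA sgnV scale1r.
Qed.

Lemma hom_coh0_shl m k X Y : hom_coh0 m (shiftn k X) Y <-> hom_coh0 (m - k) X Y.
Proof. by split=> h phi; [move=> /closed_shl/h/exact_shl|move=> /closed_shl/h/exact_shl]. Qed.

Lemma hom_coh0_shr m k X Y : hom_coh0 m X (shiftn k Y) <-> hom_coh0 (m + k) X Y.
Proof. by split=> h phi; [move=> /closed_shr/h/exact_shr|move=> /closed_shr/h/exact_shr]. Qed.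

(** Objects with the same data but different proofs or only provably equal positions are compared by
    the identity matrix, which avoids transport along equalities of records. *)
Lemma same_iso (n : nat) (p p' : 'I_n -> int) (w : 'I_n -> weight) (D D' : 'M[S]_n) hD hsq hD' hsq' :
  p =1 p' -> D = D' ->
  homotopy_equivalent (@MF _ G f (GrBasis p w) D hD hsq) (@MF _ G f (GrBasis p' w) D' hD' hsq').
Proof.
move=> /funext e eD; subst p' D'; exists 1%:M, 1%:M.
by split; try exact: closed1; rewrite mul1mx subrr; exact: exact0.
Qed.

Lemma generated_shiftn (Sb : mf G f -> Prop) k X : generated Sb X -> generated Sb (shiftn k X).
Proof.
move=> hX; elim/int_ind: k => [|k IH|k IH].
- by apply: gen_iso hX; case: X => -[r p w] D hD hs; apply: same_iso => // [j|]; rewrite ?subr0 // scale1r.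
- apply: gen_iso (gen_shift IH); apply: same_iso => [j /=|]; first lia.
  by rewrite /= -scaleNr -sgnS; congr (sgn _ *: _); lia.
- apply: gen_unshift; apply: gen_iso IH; case: (X) => -[r p w] D hD hs.
  apply: same_iso => [j /=|]; first lia.
  by rewrite /= -scaleNr -sgnS; congr (sgn _ *: _); lia.
Qed.

Lemma hom_deg_shift_l m (P Q : grbasis) (phi : 'M[S]_(rk Q, rk P)) :
  hom_deg G m (shift_basis P) Q phi <-> hom_deg G (m - 1) P Q phi.
Proof. exact: hom_deg_shl. Qed.

Lemma hom_deg_shift_r m (P Q : grbasis) (phi : 'M[S]_(rk Q, rk P)) :
  hom_deg G m P (shift_basis Q) phi <-> hom_deg G (m + 1) P Q phi.
Proof. exact: hom_deg_shr. Qed.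

Lemma cone_proj_closed X Y (phi : 'M[S]_(rk Y, rk X)) (hphi : closed_hom 0 phi) :
  closed_hom 0 (X := mf_cone hphi) (Y := mf_shift X) (row_mx 1%:M 0 : 'M_(rk X, rk X + rk Y)).
Proof.
split.
  apply/hom_deg_row; split; last exact: hom_deg0.
  by apply/hom_deg_shift_r; rewrite subrK; exact: hom_deg1.
rewrite hom_dE sgn0 scale1r; exact: cone_proj_blocks.
Qed.

(** [generated] closes under cones only, so Y is recovered by rotation: the cone of the projection
    from the cone of [phi] to X[1] is homotopy equivalent to Y[1]. *)
Lemma gen_cone_inv (Sb : mf G f -> Prop) X Y (phi : 'M[S]_(rk Y, rk X)) (hphi : closed_hom 0 phi) :
  generated Sb X -> generated Sb (mf_cone hphi) -> generated Sb Y.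
Proof.
move=> hX hC; apply: gen_unshift.
have hP := gen_cone (cone_proj_closed hphi) hC (gen_shift hX).
apply: gen_iso hP; set P := mf_cone _.
have e : mf_d Y *m phi = phi *m mf_d X.
  by apply/eqP; rewrite -subr_eq0; case: (hphi) => _; rewrite hom_dE sgn0 scale1r => ->.
pose u : 'M[S]_(rk X + rk Y + rk X, rk Y) := col_mx (col_mx 0 1%:M) 0.
pose v : 'M[S]_(rk Y, rk X + rk Y + rk X) := row_mx (row_mx 0 1%:M) phi.
have hu : closed_hom 0 (X := mf_shift Y) (Y := P) u.
  split; last by rewrite hom_dE sgn0 scale1r; apply/eqP; rewrite subr_eq0; apply/eqP; exact: rotate_du.
  apply/hom_deg_col; split; last exact: hom_deg0.
  apply/hom_deg_col; split; first exact: hom_deg0.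
  by apply/hom_deg_shift_l; rewrite addrK; exact: hom_deg1.
have hv : closed_hom 0 (X := P) (Y := mf_shift Y) v.
  split; last by rewrite hom_dE sgn0 scale1r; apply/eqP; rewrite subr_eq0 eq_sym; apply/eqP; exact: rotate_vd.
  apply/hom_deg_row; split.
    apply/hom_deg_row; split; first exact: hom_deg0.
    by apply/hom_deg_shift_r; rewrite subrK; exact: hom_deg1.
  by apply/hom_deg_shift_l/hom_deg_shift_r; rewrite subrK; case: (hphi).
exists v, u; split=> //; last first.
  by rewrite [v *m u]rotate_vu subrr; exact: exact0.
apply: (exact_any Gsub).
  apply: hom_degB => //; last exact: hom_deg1.
  rewrite -[0]addr0; apply: hom_deg_mul => //; [by case: hv|by case: hu].
rewrite hom_dE sgnD sgn0 mul1r (_ : sgn (-1) = -1) ?scaleN1r ?opprK; last by rewrite /sgn expr1.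
exact: (rotate_uv (mf_d X) (mf_d Y) phi).
Qed.

End Generation.

(** * Exceptional collections and generation *)

Lemma scale_subD (K : pzRingType) (V : lmodType K) (a b : K) (x y v : V) :
  x + y - (a + b) *: v = (x - a *: v) + (y - b *: v).
Proof. by rewrite scalerDl opprD addrACA. Qed.

Section Sums.
Context {R : realType} (G : tpoint R -> Prop) (f : poly2 R).
Local Notation S := (poly2 R).
Hypothesis Gsub : subgroup G.
Implicit Types (X Y Z W E : mf G f) (m n k : int).
Opaque hom_d.

Lemma row_block_proj (K : comNzRingType) (x y : nat) (dX : 'M[K]_x) (dY : 'M_y) :
  [/\ dX *m row_mx 1%:M 0 - row_mx 1%:M 0 *m block_mx dX 0 0 dY = 0,
      dY *m row_mx 0 1%:M - row_mx 0 1%:M *m block_mx dX 0 0 dY = 0,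
      block_mx dX 0 0 dY *m col_mx 1%:M 0 - col_mx 1%:M 0 *m dX = 0,
      block_mx dX 0 0 dY *m col_mx 0 1%:M - col_mx 0 1%:M *m dY = 0
    & col_mx 1%:M 0 *m row_mx 1%:M 0 + col_mx 0 1%:M *m row_mx 0 1%:M = 1%:M :> 'M[K]_(x + y)].
Proof.
split.
- by rewrite mul_mx_row mul_row_block !mulmx0 !mul1mx !mul0mx !addr0 mulmx1 subrr.
- by rewrite mul_mx_row mul_row_block !mulmx0 !mul1mx !mul0mx !add0r mulmx1 subrr.
- by rewrite mul_block_col mul_col_mx !mulmx0 !mul1mx !mul0mx !addr0 mulmx1 subrr.
- by rewrite mul_block_col mul_col_mx !mulmx0 !mul1mx !mul0mx !add0r mulmx1 subrr.
- rewrite !mul_col_row !mul1mx !mulmx0 !mul0mx add_block_mx !addr0 !add0r.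
  by rewrite -scalar_mx_block.
Qed.

Lemma sum_incl_proj X Y :
  [/\ closed_hom 0 (X := mf_sum X Y) (Y := X) (row_mx 1%:M 0 : 'M_(rk X, rk X + rk Y)),
      closed_hom 0 (X := mf_sum X Y) (Y := Y) (row_mx 0 1%:M : 'M_(rk Y, rk X + rk Y)),
      closed_hom 0 (Y := mf_sum X Y) (X := X) (col_mx 1%:M 0 : 'M_(rk X + rk Y, rk X))
    & closed_hom 0 (Y := mf_sum X Y) (X := Y) (col_mx 0 1%:M : 'M_(rk X + rk Y, rk Y))].
Proof.
have [p1 p2 i1 i2 _] := row_block_proj (mf_d X) (mf_d Y).
have hr (P Q : grbasis) Z (a : 'M[S]_(rk Z, rk P)) (b : 'M[S]_(rk Z, rk Q)) :
  hom_deg G 0 P Z a -> hom_deg G 0 Q Z b -> hom_deg G 0 (sum_basis P Q) Z (row_mx a b).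
  by move=> ha hb i j; rewrite /= mxE; case: split => k; [exact: ha|exact: hb].
have hc (P Q : grbasis) Z (a : 'M[S]_(rk P, rk Z)) (b : 'M[S]_(rk Q, rk Z)) :
  hom_deg G 0 Z P a -> hom_deg G 0 Z Q b -> hom_deg G 0 Z (sum_basis P Q) (col_mx a b).
  by move=> ha hb i j; rewrite /= mxE; case: split => k; [exact: ha|exact: hb].
split; (split; last by rewrite hom_dE sgn0 scale1r).
- by apply: hr; [exact: hom_deg1|exact: hom_deg0].
- by apply: hr; [exact: hom_deg0|exact: hom_deg1].
- by apply: hc; [exact: hom_deg1|exact: hom_deg0].
- by apply: hc; [exact: hom_deg0|exact: hom_deg1].
Qed.

Lemma sum_from n X Y Z : hom_coh0 n (mf_sum X Y) Z <-> hom_coh0 n X Z /\ hom_coh0 n Y Z.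
Proof.
have [p1 p2 i1 i2] := sum_incl_proj X Y.
split=> [h|[hX hY] phi hphi].
  split=> phi hphi.
    rewrite (_ : phi = phi *m row_mx 1%:M 0 *m col_mx 1%:M (0 : 'M_(rk Y, rk X))).
      by apply: (exactM0 Gsub _ i1); apply: h; exact: closedM0 p1.
    by rewrite -mulmxA mul_row_col mulmx1 mulmx0 addr0 mulmx1.
  rewrite (_ : phi = phi *m row_mx 0 1%:M *m col_mx (0 : 'M_(rk X, rk Y)) 1%:M).
    by apply: (exactM0 Gsub _ i2); apply: h; exact: closedM0 p2.
  by rewrite -mulmxA mul_row_col mulmx1 mulmx0 add0r mulmx1.
have [_ _ _ _ e] := row_block_proj (mf_d X) (mf_d Y).
rewrite -[phi]mulmx1 -e mulmxDr !mulmxA; apply: exactD => //.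
  by apply: (exactM0 Gsub _ p1); apply: hX; exact: closedM0 i1.
by apply: (exactM0 Gsub _ p2); apply: hY; exact: closedM0 i2.
Qed.

Lemma sum_to n X Y Z : hom_coh0 n Z X -> hom_coh0 n Z Y -> hom_coh0 n Z (mf_sum X Y).
Proof.
move=> hX hY phi hphi; have [p1 p2 i1 i2] := sum_incl_proj X Y.
have [_ _ _ _ e] := row_block_proj (mf_d X) (mf_d Y).
rewrite -[phi]mul1mx -e mulmxDl -!mulmxA; apply: exactD => //.
  by apply: (exact0M Gsub i1); apply: hX; exact: closed0M p1 _.
by apply: (exact0M Gsub i2); apply: hY; exact: closed0M p2 _.
Qed.

Lemma zero_to n Z : hom_coh0 n Z (mf_zero : mf G f).
Proof. by move=> phi _; rewrite (_ : phi = 0); [exact: exact0|apply/matrixP => -[]]. Qed.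

Lemma zero_from n Z : hom_coh0 n (mf_zero : mf G f) Z.
Proof. by move=> phi _; rewrite (_ : phi = 0); [exact: exact0|apply/matrixP => ? -[]]. Qed.

Lemma bigsum_to N (E : 'I_N -> mf G f) n Z :
  (forall i, hom_coh0 n Z (E i)) -> hom_coh0 n Z (\big[mf_sum/mf_zero]_(i < N) E i).
Proof.
by move=> h; apply: (big_ind (fun W => hom_coh0 n Z W)); [exact: zero_to|move=> X Y; exact: sum_to|move=> i _; exact: h].
Qed.

Lemma bigsum_from N (E : 'I_N -> mf G f) n Z :
  hom_coh0 n (\big[mf_sum/mf_zero]_(i < N) E i) Z <-> forall i, hom_coh0 n (E i) Z.
Proof.
split=> h; last first.
  by apply: (big_ind (fun W => hom_coh0 n W Z)); [exact: zero_from|move=> X Y hX hY; exact/sum_from|move=> i _; exact: h].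
move=> i; have := mem_index_enum i; move: h; elim: (index_enum _) => [|j r IH]; rewrite ?in_nil //.
rewrite big_cons => /sum_from[hj hr]; rewrite inE => /orP[/eqP->//|]; exact: IH.
Qed.

End Sums.

(** * Coning off and the criterion for full strong exceptional collections *)

Section Span.
Context {R : realType} (G : tpoint R -> Prop) (f : poly2 R).
Local Notation S := (poly2 R).
Hypothesis Gsub : subgroup G.
Implicit Types (X Y Z W E : mf G f) (m n k : int).
Opaque hom_d.

(** Linear combinations modulo exact maps, by recursion on the list instead of a sum, so that
    [coneoff] can discard one generating class at a time. *)
Fixpoint spans E X n (s : seq (int * 'M[S]_(rk X, rk E))) (phi : 'M[S]_(rk X, rk E)) : Prop :=
  if s is kc :: s' then
    if kc.1 == n then exists c : R[i], spans n s' (phi - c%:MP *: kc.2) else spans n s' phi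
  else exact_hom n phi.

Fixpoint closed_seq E X (s : seq (int * 'M[S]_(rk X, rk E))) : Prop :=
  if s is kc :: s' then closed_hom kc.1 kc.2 /\ closed_seq s' else True.

Definition spanning E X (s : seq (int * 'M[S]_(rk X, rk E))) : Prop :=
  closed_seq s /\ forall n phi, closed_hom n phi -> spans n s phi.

Lemma spans_exact E X n s (phi : 'M[S]_(rk X, rk E)) : exact_hom n phi -> spans n s phi.
Proof.
elim: s => //= kc s IH h; case: ifP => _; last exact: IH.
by exists 0; rewrite mpolyC0 scale0r subr0; exact: IH.
Qed.

Lemma spansD E X n s (phi psi : 'M[S]_(rk X, rk E)) :
  spans n s phi -> spans n s psi -> spans n s (phi + psi).
Proof.
elim: s phi psi => [|kc s IH] phi psi /=; first exact: exactD.
case: ifP => _; last exact: IH.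
case=> c hc [d hd]; exists (c + d).
have -> : (c + d)%:MP = c%:MP + d%:MP :> S by rewrite mpolyCD.
by rewrite scale_subD; exact: (IH _ _ hc hd).
Qed.

Lemma spansZ E X n s c (phi : 'M[S]_(rk X, rk E)) :
  spans n s phi -> spans n s (c%:MP *: phi).
Proof.
elim: s phi => [|kc s IH] phi /=; first exact: exactZ.
case: ifP => _; last exact: IH.
case=> d hd; exists (c * d).
have -> : (c * d)%:MP = c%:MP * d%:MP :> S by rewrite mpolyCM.
by rewrite -scalerA -scalerBr; exact: (IH _ hd).
Qed.

Lemma spans_catl E X n s s' (phi : 'M[S]_(rk X, rk E)) : spans n s phi -> spans n (s ++ s') phi.
Proof.
elim: s phi => [|kc s IH] phi /=; first exact: spans_exact.
by case: ifP => _; [case=> c hc; exists c; exact: (IH _ hc)|exact: IH].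
Qed.

Lemma spans_catr E X n s s' (phi : 'M[S]_(rk X, rk E)) : spans n s phi -> spans n (s' ++ s) phi.
Proof.
elim: s' phi => [|kc s' IH] phi //= h; case: ifP => _; last exact: IH.
by exists 0; rewrite mpolyC0 scale0r subr0; exact: IH.
Qed.

Lemma closed_seq_cat E X (s s' : seq (int * 'M[S]_(rk X, rk E))) :
  closed_seq s -> closed_seq s' -> closed_seq (s ++ s').
Proof. by elim: s => //= kc s IH [h1 h2] h3; split=> //; exact: IH. Qed.

Lemma closed_scalar n E : n = 0 -> forall c : R[i], closed_hom n (X := E) (Y := E) (c%:MP *: 1%:M).
Proof. by move=> -> c; apply/closedZ/closed1. Qed.

(** Induction on the number of classes that span the maps from E to X. Each step replaces X by the
    cone of one class on a shift of E; this stays in reach of E and keeps whatever is left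
    orthogonal to both E and X. *)
Lemma coneoff (Sb : mf G f -> Prop) E : generated Sb E -> exceptional E ->
  forall X s, spanning (E := E) (X := X) s ->
  exists X', [/\ generated Sb X' -> generated Sb X,
    forall m, hom_coh0 m E X'
  & forall Z, (forall m, hom_coh0 m Z E) -> (forall m, hom_coh0 m Z X) ->
      forall m, hom_coh0 m Z X'].
Proof.
move=> gE [excE1 excE2 excE3] X s; move: {2}(size s) (erefl (size s)) => N.
elim: N X s => [|N IH] X [|[k c] s] //= => [_ [_ h]|[sN] [[/= hc hs] h]].
  by exists X; split=> // m phi /h.
(* A class that depends on the others is dropped. Otherwise coning it off must create no new maps
   from E, and independence is what guarantees this. *)
have [hin|hout] := pselect (spans k s c).
  apply: (IH X s) => //; split=> // n phi /h /=; case: eqP => // <- [d hd].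
  by rewrite -(subrK (d%:MP *: c) phi); apply: spansD => //; exact: spansZ.
(* The shift turns the map [c] of degree k into one of degree 0, as cones require. *)
have hc' : closed_hom 0 (X := shiftn (- k) E) c by apply/closed_shl; rewrite opprK add0r.
pose X1 := mf_cone hc'.
pose tr (b : 'M[S]_(rk X, rk E)) : 'M[S]_(rk X1, rk E) := col_mx 0 b.
have trB b b' : tr (b - b') = tr b - tr b'.
  by rewrite /tr opp_col_mx add_col_mx oppr0 addr0.
have trZ d b : tr (d *: b) = d *: tr b by rewrite /tr scale_col_mx scaler0.
have htr n (s' : seq (int * 'M[S]_(rk X, rk E))) b :
  spans n s' b -> spans n (X := X1) [seq (kc.1, tr kc.2) | kc <- s'] (tr b).
  elim: s' b => [|kc s' IHs] b /=; first exact: exact_inr.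
  case: ifP => _; last exact: IHs.
  by case=> d hd; exists d; rewrite -trZ -trB; exact: IHs.
have hspan : spanning (X := X1) [seq (kc.1, tr kc.2) | kc <- s].
  split.
    elim: (s) hs => //= kc s' IHs [h1 h2]; split; last exact: IHs.
    exact: closed_inr.
  move=> n th hth; have ha := cone_usub hth.
  have ha' : closed_hom (n + 1 - k) (usubmx th : 'M[S]_(rk E, rk E)).
    by move/closed_shr: ha.
  have [|b hb hex] := @cone_to_local _ _ _ Gsub _ _ _ hc' n E th hth.
    apply/exact_shr; have [e|ne] := eqVneq (n + 1 - k) 0; last exact: excE1.
    rewrite e in ha' *; have [d hd] := excE3 _ ha'.
    have [d0|dn0] := eqVneq d 0.
      by move: hd; rewrite d0 mpolyC0 -scalemx1 scale0r subr0.
    (* The component in E of a closed map to the cone is d times the identity up to homotopy. For d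
       != 0, closedness of the whole map makes d c, hence [c], exact, against independence. *)
    case: hout; apply: spans_exact.
    have -> : c = (d^-1)%:MP *: (d%:MP *: c).
      by rewrite scalerA -mpolyCM mulVf // mpolyC1 scale1r.
    apply: exactZ => //.
    have ek : k = n + 1 by lia.
    have -> : d%:MP *: c = c *m usubmx th - c *m (usubmx th - (d%:MP)%:M).
      by rewrite mulmxBr opprB addrC subrK mul_mx_scalar.
    apply: exactB => //; last by rewrite -[k]addr0; exact: exactMr.
    have [dth e2] := hth.
    rewrite -[th]vsubmxK hom_d_col in e2.
    move: e2; rewrite -col_mx0 => /eq_col_mx[_ /eqP]; rewrite addr_eq0 => /eqP ->.
    apply: exactN => //; rewrite ek; exists (dsubmx th : 'M_(rk X, rk E)); rewrite addrK //.
    by move: dth; rewrite -[th]vsubmxK => /hom_deg_col[_]; rewrite col_mxKd.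
  rewrite -(subrK (tr b) th); apply: spansD; first exact: spans_exact.
  have /= := h n b hb; case: eqP => [ek [d hd]|_]; last exact: htr.
  have -> : tr b = tr (b - d%:MP *: c) + tr (d%:MP *: c) by rewrite trB subrK.
  apply: spansD; first exact: htr.
  apply: spans_exact; rewrite -[d%:MP *: c]mul_mx_scalar.
  have hd1 : closed_hom n (X := E) (Y := shiftn (- k) E) ((d%:MP)%:M : 'M[S]_(rk E, rk E)).
    apply/closed_shr; rewrite -scalemx1.
    by apply: closed_scalar; rewrite ek subrr.
  exact: (exact_inr_phi hc' hd1).
have [|X' [g1 g2 g3]] := IH X1 _ _ hspan; first by rewrite size_map.
exists X'; split=> //.
  by move=> /g1; apply: (gen_cone_inv Gsub); exact: generated_shiftn.
move=> Z hZE hZX; apply: g3; first exact: hZE.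
move=> m; refine (@cone_to _ _ _ Gsub _ _ _ hc' m Z _ (hZX m)).
by apply/hom_coh0_shr; exact: hZE.
Qed.

Definition finite_from E := forall X, exists s, spanning (E := E) (X := X) s.

(** Coning off the objects from the last to the first leaves an object in the right orthogonal of
    all of them: later objects have no maps to earlier ones, so earlier cones do not destroy what
    was achieved. The remainder is contractible and X is rebuilt from zero. *)
Theorem exceptional_criterion N (E : 'I_N -> mf G f) :
  (forall i, exceptional (E i)) ->
  (forall i j : 'I_N, (i < j)%N -> forall m, hom_coh0 m (E j) (E i)) ->
  (forall (i j : 'I_N) m, m != 0 -> hom_coh0 m (E i) (E j)) ->
  (forall i, finite_from (E i)) ->
  (forall Y, (forall i m, hom_coh0 m (E i) Y) -> contractible Y) ->
  full_strong_exceptional E /\ tilting (\big[mf_sum/mf_zero]_(i < N) E i).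
Proof.
move=> exc ord strong fin detect; split; last first.
  split=> [m m0|Y hY]; first by apply/bigsum_from => // i; apply: bigsum_to => // j; exact: strong.
  by apply/contractible_zero/detect => // i m; have /bigsum_from := hY m; apply.
split=> // X; set Sb := fun _ => _.
have gE i : generated Sb (E i) by apply: gen_base; exists i.
(* After j steps the last j objects, with indices at least N - j, have been treated. *)
suff H j : (j <= N)%N -> exists X', (generated Sb X' -> generated Sb X) /\
    forall i : 'I_N, (N - j <= i)%N -> forall m, hom_coh0 m (E i) X'.
  have [//|X' [gX' hX']] := H N; apply: gX'.
  have /contractible_zero : contractible X' by apply: detect => i m; apply: hX'; rewrite subnn.
  case=> // u [v [hu hv h1 h2]]; apply: (gen_iso _ (gen_zero Sb)).
  by exists v, u.
elim: j => [_|j IH jN].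
  by exists X; split=> // i; rewrite subn0 leqNgt ltn_ord.
have [|X' [gX' hX']] := IH; first exact: ltnW.
have lt : (N - j.+1 < N)%N by lia.
have [s hs] := fin (Ordinal lt) X'.
have [X2 [g1 g2 g3]] := coneoff (gE _) (exc _) hs.
exists X2; split=> [/g1/gX'//|i hi m].
have [e|ne] := eqVneq i (Ordinal lt); first by rewrite e.
have hlt : (N - j.+1 < i)%N by move/eqP: ne => ne; rewrite ltn_neqAle hi andbT; apply/eqP => e; apply: ne; apply: val_inj.
apply: g3 => m'; first exact: ord.
by apply: hX'; lia.
Qed.

End Span.

(** * Subspaces of finitely spanned vector spaces *)

Section Combinations.
Context (K : fieldType) (V : zmodType) (sc : K -> V -> V).
Hypothesis scD : forall a x y, sc a (x + y) = sc a x + sc a y.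
Hypothesis scDl : forall a b x, sc (a + b) x = sc a x + sc b x.
Hypothesis scA : forall a b x, sc a (sc b x) = sc (a * b) x.

Fixpoint comb (s : seq V) (x : V) : Prop :=
  if s is v :: s' then exists c, comb s' (x - sc c v) else x = 0.

Lemma sc0l x : sc 0 x = 0.
Proof. by apply: (addrI (sc 0 x)); rewrite -scDl !addr0. Qed.

Lemma sc0r a : sc a 0 = 0.
Proof. by apply: (addrI (sc a 0)); rewrite -scD !addr0. Qed.

Lemma scNl a x : sc (- a) x = - sc a x.
Proof. by apply: (addrI (sc a x)); rewrite -scDl !subrr sc0l. Qed.

Lemma scN a x : sc a (- x) = - sc a x.
Proof. by apply: (addrI (sc a x)); rewrite -scD !subrr sc0r. Qed.

Lemma combB s a x y : comb s x -> comb s y -> comb s (x - sc a y).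
Proof.
elim: s x y => [|v s IH] x y /=; first by move=> -> ->; rewrite sc0r subrr.
case=> c hc [d hd]; exists (c - a * d).
have -> : x - sc a y - sc (c - a * d) v = (x - sc c v) - sc a (y - sc d v).
  by rewrite scDl scNl scD scN scA !opprD !opprK addrACA.
exact: IH.
Qed.

Lemma comb_sum (I : Type) (r : seq I) (l : I -> K) (v : I -> V) :
  comb [seq v i | i <- r] (\sum_(i <- r) sc (l i) (v i)).
Proof.
elim: r => [|i r IH] /=; first by rewrite big_nil.
by exists (l i); rewrite big_cons addrAC subrr add0r.
Qed.

Lemma comb_subspace (s : seq V) (Z : V -> Prop) :
  (forall a x y, Z x -> Z y -> Z (x - sc a y)) -> (forall x, Z x -> comb s x) ->
  exists2 b : seq V, (forall i, (i < size b)%N -> Z (nth 0 b i)) & forall x, Z x -> comb b x.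
Proof.
elim: s Z => [|v s IH] Z ZB hZ; first by exists [::].
have [|b hb1 hb2] := IH (fun x => Z x /\ comb s x) _ (fun x h => h.2).
  by move=> a x y [h1 h2] [h3 h4]; split; [exact: ZB|exact: combB].
(* Elimination: an element of Z with nonzero coefficient at v clears that coefficient from all
   others. If there is none, Z already lies in the span of s. *)
have [[x0 [c0 [zx0 h0 n0]]]|no] := pselect (exists x0 c0, [/\ Z x0, comb s (x0 - sc c0 v) & c0 != 0]).
  exists (x0 :: b); first by case=> [|i] //= /hb1[].
  move=> x zx /=; have [c hc] := hZ x zx; exists (c / c0).
  apply: hb2; split; first exact: ZB.
  have -> : x - sc (c / c0) x0 = (x - sc c v) - sc (c / c0) (x0 - sc c0 v).
    by rewrite scD scN scA divfK // opprB addrC addrA subrK addrC.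
  exact: combB.
exists b; first by move=> i /hb1[].
move=> x zx; apply: hb2; split=> //; have [c hc] := hZ x zx.
have [c0|n0] := eqVneq c 0; first by move: hc; rewrite c0 sc0l subr0.
by case: no; exists x, c.
Qed.

End Combinations.

Definition bi_mon (s t : nat) : 'X_{1..2} := [multinom (if i == 0%R then s else t) | i < 2].

Lemma bi_monE (m : 'X_{1..2}) : m = bi_mon (m 0%R) (m 1%R).
Proof.
apply/mnmP => i; rewrite mnmE; case: eqP => [->//|ne].
by congr (m _); apply: val_inj; move: i ne => [[|[|k]] hk] ne //=; case: ne; apply: val_inj.
Qed.

Lemma bi_mon0 s t : bi_mon s t 0%R = s. Proof. by rewrite mnmE. Qed.
Lemma bi_mon1 s t : bi_mon s t 1%R = t. Proof. by rewrite mnmE. Qed.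

(** * Finite dimension of Hom from a positive degree *)

Section Bounded.
Context {R : realType} (G : tpoint R -> Prop) (f : poly2 R).
Local Notation S := (poly2 R).
Hypothesis Gsub : subgroup G.
Implicit Types (X Y Z W E : mf G f) (m n k : int).
Opaque hom_d.

Context (deg : weight -> int) (dA dB : nat).
Hypothesis degD : forall u v, deg (u + v) = deg u + deg v.
Hypotheses (dA0 : (0 < dA)%N) (dB0 : (0 < dB)%N) (degchi : 0 < deg chi).
Hypothesis degP : forall u (m : 'X_{1..2}), mon_weight G u m -> deg u = (dA * m 0%R + dB * m 1%R)%N.

Lemma deg0 : deg 0 = 0.
Proof. by apply: (addrI (deg 0)); rewrite -degD !addr0. Qed.

Lemma degN u : deg (- u) = - deg u.
Proof. by apply: (addrI (deg u)); rewrite -degD !subrr deg0. Qed.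

Lemma degZ u k : deg (u *~ k) = deg u * k.
Proof.
have h (n : nat) : deg (u *+ n) = deg u * n.
  by elim: n => [|n IH]; rewrite ?mulr0n ?deg0 ?mulr0 // mulrS degD IH intS mulrDr mulr1.
case: k => n; first exact: h.
by rewrite [u *~ _]/(- (u *+ n.+1)) degN h NegzE mulrN.
Qed.

Lemma weight_support u (p : S) (m : 'X_{1..2}) : has_weight G u p -> m \in msupp p ->
  deg u = (dA * m 0%R + dB * m 1%R)%N.
Proof. by move=> /has_weightP h /h; exact: degP. Qed.

Lemma neg_weight0 u (p : S) : has_weight G u p -> deg u < 0 -> p = 0.
Proof.
move=> hp hu; apply: msuppnil0; case E: (msupp p) => [//|m s].
have /(weight_support hp) : m \in msupp p by rewrite E inE eqxx.
by lia.
Qed.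

(** With positive degrees of both variables, the degree of an entry bounds its two exponents. An odd
    difference of positions gives a meaningless quotient here, which only enlarges the maximum. *)
Definition coch_bound (P Q : grbasis) n : nat :=
  (\max_(i < rk Q) \max_(j < rk P)
    absz (deg (wt j - wt i) + deg chi * ((pos j + n - pos i) %/ 2)%Z)%R).+1.

Lemma coch_boundP (P Q : grbasis) n (phi : 'M[S]_(rk Q, rk P)) i j (m : 'X_{1..2}) :
  hom_deg G n P Q phi -> m \in msupp (phi i j) ->
  (m 0%R < coch_bound P Q n)%N /\ (m 1%R < coch_bound P Q n)%N.
Proof.
move=> hphi hm; have [e|[k [ek hk]]] := hphi i j; first by rewrite e msupp0 in hm.
have e := weight_support hk hm; rewrite degD degZ in e.
suff : (dA * m 0%R + dB * m 1%R < coch_bound P Q n)%N by nia.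
rewrite ltnS; apply: leq_trans (leq_bigmax i); apply: leq_trans (leq_bigmax j).
by rewrite (parity_div ek).2 e absz_nat.
Qed.

Lemma mpoly_boundE (D : nat) (p : S) :
  (forall m : 'X_{1..2}, m \in msupp p -> (m 0%R < D)%N /\ (m 1%R < D)%N) ->
  p = \sum_(st : 'I_D * 'I_D) p@_(bi_mon st.1 st.2) *: 'X_[bi_mon st.1 st.2].
Proof.
move=> h; apply/mpolyP => m; rewrite raddf_sum /=.
have [hm|hm] := boolP (m \in msupp p).
  have [h0 h1] := h m hm; rewrite (bigD1 (Ordinal h0, Ordinal h1)) //= -bi_monE.
  rewrite mcoeffZ mcoeffX eqxx mulr1 big1 ?addr0 // => -[s t] /= ne.
  rewrite mcoeffZ mcoeffX; case: eqP => [e|]; last by rewrite mulr0.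
  case/eqP: ne; congr pair; apply: val_inj; rewrite /= -e ?bi_mon0 ?bi_mon1 //.
rewrite (memN_msupp_eq0 hm) big1 // => -[s t] _ /=.
rewrite mcoeffZ mcoeffX; case: eqP => [->|]; rewrite ?mulr0 // (memN_msupp_eq0 hm) mul0r //.
Qed.

Lemma cochains_comb n (P Q : grbasis) : exists s : seq 'M[S]_(rk Q, rk P),
  forall phi, hom_deg G n P Q phi ->
    comb (fun (c : R[i]) (A : 'M[S]_(rk Q, rk P)) => c%:MP *: A) s phi.
Proof.
pose D := coch_bound P Q n.
pose v (x : 'I_(rk Q) * 'I_(rk P) * ('I_D * 'I_D)) : 'M[S]_(rk Q, rk P) :=
  'X_[bi_mon x.2.1 x.2.2] *: delta_mx x.1.1 x.1.2.
exists [seq v x | x <- index_enum _] => phi hphi.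
pose l (x : 'I_(rk Q) * 'I_(rk P) * ('I_D * 'I_D)) := (phi x.1.1 x.1.2)@_(bi_mon x.2.1 x.2.2).
have -> : phi = \sum_x (l x)%:MP *: v x.
  rewrite {1}[phi]matrix_sum_delta pair_big /=.
  rewrite -(pair_big xpredT xpredT (fun a b => (l (a, b))%:MP *: v (a, b))) /=.
  apply: eq_bigr => -[i j] _ /=.
  rewrite {1}[phi i j](@mpoly_boundE D); last by move=> m; exact: coch_boundP.
  rewrite scaler_suml; apply: eq_bigr => st _.
  by rewrite /l /v /= scalerA mul_mpolyC.
exact: (comb_sum _ (index_enum _) l v).
Qed.

Lemma degree_spanning n E X : exists s, closed_seq s /\
  forall phi : 'M[S]_(rk X, rk E), closed_hom n phi -> spans n s phi.
Proof.
have [s hs] := cochains_comb n E X.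
have h1 (a : R[i]) (x y : 'M[S]_(rk X, rk E)) : a%:MP *: (x + y) = a%:MP *: x + a%:MP *: y.
  exact: scalerDr.
have h2 (a b : R[i]) (x : 'M[S]_(rk X, rk E)) : (a + b)%:MP *: x = a%:MP *: x + b%:MP *: x.
  by rewrite (mpolyCD _ a b) scalerDl.
have h3 (a b : R[i]) (x : 'M[S]_(rk X, rk E)) : a%:MP *: (b%:MP *: x) = (a * b)%:MP *: x.
  by rewrite scalerA -(mpolyCM _ a b).
have [||b hb1 hb2] := @comb_subspace _ _ _ h1 h2 h3 s (fun phi => closed_hom n (X := E) (Y := X) phi).
- move=> a x y /= hx hy; refine (closedB hx _); exact: closedZ.
- by move=> x [hx _]; exact: hs.
exists [seq (n, x) | x <- b]; split.
  elim: (b) hb1 => //= x b' IH hb; split; first exact: (hb 0%N).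
  by apply: IH => i hi; exact: (hb i.+1).
move=> phi /hb2; elim: (b) phi => [|x b' IH] phi /=; first by move=> ->; exact: exact0.
by case=> c hc; rewrite eqxx; exists c; exact: IH.
Qed.

Lemma hom_coh0_neg E X : exists N : nat, forall n, n < - N%:Z -> hom_coh0 n E X.
Proof.
(* Below -M the twist satisfies k < -|d|, d the degree of the difference of weights, so d + k deg
   chi is negative and every entry vanishes. The factor 2 comes from 2 k = pos j + n - pos i. *)
pose M := \max_(i < rk X) \max_(j < rk E) (2 * absz (deg (wt j - wt i)%R) + absz (pos j) + absz (pos i))%N.
exists M => n hn phi hphi.
suff -> : phi = 0 by exact: exact0.
apply/matrixP => i j; rewrite mxE; case: hphi => hphi _.
have [//|[k [ek hk]]] := hphi i j; apply: (neg_weight0 hk); rewrite degD degZ.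
have : (2 * absz (deg (wt j - wt i)%R) + absz (pos j) + absz (pos i) <= M)%N.
  by apply: leq_trans (leq_bigmax i); apply: leq_trans (leq_bigmax j).
set d := deg (wt j - wt i) => hM.
have hk0 : k + `|d|%N%:Z < 0 by lia.
by nia.
Qed.

Definition bounded_from E := forall X, exists N : nat, forall n, N%:Z <= n -> hom_coh0 n E X.

(** Only the degrees from -M to N - 1 remain, and each contributes finitely many classes. *)
Lemma bounded_finite E : bounded_from E -> finite_from E.
Proof.
move=> hE X; have [N hN] := hE X; have [M hM] := hom_coh0_neg E X.
have [s hs] : exists s : seq (int * 'M[S]_(rk X, rk E)), closed_seq s /\
    forall i : nat, (i < M + N)%N -> forall phi, closed_hom (i%:Z - M%:Z) phi -> spans (i%:Z - M%:Z) s phi.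
  elim: (M + N)%N => [|l [s [hs1 hs2]]]; first by exists [::].
  have [s' [hs'1 hs'2]] := degree_spanning (l%:Z - M%:Z) E X.
  exists (s ++ s'); split; first exact: closed_seq_cat.
  move=> i; rewrite ltnS leq_eqVlt => /orP[/eqP -> phi /hs'2|/hs2 h phi /h].
    exact: spans_catr.
  exact: spans_catl.
exists s; split; first exact: hs.1.
move=> n phi hphi.
have [h1|h1] := ltrP n (- M%:Z); first by apply: spans_exact; exact: hM hphi.
have [h2|h2] := lerP N%:Z n; first by apply: spans_exact; exact: hN hphi.
have e : n = (absz (n + M%:Z)%R)%:Z - M%:Z by lia.
by rewrite e in hphi *; apply: hs.2 hphi; lia.
Qed.

End Bounded.

(** * Exactness modulo an ideal *)

Lemma addr_shuffle (V : zmodType) (w u a b : V) : w - a + b = u + (w - u - a + b).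
Proof. by rewrite -!addrA [RHS]addrCA [u + (- u + _)]addrA subrr add0r. Qed.

Lemma addr_swap (V : zmodType) (a b c d : V) : a - b + (c + d) = a + d - b + c.
Proof. by rewrite [a + d - b]addrAC -[RHS]addrA [d + c]addrC. Qed.

Section Quotients.
Context {R : realType} (G : tpoint R -> Prop) (f : poly2 R).
Local Notation S := (poly2 R).
Hypothesis Gsub : subgroup G.
Implicit Types (Y : mf G f) (n k : int) (w u : weight) (I J : S -> Prop).
Opaque hom_d.

Definition pt w : grbasis := @GrBasis 1 (fun=> 0) (fun=> w).

Definition vec n w (P : grbasis) (v : 'cV[S]_(rk P)) : Prop := hom_deg G n (pt w) P v.

(** Ideals as predicates. Stability under the projections expresses homogeneity without naming
    generators, so the whole ring and the maximal ideal at the origin are covered alike. *)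
Record hideal I : Prop := HIdeal {
  hideal0 : I 0;
  hidealD : forall p q, I p -> I q -> I (p + q);
  hidealM : forall p q, I q -> I (p * q);
  hideal_proj : forall u p, I p -> I (wproj G u p) }.

Definition vec_in I m (v : 'cV[S]_m) : Prop := forall i, I (v i 0).

(* Y/IY has no cohomology in the degrees of Y[n] twisted by w. *)
Definition acyclic_mod I w Y : Prop :=
  forall n v, vec n w (P := Y) v -> vec_in I (mf_d Y *m v) ->
    exists p j, vec_in I j /\ v = mf_d Y *m p + j.

Lemma hidealN I : hideal I -> forall p, I p -> I (- p).
Proof. by move=> hI p h; rewrite -mulN1r; exact: hidealM. Qed.

Lemma vec_inD I m (v v' : 'cV[S]_m) : hideal I -> vec_in I v -> vec_in I v' -> vec_in I (v + v').
Proof. by move=> hI h h' i; rewrite mxE; exact: hidealD. Qed.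

Lemma vec_inN I m (v : 'cV[S]_m) : hideal I -> vec_in I v -> vec_in I (- v).
Proof. by move=> hI h i; rewrite mxE; exact: hidealN. Qed.

Lemma vec_inB I m (v v' : 'cV[S]_m) : hideal I -> vec_in I v -> vec_in I v' -> vec_in I (v - v').
Proof. by move=> hI h h'; apply: vec_inD => //; exact: vec_inN. Qed.

Lemma vec_inM I m l (A : 'M[S]_(l, m)) (v : 'cV[S]_m) : hideal I -> vec_in I v -> vec_in I (A *m v).
Proof.
move=> hI h i; rewrite mxE; apply: (big_ind I); [exact: hideal0|exact: hidealD|].
by move=> j _; apply: hidealM.
Qed.

Lemma vec_in_gen I m c (v : 'cV[S]_m) : hideal I -> I c -> vec_in I (c *: v).
Proof. by move=> hI h i; rewrite mxE mulrC; exact: hidealM. Qed.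

Definition vproj n w (P : grbasis) (v : 'cV[S]_(rk P)) : 'cV[S]_(rk P) :=
  mproj G n (v : 'M_(rk P, rk (pt w))).

Lemma vproj_vec n w (P : grbasis) v : vec n w (vproj n w v : 'cV_(rk P)).
Proof. exact: hom_deg_proj. Qed.

Lemma vproj_id n w (P : grbasis) (v : 'cV_(rk P)) : vec n w v -> vproj n w v = v.
Proof. by move/hom_degE. Qed.

Lemma vprojD n w (P : grbasis) (v v' : 'cV_(rk P)) :
  vproj n w (v + v') = vproj n w v + vproj n w v'.
Proof. by rewrite /vproj mproj_is_additive. Qed.

Lemma vproj_in I n w (P : grbasis) (v : 'cV_(rk P)) : hideal I -> vec_in I v -> vec_in I (vproj n w v).
Proof.
move=> hI h i; rewrite mxE /entry_proj; case: ifP => _; last exact: hideal0.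
exact: hideal_proj.
Qed.

Lemma vproj_d n w Y (v : 'cV_(rk Y)) : vproj (1 + n) w (mf_d Y *m v) = mf_d Y *m vproj n w v.
Proof. by rewrite /vproj; apply: (@mproj_mull _ _ Gsub n 1 (pt w)); exact: mf_d_hom. Qed.

Lemma vec_d n w Y (v : 'cV_(rk Y)) : vec n w v -> vec (1 + n) w (mf_d Y *m v : 'cV_(rk Y)).
Proof. by move=> h; rewrite -(vproj_id h) -vproj_d; exact: vproj_vec. Qed.

Lemma vproj_scale n w u c (P : grbasis) (v : 'cV_(rk P)) : has_weight G u c ->
  vproj n w (c *: v) = c *: vproj n (w - u) v.
Proof.
move=> hc; apply/matrixP => i j; rewrite !mxE /entry_proj /=.
case: ifP => _; last by rewrite mulr0.
rewrite -(wprojMl Gsub _ _ hc); congr wproj.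
exact: addr_shuffle.
Qed.

Lemma vec_scale n w u c (P : grbasis) (v : 'cV_(rk P)) : has_weight G u c ->
  vec n (w - u) v -> vec n w (c *: v).
Proof. by move=> hc hv; rewrite -(vproj_id hv) -(vproj_scale _ _ _ hc); exact: vproj_vec. Qed.

Lemma vecB n w (P : grbasis) (v v' : 'cV_(rk P)) : vec n w v -> vec n w v' -> vec n w (v - v').
Proof. exact: hom_degB. Qed.

(** The definition of [acyclic_mod] leaves the solution ungraded; projecting both terms restores the
    degree. *)
Lemma acyclic_homog I w Y n v : hideal I -> acyclic_mod I w Y ->
  vec n w v -> vec_in I (mf_d Y *m v) ->
  exists p j, [/\ vec (n - 1) w (p : 'cV_(rk Y)), vec n w j, vec_in I j & v = mf_d Y *m p + j].
Proof.
move=> hI hY hv hdv; have [p [j [hj e]]] := hY n v hv hdv.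
exists (vproj (n - 1) w p), (vproj n w j); split; try exact: vproj_vec.
  exact: vproj_in.
have en : 1 + (n - 1) = n by rewrite addrC subrK.
by rewrite -vproj_d en -vprojD -e vproj_id.
Qed.

(** * Two out of three for I = J + (s) and I' = (J : s) *)

Section TwoOfThree.
Context (I J I' : S -> Prop) (s : S) (u w : weight) (Y : mf G f).
Hypotheses (hI : hideal I) (hJ : hideal J) (hI' : hideal I') (hs : has_weight G u s).
Hypotheses (fJ : J f) (JI : forall x, J x -> I x) (sI : I s).
Hypothesis Isplit : forall x, I x -> exists j r, J j /\ x = j + s * r.
Hypothesis I'J : forall r, I' r <-> J (s * r).

Lemma vec_split m (x : 'cV[S]_m) : vec_in I x -> exists j r, vec_in J j /\ x = j + s *: r.
Proof.
move=> hx; have /choice[F hF] : forall i, exists jr : S * S, J jr.1 /\ x i 0 = jr.1 + s * jr.2.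
  by move=> i; have [j [r [h1 h2]]] := Isplit (hx i); exists (j, r).
exists (\col_i (F i).1), (\col_i (F i).2); split=> [i|]; first by rewrite mxE; case: (hF i).
by apply/matrixP => i j; rewrite !mxE ord1; case: (hF i).
Qed.

Lemma vec_colon m (r : 'cV[S]_m) : vec_in I' r <-> vec_in J (s *: r).
Proof. by split=> h i; have := h i; rewrite mxE => /I'J. Qed.

Lemma dd (v : 'cV[S]_(rk Y)) : mf_d Y *m (mf_d Y *m v) = f *: v.
Proof. by rewrite mulmxA mf_d_sq mul_scalar_mx. Qed.

Lemma vec_sub_in m (x : 'cV[S]_m) : vec_in J x -> vec_in I x.
Proof. by move=> h i; apply/JI/h. Qed.

(** Injectivity of multiplication by s from S/I' to S/J: exactness of s v in S/J lifts once the
    preimage is corrected by exactness modulo I. That f lies in J makes the differential square to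
    zero there. *)
Lemma acyclic_colon : acyclic_mod J w Y -> acyclic_mod I w Y -> acyclic_mod I' (w - u) Y.
Proof.
move=> aJ aI n v hv hdv.
have [|p [j [hp _ hj e]]] := acyclic_homog hJ aJ (vec_scale hs hv).
  by rewrite -scalemxAr; apply/vec_colon.
have [|q [i [hi ep]]] := aI _ _ hp.
  have -> : mf_d Y *m p = s *: v - j by rewrite e addrK.
  by apply: vec_inB => //; [exact: vec_in_gen|exact: vec_sub_in].
have [j' [r [hj' ei]]] := vec_split hi.
exists r, (v - mf_d Y *m r); split; last by rewrite addrC subrK.
apply/vec_colon; have -> : s *: (v - mf_d Y *m r) = f *: q + mf_d Y *m j' + j.
  rewrite scalerBr e ep ei mulmxDr dd mulmxDr -scalemxAr.
  by rewrite addrAC [in LHS]addrA addrK.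
apply: vec_inD => //; apply: vec_inD => //; first exact: vec_in_gen.
exact: vec_inM.
Qed.

(** The connecting map: the differential of a cycle modulo I has a part s r with r a cycle modulo
    I'. Solving for r and subtracting gives a cycle modulo J. *)
Lemma acyclic_sum : acyclic_mod I' (w - u) Y -> acyclic_mod J w Y -> acyclic_mod I w Y.
Proof.
move=> aI' aJ n v hv hdv; have [j0 [r0 [hj0 e0]]] := vec_split hdv.
pose j := vproj (1 + n) w j0; pose r := vproj (1 + n) (w - u) r0.
have hj : vec_in J j by exact: vproj_in.
have e : mf_d Y *m v = j + s *: r.
  by rewrite /j /r -(vproj_scale _ _ _ hs) -vprojD -e0 vproj_id //; exact: vec_d.
have hr : vec (1 + n) (w - u) r by exact: vproj_vec.
have [|q [i' [hq _ hi' er]]] := acyclic_homog hI' aI' hr.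
  apply/vec_colon; rewrite scalemxAr.
  have -> : mf_d Y *m (s *: r) = f *: v - mf_d Y *m j.
    by rewrite -dd e mulmxDr addrAC subrr add0r.
  by apply: vec_inB => //; [exact: vec_in_gen|exact: vec_inM].
have en : 1 + n - 1 = n by rewrite addrC addKr.
rewrite en in hq; have hsq := vec_scale hs hq.
have [|p [j'' [hj'' ev]]] := aJ _ _ (vecB hv hsq).
  have -> : mf_d Y *m (v - s *: q) = j + s *: i'.
    by rewrite mulmxBr e er scalerDr -scalemxAr [s *: _ + _]addrC addrA addrK.
  by apply: vec_inD => //; exact/vec_colon.
exists p, (s *: q + j''); split.
  by apply: vec_inD => //; [exact: vec_in_gen|exact: vec_sub_in].
by rewrite [s *: q + _]addrC addrA -ev subrK.
Qed.

(** Solving first modulo I leaves an error s r modulo J, with r a cycle modulo I'. *)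
Lemma acyclic_extend : acyclic_mod I' (w - u) Y -> acyclic_mod I w Y -> acyclic_mod J w Y.
Proof.
move=> aI' aI n v hv hdv.
have [|p [x [hp hx xI e]]] := acyclic_homog hI aI hv; first exact: vec_sub_in.
have [j0 [r0 [hj0 e0]]] := vec_split xI.
pose j := vproj n w j0; pose r := vproj n (w - u) r0.
have hj : vec_in J j by exact: vproj_in.
have ex : x = j + s *: r.
  by rewrite /j /r -(vproj_scale _ _ _ hs) -vprojD -e0 vproj_id.
have hr : vec n (w - u) r by exact: vproj_vec.
have [|q [i' [hi' er]]] := aI' n r hr.
  apply/vec_colon; rewrite scalemxAr.
  have -> : mf_d Y *m (s *: r) = mf_d Y *m v - f *: p - mf_d Y *m j.
    by rewrite e ex !mulmxDr dd [f *: p + _]addrC addrK addrAC subrr add0r.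
  apply: vec_inB => //; last exact: vec_inM.
  by apply: vec_inB => //; exact: vec_in_gen.
exists (p + s *: q), (j + s *: i'); split; first by apply: vec_inD => //; exact/vec_colon.
by rewrite e ex er scalerDr mulmxDr scalemxAr -!addrA; congr (_ + _); rewrite addrCA.
Qed.

End TwoOfThree.

Lemma acyclic_all w Y : acyclic_mod (fun=> True) w Y.
Proof. by move=> n v _ _; exists 0, v; rewrite mulmx0 add0r. Qed.

Lemma acyclic_ext I I' w Y : (forall p, I p <-> I' p) -> acyclic_mod I w Y -> acyclic_mod I' w Y.
Proof.
move=> e aI n v hv hdv; have [|p [j [hj ej]]] := aI n v hv; first by move=> i; apply/e.
by exists p, j; split=> // i; apply/e.
Qed.

(** A twist by chi is absorbed by two steps in the unrolled sequence, where K^(n+2) = K^n(chi). *)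
Lemma acyclic_chi I w Y : acyclic_mod I w Y -> acyclic_mod I (w + chi) Y.
Proof.
move=> aI n v hv; apply: (aI (n + 2)) => i j.
have [->|[k [e hk]]] := hv i j; [by left|right; exists (k + 1)].
split; first by move: e => /=; lia.
suff -> : w - wt i + chi *~ (k + 1) = w + chi - wt i + chi *~ k by [].
by rewrite mulrzDr mulr1z addr_swap.
Qed.

Lemma acyclic_chiN I w Y : acyclic_mod I w Y -> acyclic_mod I (w - chi) Y.
Proof.
move=> aI n v hv; apply: (aI (n - 2)) => i j.
have [->|[k [e hk]]] := hv i j; [by left|right; exists (k - 1)].
split; first by move: e => /=; lia.
suff -> : w - wt i + chi *~ (k - 1) = w - chi - wt i + chi *~ k by [].
by rewrite mulrzBr mulr1z addr_swap.
Qed.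

Lemma acyclic_chiZ I w k Y : acyclic_mod I w Y -> acyclic_mod I (w + chi *~ k) Y.
Proof.
move=> aI; elim/int_ind: k => [|k IH|k IH]; first by rewrite mulr0z addr0.
  by rewrite -addn1 PoszD mulrzDr mulr1z addrA; exact: acyclic_chi.
by rewrite -addn1 PoszD opprD mulrzDr mulrN1z addrA; exact: acyclic_chiN.
Qed.

Definition weq w w' := forall t, G t -> eval_weight w t = eval_weight w' t.

Lemma weq_weight w w' p : weq w w' -> has_weight G w p -> has_weight G w' p.
Proof. by move=> e h t Gt; rewrite -e // h. Qed.

Lemma weqD w w' u : weq w w' -> weq (w + u) (w' + u).
Proof. by move=> e t Gt; rewrite !(eval_weightD Gsub) // e. Qed.

Lemma weq_sym w w' : weq w w' -> weq w' w.
Proof. by move=> e t Gt; rewrite e. Qed.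

Lemma acyclic_weq I w w' Y : weq w w' -> acyclic_mod I w Y -> acyclic_mod I w' Y.
Proof.
move=> e aI n v hv; apply: (aI n) => i j.
have [->|[k [ek hk]]] := hv i j; [by left|right; exists k; split=> //].
apply: weq_weight hk; rewrite /= -!addrA; exact/weqD/weq_sym.
Qed.

(** If d v = f b then d v = d (d b), and d is injective because its square is f. *)
Lemma acyclic_f w Y : f != 0 -> acyclic_mod (fun p => exists q, p = f * q) w Y.
Proof.
move=> f0 n v hv hdv.
have /choice[F hF] : forall i, exists q, (mf_d Y *m v) i 0 = f * q by [].
pose b := \col_i F i; have e : mf_d Y *m v = f *: b.
  by apply/matrixP => i j; rewrite ord1 hF !mxE.
exists b, 0; split; first by move=> i; rewrite mxE; exists 0; rewrite mulr0.
rewrite addr0; apply/matrixP => i j; apply: (mulfI f0).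
have := congr1 (fun M => (mf_d Y *m M) i j) e; rewrite /= dd -scalemxAr.
by rewrite [LHS]mxE [RHS]mxE.
Qed.

(** From d v = a x + f b one gets f (v - d b) = a d x, and f is a nonzero divisor modulo a. *)
Lemma acyclic_f2 a w Y : f != 0 -> (forall p q, f * p = a * q -> exists r, p = a * r) ->
  acyclic_mod (fun p => exists q r, p = a * q + f * r) w Y.
Proof.
move=> f0 hcop n v hv hdv.
have /choice[F hF] : forall i, exists qr : S * S, (mf_d Y *m v) i 0 = a * qr.1 + f * qr.2.
  by move=> i; have [q [r e]] := hdv i; exists (q, r).
pose x := \col_i (F i).1; pose b := \col_i (F i).2.
have e : mf_d Y *m v = a *: x + f *: b.
  apply/matrixP => i j; rewrite ord1 hF [RHS]mxE; congr (_ + _).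
    by rewrite [RHS]mxE [x _ _]mxE.
  by rewrite [RHS]mxE [b _ _]mxE.
have e2 : f *: (v - mf_d Y *m b) = a *: (mf_d Y *m x).
  by rewrite scalemxAr -dd mulmxBr dd e addrK.
exists b, (v - mf_d Y *m b); split; last by rewrite addrC subrK.
move=> i; have := congr1 (fun M : 'cV_ _ => M i 0) e2; rewrite /= [LHS]mxE [RHS]mxE.
by move=> /hcop[r ->]; exists r, 0; rewrite mulr0 addr0.
Qed.

End Quotients.

Lemma nilp_step (C : comNzRingType) n (T K : 'M[C]_n) (s : C) :
  1%:M - (- s) *: ((T - 1%:M) *m K) = (1%:M - s *: K) + s *: (T *m K).
Proof. by rewrite scaleNr opprK mulmxBl mul1mx scalerBr -addrA [- _ + _]addrC. Qed.

(** * Contractibility from exactness at the origin *)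

Section Contraction.
Context {R : realType} (G : tpoint R -> Prop) (f : poly2 R).
Local Notation S := (poly2 R).
Hypothesis Gsub : subgroup G.
Context (deg : weight -> int) (dA dB : nat).
Hypothesis degD : forall u v, deg (u + v) = deg u + deg v.
Hypotheses (dA0 : (0 < dA)%N) (dB0 : (0 < dB)%N) (degchi : 0 < deg chi).
Hypothesis degP : forall u (m : 'X_{1..2}), mon_weight G u m ->
  deg u = (dA * m 0%R + dB * m 1%R)%N.
Implicit Types (n k : int) (w u : weight).
Opaque hom_d.

Definition vanish0 (p : S) : Prop := p@_0%MM = 0.

Lemma mcoeff0M (p q : S) : (p * q)@_0%MM = p@_0%MM * q@_0%MM.
Proof.
have e (r : S) : r@_0%MM = r.@[fun=> 0].
  rewrite mevalE [in LHS](mpolyE r) raddf_sum /=; apply: eq_bigr => m _.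
  rewrite mcoeffZ mcoeffX; congr (_ * _).
  have [->|ne] := eqVneq m 0%MM; first by rewrite big1 // => i _; rewrite mnmE expr0.
  have [i hi] : exists i, m i != 0%N.
    apply/existsP; apply: contra_neqT ne => /existsPn h.
    by apply/mnmP => i; rewrite mnmE; apply/eqP/negPn/h.
  by rewrite (bigD1 i) //= expr0n (negPf hi) mul0r.
by rewrite !e mevalM.
Qed.

Lemma vanish0_hideal : hideal G vanish0.
Proof.
split; rewrite /vanish0; first by rewrite mcoeff0.
- by move=> p q hp hq; rewrite mcoeffD hp hq addr0.
- by move=> p q hq; rewrite mcoeff0M hq mulr0.
- by move=> u p hp; rewrite mcoeff_wproj hp if_same.
Qed.

Definition const_mx0 m l (A : 'M[S]_(m, l)) : 'M[R[i]]_(m, l) := map_mx (mcoeff 0%MM) A.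
Definition poly_mx m l (A : 'M[R[i]]_(m, l)) : 'M[S]_(m, l) := map_mx (@mpolyC 2 R[i]) A.

Lemma const_mx0M (m l k : nat) (A : 'M[S]_(m, l)) (B : 'M[S]_(l, k)) :
  const_mx0 (A *m B) = const_mx0 A *m const_mx0 B.
Proof.
apply/matrixP => i j; rewrite !mxE raddf_sum; apply: eq_bigr => x _.
by rewrite /= mcoeff0M !mxE.
Qed.

Lemma const_mx0D m l (A B : 'M[S]_(m, l)) : const_mx0 (A + B) = const_mx0 A + const_mx0 B.
Proof. by apply/matrixP => i j; rewrite !mxE mcoeffD. Qed.

Lemma poly_mxK m l (A : 'M[R[i]]_(m, l)) : const_mx0 (poly_mx A) = A.
Proof. by apply/matrixP => i j; rewrite !mxE mcoeffC eqxx mulr1. Qed.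

Lemma const_mx0_in m (v : 'cV[S]_m) : vec_in vanish0 v <-> const_mx0 v = 0.
Proof.
split=> [h|h i]; first by apply/matrixP => i j; rewrite !mxE ord1 h.
by have := congr1 (fun A : 'cV_ _ => A i 0) h; rewrite !mxE.
Qed.

(** With g a generalised inverse of D, the columns of W = 1 - g D lie in the kernel of D, which is
    its image, so D g W = W. Then g W is a contracting homotopy. *)
Lemma exact_pinv (F : fieldType) m (D : 'M[F]_m) :
  D *m D = 0 -> (forall c : 'cV_m, D *m c = 0 -> exists c', c = D *m c') ->
  exists H, D *m H + H *m D = 1%:M.
Proof.
move=> D2 ex; pose g := pinvmx D.
have DgD : D *m g *m D = D by rewrite /g mulmxKpV.
pose W := 1%:M - g *m D; exists (g *m W).
have DW : D *m W = 0 by rewrite /W mulmxBr mulmx1 mulmxA DgD subrr.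
have e1 : D *m g *m W = W.
  apply/matrixP => i j; have [|c' hc'] := ex (W *m delta_mx j 0).
    by rewrite mulmxA DW mul0mx.
  have : (D *m g *m W) *m delta_mx j (0 : 'I_1) = W *m delta_mx j 0.
    by rewrite -mulmxA hc' mulmxA DgD.
  by rewrite -!colE => /(congr1 (fun A : 'cV_m => A i 0)); rewrite !mxE.
rewrite mulmxA e1 -mulmxA /W mulmxBl mul1mx -[g *m D *m D]mulmxA D2 mulmx0 subr0.
by rewrite subrK.
Qed.

(** A graded form of Nakayama's lemma. A contraction of the constant terms lifts to a homotopy whose
    boundary is 1 + N, with N vanishing at the origin; gradedness makes N nilpotent, and the
    identity is then exact. *)
Theorem contractible_of_acyclic (Y : mf G f) :
  vanish0 f -> (forall w, acyclic_mod vanish0 w Y) -> contractible Y.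
Proof.
move=> f0 hY; have hI := vanish0_hideal.
pose D := const_mx0 (mf_d Y).
have D2 : D *m D = 0.
  by rewrite -const_mx0M mf_d_sq; apply/matrixP => i j; rewrite !mxE mcoeffMn f0 mul0rn.
(* The hypothesis speaks of homogeneous vectors. A constant cycle is split into homogeneous pieces,
   by induction on the number of its nonzero entries. *)
have ex (c : 'cV[R[i]]_(rk Y)) : D *m c = 0 -> exists c', c = D *m c'.
  move: {2}(#|[set i | c i 0 != 0]|) (leqnn #|[set i | c i 0 != 0]|) => N.
  elim: N c => [|N IH] c hN hc.
    exists 0; rewrite mulmx0; apply/matrixP => i j; rewrite mxE ord1; apply/eqP/negPn/negP => ne.
    have : i \in [set i | c i 0 != 0] by rewrite inE.
    by move: hN; rewrite leqn0 cards_eq0 => /eqP ->; rewrite inE.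
  have [/existsP[i0 hi0]|] := boolP [exists i, c i 0 != 0]; last first.
    move=> /existsPn h; exists 0; rewrite mulmx0; apply/matrixP => i j.
    by rewrite mxE ord1; apply/eqP/negPn/h.
  (* The piece in the degree of e_i0 keeps some entries of [c], that at i0 among them, and kills the
     others; subtracting it shrinks the support. *)
  pose v := vproj G (pos i0) (wt i0) (poly_mx c : 'cV_(rk Y)).
  have hv : vec G (pos i0) (wt i0) v by exact: vproj_vec.
  have [|p [j [hj e]]] := hY _ _ _ hv.
    rewrite /v -vproj_d //; apply: vproj_in => //; apply/const_mx0_in.
    by rewrite const_mx0M poly_mxK.
  have ec : const_mx0 v = D *m const_mx0 p.
    by rewrite e const_mx0D const_mx0M; move/const_mx0_in: hj => ->; rewrite addr0.
  have ev i : const_mx0 v i 0 = 0 \/ const_mx0 v i 0 = c i 0.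
    rewrite !mxE /entry_proj; case: ifP => _; last by left; rewrite mcoeff0.
    by rewrite mcoeff_wproj; case: ifP => _; [right; rewrite mcoeffC eqxx mulr1|left].
  have ev0 : const_mx0 v i0 0 = c i0 0.
    rewrite !mxE /entry_proj /=; have -> : 0 + pos i0 - pos i0 = 0 :> int by lia.
    rewrite dvdz0 div0z mulr0z addr0 subrr.
    by move/wprojE: (@has_weightC R G (c i0 0)) => ->; rewrite mcoeffC eqxx mulr1.
  have [||c' hc'] := IH (c - const_mx0 v).
  - rewrite -ltnS; apply: leq_trans hN; apply: proper_card; apply/properP; split.
      apply/subsetP => i; rewrite !inE mxE [X in _ + X]mxE.
      by have [->|->] := ev i; rewrite ?subr0 // subrr eqxx.
    by exists i0; rewrite ?inE // mxE [X in _ + X]mxE ev0 subrr negbK.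
  - by rewrite mulmxBr hc ec mulmxA D2 mul0mx subrr.
  by exists (c' + const_mx0 p); rewrite mulmxDr -hc' -ec subrK.
have [h0 eh0] := exact_pinv D2 ex.
pose P : 'M[S]_(rk Y) := poly_mx h0.
pose H : 'M[S]_(rk Y, rk Y) := mproj G (-1) (P : 'M_(rk Y, rk Y)).
have hH : hom_deg G (0 - 1) Y Y H by exact: hom_deg_proj.
pose T := hom_d (0 - 1) (X := Y) (Y := Y) H.
have hT : exact_hom 0 (X := Y) (Y := Y) T by exists H.
pose N := T - 1%:M.
have hN : closed_hom 0 (X := Y) (Y := Y) N.
  by apply: closedB; [exact: exact_closed|exact: closed1].
have eN : N = mproj G 0 (mf_d Y *m P + P *m mf_d Y - 1%:M : 'M_(rk Y, rk Y)).
  rewrite mprojB mproj_is_additive.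
  have /hom_degE -> := @hom_deg1 R G Y.
  have hd := mf_d_hom (m := Y).
  have -> := @mproj_mull _ _ Gsub (-1) 1 Y Y Y _ P hd.
  have -> := @mproj_mulr _ _ Gsub (-1) 1 Y Y Y P _ hd.
  by rewrite /N /T hom_dE (_ : sgn (0 - 1) = -1) ?scaleN1r ?opprK // /sgn expr1.
have N0 i j : vanish0 (N i j).
  rewrite eN mxE /entry_proj; case: ifP => _; last exact: (hideal0 hI).
  apply: (hideal_proj hI); have := congr1 (fun A : 'M_(rk Y) => A i j) eh0.
  rewrite -[h0]poly_mxK -!const_mx0M -const_mx0D => e.
  rewrite /vanish0 mxE mcoeffD; move: e; rewrite [LHS]mxE => ->.
  rewrite [X in _ + X@__]mxE [X in _ + (- X)@__]mxE mcoeffN mxE mcoeffMn mcoeff1 eqxx.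
  by rewrite subrr.
(* Normalised so that ht j - ht i is twice the degree of a nonzero entry (i, j) of a map of degree
   0. Entries without constant term therefore move the height strictly. *)
pose ht (i : 'I_(rk Y)) : int := 2 * deg (wt i) + deg chi * pos i.
have hht i j : N i j != 0 -> ht i + 1 <= ht j.
  case: hN => hN _ ne; have [e|[k [ek hk]]] := hN i j; first by rewrite e eqxx in ne.
  have [m mN] : exists m, m \in msupp (N i j).
    case E: (msupp (N i j)) => [|m s]; last by exists m; rewrite inE eqxx.
    by move/msuppnil0: E ne => ->; rewrite eqxx.
  have e := weight_support degP hk mN; rewrite !degD (degN degD) (degZ degD) in e.
  have m0 : m != 0%MM.
    by apply/eqP => m0; move: mN; rewrite m0 mcoeff_msupp N0 eqxx.
  have pm : (0 < m 0%R + m 1%R)%N.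
    rewrite lt0n; apply: contraNneq m0 => /eqP; rewrite addn_eq0 => /andP[/eqP a /eqP b].
    by rewrite (bi_monE m) a b; apply/eqP/mnmP => l; rewrite !mnmE if_same.
  have : (0 < dA * m 0%R + dB * m 1%R)%N by nia.
  rewrite /ht; move: e ek; set a := deg (wt j); set b := deg (wt i); set c := deg chi.
  by move: (dA * m 0%R + dB * m 1%R)%N => q e ek q0; nia.
pose Nk (k : nat) : 'M[S]_(rk Y) := iter k (mulmx N) 1%:M.
have hNk (k : nat) : closed_hom 0 (X := Y) (Y := Y) (Nk k).
  by elim: k => [|k IH]; [exact: closed1|exact: closed0M].
have htk (k : nat) i j : Nk k i j != 0 -> ht i + k%:Z <= ht j.
  elim: k i j => [|k IH] i j; rewrite /Nk /= mxE.
    by have [->|_] := eqVneq i j; rewrite ?addr0 // mulr0n eqxx.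
  move=> ne; have [/existsP[l /andP[h1 h2]]|/existsPn h] :=
    boolP [exists l, (N i l != 0) && (Nk k l j != 0)].
    by have := hht _ _ h1; have := IH _ _ h2; lia.
  case/eqP: ne; apply: big1 => l _; have := h l; rewrite negb_and !negbK.
  by case/orP => /eqP e; rewrite -/(Nk k) e ?mul0r ?mulr0.
pose B := (\sum_(i < rk Y) \sum_(j < rk Y) absz (ht j - ht i)%R).+1.
have NB : Nk B = 0.
  apply/matrixP => i j; rewrite [RHS]mxE; apply/eqP/negPn/negP => /htk.
  have : (absz (ht j - ht i)%R < B)%N.
    by rewrite ltnS (bigD1 i) //= (bigD1 j) //= -addnA leq_addr.
  lia.
(* Since N = T - 1 with T exact, consecutive terms 1 - (-1)^k N^k differ by (-1)^k T N^k, which is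
   exact. *)
have exk (k : nat) : exact_hom 0 (X := Y) (Y := Y) (1%:M - sgn k *: Nk k).
  elim: k => [|k IH]; first by rewrite sgn0 scale1r subrr; exact: exact0.
  have es : sgn k.+1 = - sgn k :> S by rewrite -sgnS; f_equal; lia.
  have -> : 1%:M - sgn k.+1 *: Nk k.+1 = (1%:M - sgn k *: Nk k) + sgn k *: (T *m Nk k).
    by rewrite es; exact: nilp_step.
  exact: (exactD IH (exact_sgn _ (exactM0 Gsub hT (hNk k)))).
by have := exk B; rewrite NB scaler0 subr0.
Qed.

End Contraction.

(** * Rank-one and Koszul factorisations *)

Section SmallBlocks.
Context (K : comNzRingType).
Implicit Types (g h : K).

Definition mx_pair g h : 'M[K]_(1 + 1) := block_mx 0 g%:M h%:M 0.

Lemma mx_pair_row n g h (v0 v1 : 'M[K]_(n, 1)) :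
  row_mx v0 v1 *m mx_pair g h = row_mx (h *: v1) (g *: v0).
Proof. by rewrite mul_row_block !mulmx0 !mul_mx_scalar add0r addr0. Qed.

Lemma mx_pair_col n g h (r0 r1 : 'M[K]_(1, n)) :
  mx_pair g h *m col_mx r0 r1 = col_mx (g *: r1) (h *: r0).
Proof. by rewrite mul_block_col !mul0mx !mul_scalar_mx add0r addr0. Qed.

Lemma mx_pair_sq g h : mx_pair g h *m mx_pair g h = (g * h)%:M.
Proof.
rewrite mulmx_block !mulmx0 !mul0mx !add0r !addr0 -!scalar_mxM [h * g]mulrC.
by rewrite -scalar_mx_block.
Qed.

Definition mx_sgn g : 'M[K]_(1 + 1) := block_mx g%:M 0 0 (- g)%:M.

(** The tensor product of the factorisations (a, A) and (b, B); [mx_sgn] carries the Koszul sign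
    that makes the mixed terms cancel. *)
Definition mx_koszul a b A B : 'M[K]_(1 + 1 + (1 + 1)) :=
  block_mx (mx_pair a A) (mx_sgn b) (mx_sgn B) (mx_pair a A).

Lemma mx_sgn_row n g (v0 v1 : 'M[K]_(n, 1)) :
  row_mx v0 v1 *m mx_sgn g = row_mx (g *: v0) (- g *: v1).
Proof. by rewrite mul_row_block !mulmx0 !mul_mx_scalar add0r addr0. Qed.

Lemma mx_sgn_col n g (r0 r1 : 'M[K]_(1, n)) :
  mx_sgn g *m col_mx r0 r1 = col_mx (g *: r0) (- g *: r1).
Proof. by rewrite mul_block_col !mul0mx !mul_scalar_mx add0r addr0. Qed.

Lemma mx_koszul_row n a b A B (v0 v1 v2 v3 : 'M[K]_(n, 1)) :
  row_mx (row_mx v0 v1) (row_mx v2 v3) *m mx_koszul a b A B =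
  row_mx (row_mx (A *: v1 + B *: v2) (a *: v0 - B *: v3))
         (row_mx (b *: v0 + A *: v3) (a *: v2 - b *: v1)).
Proof.
rewrite mul_row_block !mx_pair_row !mx_sgn_row !add_row_mx !scaleNr.
by rewrite [- _ + _]addrC.
Qed.

Lemma mx_koszul_col n a b A B (r0 r1 r2 r3 : 'M[K]_(1, n)) :
  mx_koszul a b A B *m col_mx (col_mx r0 r1) (col_mx r2 r3) =
  col_mx (col_mx (a *: r1 + b *: r2) (A *: r0 - b *: r3))
         (col_mx (B *: r0 + a *: r3) (A *: r2 - B *: r1)).
Proof.
rewrite mul_block_col !mx_pair_col !mx_sgn_col !add_col_mx !scaleNr.
by rewrite [- _ + _]addrC.
Qed.

Lemma mx_koszul_sq a b A B : mx_koszul a b A B *m mx_koszul a b A B = (a * A + b * B)%:M.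
Proof.
have sp g h : mx_sgn g *m mx_sgn h = (g * h)%:M.
  rewrite mulmx_block !mulmx0 !mul0mx !add0r !addr0 -!scalar_mxM mulrNN.
  by rewrite -scalar_mx_block.
have pc g h c : mx_pair g h *m mx_sgn c + mx_sgn c *m mx_pair g h = 0.
  rewrite !mulmx_block !mulmx0 !mul0mx !add0r !addr0 -!scalar_mxM add_block_mx !addr0.
  by rewrite -!raddfD /= !mulrN mulNr [c * g]mulrC [c * h]mulrC addNr subrr raddf0 block_mx0.
rewrite mulmx_block !mx_pair_sq !sp pc addrC [mx_sgn B *m _ + _]addrC pc.
rewrite -!raddfD /= [B * b]mulrC [b * B + _]addrC.
by rewrite addrC -scalar_mx_block.
Qed.

End SmallBlocks.

Section Objects.
Context {R : realType} (G : tpoint R -> Prop) (f : poly2 R).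
Local Notation S := (poly2 R).
Hypothesis Gsub : subgroup G.
Implicit Types (X Y Z W : mf G f) (m n k : int) (P Q T : grbasis).

Lemma hom_deg_sum_row n P Q T (a : 'M[S]_(rk T, rk P)) (b : 'M[S]_(rk T, rk Q)) :
  hom_deg G n (sum_basis P Q) T (row_mx a b) <-> hom_deg G n P T a /\ hom_deg G n Q T b.
Proof.
split=> [h|[ha hb]].
  split=> i j; [have := h i (lshift _ j)|have := h i (rshift _ j)].
    by rewrite row_mxEl /= split_lshift.
  by rewrite row_mxEr /= split_rshift.
by move=> i j; rewrite /= mxE; case: split => k; [exact: ha|exact: hb].
Qed.

Lemma hom_deg_sum_col n P Q T (a : 'M[S]_(rk P, rk T)) (b : 'M[S]_(rk Q, rk T)) :
  hom_deg G n T (sum_basis P Q) (col_mx a b) <-> hom_deg G n T P a /\ hom_deg G n T Q b.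
Proof.
split=> [h|[ha hb]].
  split=> i j; [have := h (lshift _ i) j|have := h (rshift _ i) j].
    by rewrite col_mxEu /= split_lshift.
  by rewrite col_mxEd /= split_rshift.
by move=> i j; rewrite /= mxE; case: split => k; [exact: ha|exact: hb].
Qed.

Lemma hom_deg_block n P Q P' Q' (a : 'M[S]_(rk P', rk P)) (b : 'M[S]_(rk P', rk Q))
    (c : 'M[S]_(rk Q', rk P)) (d : 'M[S]_(rk Q', rk Q)) :
  hom_deg G n P P' a -> hom_deg G n Q P' b -> hom_deg G n P Q' c -> hom_deg G n Q Q' d ->
  hom_deg G n (sum_basis P Q) (sum_basis P' Q') (block_mx a b c d).
Proof.
move=> ha hb hc hd; rewrite /block_mx.
refine ((@hom_deg_sum_col n P' Q' (sum_basis P Q) _ _).2 _); split.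
  by refine ((@hom_deg_sum_row n P Q P' _ _).2 _).
by refine ((@hom_deg_sum_row n P Q Q' _ _).2 _).
Qed.

Lemma hom_deg_pt n u v k (c : S) : n = k * 2 -> has_weight G (u - v + chi *~ k) c ->
  hom_deg G n (pt u) (pt v) c%:M.
Proof.
move=> e hc i j; rewrite !ord1 mxE eqxx mulr1n; right; exists k; split=> //=.
by rewrite e !add0r; lia.
Qed.

Definition basis2 (al u : weight) : grbasis := sum_basis (pt u) (shift_basis (pt (u + al))).

Lemma hom_deg_pair n k al u v (g h : S) : n = k * 2 + 1 ->
  has_weight G (u - v + al + chi *~ k) g -> has_weight G (u - v - al + chi *~ (k + 1)) h ->
  hom_deg G n (basis2 al u) (basis2 al v) (mx_pair g h).
Proof.
move=> e hg hh; apply: hom_deg_block; try exact: hom_deg0.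
  apply/hom_deg_shift_l; apply: (hom_deg_pt (k := k)); first by lia.
  suff -> : u + al - v + chi *~ k = u - v + al + chi *~ k by [].
  by rewrite [u + al - v]addrAC.
apply/hom_deg_shift_r; apply: (hom_deg_pt (k := k + 1)); first by lia.
suff -> : u - (v + al) + chi *~ (k + 1) = u - v - al + chi *~ (k + 1) by [].
by rewrite opprD addrA.
Qed.

Lemma hom_deg_diag n k al u v (g h : S) : n = k * 2 ->
  has_weight G (u - v + chi *~ k) g -> has_weight G (u - v + chi *~ k) h ->
  hom_deg G n (basis2 al u) (basis2 al v) (block_mx g%:M 0 0 h%:M).
Proof.
move=> e hg hh; apply: hom_deg_block; try exact: hom_deg0.
  exact: (hom_deg_pt (k := k)).
apply/hom_deg_shift_l/hom_deg_shift_r; apply: (hom_deg_pt (k := k)); first by lia.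
suff -> : u + al - (v + al) + chi *~ k = u - v + chi *~ k by [].
by rewrite opprD addrACA subrr addr0.
Qed.

Section RankOne.
Context (g h : S) (ga u : weight).
Hypotheses (hg : has_weight G ga g) (hh : has_weight G (chi - ga) h) (fgh : f = g * h).

Lemma rank1_hom : hom_deg G 1 (basis2 ga u) (basis2 ga u) (mx_pair g h).
Proof.
apply: (hom_deg_pair (k := 0)) => //; first by rewrite subrr add0r mulr0z addr0.
by rewrite subrr add0r mulr1z addrC.
Qed.

Lemma rank1_sq : mx_pair g h *m mx_pair g h = f%:M.
Proof. by rewrite fgh; exact: mx_pair_sq. Qed.

(** The odd generator, of weight u + ga, maps to g times the even one, so this is the factorisation
    attached to S/(g). *)
Definition rank1 : mf G f := MF rank1_hom rank1_sq.

End RankOne.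

Section Koszul.
Context (a b A B : S) (al be u : weight).
Hypotheses (ha : has_weight G al a) (hb : has_weight G be b).
Hypotheses (hA : has_weight G (chi - al) A) (hB : has_weight G (chi - be) B).
Hypothesis fab : f = a * A + b * B.

Definition basisK : grbasis := sum_basis (basis2 al u) (shift_basis (basis2 al (u + be))).

Lemma koszul_hom : hom_deg G 1 basisK basisK (mx_koszul a b A B).
Proof.
have hp v : hom_deg G 1 (basis2 al v) (basis2 al v) (mx_pair a A).
  apply: (hom_deg_pair (k := 0)) => //; first by rewrite subrr add0r mulr0z addr0.
  by rewrite subrr add0r mulr1z addrC.
apply: hom_deg_block; first exact: hp.
- apply/hom_deg_shift_l; have e : u + be - u + chi *~ 0 = be by rewrite [u + be - u]addrAC subrr add0r mulr0z addr0.
  by apply: (hom_deg_diag (k := 0)) => //; rewrite e //; exact: has_weightN.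
- apply/hom_deg_shift_r; have e : u - (u + be) + chi *~ 1 = chi - be.
    by rewrite opprD addrA subrr add0r mulr1z addrC.
  by apply: (hom_deg_diag (k := 1)) => //; rewrite e //; exact: has_weightN.
- by apply/hom_deg_shift_l/hom_deg_shift_r; exact: hp.
Qed.

Lemma koszul_sq : mx_koszul a b A B *m mx_koszul a b A B = f%:M.
Proof. by rewrite fab; exact: mx_koszul_sq. Qed.

Definition koszul : mf G f := MF koszul_hom koszul_sq.

End Koszul.
End Objects.

(** * Solving the equations for maps from and to small factorisations *)

Section Solve.
Context (K : idomainType).

Lemma scalemx_inj m n (c : K) (A B : 'M[K]_(m, n)) : c != 0 -> c *: A = c *: B -> A = B.
Proof.
move=> c0 e; apply/matrixP => i j; apply: (mulfI c0).
by have := congr1 (fun M : 'M_(_, _) => M i j) e; rewrite !mxE.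
Qed.

Context (m : nat) (d : 'M[K]_m) (s : K).
Hypothesis ss : s * s = 1.

Lemma pair_dE g h (t : K) (v0 v1 : 'cV[K]_m) :
  d *m row_mx v0 v1 - t *: (row_mx v0 v1 *m mx_pair g h) =
  row_mx (d *m v0 - t *: (h *: v1)) (d *m v1 - t *: (g *: v0)).
Proof. by rewrite mx_pair_row mul_mx_row scale_row_mx opp_row_mx add_row_mx. Qed.

(** The component v0 is determined by v1 because g is a nonzero divisor, so a homotopy for v1
    suffices. *)
Lemma pair_solve g h (v0 v1 p q : 'cV[K]_m) : g != 0 -> d *m d = (g * h)%:M ->
  d *m v1 - s *: (g *: v0) = 0 -> v1 = d *m p + g *: q ->
  v0 = d *m (s *: q) - (- s) *: (h *: p) /\ v1 = d *m p - (- s) *: (g *: (s *: q)).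
Proof.
move=> g0 dd /eqP; rewrite subr_eq0 => /eqP e ev.
split; last first.
  rewrite ev scaleNr opprK !scalerA.
  by rewrite mulrCA ss mulr1.
apply: (scalemx_inj g0).
have -> : g *: v0 = s *: (d *m v1) by rewrite e scalerA ss scale1r.
rewrite ev mulmxDr mulmxA dd mul_scalar_mx -!scalemxAr scaleNr opprK !scalerDr !scalerA addrC.
by congr (_ *: _ + _ *: _); ring.
Qed.

(** Converse direction: a vector that is a cycle modulo g extends to a closed map from the rank-one
    factorisation. *)
Lemma pair_closed g h (v v0 : 'cV[K]_m) : g != 0 -> d *m d = (g * h)%:M ->
  d *m v = g *: v0 ->
  d *m (s *: v0) - s *: (h *: v) = 0 /\ d *m v - s *: (g *: (s *: v0)) = 0.
Proof.
move=> g0 dd e.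
have e2 : d *m v0 = h *: v.
  by apply: (scalemx_inj g0); rewrite scalemxAr -e mulmxA dd mul_scalar_mx scalerA.
split; first by rewrite -scalemxAr e2 subrr.
by rewrite e scalerA scalerA mulrAC ss mul1r subrr.
Qed.

Section Koszul.
Context (a b A B : K).
Hypotheses (a0 : a != 0) (b0 : b != 0).
Hypothesis reg : forall q r, b * q = a * r -> exists t, q = a * t.
Hypothesis dd : d *m d = (a * A + b * B)%:M.
Local Notation D := (mx_koszul a b A B).

Lemma regmx k n (v w : 'M[K]_(k, n)) : b *: v = a *: w -> exists t : 'M[K]_(k, n), v = a *: t.
Proof.
move=> e; have h i j : exists t, v i j = a * t.
  by apply: (reg (r := w i j)); have := congr1 (fun M : 'M_(_, _) => M i j) e; rewrite !mxE.
have /choice[F hF] : forall ij, exists t, v ij.1 ij.2 = a * t by move=> [i j]; exact: h.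
by exists (\matrix_(i, j) F (i, j)); apply/matrixP => i j; rewrite !mxE -hF.
Qed.

Lemma koszul_dE (t : K) (v0 v1 v2 v3 : 'cV[K]_m) :
  d *m row_mx (row_mx v0 v1) (row_mx v2 v3)
    - t *: (row_mx (row_mx v0 v1) (row_mx v2 v3) *m D) =
  row_mx (row_mx (d *m v0 - t *: (A *: v1 + B *: v2)) (d *m v1 - t *: (a *: v0 - B *: v3)))
         (row_mx (d *m v2 - t *: (b *: v0 + A *: v3)) (d *m v3 - t *: (a *: v2 - b *: v1))).
Proof.
by rewrite mx_koszul_row !mul_mx_row !scale_row_mx !opp_row_mx !add_row_mx.
Qed.

(** With the last component zero, b v1 = a v2 holds, and regularity of a, b writes both as multiples
    of a single vector, which gives the homotopy. *)
Lemma koszul_solve0 (v0 v1 v2 : 'cV[K]_m) :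
  d *m row_mx (row_mx v0 v1) (row_mx v2 0)
    - s *: (row_mx (row_mx v0 v1) (row_mx v2 0) *m D) = 0 ->
  exists psi, row_mx (row_mx v0 v1) (row_mx v2 0) = d *m psi - (- s) *: (psi *m D).
Proof.
rewrite mx_koszul_row !mul_mx_row !scale_row_mx !opp_row_mx !add_row_mx -!row_mx0.
move=> /eq_row_mx[/eq_row_mx[_ e1] /eq_row_mx[e2 e3]].
have e3' : b *: v1 = a *: v2.
  move/eqP: e3; rewrite mulmx0 add0r oppr_eq0 => /eqP e3; apply/eqP; rewrite eq_sym -subr_eq0.
  by rewrite -[_ - _]scale1r -ss -scalerA e3 scaler0.
have [w ew] := regmx e3'.
have ew2 : v2 = b *: w.
  by apply: (scalemx_inj a0); rewrite -e3' ew !scalerA mulrC.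
have ev0 : d *m w = s *: v0.
  apply: (scalemx_inj a0); rewrite scalemxAr -ew scalerA mulrC -scalerA.
  by move/eqP: e1; rewrite scaler0 subr0 subr_eq0 => /eqP.
exists (row_mx (row_mx (s *: w) 0) (row_mx 0 0)).
rewrite mx_koszul_row !mul_mx_row !scale_row_mx !opp_row_mx !add_row_mx.
rewrite !mulmx0 !scaler0 !add0r !addr0 !subr0 !scaleNr !opprK -scalemxAr ev0.
congr (row_mx (row_mx _ _) (row_mx _ _)).
- by rewrite scalerA ss scale1r scaler0 addr0.
- by rewrite ew !scalerA mulrAC ss mul1r.
- by rewrite ew2 !scalerA mulrAC ss mul1r.
- by rewrite oppr0 scaler0.
Qed.

Lemma koszul_solve (v0 v1 v2 v3 p q1 q2 : 'cV[K]_m) :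
  d *m row_mx (row_mx v0 v1) (row_mx v2 v3)
    - s *: (row_mx (row_mx v0 v1) (row_mx v2 v3) *m D) = 0 ->
  v3 = d *m p + (a *: q1 + b *: q2) ->
  exists psi, row_mx (row_mx v0 v1) (row_mx v2 v3) = d *m psi - (- s) *: (psi *m D).
Proof.
move=> e ev; set V := row_mx _ _ in e *.
(* Chosen so that the last component of its boundary is v3; what remains is the case of
   [koszul_solve0]. *)
pose psi0 : 'M_(m, 1 + 1 + (1 + 1)) := row_mx (row_mx 0 (- s *: q2)) (row_mx (s *: q1) p).
pose V' := V - (d *m psi0 - (- s) *: (psi0 *m D)).
have DD : D *m D = (a * A + b * B)%:M by exact: mx_koszul_sq.
have e' : d *m V' - s *: (V' *m D) = 0.
  rewrite /V' mulmxBr mulmxBl scalerBr !mulmxBr !mulmxBl -!scalemxAr -!scalemxAl !mulmxA dd.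
  rewrite -[psi0 *m D *m D]mulmxA DD mul_scalar_mx mul_mx_scalar !scaleNr !opprK !scalerDr !scalerA.
  have -> : d *m V = s *: (V *m D) by apply/eqP; rewrite -subr_eq0 e.
  by rewrite ss mul1r [X in _ - X - _]addrC subrr.
have [v0' [v1' [v2' eV']]] : exists v0' v1' v2', V' = row_mx (row_mx v0' v1') (row_mx v2' 0).
  rewrite /V' /V /psi0 mx_koszul_row !mul_mx_row !scale_row_mx !opp_row_mx !add_row_mx.
  rewrite !opp_row_mx !add_row_mx; do 3 eexists; congr (row_mx (row_mx _ _) (row_mx _ _)).
  rewrite ev !scaleNr !opprK !scalerN !opprK !scalerDr !scalerA.
  by rewrite [s * a * s]mulrAC [s * b * s]mulrAC ss !mul1r subrr.
rewrite eV' in e'; have [psi1 e1] := koszul_solve0 e'.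
exists (psi0 + psi1); rewrite mulmxDr mulmxDl scalerDr opprD addrACA -e1 -eV' /V'.
by rewrite addrC subrK.
Qed.

(** A cycle v modulo (a, b) becomes the last component of a closed map from the Koszul
    factorisation; regularity provides the missing first component. *)
Lemma koszul_close (v x y : 'cV[K]_m) : d *m v = a *: x + b *: y ->
  exists v0, B *: v - d *m y = a *: v0 /\
    d *m row_mx (row_mx v0 (- s *: y)) (row_mx (s *: x) v)
      - s *: (row_mx (row_mx v0 (- s *: y)) (row_mx (s *: x) v) *m D) = 0.
Proof.
move=> e; have e2 : a *: (A *: v) + b *: (B *: v) = a *: (d *m x) + b *: (d *m y).
  by rewrite !scalerA -scalerDl -mul_scalar_mx -dd -mulmxA e mulmxDr !scalemxAr.
have e3 : b *: (B *: v - d *m y) = a *: (d *m x - A *: v).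
  have e3 : b *: (B *: v) = a *: (d *m x) + b *: (d *m y) - a *: (A *: v).
    by rewrite -e2 addrAC subrr add0r.
  by rewrite !scalerBr e3 addrAC addrK.
have [v0 e4] := regmx e3; exists v0; split=> //.
have e5 : d *m x - A *: v = b *: v0.
  by apply: (scalemx_inj a0); rewrite -e3 e4 !scalerA mulrC.
have e6 : d *m v0 = B *: x - A *: y.
  apply: (scalemx_inj a0); rewrite scalemxAr -e4 mulmxBr -scalemxAr e mulmxA dd mul_scalar_mx.
  rewrite scalerDr scalerDl scalerBr !scalerA [B * b]mulrC [B * a]mulrC opprD addrA addrAC.
  by rewrite addrK.
rewrite mx_koszul_row !mul_mx_row !scale_row_mx !opp_row_mx !add_row_mx -e4 -e5 -!scalemxAr e e6.
rewrite -!row_mx0; congr (row_mx (row_mx _ _) (row_mx _ _)).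
- rewrite scaleNr scalerN scalerDr scalerN !scalerA [s * A * s]mulrAC [s * B * s]mulrAC ss !mul1r.
  by rewrite [- _ + _]addrC subrr.
- by rewrite [B *: v - _ - _]addrAC subrr sub0r scalerN scaleNr opprK addNr.
- by rewrite subrK subrr.
- rewrite scaleNr scalerN opprK scalerDr !scalerA [s * a * s]mulrAC [s * b * s]mulrAC ss !mul1r.
  by rewrite subrr.
Qed.

Lemma koszul_into r (dX : 'M[K]_r) (r0 r1 r2 r3 p1 p2 : 'rV[K]_r) :
  dX *m dX = (a * A + b * B)%:M ->
  D *m col_mx (col_mx r0 r1) (col_mx r2 r3)
    - s *: (col_mx (col_mx r0 r1) (col_mx r2 r3) *m dX) = 0 ->
  r0 = a *: p1 + b *: p2 ->
  exists psi, col_mx (col_mx r0 r1) (col_mx r2 r3) = D *m psi - (- s) *: (psi *m dX).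
Proof.
move=> dXX e er; set V := col_mx _ _ in e *.
(* Its image under D has first component a p1 + b p2 = r0, so the difference starts with zero. *)
pose psi0 : 'M_(1 + 1 + (1 + 1), r) := col_mx (col_mx 0 p1) (col_mx p2 0).
pose V' := V - (D *m psi0 - (- s) *: (psi0 *m dX)).
have DD : D *m D = (a * A + b * B)%:M by exact: mx_koszul_sq.
have e' : D *m V' - s *: (V' *m dX) = 0.
  rewrite /V' mulmxBr mulmxBl scalerBr !mulmxBr !mulmxBl -!scalemxAr -!scalemxAl !mulmxA DD.
  rewrite -[psi0 *m dX *m dX]mulmxA dXX mul_scalar_mx mul_mx_scalar !scaleNr !opprK !scalerDr !scalerA.
  have -> : D *m V = s *: (V *m dX) by apply/eqP; rewrite -subr_eq0 e.
  by rewrite ss mul1r [X in _ - X - _]addrC subrr.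
have [v1 [v2 [v3 eV']]] : exists v1 v2 v3, V' = col_mx (col_mx 0 v1) (col_mx v2 v3).
  rewrite /V' /V /psi0 mx_koszul_col !mul_col_mx !scale_col_mx !opp_col_mx !add_col_mx.
  rewrite !opp_col_mx !add_col_mx; do 3 eexists; congr (col_mx (col_mx _ _) (col_mx _ _)).
  by rewrite mul0mx scaler0 oppr0 addr0 er subrr.
suff [psi1 e1] : exists psi1, V' = D *m psi1 - (- s) *: (psi1 *m dX).
  exists (psi0 + psi1); rewrite mulmxDr mulmxDl scalerDr opprD addrACA -e1 /V'.
  by rewrite addrC subrK.
move: e'; rewrite eV' mx_koszul_col !mul_col_mx !scale_col_mx !opp_col_mx !add_col_mx -!col_mx0.
rewrite mul0mx !scaler0 subr0 => /eq_col_mx[/eq_col_mx[e1 e2] /eq_col_mx[e3 _]].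
have e4 : b *: v2 = a *: - v1 by apply/eqP; rewrite scalerN -addr_eq0 addrC e1.
have [w ew] := regmx e4.
have ew1 : v1 = - (b *: w).
  by apply: (scalemx_inj a0); rewrite -[LHS]opprK -scalerN -e4 ew scalerN !scalerA mulrC.
have ev3 : v3 = s *: (w *m dX).
  apply: (scalemx_inj a0); move/eqP: e3; rewrite add0r subr_eq0 => /eqP ->.
  by rewrite ew -scalemxAl !scalerA mulrC.
exists (col_mx (col_mx 0 0) (col_mx 0 w)).
rewrite mx_koszul_col !mul_col_mx !scale_col_mx !opp_col_mx !add_col_mx.
rewrite !mul0mx !scaler0 !add0r !oppr0 !addr0.
congr (col_mx (col_mx _ _) (col_mx _ _)); rewrite ?ew1 ?ew ?ev3 //.
by rewrite scaleNr sub0r opprK.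
Qed.

End Koszul.
End Solve.

(** * Hom from rank-one and Koszul factorisations as exactness modulo their ideals *)

Section Homs.
Context {R : realType} (G : tpoint R -> Prop) (f : poly2 R).
Local Notation S := (poly2 R).
Hypothesis Gsub : subgroup G.
Implicit Types (X Y Z W : mf G f) (m n k : int) (P Q T : grbasis).
Opaque hom_d.

Definition gen1 (a : S) : S -> Prop := fun p => exists q, p = a * q.
Definition gen2 (a b : S) : S -> Prop := fun p => exists q r, p = a * q + b * r.

Lemma gen1_hideal ga a : has_weight G ga a -> hideal G (gen1 a).
Proof.
move=> ha; split.
- by exists 0; rewrite mulr0.
- by move=> _ _ [q ->] [q' ->]; exists (q + q'); rewrite mulrDr.
- by move=> p _ [q ->]; exists (p * q); rewrite mulrCA.
- move=> u _ [q ->]; exists (wproj G (u - ga) q).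
  by rewrite -(wprojMl Gsub _ _ ha) addrC subrK.
Qed.

Lemma gen2_hideal al be a b : has_weight G al a -> has_weight G be b -> hideal G (gen2 a b).
Proof.
move=> ha hb; split.
- by exists 0, 0; rewrite !mulr0 addr0.
- by move=> _ _ [q [r ->]] [q' [r' ->]]; exists (q + q'), (r + r'); rewrite !mulrDr addrACA.
- by move=> p _ [q [r ->]]; exists (p * q), (p * r); rewrite mulrDr [p * (a * q)]mulrCA [p * (b * r)]mulrCA.
- move=> u _ [q [r ->]]; exists (wproj G (u - al) q), (wproj G (u - be) r).
  by rewrite -(wprojMl Gsub _ _ ha) -(wprojMl Gsub _ _ hb) [al + _]addrC [be + _]addrC !subrK linearD.
Qed.

Lemma vec_gen1 a (m : nat) (v : 'cV[S]_m) : vec_in (gen1 a) v <-> exists q, v = a *: q.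
Proof.
split=> [h|[q ->] i]; last by exists (q i 0); rewrite mxE.
have /choice[F hF] : forall i, exists q, v i 0 = a * q by [].
by exists (\col_i F i); apply/matrixP => i j; rewrite ord1 hF !mxE.
Qed.

Lemma vec_gen2 a b (m : nat) (v : 'cV[S]_m) : vec_in (gen2 a b) v <-> exists q r, v = a *: q + b *: r.
Proof.
split=> [h|[q [r ->]] i]; last first.
  by exists (q i 0), (r i 0); rewrite mxE; congr (_ + _); rewrite mxE.
have /choice[F hF] : forall i, exists qr : S * S, v i 0 = a * qr.1 + b * qr.2.
  by move=> i; have [q [r e]] := h i; exists (q, r).
exists (\col_i (F i).1), (\col_i (F i).2); apply/matrixP => i j.
by rewrite ord1 hF [RHS]mxE; congr (_ + _); rewrite !mxE.
Qed.

Lemma vec_cancel n w ga c P (v : 'cV[S]_(rk P)) : c != 0 -> has_weight G ga c ->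
  vec G n w (c *: v) -> vec G n (w - ga) v.
Proof.
move=> c0 hc hv; have e := vproj_id hv; rewrite (vproj_scale Gsub _ _ _ hc) in e.
rewrite -[v](scalemx_inj c0 e); exact: vproj_vec.
Qed.

Lemma hom_dNsgn m X Y (psi : 'M[S]_(rk Y, rk X)) :
  hom_d (m - 1) psi = mf_d Y *m psi - (- sgn m) *: (psi *m mf_d X).
Proof. by rewrite hom_dE sgnP. Qed.

Section RankOne.
Context (g h : S) (ga u : weight).
Hypotheses (hg : has_weight G ga g) (hh : has_weight G (chi - ga) h) (fgh : f = g * h).
Hypothesis f0 : f != 0.
Local Notation B := (rank1 u hg hh fgh).

Let g0 : g != 0.
Proof. by apply: contraNneq f0 => e; rewrite fgh e mul0r. Qed.

Let dd Y : mf_d Y *m mf_d Y = (g * h)%:M.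
Proof. by rewrite -fgh mf_d_sq. Qed.

Lemma rank1_deg n Y (v0 v1 : 'cV[S]_(rk Y)) :
  hom_deg G n B Y (row_mx v0 v1) <-> vec G n u v0 /\ vec G (n - 1) (u + ga) v1.
Proof.
split.
  by move/hom_deg_sum_row => [h1 /hom_deg_shift_l h2].
move=> [h1 h2]; refine ((@hom_deg_sum_row _ _ n (pt u) (shift_basis (pt (u + ga))) Y _ _).2 _).
by split=> //; apply/hom_deg_shift_l.
Qed.

Lemma rank1_dE n Y (v0 v1 : 'cV[S]_(rk Y)) :
  hom_d n (X := B) (row_mx v0 v1) =
  row_mx (mf_d Y *m v0 - sgn n *: (h *: v1)) (mf_d Y *m v1 - sgn n *: (g *: v0)).
Proof. rewrite hom_dE; exact: (pair_dE (mf_d Y) g h (sgn n) v0 v1). Qed.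

Lemma rank1_closed n Y (v0 v1 : 'cV[S]_(rk Y)) : closed_hom n (X := B) (row_mx v0 v1) ->
  mf_d Y *m v1 - sgn n *: (g *: v0) = 0.
Proof. by case=> _; rewrite rank1_dE -row_mx0 => /eq_row_mx[]. Qed.

Lemma rank1_exact n Y (v0 v1 p q : 'cV[S]_(rk Y)) : closed_hom n (X := B) (row_mx v0 v1) ->
  v1 = mf_d Y *m p + g *: q -> exact_hom n (X := B) (row_mx v0 v1).
Proof.
move=> hc ev; refine (@exact_any R G f Gsub n B Y _ (row_mx (sgn n *: q) p) (proj1 hc) _).
rewrite rank1_dE sgnP.
have [e1 e2] := @pair_solve (poly2 R) (rk Y) (mf_d Y) (sgn n) (sgnV n) g h v0 v1 p q g0 (dd Y) (rank1_closed hc) ev.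
exact: (congr2 (@row_mx _ _ _ _) e1 e2).
Qed.

(** Hom^n from this factorisation to Y is the cohomology of Y modulo g, one position lower and in
    the weight of the odd generator. *)
Lemma rank1_from n Y :
  (forall v : 'cV[S]_(rk Y), vec G (n - 1) (u + ga) v -> vec_in (gen1 g) (mf_d Y *m v) ->
     exists p q, v = mf_d Y *m p + g *: q) ->
  hom_coh0 n B Y.
Proof.
move=> H phi hphi; rewrite -[phi]hsubmxK in hphi *.
move: (lsubmx phi) (rsubmx phi) hphi => v0 v1 hphi.
have [|p [q e]] := H v1 (proj2 ((rank1_deg _ _ _).1 (proj1 hphi))).
  apply/vec_gen1; exists (sgn n *: v0); have /eqP := rank1_closed hphi.
  by rewrite subr_eq0 => /eqP ->; rewrite !scalerA mulrC.
exact: rank1_exact hphi e.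
Qed.

Lemma rank1_acyclic Y : (forall n, hom_coh0 n B Y) -> acyclic_mod (gen1 g) (u + ga) Y.
Proof.
move=> H n v hv /vec_gen1[v0 e].
have hv0 : vec G (n + 1) u v0.
  have := vec_d Gsub hv; rewrite e addrC => /(vec_cancel g0 hg).
  by rewrite addrK.
have [|psi hpsi epsi] := H (n + 1) (row_mx (sgn (n + 1) *: v0) v).
  have [e1 e2] := pair_closed (K := poly2 R) (sgnV (n + 1)) g0 (dd Y) e.
  split; last by rewrite rank1_dE e1 e2 row_mx0.
  apply/rank1_deg; split; last by rewrite addrK.
  by rewrite /sgn; exact: hom_deg_scale.
move: epsi; rewrite -[psi]hsubmxK rank1_dE => /eq_row_mx[_ ->].
exists (rsubmx psi), (- (sgn (n + 1 - 1) *: (g *: lsubmx psi))); split=> //.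
apply/vec_gen1; exists (- (sgn (n + 1 - 1) *: lsubmx psi)).
by rewrite scalerN !scalerA mulrC.
Qed.

End RankOne.

Section Koszul.
Context (a b A B : S) (al be u : weight).
Hypotheses (ha : has_weight G al a) (hb : has_weight G be b).
Hypotheses (hA : has_weight G (chi - al) A) (hB : has_weight G (chi - be) B).
Hypothesis fab : f = a * A + b * B.
Hypotheses (a0 : a != 0) (b0 : b != 0).
Hypothesis reg : forall q r, b * q = a * r -> exists t, q = a * t.
Local Notation C := (koszul u ha hb hA hB fab).

Let dd Y : mf_d Y *m mf_d Y = (a * A + b * B)%:M.
Proof. by rewrite -fab mf_d_sq. Qed.

Lemma koszul_deg n Y (v0 v1 v2 v3 : 'cV[S]_(rk Y)) :
  hom_deg G n C Y (row_mx (row_mx v0 v1) (row_mx v2 v3)) <->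
  [/\ vec G n u v0, vec G (n - 1) (u + al) v1, vec G (n - 1) (u + be) v2
    & vec G (n - 1 - 1) (u + be + al) v3].
Proof.
split.
  move/hom_deg_sum_row => [/hom_deg_sum_row[h1 /hom_deg_shift_l h2] /hom_deg_shift_l].
  by move/hom_deg_sum_row => [h3 /hom_deg_shift_l h4].
move=> [h1 h2 h3 h4].
refine ((@hom_deg_sum_row _ _ n (basis2 al u) (shift_basis (basis2 al (u + be))) Y _ _).2 _); split.
  refine ((@hom_deg_sum_row _ _ n (pt u) (shift_basis (pt (u + al))) Y _ _).2 _).
  by split=> //; apply/hom_deg_shift_l.
apply/hom_deg_shift_l.
refine ((@hom_deg_sum_row _ _ (n - 1) (pt (u + be)) (shift_basis (pt (u + be + al))) Y _ _).2 _).
by split=> //; apply/hom_deg_shift_l.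
Qed.

Lemma koszul_hom_dE n Y (v0 v1 v2 v3 : 'cV[S]_(rk Y)) :
  hom_d n (X := C) (row_mx (row_mx v0 v1) (row_mx v2 v3)) =
  row_mx (row_mx (mf_d Y *m v0 - sgn n *: (A *: v1 + B *: v2)) (mf_d Y *m v1 - sgn n *: (a *: v0 - B *: v3)))
         (row_mx (mf_d Y *m v2 - sgn n *: (b *: v0 + A *: v3)) (mf_d Y *m v3 - sgn n *: (a *: v2 - b *: v1))).
Proof. rewrite hom_dE; exact: (koszul_dE (K := poly2 R) (mf_d Y) a b A B (sgn n) v0 v1 v2 v3). Qed.

Lemma koszul_from n Y :
  (forall v : 'cV[S]_(rk Y), vec G (n - 1 - 1) (u + be + al) v ->
     vec_in (gen2 a b) (mf_d Y *m v) ->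
     exists p q1 q2, v = mf_d Y *m p + (a *: q1 + b *: q2)) ->
  hom_coh0 n C Y.
Proof.
move=> H phi hphi; rewrite -[phi]hsubmxK -[lsubmx phi]hsubmxK -[rsubmx phi]hsubmxK in hphi *.
move: (lsubmx (lsubmx phi)) (rsubmx (lsubmx phi)) (lsubmx (rsubmx phi)) (rsubmx (rsubmx phi)) hphi.
move=> v0 v1 v2 v3 hphi; have [hd e] := hphi.
have [_ _ _ h3] := (koszul_deg _ _ _ _ _).1 hd.
have [|p [q1 [q2 ev]]] := H v3 h3.
  have := e; rewrite koszul_hom_dE -!row_mx0.
  move=> /eq_row_mx[_ /eq_row_mx[_ /eqP]]; rewrite subr_eq0 => /eqP ->.
  apply/vec_gen2; exists (sgn n *: v2), (- (sgn n *: v1)).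
  by rewrite scalerBr scalerN !scalerA mulrC [b * _]mulrC.
have e' : mf_d Y *m row_mx (row_mx v0 v1) (row_mx v2 v3) - sgn n *: (row_mx (row_mx v0 v1) (row_mx v2 v3) *m mx_koszul a b A B) = 0.
  by rewrite (koszul_dE (K := poly2 R)) -koszul_hom_dE.
have [psi epsi] := koszul_solve (K := poly2 R) (sgnV n) a0 reg (dd Y) e' ev.
refine (@exact_any R G f Gsub n C Y _ psi hd _).
rewrite hom_dNsgn; exact: epsi.
Qed.

Lemma koszul_acyclic Y : (forall n, hom_coh0 n C Y) -> acyclic_mod (gen2 a b) (u + be + al) Y.
Proof.
move=> H n v hv hdv.
have [x0 [y0 e0]] := (vec_gen2 _ _ _).1 hdv.
pose x := vproj G (1 + n) (u + be) x0; pose y := vproj G (1 + n) (u + al) y0.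
have hx : vec G (1 + n) (u + be) x by exact: vproj_vec.
have hy : vec G (1 + n) (u + al) y by exact: vproj_vec.
have e : mf_d Y *m v = a *: x + b *: y.
  rewrite -(vproj_id (vec_d Gsub hv)) e0 vprojD (vproj_scale Gsub _ _ _ ha) (vproj_scale Gsub _ _ _ hb).
  by rewrite addrK [u + be + al]addrAC addrK.
have [v0 [e4 ec]] := koszul_close (K := poly2 R) (sgnV (n + 1 + 1)) a0 reg (dd Y) e.
have [|psi hpsi epsi] := H (n + 1 + 1) (row_mx (row_mx v0 (- sgn (n + 1 + 1) *: y)) (row_mx (sgn (n + 1 + 1) *: x) v)).
  split; last by rewrite koszul_hom_dE -(koszul_dE (K := poly2 R) (mf_d Y) a b A B).
  apply/koszul_deg; split; last by rewrite !addrK.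
  - have h1 : vec G (1 + (1 + n)) (u + al) (mf_d Y *m y) by exact: vec_d.
    have h2 : vec G (1 + (1 + n)) (u + al) (B *: v).
      (* The weight of B contains one chi, which accounts for the two extra positions of B v
         compared with v. *)
      apply: (vec_scale Gsub hB); have ew : u + al - (chi - be) = u + be + al + chi *~ (- 1).
        by rewrite mulrN1z opprB addrA [u + al + be]addrAC.
      rewrite ew => i j; have [->|[k [ek hk]]] := hv i j; [by left|right; exists (k + 1)].
      split; first by move: ek => /=; lia.
      suff -> : u + be + al + chi *~ (-1) - wt i + chi *~ (k + 1) = u + be + al - wt i + chi *~ k by [].
      by rewrite mulrzDr mulr1z mulrN1z [_ - chi - _]addrAC addrACA addNr addr0 //.
    have h3 := vecB h2 h1; rewrite e4 in h3.
    have := vec_cancel a0 ha h3; rewrite addrK.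
    by have -> : n + 1 + 1 = 1 + (1 + n) by lia.
  - rewrite addrK scaleNr; apply: hom_degN; rewrite /sgn; apply: hom_deg_scale.
    by rewrite addrC.
  - by rewrite addrK /sgn; apply: hom_deg_scale; rewrite addrC.
move: epsi; rewrite -[psi]hsubmxK -[lsubmx psi]hsubmxK -[rsubmx psi]hsubmxK.
move: (lsubmx (lsubmx psi)) (rsubmx (lsubmx psi)) (lsubmx (rsubmx psi)) (rsubmx (rsubmx psi)).
move=> p0 p1 p2 p3; rewrite koszul_hom_dE sgnP => /eq_row_mx[_ /eq_row_mx[_ ->]].
exists p3, (- (- sgn (n + 1 + 1) *: (a *: p2 - b *: p1))); split=> //.
apply/vec_gen2; exists (sgn (n + 1 + 1) *: p2), (- (sgn (n + 1 + 1) *: p1)).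
by rewrite scaleNr opprK scalerBr scalerN !scalerA [sgn _ * a]mulrC [sgn _ * b]mulrC.
Qed.

(** The top row represents the map to S/(a, b); a closed map is exact as soon as this row vanishes
    there. *)
Lemma koszul_to n X (phi : 'M[S]_(rk C, rk X)) : closed_hom n (Y := C) phi ->
  (forall j, gen2 a b (phi (lshift _ (lshift _ 0)) j)) -> exact_hom n (Y := C) phi.
Proof.
move=> [hd e] h0.
have /choice[F hF] : forall j, exists qr : S * S, phi (lshift _ (lshift _ 0)) j = a * qr.1 + b * qr.2.
  by move=> j; have [q [r ej]] := h0 j; exists (q, r).
move: hd e hF {h0}; rewrite -[phi]vsubmxK -[usubmx phi]vsubmxK -[dsubmx phi]vsubmxK.
move: (usubmx (usubmx phi)) (dsubmx (usubmx phi)) (usubmx (dsubmx phi)) (dsubmx (dsubmx phi)).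
move=> r0 r1 r2 r3 hd e hF; rewrite hom_dE in e.
have er : r0 = a *: \row_j (F j).1 + b *: \row_j (F j).2.
  apply/matrixP => i j; have := hF j; rewrite !col_mxEu ord1 => ->.
  by rewrite [RHS]mxE; congr (_ + _); rewrite !mxE.
have [psi epsi] := koszul_into (K := poly2 R) (sgnV n) a0 reg (dd X) e er.
refine (@exact_any R G f Gsub n X C _ psi hd _).
rewrite hom_dNsgn; exact: epsi.
Qed.

End Koszul.
End Homs.

(** * Coprime factors *)

Section Weighted.
Context {R : realType} (G : tpoint R -> Prop).
Local Notation S := (poly2 R).
Hypothesis Gsub : subgroup G.
Implicit Types (u v w : weight) (p q g h l : S) (z : 'I_2 -> R[i]).

Lemma weq_trans v w u : weq G v w -> weq G w u -> weq G v u.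
Proof. by move=> h1 h2 t Gt; rewrite h1 // h2. Qed.

Lemma weq_sub0 v w : weq G v w <-> weq G (v - w) 0.
Proof.
split=> h; first by rewrite -(subrr w); exact: weqD.
by have := weqD Gsub w h; rewrite subrK add0r.
Qed.

Lemma weqDD v v' w w' : weq G v v' -> weq G w w' -> weq G (v + w) (v' + w').
Proof.
move=> h1 h2; apply: (@weq_trans _ (v' + w)); first exact: weqD.
by rewrite ![v' + _]addrC; exact: weqD.
Qed.

Lemma weqN v v' : weq G v v' -> weq G (- v) (- v').
Proof. by move=> /weq_sym /weq_sub0 h; apply/weq_sub0; rewrite opprK addrC. Qed.

Lemma weqZ v v' (k : int) : weq G v v' -> weq G (v *~ k) (v' *~ k).
Proof.
move=> h; have hn (n : nat) : weq G (v *+ n) (v' *+ n).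
  by elim: n => [|n IH]; rewrite ?mulr0n // !mulrS; exact: weqDD.
by case: k => n; [exact: hn|rewrite !NegzE !mulrNz; exact/weqN/hn].
Qed.

(* All homogeneous forms vanishing at z are multiples of l, although l need not be
   prime when P and Q have a common factor. *)
Definition line l z := l.@[z] = 0 /\ forall v p, has_weight G v p -> p.@[z] = 0 -> gen1 l p.

(** The form h is a nonzero divisor modulo g. *)
Definition cop g h := forall c, gen1 g (h * c) -> gen1 g c.

Definition supp z v := exists p, has_weight G v p /\ p.@[z] != 0.

Definition spanned w g h := forall c, has_weight G w c -> gen2 g h c.

Lemma wproj_meas p (m : 'X_{1..2}) u : m \in msupp p -> mon_weight G u m ->
  (size (msupp (p - wproj G u p)) < size (msupp p))%N.
Proof.
move=> hm hu; have hc m' : (p - wproj G u p)@_m' = if `[< mon_weight G u m' >] then 0 else p@_m'.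
  by rewrite mcoeffB mcoeff_wproj; case: ifP; rewrite ?subrr ?subr0.
have -> : size (msupp p) = (size (rem m (msupp p))).+1.
  by rewrite size_rem // prednK //; case: (msupp p) hm.
rewrite ltnS; apply: uniq_leq_size; first exact: msupp_uniq.
move=> m'; rewrite mcoeff_msupp hc mem_rem_uniq ?msupp_uniq // inE.
case: asboolP => [_|ne]; first by rewrite eqxx.
by rewrite -mcoeff_msupp => ->; rewrite andbT; apply/eqP => e; apply: ne; rewrite e.
Qed.

Lemma mon_weight_self (m : 'X_{1..2}) : mon_weight G (Posz (m 0%R), Posz (m 1%R), 0) m.
Proof. by move=> t Gt; rewrite /mchar /eval_weight /= expr0z mulr1. Qed.

(** If l divides h c, it divides each h c_u with c_u homogeneous; evaluating at z gives c_u (z) = 0,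
    and the line property applies. The components of c are removed one at a time. *)
Lemma cop_line l z de h et : line l z -> has_weight G de l -> has_weight G et h ->
  h.@[z] != 0 -> cop l h.
Proof.
move=> [l0 hl] hde het hz c; have [k] := ubnP (size (msupp c)).
elim: k c => // k IH c hk hc.
have [->|c0] := eqVneq c 0; first by exists 0; rewrite mulr0.
have [m hm] : exists m, m \in msupp c.
  case E: (msupp c) => [|m s]; last by exists m; rewrite inE eqxx.
  by move/msuppnil0: E c0 => ->; rewrite eqxx.
set u : weight := (Posz (m 0%R), Posz (m 1%R), 0); have hu := mon_weight_self m.
have hI := gen1_hideal Gsub hde.
have h1 : gen1 l (h * wproj G u c).
  by rewrite -(wprojMl Gsub _ _ het); exact: hideal_proj.
have h2 : gen1 l (wproj G u c).
  apply: (hl u); first exact: wproj_weight.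
  case: h1 => q /(congr1 (fun p => p.@[z])); rewrite !mevalM l0 mul0r => /eqP.
  by rewrite mulf_eq0 (negPf hz) => /eqP.
rewrite -[c](subrK (wproj G u c)); apply: (hidealD hI) => //.
apply: IH; first exact: (leq_trans (wproj_meas hm hu)).
by rewrite mulrBr; apply: (hidealD hI) => //; exact: (hidealN hI).
Qed.

Lemma cop1 h : cop 1 h.
Proof. by move=> c _; exists c; rewrite mul1r. Qed.

Lemma copM l g h : l != 0 -> cop l h -> cop g h -> cop (l * g) h.
Proof.
move=> l0 cl cg c [q e]; have [|c' ec] := cl c; first by exists (g * q); rewrite e mulrA.
have [|d ed] := cg c'.
  by exists q; apply: (mulfI l0); rewrite mulrCA -ec e mulrA.
by exists d; rewrite ec ed mulrA.
Qed.

Lemma homog_quot l de w c q : l != 0 -> has_weight G de l -> has_weight G w c -> c = l * q ->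
  has_weight G (w - de) q.
Proof.
move=> l0 hl hc e; have : wproj G (de + (w - de)) c = c by apply/wprojE; rewrite addrC subrK.
rewrite e (wprojMl Gsub _ _ hl) => /(mulfI l0) <-; exact: wproj_weight.
Qed.

Lemma spanned1 w h : spanned w 1 h.
Proof. by move=> c _; exists c, 0; rewrite mul1r mulr0 addr0. Qed.

(** A form of weight w is corrected by a multiple of h until it vanishes at z, then divided by l.
    The correction exists because the support condition provides a form of weight w - et that does
    not vanish at z. *)
Lemma peel l z de g h et w : l != 0 -> line l z -> has_weight G de l -> has_weight G et h ->
  h.@[z] != 0 -> (supp z w -> supp z (w - et)) -> spanned (w - de) g h -> spanned w (l * g) h.
Proof.
move=> l0 [lz hl] hde het hz hs sp c hc.
have main c' : has_weight G w c' -> c'.@[z] = 0 -> gen2 (l * g) h c'.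
  move=> hc' /(hl _ _ hc')[q eq]; have [a [b e]] := sp q (homog_quot l0 hde hc' eq).
  by exists a, (l * b); rewrite eq e mulrDr mulrA [l * (h * b)]mulrCA.
have [cz|cz] := eqVneq c.@[z] 0; first exact: main.
have [|mu [hmu muz]] := hs; first by exists c.
pose k := c.@[z] / (h.@[z] * mu.@[z]).
have hk : has_weight G w (k%:MP * (h * mu)).
  have -> : w = 0 + (et + (w - et)) by rewrite add0r addrC subrK.
  by apply: (has_weightM Gsub); [exact: has_weightC|exact: has_weightM].
have [||a [b e]] := main (c - k%:MP * (h * mu)).
- by apply: has_weightD => //; exact: has_weightN.
- by rewrite mevalB !mevalM mevalC divfK ?subrr // mulf_neq0.
exists a, (b + k%:MP * mu); rewrite -[c](subrK (k%:MP * (h * mu))) e mulrDr addrA.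
by congr (_ + _); rewrite mulrCA.
Qed.

End Weighted.

Section RankOneHoms.
Context {R : realType} (G : tpoint R -> Prop) (f : poly2 R).
Local Notation S := (poly2 R).
Hypothesis Gsub : subgroup G.
Hypothesis f0 : f != 0.
Implicit Types (X Y Z W : mf G f) (m n k : int) (u v w : weight).
Opaque hom_d.

(** Evaluated at the origin, the diagonal entry at i0 of d psi + psi d vanishes, while that of the
    identity is 1. *)
Lemma not_contractible X (i0 : 'I_(rk X)) :
  (forall j, vanish0 (mf_d X i0 j)) -> (forall j, vanish0 (mf_d X j i0)) ->
  ~ exact_hom 0 (X := X) (Y := X) 1%:M.
Proof.
move=> hr hc [psi _]; rewrite hom_dE => /(congr1 (fun M : 'M_(_, _) => (M i0 i0)@_0%MM)) /eqP.
have hI := vanish0_hideal G.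
have e1 : vanish0 ((mf_d X *m psi) i0 i0).
  by rewrite mxE; apply: (big_ind (@vanish0 R)); [exact: (hideal0 hI)|exact: (hidealD hI)|move=> j _; rewrite mulrC; exact: (hidealM hI)].
have e2 : vanish0 ((psi *m mf_d X) i0 i0).
  by rewrite mxE; apply: (big_ind (@vanish0 R)); [exact: (hideal0 hI)|exact: (hidealD hI)|move=> j _; exact: (hidealM hI)].
rewrite [X in X@__ == _]mxE eqxx mulr1n mcoeff1 eqxx mxE mcoeffD e1 add0r [X in X@__]mxE mcoeffN [X in X@__]mxE.
by rewrite (hidealM hI _ e2) oppr0 oner_eq0.
Qed.

Lemma rank1_not_contractible g h ga u (hg : has_weight G ga g) (hh : has_weight G (chi - ga) h)
    (fgh : f = g * h) : vanish0 g -> vanish0 h ->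
  ~ exact_hom 0 (X := rank1 u hg hh fgh) (Y := rank1 u hg hh fgh) 1%:M.
Proof.
move=> vg vh; have v0 := hideal0 (vanish0_hideal G).
have e i j : vanish0 (mx_pair g h i j).
  rewrite /mx_pair /block_mx /col_mx /row_mx !mxE.
  by case: split => k; rewrite mxE; case: split => k'; rewrite !mxE ?ord1 ?eqxx ?mulr1n.
by apply: (@not_contractible (rank1 u hg hh fgh) (lshift 1 0)) => j; exact: e.
Qed.

(** A large position forces many copies of chi in the weight of every entry, hence a large
    degree. *)
Lemma vec_high (deg : weight -> int) : (forall u v, deg (u + v) = deg u + deg v) -> 0 < deg chi ->
  forall (Q : grbasis) w (D : int), exists N : nat, forall n (v : 'cV[S]_(rk Q)), N%:Z <= n ->
  vec G n w v -> forall i, v i 0 = 0 \/ exists u, has_weight G u (v i 0) /\ D <= deg u.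
Proof.
move=> degD degchi Q w D.
exists (\sum_(i < rk Q) (absz (pos i) + 2 * (absz D + absz (deg (w - wt i)%R))))%N => n v hn hv i.
have [->|[k [ek hk]]] := hv i 0; [by left|right; exists (w - wt i + chi *~ k)].
split; [exact: hk|rewrite degD (degZ degD)].
have : (absz (pos i) + 2 * (absz D + absz (deg (w - wt i)%R)) <= \sum_(i < rk Q) (absz (pos i) + 2 * (absz D + absz (deg (w - wt i)%R))))%N.
  by rewrite (bigD1 i) //= leq_addr.
move: ek => /=; move: (deg _) (deg chi) degchi (\sum_(_ < _) _)%N hn => d c c0 s hn ek hs.
have hk0 : `|D|%N%:Z + `|d|%N%:Z <= k by lia.
nia.
Qed.

Section Two.
Context (g h g' h' : S) (ga ga' u u' : weight).
Hypotheses (hg : has_weight G ga g) (hh : has_weight G (chi - ga) h) (fgh : f = g * h).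
Hypotheses (hg' : has_weight G ga' g') (hh' : has_weight G (chi - ga') h') (fgh' : f = g' * h').
Local Notation B := (rank1 u hg hh fgh).
Local Notation B' := (rank1 u' hg' hh' fgh').

Lemma rank1_vec n w (c0 c1 : 'cV[S]_1) : vec G n w (P := B') (col_mx c0 c1) <->
  (c0 0 0 = 0 \/ exists k, n = k * 2 /\ has_weight G (w - u' + chi *~ k) (c0 0 0)) /\
  (c1 0 0 = 0 \/ exists k, n + 1 = k * 2 /\ has_weight G (w - (u' + ga') + chi *~ k) (c1 0 0)).
Proof.
split=> [/hom_deg_sum_col[h0 h1]|[h0 h1]].
  split; first by have [->|[k [e hk]]] := h0 0 0; [left|right; exists k; split=> //; move: e => /=; lia].
  move/hom_deg_shift_r: h1 => h1.
  by have [->|[k [e hk]]] := h1 0 0; [left|right; exists k; split=> //; move: e => /=; lia].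
refine ((@hom_deg_sum_col _ _ n (pt u') (shift_basis (pt (u' + ga'))) (pt w) _ _).2 _); split.
  move=> i j; rewrite !ord1; case: h0 => [->|[k [e hk]]]; [by left|right; exists k; split=> //=; lia].
move=> i j; rewrite !ord1; case: h1 => [->|[k [e hk]]]; [by left|right; exists k; split=> //=; lia].
Qed.

Lemma rank1_dcol (c0 c1 : 'cV[S]_1) : mf_d B' *m col_mx c0 c1 = col_mx (g' *: c1) (h' *: c0).
Proof. exact: mx_pair_col. Qed.

Lemma scale_col_scalar (a c : S) : a *: (c%:M : 'cV[S]_1) = (a * c)%:M.
Proof. by rewrite scale_scalar_mx. Qed.

(** A homogeneous vector of the target has one possibly nonzero component, selected by the parity of
    n: the even one for odd n, the odd one for even n. *)
Lemma rank1_hom0 n :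
  (forall k c, n = k * 2 + 1 -> has_weight G (u + ga - u' + chi *~ k) c -> gen1 g (h' * c) -> gen2 g' g c) ->
  (forall k c, n = k * 2 -> has_weight G (u + ga - (u' + ga') + chi *~ k) c -> gen1 g (g' * c) -> gen2 h' g c) ->
  hom_coh0 n B B'.
Proof.
move=> H0 H1; apply: rank1_from => // v; rewrite -[v]vsubmxK.
move: (usubmx v) (dsubmx v) => c0 c1 /rank1_vec[hc0 hc1] /vec_gen1[q].
rewrite rank1_dcol -[q]vsubmxK scale_col_mx => /eq_col_mx[e1 e0].
have g0 : gen1 g (h' * c0 0 0).
  by exists (dsubmx q 0 0); have := congr1 (fun M : 'cV_1 => M 0 0) e0; rewrite !mxE.
have g1 : gen1 g (g' * c1 0 0).
  by exists (usubmx q 0 0); have := congr1 (fun M : 'cV_1 => M 0 0) e1; rewrite !mxE.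
have [p0 [q0 E0]] : gen2 g' g (c0 0 0).
  case: hc0 => [->|[k [ek hk]]]; first by exists 0, 0; rewrite !mulr0 addr0.
  by apply: (H0 k) => //; lia.
have [p1 [q1 E1]] : gen2 h' g (c1 0 0).
  case: hc1 => [->|[k [ek hk]]]; first by exists 0, 0; rewrite !mulr0 addr0.
  by apply: (H1 k) => //; lia.
exists (col_mx p1%:M p0%:M), (col_mx q0%:M q1%:M).
rewrite rank1_dcol scale_col_mx add_col_mx !scale_col_scalar.
by congr col_mx; rewrite -raddfD /= -?E0 -?E1; exact: mx11_scalar.
Qed.

End Two.

Section One.
Context (g h : S) (ga u : weight).
Hypotheses (hg : has_weight G ga g) (hh : has_weight G (chi - ga) h) (fgh : f = g * h).
Local Notation B := (rank1 u hg hh fgh).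
Hypothesis S0 : forall c, has_weight G 0 c -> exists a : R[i], c = a%:MP.

Lemma rank1_end (phi : 'M[S]_(rk B)) : closed_hom 0 (X := B) (Y := B) phi ->
  exists a : R[i], exact_hom 0 (X := B) (Y := B) (phi - (a%:MP)%:M).
Proof.
move=> hphi; have [hd _] := hphi; have e := hsubmxK phi.
have hd' := hd; rewrite -e in hd'; have [_ hv] := (rank1_deg _ _ _ _ _ _ _).1 hd'.
have ev := vsubmxK (rsubmx phi); rewrite -ev in hv.
have [h0 h1] := (rank1_vec _ _ _ _ _ _ _ _).1 hv.
have c00 : usubmx (rsubmx phi) 0 0 = 0 by case: h0 => // -[k [ek _]]; lia.
have [a ea] : exists a : R[i], dsubmx (rsubmx phi) 0 0 = a%:MP.
  case: h1 => [->|[k [ek hk]]]; first by exists 0; rewrite mpolyC0.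
  have k0 : k = 0 by lia.
  by apply: S0; move: hk; rewrite k0 mulr0z addr0 subrr => hk.
exists a; set psi := phi - _.
have hpsi : closed_hom 0 (X := B) (Y := B) psi.
  refine (closedB hphi _); have := closed_scalar B (erefl (0 : int)) a.
  by rewrite scalemx1.
have epsi := hsubmxK psi; rewrite -epsi in hpsi *.
apply: (@rank1_exact _ _ _ Gsub _ _ _ _ _ _ _ f0 _ _ _ _ 0 0 hpsi).
rewrite mulmx0 scaler0 addr0; apply/matrixP => i j; rewrite ord1 [RHS]mxE.
have -> : rsubmx psi i 0 = rsubmx phi i 0 - a%:MP *+ (i == rshift 1 0).
  by rewrite /psi !mxE.
rewrite -ev mxE; case: splitP => k ek.
  rewrite ord1 c00 sub0r (_ : (i == _) = false) ?oppr0 //.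
  by apply/eqP => ei; move: ek; rewrite ei ord1.
rewrite ord1 ea (_ : (i == _) = true) ?subrr //.
by apply/eqP/val_inj; move: ek; rewrite ord1 => ek; exact: ek.
Qed.

Lemma rank1_exceptional : vanish0 g -> vanish0 h -> (forall n, n != 0 -> hom_coh0 n B B) -> exceptional B.
Proof. by move=> vg vh H; split; [exact: H|exact: rank1_not_contractible|exact: rank1_end]. Qed.

(** In high degrees every vector has its entries in (g, h), so it can be written g p + h q; the
    h-part is then shown to be a boundary. *)
Lemma rank1_bounded (deg : weight -> int) (D : int) :
  (forall v w, deg (v + w) = deg v + deg w) -> 0 < deg chi ->
  cop g h -> (forall w, D <= deg w -> spanned G w g h) -> bounded_from B.
Proof.
move=> degD degchi cgh sp Y.
have [N hN] := vec_high degD degchi (mf_basis Y) (u + ga) D.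
exists N.+1 => n hn; apply: rank1_from => // v hv /vec_gen1[r er].
have g0 : g != 0 by apply: contraNneq f0 => e; rewrite fgh e mul0r.
have [|p [q ev]] := (vec_gen2 g h v).1.
  move=> i; have [|->|[w [hw dw]]] := hN (n - 1) v _ hv i; first by lia.
    by exists 0, 0; rewrite !mulr0 addr0.
  exact: sp hw.
(* Since d v is divisible by g, so is h d q, and coprimality makes d q divisible by g. Then g h q =
   d (d q) = g d q', that is h q = d q'. *)
have [q' eq'] : exists q', mf_d Y *m q = g *: q'.
  apply/vec_gen1 => i; apply: cgh; exists (r i 0 - (mf_d Y *m p) i 0).
  have := congr1 (fun M : 'cV_ _ => M i 0) er; rewrite /= ev mulmxDr -!scalemxAr.
  rewrite [LHS]mxE [X in X + _]mxE [X in _ + X]mxE [RHS]mxE => e.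
  by rewrite mulrBr -e addrAC subrr add0r.
exists q', p; rewrite ev addrC; congr (_ + _); apply: (scalemx_inj g0).
by rewrite scalerA -fgh scalemxAr -eq' mulmxA mf_d_sq mul_scalar_mx.
Qed.

End One.
End RankOneHoms.

Lemma ord2P (i j k : 'I_2) : i != j -> k = i \/ k = j.
Proof.
move=> ij; have [->|ki] := eqVneq k i; [by left|right; apply: val_inj].
by move: ij ki; rewrite -!val_eqE; case: i => -[|[|?]] //; case: j => -[|[|?]] //; case: k => -[|[|?]].
Qed.

Lemma ord2_cases (i j : 'I_2) : i != j -> (i = 0 /\ j = 1) \/ (i = 1 /\ j = 0).
Proof.
by case: i => -[|[|?]] // hi; case: j => -[|[|?]] // hj _; [left|right]; split; apply: val_inj.
Qed.

(* The weight of X_i^a X_j^b, for {i, j} = {0, 1}. *)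
Definition wt2 (i : 'I_2) (a b : int) : weight := if i == 0 then (a, b, 0) else (b, a, 0).
(** The exponents of x and, for [wc2], of y after the third coordinate has been eliminated by means
    of chi = (c1, c2). *)
Definition wc1 (i : 'I_2) (c : int) (v : weight) : int :=
  (if i == 0 then v.1.1 else v.1.2) + c * v.2.
Definition wc2 (i : 'I_2) (c : int) (v : weight) : int :=
  (if i == 0 then v.1.2 else v.1.1) + c * v.2.

Section Coordinates.
Context (i : 'I_2) (c1 c2 : int).
Implicit Types (u v : weight).
Local Notation wA := (wc1 i c1).
Local Notation wB := (wc2 i c2).

Lemma wAD u v : wA (u + v) = wA u + wA v. Proof. by rewrite /wc1 /=; case: ifP => _ /=; lia. Qed.
Lemma wBD u v : wB (u + v) = wB u + wB v. Proof. by rewrite /wc2 /=; case: ifP => _ /=; lia. Qed.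
Lemma wAN u : wA (- u) = - wA u. Proof. by rewrite /wc1 /=; case: ifP => _ /=; lia. Qed.
Lemma wBN u : wB (- u) = - wB u. Proof. by rewrite /wc2 /=; case: ifP => _ /=; lia. Qed.
Lemma wA0 : wA 0 = 0. Proof. by rewrite /wc1 /=; case: ifP => _ /=; lia. Qed.
Lemma wB0 : wB 0 = 0. Proof. by rewrite /wc2 /=; case: ifP => _ /=; lia. Qed.
Lemma wA_chi : wA chi = c1. Proof. by rewrite /wc1 /=; case: ifP => _ /=; lia. Qed.
Lemma wB_chi : wB chi = c2. Proof. by rewrite /wc2 /=; case: ifP => _ /=; lia. Qed.
Lemma wA_wt a b : wA (wt2 i a b) = a. Proof. by rewrite /wc1 /wt2; case: (i == 0) => /=; lia. Qed.
Lemma wB_wt a b : wB (wt2 i a b) = b. Proof. by rewrite /wc2 /wt2; case: (i == 0) => /=; lia. Qed.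

Lemma wAZ u k : wA (u *~ k) = wA u * k.
Proof.
have hn (n : nat) : wA (u *+ n) = wA u * n.
  by elim: n => [|n IH]; rewrite ?mulr0n ?wA0 ?mulr0 // mulrS wAD IH intS mulrDr mulr1.
by case: k => n; [exact: hn|rewrite NegzE mulrNz -pmulrn wAN hn mulrN].
Qed.

Lemma wBZ u k : wB (u *~ k) = wB u * k.
Proof.
have hn (n : nat) : wB (u *+ n) = wB u * n.
  by elim: n => [|n IH]; rewrite ?mulr0n ?wB0 ?mulr0 // mulrS wBD IH intS mulrDr mulr1.
by case: k => n; [exact: hn|rewrite NegzE mulrNz -pmulrn wBN hn mulrN].
Qed.

Definition wcE := (wAD, wBD, wAN, wBN, wA0, wB0, wA_chi, wB_chi, wA_wt, wB_wt, wAZ, wBZ).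

(* A Z-valued degree, positive on the variables. *)
Definition wdeg (P Q : nat) v : int := Q%:Z * wA v + P%:Z * wB v.

Lemma wdegD P Q u v : wdeg P Q (u + v) = wdeg P Q u + wdeg P Q v.
Proof. by rewrite /wdeg !wcE; lia. Qed.

End Coordinates.

(** * Weights, supports and lines in the coordinates x and y *)

Section Plane.
Context {R : realType} (G : tpoint R -> Prop).
Local Notation S := (poly2 R).
Hypothesis Gsub : subgroup G.
Context (i j : 'I_2) (P Q : nat) (c1 c2 : int).
Hypothesis ij : i != j.
Hypotheses (P0 : (0 < P)%N) (Q0 : (0 < Q)%N).
Hypothesis Hchi : weq G chi (wt2 i c1 c2).
Hypothesis HG : forall a b : int, weq G (wt2 i a b) 0 <-> exists r : int, a = r * P /\ b = - (r * Q%:Z).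
Implicit Types (u v w : weight) (p q g h l : S) (z : 'I_2 -> R[i]).

Local Notation x := ('X_i : S).
Local Notation y := ('X_j : S).
Local Notation wA := (wc1 i c1).
Local Notation wB := (wc2 i c2).
Local Notation wE := (wcE i c1 c2).
Local Notation wdeg := (wdeg i c1 c2 P Q).

Definition mon (a b : nat) : 'X_{1..2} := (U_(i) *+ a + U_(j) *+ b)%MM.

Lemma mon_i a b : mon a b i = a.
Proof. by rewrite mnmDE !mulmnE !mnmE eqxx eq_sym (negPf ij) mul1n mul0n addn0. Qed.

Lemma mon_j a b : mon a b j = b.
Proof. by rewrite mnmDE !mulmnE !mnmE eqxx (negPf ij) mul1n mul0n add0n. Qed.

Lemma monE (m : 'X_{1..2}) : m = mon (m i) (m j).
Proof. by apply/mnmP => k; have [->|->] := ord2P k ij; rewrite ?mon_i ?mon_j. Qed.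

Lemma monX a b : 'X_[mon a b] = x ^+ a * y ^+ b :> S.
Proof. by rewrite mpolyXD !mpolyXn. Qed.

Lemma wt2D a b a' b' : wt2 i a b + wt2 i a' b' = wt2 i (a + a') (b + b').
Proof. by rewrite /wt2; case: ifP => _; congr (_, _, _); rewrite addr0. Qed.

Lemma wt2N a b : - wt2 i a b = wt2 i (- a) (- b).
Proof. by rewrite /wt2; case: ifP => _; congr (_, _, _); rewrite oppr0. Qed.

Lemma wt2Z a b k : wt2 i a b *~ k = wt2 i (a * k) (b * k).
Proof.
have hn (n : nat) : wt2 i a b *+ n = wt2 i (a * n) (b * n).
  elim: n => [|n IH]; first by rewrite mulr0n !mulr0 /wt2; case: ifP.
  by rewrite mulrS IH wt2D intS !mulrDr !mulr1.
case: k => n; first exact: hn.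
by rewrite NegzE mulrNz -pmulrn hn wt2N !mulrN.
Qed.

Lemma weq_norm v : weq G v (wt2 i (wA v) (wB v)).
Proof.
have e : v = wt2 i (wA v - c1 * v.2) (wB v - c2 * v.2) + chi *~ v.2.
  have hz (n : int) : chi *~ n = (0, 0, n).
    have hn (k : nat) : chi *+ k = (0, 0, k%:Z).
      by elim: k => [|k IH] //; rewrite mulrS IH; congr (_, _, _); rewrite intS.
    by case: n => n; [exact: hn|rewrite NegzE mulrNz -pmulrn hn; congr (_, _, _)].
  rewrite hz /wc1 /wc2 /wt2; case: v => -[v1 v2] v3 /=.
  by case: (i == 0); congr (_, _, _) => /=; lia.
rewrite {1}e; have -> : wt2 i (wA v) (wB v) = wt2 i (wA v - c1 * v.2) (wB v - c2 * v.2) + wt2 i c1 c2 *~ v.2.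
  by rewrite wt2Z wt2D !subrK.
by apply: weqDD => //; apply: weqZ.
Qed.

Lemma weqE v w : weq G v w <-> exists r : int, wA v = wA w + r * P /\ wB v = wB w - r * Q%:Z.
Proof.
have -> : weq G v w <-> weq G (wt2 i (wA v - wA w) (wB v - wB w)) 0.
  rewrite (weq_sub0 Gsub) -!(wAN i c1) -!(wBN i c2) -!wAD -!wBD; split=> h; apply: weq_trans h => //.
    exact/weq_sym/weq_norm.
  exact: weq_norm.
by rewrite HG; split=> -[r [e1 e2]]; exists r; lia.
Qed.

Lemma mon_weight_wt (m : 'X_{1..2}) : mon_weight G (wt2 i (m i) (m j)) m.
Proof.
move=> t Gt; rewrite /mchar /eval_weight /wt2.
by have [[-> ->]|[-> ->]] := ord2_cases ij; rewrite /= expr0z mulr1.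
Qed.

Lemma mon_weightE v (m : 'X_{1..2}) :
  mon_weight G v m <-> exists r : int, wA v = (m i)%:Z + r * P /\ wB v = (m j)%:Z - r * Q%:Z.
Proof.
have -> : mon_weight G v m <-> weq G v (wt2 i (m i) (m j)).
  have h := mon_weight_wt m.
  by split=> h' t Gt; [rewrite -h' // -h|rewrite h' // -h].
by rewrite weqE !wE.
Qed.

Lemma has_weight_mon v a b (r : int) : wA v = a%:Z + r * P -> wB v = b%:Z - r * Q%:Z ->
  has_weight G v (x ^+ a * y ^+ b).
Proof.
move=> e1 e2; rewrite -monX; apply/has_weightX/mon_weightE.
by exists r; rewrite mon_i mon_j.
Qed.

Lemma has_weight_x : has_weight G (wt2 i 1 0) x.
Proof. by rewrite -[x]mulr1; apply: (@has_weight_mon _ 1 0 0); rewrite wE; lia. Qed.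

Lemma has_weight_y : has_weight G (wt2 i 0 1) y.
Proof. by rewrite -[y]mul1r; apply: (@has_weight_mon _ 0 1 0); rewrite wE; lia. Qed.

Lemma has_weight_yn n : has_weight G (wt2 i 0 n%:Z) (y ^+ n).
Proof. by rewrite -[y ^+ n]mul1r; apply: (@has_weight_mon _ 0 n 0); rewrite wE; lia. Qed.

Lemma has_weight_xn n : has_weight G (wt2 i n%:Z 0) (x ^+ n).
Proof. by rewrite -[x ^+ n]mulr1; apply: (@has_weight_mon _ n 0 0); rewrite wE; lia. Qed.

Lemma wdeg_mon v (m : 'X_{1..2}) : mon_weight G v m -> wdeg v = (Q * m i + P * m j)%N.
Proof. by move=> /mon_weightE[r [e1 e2]]; rewrite /wdeg e1 e2; nia. Qed.

Lemma wdeg01 v (m : 'X_{1..2}) : mon_weight G v m ->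
  wdeg v = ((if i == 0%R then Q else P) * m 0%R + (if i == 0%R then P else Q) * m 1%R)%N.
Proof.
move/wdeg_mon; have [[-> ->]|[-> ->]] := ord2_cases ij => //= ->.
by rewrite addnC.
Qed.

Lemma weight0_const v p : wdeg v = 0 -> has_weight G v p -> exists c : R[i], p = c%:MP.
Proof.
move=> e /has_weightP h; exists p@_0%MM; apply/mpolyP => m; rewrite mcoeffC.
have [hm|hm] := boolP (m \in msupp p); last first.
  rewrite (memN_msupp_eq0 hm); case: eqVneq => [em|]; last by rewrite mulr0.
  by move: hm; rewrite -em => /memN_msupp_eq0 ->; rewrite mul0r.
have := wdeg_mon (h m hm); rewrite e => e'.
have -> : m = 0%MM by rewrite [m]monE; apply/mnmP => k; have [->|->] := ord2P k ij; rewrite ?mon_i ?mon_j !mnmE; nia.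
by rewrite eqxx mulr1.
Qed.

Definition zpt (a b : R[i]) : 'I_2 -> R[i] := fun k => if k == i then a else b.

Lemma zpt_mon a b (m : 'X_{1..2}) : ('X_[m] : S).@[zpt a b] = a ^+ m i * b ^+ m j.
Proof.
rewrite {1}[m]monE monX mevalM !rmorphXn /= !mevalXU /zpt eqxx.
by rewrite eq_sym (negPf ij).
Qed.

Lemma supp_mon z v : supp G z v -> exists m : 'X_{1..2}, mon_weight G v m /\ ('X_[m] : S).@[z] != 0.
Proof.
move=> [p [/has_weightP hp pz]]; apply: contrapT => no; case/eqP: pz.
rewrite [p]mpolyE raddf_sum big_seq big1 //= => m hm.
rewrite mevalZ; have [->|ne] := eqVneq ('X_[m] : S).@[z] 0; first by rewrite mulr0.
by case: no; exists m; split=> //; exact: hp.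
Qed.

Lemma mon_supp z v (m : 'X_{1..2}) : mon_weight G v m -> ('X_[m] : S).@[z] != 0 -> supp G z v.
Proof. by move=> h1 h2; exists 'X_[m]; split=> //; exact/has_weightX. Qed.

(** Off the coordinate axes no monomial vanishes, so the weight is supported as soon as it contains
    a monomial. *)
Lemma supp_gen (ze : R[i]) v : ze != 0 -> supp G (zpt ze 1) v <->
  exists r : int, 0 <= wA v - r * P /\ 0 <= wB v + r * Q.
Proof.
move=> ze0; split.
  by move/supp_mon => [m [/mon_weightE[r [e1 e2]] _]]; exists r; lia.
move=> [r [e1 e2]]; apply: (@mon_supp _ _ (mon (absz (wA v - r * P)%R) (absz (wB v + r * Q)%R))).
  by apply/mon_weightE; exists r; rewrite mon_i mon_j; lia.
by rewrite zpt_mon expr1n mulr1 expf_neq0.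
Qed.

(** On the axis x = 0 only pure powers of y survive. *)
Lemma supp_x v : supp G (zpt 0 1) v <-> exists r : int, wA v = r * P /\ 0 <= wB v + r * Q.
Proof.
split.
  move/supp_mon => [m [/mon_weightE[r [e1 e2]]]]; rewrite zpt_mon expr1n mulr1 expr0n.
  have [e _|_] := eqVneq (m i) 0%N; last by rewrite mulr0n eqxx.
  by exists r; lia.
move=> [r [e1 e2]]; apply: (@mon_supp _ _ (mon 0 (absz (wB v + r * Q)%R))).
  by apply/mon_weightE; exists r; rewrite mon_i mon_j; lia.
by rewrite zpt_mon mon_i mon_j expr0 mul1r expr1n oner_neq0.
Qed.

(** A form vanishing at z is a combination of monomials vanishing at z and of the binomials below,
    so divisibility needs checking on these only. *)
Lemma line_mono l z : l.@[z] = 0 ->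
  (forall m : 'X_{1..2}, ('X_[m] : S).@[z] = 0 -> gen1 l ('X_[m] : S)) ->
  (forall m m' : 'X_{1..2}, (exists r : int, Posz (m i) = (m' i)%:Z + r * P /\ Posz (m j) = (m' j)%:Z - r * Q%:Z) ->
     gen1 l (('X_[m'] : S).@[z] *: 'X_[m] - ('X_[m] : S).@[z] *: 'X_[m'] : S)) ->
  line G l z.
Proof.
move=> lz h0 h; split=> // v p /has_weightP hp pz.
have gD a b : gen1 l a -> gen1 l b -> gen1 l (a + b).
  by move=> [q ->] [q' ->]; exists (q + q'); rewrite mulrDr.
have gZ (c : R[i]) a : gen1 l a -> gen1 l (c *: a).
  by move=> [q ->]; exists (c *: q); rewrite scalerAr.
have g0 : gen1 l 0 by exists 0; rewrite mulr0.
have gs (F : 'X_{1..2} -> S) : (forall m, m \in msupp p -> gen1 l (F m)) -> gen1 l (\sum_(m <- msupp p) F m).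
  by move=> hF; rewrite big_seq; apply: (big_ind (gen1 l)).
have [[m0 [hm0 n0]]|no] := pselect (exists m0, m0 \in msupp p /\ ('X_[m0] : S).@[z] != 0); last first.
  rewrite [p]mpolyE; apply: gs => m hm; apply: gZ; apply: h0.
  by apply/eqP/negPn/negP => hz; apply: no; exists m.
(* Subtracting multiples of a monomial m0 with nonzero value costs nothing in total, because the
   coefficients of m0 add up to p (z) = 0. *)
have e : ('X_[m0] : S).@[z] *: p =
    \sum_(m <- msupp p) p@_m *: (('X_[m0] : S).@[z] *: 'X_[m] - ('X_[m] : S).@[z] *: 'X_[m0] : S).
  under eq_bigr do rewrite scalerBr !scalerA.
  rewrite big_split /= sumrN -scaler_suml.
  have -> : \sum_(m <- msupp p) p@_m * ('X_[m] : S).@[z] = p.@[z].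
    by rewrite {3}[p]mpolyE raddf_sum; apply: eq_bigr => m _; rewrite /= mevalZ.
  rewrite pz scale0r oppr0 addr0 {1}[p]mpolyE scaler_sumr.
  by apply: eq_bigr => m _; rewrite scalerA mulrC.
rewrite -[p]scale1r -(mulVf n0) -scalerA e; apply/gZ/gs => m hm; apply: gZ; apply: h.
have [r [a1 a2]] := (mon_weightE _ _).1 (hp m hm).
have [r' [b1 b2]] := (mon_weightE _ _).1 (hp m0 hm0).
by exists (r' - r); lia.
Qed.

Lemma line_x : line G x (zpt 0 1).
Proof.
apply: line_mono; first by rewrite mevalXU /zpt eqxx.
  move=> m; rewrite zpt_mon expr1n mulr1 => /eqP; rewrite expf_eq0 eqxx andbT => h.
  exists (x ^+ (m i).-1 * y ^+ (m j)); rewrite {1}[m]monE monX mulrA -exprS prednK //.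
move=> m m' [r [e1 e2]]; rewrite !zpt_mon !expr1n !mulr1 !expr0n.
have [h|h] := eqVneq (m i) 0%N; have [h'|h'] := eqVneq (m' i) 0%N.
- have r0 : r = 0 by nia.
  have -> : m = m' by rewrite [m]monE [m']monE; congr mon; lia.
  by exists 0; rewrite subrr mulr0.
- exists (- (x ^+ (m' i).-1 * y ^+ (m' j))).
  by rewrite scale0r sub0r scale1r {1}[m']monE monX mulrN mulrA -exprS prednK // lt0n.
- exists (x ^+ (m i).-1 * y ^+ (m j)).
  by rewrite scale0r subr0 scale1r {1}[m]monE monX mulrA -exprS prednK // lt0n.
- by exists 0; rewrite !scale0r subrr mulr0.
Qed.

(** Two monomials of equal weight differ by exchanging x^(nP) and y^(nQ), and the resulting
    binomials are multiples of (x^P)^n - (la y^Q)^n. *)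
Lemma line_lam (la ze : R[i]) : ze != 0 -> ze ^+ P = la ->
  line G (x ^+ P - la *: y ^+ Q) (zpt ze 1).
Proof.
move=> ze0 ela; have zx : x.@[zpt ze 1] = ze by rewrite mevalXU /zpt eqxx.
have zy : y.@[zpt ze 1] = 1 by rewrite mevalXU /zpt eq_sym (negPf ij).
apply: line_mono; first by rewrite mevalB mevalZ !rmorphXn /= zx zy ela expr1n mulr1 subrr.
  by move=> m; rewrite zpt_mon expr1n mulr1 => /eqP; rewrite expf_eq0 (negPf ze0) andbF.
have key a b (n : nat) : gen1 (x ^+ P - la *: y ^+ Q)
    (ze ^+ a *: (x ^+ (a + n * P) * y ^+ b) - ze ^+ (a + n * P) *: (x ^+ a * y ^+ (b + n * Q)) : S).
  have [q hq] : gen1 (x ^+ P - la *: y ^+ Q) ((x ^+ P) ^+ n - (la *: y ^+ Q) ^+ n).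
    by rewrite subrXX; eexists.
  exists (ze ^+ a *: (x ^+ a * y ^+ b) * q); rewrite mulrCA -hq.
  rewrite -scalerAl; rewrite [in ze ^+ (a + _)]exprD -scalerA -scalerBr; congr (_ *: _).
  rewrite mulrBr [in ze ^+ _]mulnC exprM ela exprZn -scalerAr -!exprM.
  congr (_ - _ *: _); first by rewrite exprD mulrAC [(n * P)%N]mulnC.
  by rewrite -mulrA -exprD [(n * Q)%N]mulnC.
move=> m m' [r [e1 e2]]; rewrite !zpt_mon !expr1n !mulr1.
have [r0|r0] := lerP 0 r.
  have a1 : m i = (m' i + absz r * P)%N by nia.
  have a2 : m' j = (m j + absz r * Q)%N by nia.
  by have := key (m' i) (m j) (absz r); rewrite -a1 -a2 -!monX -!monE.
have a1 : m' i = (m i + absz r * P)%N by nia.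
have a2 : m j = (m' j + absz r * Q)%N by nia.
have [q hq] := key (m i) (m' j) (absz r); exists (- q); rewrite mulrN -hq -a1 -a2 -!monX -!monE.
by rewrite opprB.
Qed.

Lemma modx v p : has_weight G v p -> gen1 x p \/
  exists (r : int) (e : nat) (c : R[i]) q, [/\ wA v = r * P, wB v + r * Q = e & p = c *: y ^+ e + x * q].
Proof.
move=> hp; have [lz hl] := line_x.
have [z0|z0] := eqVneq p.@[zpt 0 1] 0; first by left; exact: hl hp z0.
have [r [e1 e2]] := (supp_x v).1 (ex_intro _ p (conj hp z0)).
have [e he] : exists e : nat, wB v + r * Q = e by exists (absz (wB v + r * Q)%R); lia.
right; have hy : has_weight G v (y ^+ e).
  by rewrite -[y ^+ e]mul1r; apply: (@has_weight_mon v 0 e r); lia.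
have [||q hq] := hl v (p - p.@[zpt 0 1] *: y ^+ e).
- by apply: has_weightD => //; apply: has_weightN; exact: has_weightZ.
- by rewrite mevalB mevalZ rmorphXn /= mevalXU /zpt eq_sym (negPf ij) expr1n mulr1 subrr.
by exists r, e, p.@[zpt 0 1], q; split=> //; rewrite -hq addrC subrK.
Qed.

End Plane.

(** * Factorisations attached to a product *)

Lemma weight_eq (u v : weight) : u.1.1 = v.1.1 -> u.1.2 = v.1.2 -> u.2 = v.2 -> u = v.
Proof. by case: u v => -[a b] c [[a' b'] c'] /= -> -> ->. Qed.

Ltac wring := apply: weight_eq => /=; lia.

Section Mult.
Context {R : realType} (G : tpoint R -> Prop) (f : poly2 R).
Local Notation S := (poly2 R).
Hypothesis Gsub : subgroup G.
Hypothesis f0 : f != 0.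
Implicit Types (m n k : int).
Opaque hom_d.

Definition dmx (a b : S) : 'M[S]_(1 + 1) := block_mx a%:M 0 0 b%:M.

Lemma dmxE a b : dmx a b = row_mx (col_mx a%:M 0) (col_mx 0 b%:M).
Proof. by rewrite /dmx block_mxEh. Qed.

Lemma dmxM a b c d : dmx a b *m dmx c d = dmx (a * c) (b * d).
Proof. by rewrite mulmx_block !mulmx0 !mul0mx !addr0 !add0r -!scalar_mxM. Qed.

Lemma dmxB a b c d : dmx a b - dmx c d = dmx (a - c) (b - d).
Proof. by rewrite opp_block_mx add_block_mx !oppr0 !addr0 -!raddfB. Qed.

Context (g1 h1 g2 h2 e : S) (ga1 ga2 u1 u2 : weight).
Hypotheses (hg1 : has_weight G ga1 g1) (hh1 : has_weight G (chi - ga1) h1) (fgh1 : f = g1 * h1).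
Hypotheses (hg2 : has_weight G ga2 g2) (hh2 : has_weight G (chi - ga2) h2) (fgh2 : f = g2 * h2).
Hypotheses (eg : g1 = g2 * e) (eh : h2 = e * h1).
Local Notation B1 := (rank1 u1 hg1 hh1 fgh1).
Local Notation B2 := (rank1 u2 hg2 hh2 fgh2).

Let g10 : g1 != 0. Proof. by apply: contraNneq f0 => h; rewrite fgh1 h mul0r. Qed.
Let g20 : g2 != 0. Proof. by apply: contraNneq g10 => h; rewrite eg h mul0r. Qed.
Let e0 : e != 0. Proof. by apply: contraNneq g10 => h; rewrite eg h mulr0. Qed.

Let he : has_weight G (ga1 - ga2) e.
Proof. exact: (homog_quot Gsub g20 hg2 hg1 eg). Qed.

(** This diagonal matrix represents multiplication by c from S/(g1) to S/(g2), which is well defined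
    as g2 divides g1. *)
Lemma mult_deg c : has_weight G (u1 - u2) c -> hom_deg G 0 B1 B2 (dmx c (c * e)).
Proof.
move=> hc; apply: hom_deg_block; try exact: hom_deg0.
  by apply: (hom_deg_pt (k := 0)) => //; rewrite mulr0z addr0.
apply/hom_deg_shift_l/hom_deg_shift_r; apply: (hom_deg_pt (k := 0)) => //.
have -> : u1 + ga1 - (u2 + ga2) + chi *~ 0 = (u1 - u2) + (ga1 - ga2) by rewrite mulr0z; wring.
exact: (has_weightM Gsub).
Qed.

Lemma mult_blocks (C : comNzRingType) (c a b a1 b1 x : C) : a1 = a * x -> b = x * b1 ->
  mx_pair a b *m block_mx c%:M 0 0 (c * x)%:M - 1 *: (block_mx c%:M 0 0 (c * x)%:M *m mx_pair a1 b1) = 0.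
Proof.
move=> -> ->; rewrite scale1r !mulmx_block !mulmx0 !mul0mx !addr0 !add0r -!scalar_mxM.
rewrite opp_block_mx add_block_mx !subrr mulrCA subrr [x * b1 * c]mulrAC [x * c]mulrC subrr.
by rewrite block_mx0.
Qed.

Lemma mult_closed c : has_weight G (u1 - u2) c -> closed_hom 0 (X := B1) (Y := B2) (dmx c (c * e)).
Proof.
move=> hc; split; first exact: mult_deg.
by rewrite hom_dE sgn0; exact: (mult_blocks c eg eh).
Qed.

(** The odd component determines the class, and closedness makes it divisible by e; hence all maps
    of degree 0 are multiplications. By the next two lemmas such a map is exact precisely when c
    lies in (g2, h1). *)
Lemma mult_of (phi : 'M[S]_(rk B2, rk B1)) : closed_hom 0 (X := B1) (Y := B2) phi ->
  exists c, has_weight G (u1 - u2) c /\ exact_hom 0 (X := B1) (Y := B2) (phi - dmx c (c * e)).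
Proof.
rewrite -[phi]hsubmxK; move: (lsubmx phi) (rsubmx phi) => w v hphi; have [hd _] := hphi.
have [_ hv] := (rank1_deg _ _ _ _ _ _ _).1 hd.
have hcl := rank1_closed hphi; rewrite -[v]vsubmxK in hphi hd hv hcl *.
move: (usubmx v) (dsubmx v) hphi hd hv hcl => v0 v1 hphi hd hv hcl.
have [h0 h1'] := (rank1_vec f0 u2 hg2 hh2 fgh2 _ _ _ _).1 hv.
have v00 : v0 = 0 by rewrite [v0]mx11_scalar; case: h0 => [->|[k [ek _]]]; [rewrite raddf0|lia].
have [c ec] : exists c, v1 = (c * e)%:M.
  have : gen1 (g2 * e) (g2 * v1 0 0).
    exists (w (lshift 1 0) 0); rewrite -eg.
    move/eqP: hcl; rewrite sgn0 scale1r subr_eq0 rank1_dcol => /eqP/(congr1 (fun M : 'cV_(1 + 1) => M (lshift 1 0) 0)).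
    by rewrite col_mxEu mxE [RHS]mxE.
  case=> c ec; exists c; rewrite [v1]mx11_scalar; congr scalar_mx.
  by apply: (mulfI g20); rewrite ec; ring.
have hc : has_weight G (u1 - u2) c.
  case: h1' => [z0|[k [ek hk]]].
    have : c * e = 0 by move: z0; rewrite ec mxE eqxx mulr1n.
    by move/eqP; rewrite mulf_eq0 (negPf e0) orbF => /eqP ->; exact: has_weight0.
  have k0 : k = 0 by lia.
  move: hk; rewrite k0 mulr0z addr0 ec mxE eqxx mulr1n => hk.
  have := homog_quot Gsub e0 he hk (mulrC _ _).
  have -> : u1 + ga1 - (u2 + ga2) - (ga1 - ga2) = u1 - u2 by wring.
  by [].
exists c; split=> //.
have := closedB hphi (mult_closed hc).
rewrite dmxE opp_row_mx add_row_mx => hp.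
apply: (rank1_exact Gsub f0 (p := 0) (q := 0) hp).
by rewrite mulmx0 scaler0 addr0 v00 ec opp_col_mx add_col_mx oppr0 addr0 subrr col_mx0.
Qed.

Lemma mult_exact c : has_weight G (u1 - u2) c -> gen2 g2 h1 c ->
  exact_hom 0 (X := B1) (Y := B2) (dmx c (c * e)).
Proof.
move=> hc [a [b ec]]; have := mult_closed hc; rewrite dmxE => hp.
apply: (rank1_exact Gsub f0 (Y := B2) (p := col_mx b%:M 0) (q := col_mx 0 a%:M) hp).
rewrite rank1_dcol scale_col_mx add_col_mx !scaler0 !addr0 !scale_scalar_mx -raddfD /=.
by congr col_mx; congr scalar_mx; rewrite ec eg eh; ring.
Qed.

Lemma mult_exact_inv c : exact_hom 0 (X := B1) (Y := B2) (dmx c (c * e)) -> gen2 g2 h1 c.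
Proof.
case=> psi _; rewrite -[psi]hsubmxK dmxE rank1_dE => /eq_row_mx[_].
rewrite -[rsubmx psi]vsubmxK -[lsubmx psi]vsubmxK rank1_dcol !scale_col_mx opp_col_mx add_col_mx.
move: (usubmx (rsubmx psi)) (dsubmx (lsubmx psi)) => b a.
move=> /eq_col_mx[_ /(congr1 (fun M : 'cV_1 => M 0 0))]; rewrite !mxE eqxx mulr1n => E.
exists (- (sgn (0 - 1) * a 0 0)), (b 0 0); apply: (mulIf e0).
by rewrite E eg eh; ring.
Qed.

End Mult.

(** * The rank-one factorisations of an ordered product *)

Section Chain.
Context {R : realType} (G : tpoint R -> Prop) (f : poly2 R).
Local Notation S := (poly2 R).
Hypothesis Gsub : subgroup G.
Hypothesis f0 : f != 0.
Implicit Types (X Y : mf G f) (n : int) (u v w : weight).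
Context (r : nat) (l : nat -> S) (z : nat -> 'I_2 -> R[i]) (dl : nat -> weight).
Hypothesis hw : forall k, has_weight G (dl k) (l k).
Hypothesis l1 : forall k, (r <= k)%N -> l k = 1.
Hypothesis d0 : forall k, (r <= k)%N -> dl k = 0.
Hypothesis hline : forall k, (k.+1 < r)%N -> line G (l k) (z k).
Hypothesis hsep : forall s t, (s.+1 < r)%N -> (s < t)%N -> (t < r)%N -> (l t).@[z s] != 0.
Hypothesis ff : f = \prod_(0 <= k < r) l k.
Hypothesis fw : weq G (\sum_(0 <= k < r) dl k) chi.

(** For k < r only factors before the last divide this product, so [hline] and [hsep] stop there;
    the last factor may for instance be y. *)
Definition gk k : S := \prod_(0 <= s < k) l s.
Definition hk k : S := \prod_(k <= s < r) l s.
Definition gd k : weight := \sum_(0 <= s < k) dl s.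

Lemma has_weight_prod a b : has_weight G (\sum_(a <= s < b) dl s) (\prod_(a <= s < b) l s).
Proof.
rewrite unlock; elim: (index_iota a b) => [|s t IH] /=; first exact: has_weight1.
exact: (has_weightM Gsub).
Qed.

Lemma gk_weight k : has_weight G (gd k) (gk k).
Proof. exact: has_weight_prod. Qed.

Lemma gd_split a b : (a <= b)%N -> gd b = gd a + \sum_(a <= s < b) dl s.
Proof. by move=> ab; rewrite /gd (big_cat_nat (n := a)). Qed.

Lemma gk_split a b : (a <= b)%N -> gk b = gk a * \prod_(a <= s < b) l s.
Proof. by move=> ab; rewrite /gk (big_cat_nat (n := a)). Qed.

Lemma hk_split a b : (a <= b)%N -> (b <= r)%N -> hk a = \prod_(a <= s < b) l s * hk b.
Proof. by move=> ab br; rewrite /hk (big_cat_nat (n := b)). Qed.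

Lemma gd_top k : (r <= k)%N -> gd k = gd r.
Proof.
move=> rk; rewrite (gd_split rk) big_nat_cond big1 ?addr0 // => s.
by rewrite andbT => /andP[h _]; exact: d0.
Qed.

Lemma hk_weight k : has_weight G (chi - gd k) (hk k).
Proof.
apply: (weq_weight (w := \sum_(k <= s < r) dl s)); last exact: has_weight_prod.
have [kr|rk] := leqP k r.
  have -> : \sum_(k <= s < r) dl s = gd r - gd k by rewrite (gd_split kr) addrC addKr.
  exact: weqD.
rewrite big_geq ?(ltnW rk) // gd_top ?(ltnW rk) //.
exact: (weq_sym ((weq_sub0 Gsub _ _).1 (weq_sym fw))).
Qed.

Lemma fgh k : f = gk k * hk k.
Proof.
have [kr|rk] := leqP k r; first by rewrite ff (big_cat_nat (n := k)).
have e : \prod_(r <= s < k) l s = 1.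
  by rewrite big_nat_cond big1 // => s; rewrite andbT => /andP[h _]; exact: l1.
by rewrite /hk big_geq ?(ltnW rk) // mulr1 (gk_split (ltnW rk)) e mulr1.
Qed.

Definition B k u : mf G f := rank1 u (gk_weight k) (hk_weight k) (fgh k).

Lemma l_neq0 k : l k != 0.
Proof.
have [kr|rk] := ltnP k r; last by rewrite l1 // oner_neq0.
by apply: contraNneq f0 => e; rewrite ff (bigD1_seq k) ?iota_uniq ?mem_index_iota //= e mul0r.
Qed.

Lemma hk_neq0 s b : (s.+1 < r)%N -> (s < b)%N -> (hk b).@[z s] != 0.
Proof.
move=> sr sb; rewrite /hk rmorph_prod /= prodf_seq_neq0; apply/allP => t.
by rewrite mem_index_iota /= => /andP[h1 h2]; apply: hsep => //; exact: leq_trans h1.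
Qed.

Lemma chain_cop a b : (a <= b)%N -> (a < r)%N -> cop (gk a) (hk b).
Proof.
elim: a => [|a IH] ab ar; first by rewrite /gk big_geq //; exact: cop1.
rewrite /gk big_nat_recr //= mulrC; apply: copM; first exact: l_neq0.
  exact: (cop_line Gsub (hline ar) (hw a) (hk_weight b) (hk_neq0 ar ab)).
by apply: IH; exact: ltnW.
Qed.

(** [peel] applied to the factors l_0, ..., l_(a-1) in turn; before the s-th one the weight has
    dropped by that of l_0 ... l_(s-1). *)
Lemma chain_span w a b : (a <= b)%N -> (a < r)%N ->
  (forall s, (s < a)%N -> supp G (z s) (w - gd s) -> supp G (z s) (w - gd s - (chi - gd b))) ->
  spanned G w (gk a) (hk b).
Proof.
move=> ab ar H.
suff h k : (k <= a)%N -> spanned G (w - gd (a - k)) (\prod_((a - k)%N <= s < a) l s) (hk b).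
  by have := h a (leqnn a); rewrite subnn (_ : gd 0 = 0) ?subr0 // /gd big_geq.
elim: k => [|k IH] ka; first by rewrite subn0 big_geq //; exact: spanned1.
have e : (a - k)%N = (a - k.+1).+1 by lia.
have lt : (a - k.+1 < a)%N by lia.
rewrite big_ltn // -e; apply: (peel Gsub (l_neq0 _) _ (hw _) (hk_weight b)).
- by apply: hline; lia.
- by apply: hk_neq0; lia.
- exact: H.
have -> : w - gd (a - k.+1) - dl (a - k.+1) = w - gd (a - k).
  by rewrite e /gd [X in _ = w - X]big_nat_recr //= opprD addrA.
by apply: IH; lia.
Qed.

(** Odd Hom vanishes by coprimality alone. Even Hom is a graded piece of S modulo g at the smaller
    and h at the larger index; for a < b the weight is lowered by that of l_a ... l_(b-1). *)
Lemma chain_hom a b u u' n : (a < r)%N -> (b < r)%N ->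
  (forall k s, n = k * 2 -> (s < minn a b)%N ->
     let w := u - u' + chi *~ k - (if (a < b)%N then gd b - gd a else 0) - gd s in
     supp G (z s) w -> supp G (z s) (w - (chi - gd (maxn a b)))) ->
  hom_coh0 n (B a u) (B b u').
Proof.
move=> ar br H.
have gne k : gk k != 0 by apply: contraNneq f0 => e; rewrite (fgh k) e mul0r.
have [ba|ab] := leqP b a.
  have eg := gk_split ba; have eh := hk_split ba (ltnW ar).
  set e := \prod_(b <= s < a) l s in eg eh.
  have he : has_weight G (gd a - gd b) e by exact: (homog_quot Gsub (gne b) (gk_weight b) (gk_weight a) eg).
  have e0 : e != 0 by apply: contraNneq (gne a) => h; rewrite eg h mulr0.
  apply: rank1_hom0 => // k c ek hc.
    rewrite eg eh => -[q eq]; have [|d ->] := chain_cop ba br (c := c).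
      by exists q; apply: (mulfI e0); rewrite mulrA eq mulrA [e * _]mulrC.
    by exists d, 0; rewrite mulr0 addr0.
  rewrite eg => -[q eq].
  have ec : c = e * q by apply: (mulfI (gne b)); rewrite eq mulrA.
  have hq := homog_quot Gsub e0 he hc ec.
  have ew : u + gd a - (u' + gd b) + chi *~ k - (gd a - gd b) = u - u' + chi *~ k - (0 : weight).
    by rewrite subr0; move: (gd a) (gd b) (chi *~ k) => x y t; wring.
  rewrite ew in hq; have [|x [y eqq]] := @chain_span (u - u' + chi *~ k - 0) b a ba br _ q hq.
    move=> s sb; have := H k s ek; rewrite (minn_idPr ba) (maxn_idPl ba) (ltnNge a b) ba /= => /(_ sb); apply.
  by exists y, x; rewrite ec eqq eh; ring.
have eg := gk_split (ltnW ab); have eh := hk_split (ltnW ab) (ltnW br).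
set e := \prod_(a <= s < b) l s in eg eh.
apply: rank1_hom0 => // k c ek hc.
  move=> /(chain_cop (ltnW ab) ar)[d ->].
  by exists 0, d; rewrite mulr0 add0r.
move=> _; have ew : u + gd a - (u' + gd b) + chi *~ k = u - u' + chi *~ k - (gd b - gd a).
  by move: (gd a) (gd b) (chi *~ k) => x y t; wring.
rewrite ew in hc; have [|x [y ec]] := @chain_span (u - u' + chi *~ k - (gd b - gd a)) a b (ltnW ab) ar _ c hc.
  move=> s sa; have := H k s ek; rewrite (minn_idPl (ltnW ab)) (maxn_idPr (ltnW ab)) ab /= => /(_ sa); apply.
by exists y, x; rewrite ec addrC.
Qed.

Lemma chain_acyclic k u Y : (forall n, hom_coh0 n (B k u) Y) -> acyclic_mod (gen1 (gk k)) (u + gd k) Y.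
Proof. exact: rank1_acyclic. Qed.

Lemma chain_bounded (deg : weight -> int) (D : int) k u : (k < r)%N ->
  (forall v w, deg (v + w) = deg v + deg w) -> 0 < deg chi ->
  (forall s w, (s < k)%N -> D <= deg w -> supp G (z s) w -> supp G (z s) (w - (chi - gd k))) ->
  bounded_from (B k u).
Proof.
move=> kr degD degchi H.
(* Absorbs the weights [gd s] subtracted in [chain_span], so that the degree stays above D at every
   factor. *)
pose M := \sum_(0 <= s < k) absz (deg (gd s))%R.
apply: (rank1_bounded Gsub f0 _ _ _ _ (deg := deg) (D := `|D|%N%:Z + M%:Z) degD degchi).
  exact: chain_cop.
move=> w hwD; apply: chain_span => // s sk hs; apply: H => //.
have := degN degD (gd s); rewrite degD => ->.
have : (absz (deg (gd s))%R <= M)%N by rewrite /M (bigD1_seq s) ?iota_uniq ?mem_index_iota //= leq_addr.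
lia.
Qed.

(** The sequence of multiplication by l_k from S/(g_k) to S/(g_(k+1)), with cokernel S/(l_k). *)
Lemma chain_factor k w Y : (k < r)%N -> acyclic_mod (gen1 (gk k)) (w - dl k) Y ->
  acyclic_mod (gen1 (gk k.+1)) w Y -> acyclic_mod (gen1 (l k)) w Y.
Proof.
move=> kr h1 h2; have e : gk k.+1 = gk k * l k by rewrite /gk big_nat_recr.
apply: (@acyclic_sum _ _ _ Gsub (gen1 (l k)) (gen1 (gk k.+1)) (gen1 (gk k)) (l k) (dl k)) => //.
- exact: gen1_hideal (hw k).
- exact: gen1_hideal (gk_weight k.+1).
- exact: gen1_hideal (gk_weight k).
- by exists (hk k.+1); exact: fgh.
- by move=> _ [q ->]; exists (gk k * q); rewrite e; ring.
- by exists 1; rewrite mulr1.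
- by move=> _ [q ->]; exists 0, q; split; [exists 0; rewrite mulr0|rewrite add0r].
- move=> p; rewrite e; split=> [[q ->]|[q eq]]; exists q; first by ring.
  by apply: (mulfI (l_neq0 k)); rewrite eq; ring.
Qed.

End Chain.

Section Lists.
Context {R : realType} (G : tpoint R -> Prop) (f : poly2 R).
Local Notation S := (poly2 R).
Hypothesis Gsub : subgroup G.

(** The exceptional order is obtained by sorting the labels by an injective numerical key. *)
Lemma tilting_of_list (D : eqType) (d0 : D) (s : seq D) (E : D -> mf G f) (key : D -> nat) :
  uniq [seq key d | d <- s] ->
  (forall d, d \in s -> exceptional (E d)) ->
  (forall d e, d \in s -> e \in s -> (key d < key e)%N -> forall m, hom_coh0 m (E e) (E d)) ->
  (forall d e m, d \in s -> e \in s -> m != 0 -> hom_coh0 m (E d) (E e)) ->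
  (forall d, d \in s -> finite_from (E d)) ->
  (forall Y, (forall d, d \in s -> forall m, hom_coh0 m (E d) Y) -> contractible Y) ->
  has_tilting_of_length G f (size s).
Proof.
move=> us exc ord strong fin det.
pose le d e := (key d <= key e)%N; pose s' := sort le s.
have ss : size s' = size s by rewrite size_sort.
have ms d : (d \in s') = (d \in s) by rewrite mem_sort.
have srt : sorted ltn [seq key d | d <- s'].
  rewrite ltn_sorted_uniq_leq; apply/andP; split.
    by rewrite (perm_uniq (perm_map key (permEl (perm_sort le s)))).
  by rewrite sorted_map; apply: sort_sorted => d e; exact: leq_total.
exists (fun i => E (nth d0 s' i)).
have mi (i : 'I_(size s)) : nth d0 s' i \in s by rewrite -ms mem_nth // ss.
apply: (exceptional_criterion Gsub) => [i|i j ij m|i j m m0|i|Y hY].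
- exact: exc.
- apply: ord => //; have := sorted_ltn_nth ltn_trans 0%N srt.
  move/(_ i j); rewrite !inE !size_map ss => /(_ (ltn_ord _) (ltn_ord _) ij).
  by rewrite !(nth_map d0) ?ss.
- exact: strong.
- exact: fin.
apply: det => d; rewrite -ms => hd m.
have hi : (index d s' < size s)%N by rewrite -ss index_mem.
by have := hY (Ordinal hi) m; rewrite /= nth_index.
Qed.

End Lists.

(** * Moving exactness between weights and between ideals in x and y *)

Section PlaneAcyclic.
Context {R : realType} (G : tpoint R -> Prop) (f : poly2 R).
Local Notation S := (poly2 R).
Hypothesis Gsub : subgroup G.
Context (i j : 'I_2) (P Q : nat) (c1 c2 : int).
Hypothesis ij : i != j.
Hypotheses (P0 : (0 < P)%N) (Q0 : (0 < Q)%N).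
Hypothesis Hchi : weq G chi (wt2 i c1 c2).
Hypothesis HG : forall a b : int, weq G (wt2 i a b) 0 <-> exists r : int, a = r * P /\ b = - (r * Q%:Z).
Implicit Types (Y : mf G f) (u v w : weight).
Local Notation x := ('X_i : S).
Local Notation y := ('X_j : S).
Local Notation wA := (wc1 i c1).
Local Notation wB := (wc2 i c2).

Lemma acyclic_move I a b w Y : acyclic_mod I (wt2 i a b) Y ->
  (exists k r : int, wA w = a + k * c1 + r * P /\ wB w = b + k * c2 - r * Q%:Z) ->
  acyclic_mod I w Y.
Proof.
move=> h [k [r [e1 e2]]]; apply: (acyclic_weq Gsub _ (acyclic_chiZ (k := k) h)).
apply: weq_sym; apply/(weqE Gsub ij P0 Q0 Hchi HG); exists r.
by rewrite !wcE e1 e2; lia.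
Qed.

Lemma gen2_swap_ext (a a' b : S) : (exists q, a = a' + b * q) -> forall p, gen2 a b p <-> gen2 a' b p.
Proof.
move=> [q ->] p; split=> -[s [t ->]]; first by exists s, (q * s + t); ring.
by exists s, (t - q * s); ring.
Qed.

Lemma X_neq0 (k : 'I_2) : ('X_k : S) != 0.
Proof.
apply/eqP => /(congr1 (fun p : S => p@_U_(k)%MM)) /eqP.
by rewrite mcoeffX eqxx mcoeff0 oner_eq0.
Qed.

Lemma vanish0_gen2 (p : S) : gen2 x y p <-> vanish0 p.
Proof.
have vx k : vanish0 ('X_k : S).
  rewrite /vanish0 mcoeffX; case: eqP => // /(congr1 (fun m : 'X_{1..2} => m k)).
  by rewrite !mnmE eqxx.
have hI := vanish0_hideal G.
split=> [[a [b ->]]|hp].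
  by apply: (hidealD hI); rewrite mulrC; exact: (hidealM hI).
have hJ := gen2_hideal Gsub (has_weight_x Gsub ij P0 Q0 Hchi HG) (has_weight_y Gsub ij P0 Q0 Hchi HG).
rewrite [p]mpolyE big_seq; apply: (big_ind (gen2 x y)); [exact: (hideal0 hJ)|exact: (hidealD hJ)|].
move=> m hm; rewrite -mul_mpolyC; apply: (hidealM hJ).
have m0 : m != 0%MM by apply/eqP => e; move: hm; rewrite e mcoeff_msupp hp eqxx.
rewrite (monE ij m) monX; case: (posnP (m i)) => [ei|mi].
  case: (posnP (m j)) => [ej|mj].
    by case/eqP: m0; apply/mnmP => k; have [->|->] := ord2P k ij; rewrite mnmE.
  exists 0, (x ^+ m i * y ^+ (m j).-1); rewrite mulr0 add0r mulrCA -exprS prednK //.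
exists (x ^+ (m i).-1 * y ^+ m j), 0; rewrite mulr0 addr0 mulrA -exprS prednK //.
Qed.

Lemma plane_contractible Y : vanish0 f -> 0 < wdeg i c1 c2 P Q chi ->
  (forall w, acyclic_mod (gen2 x y) w Y) -> contractible Y.
Proof.
move=> vf hchi h.
apply: (contractible_of_acyclic Gsub (wdegD i c1 c2 P Q) (dA := if i == 0 then Q else P) (dB := if i == 0 then P else Q)) => //.
- by case: ifP.
- by case: ifP.
- by move=> u m; exact: (wdeg01 Gsub ij P0 Q0 Hchi HG).
by move=> w; apply: acyclic_ext (h w); exact: vanish0_gen2.
Qed.

Lemma plane_finite (E : mf G f) : 0 < wdeg i c1 c2 P Q chi -> bounded_from E -> finite_from E.
Proof.
move=> hchi; apply: (bounded_finite (wdegD i c1 c2 P Q) (dA := if i == 0 then Q else P) (dB := if i == 0 then P else Q)) => //.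
- by case: ifP.
- by case: ifP.
- by move=> u m; exact: (wdeg01 Gsub ij P0 Q0 Hchi HG).
Qed.

(* The filtration of S/(l, s) by S/(l), for s prime to l. *)
Lemma acyclic_cut l s de si w Y : has_weight G de l -> has_weight G si s -> cop l s -> gen1 l f ->
  acyclic_mod (gen1 l) (w - si) Y -> acyclic_mod (gen1 l) w Y -> acyclic_mod (gen2 l s) w Y.
Proof.
move=> hl hs cls lf h1 h2.
apply: (@acyclic_sum _ _ _ Gsub (gen2 l s) (gen1 l) (gen1 l) s si) => //.
- exact: gen2_hideal hl hs.
- exact: gen1_hideal hl.
- exact: gen1_hideal hl.
- by move=> _ [q ->]; exists q, 0; rewrite mulr0 addr0.
- by exists 0, 1; rewrite mulr0 mulr1 add0r.
- by move=> _ [q [t ->]]; exists (l * q), t; split; first by exists q.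
- by move=> p; split=> [[q ->]|]; [exists (s * q); ring|exact: cls].
Qed.

(** With a = s b' and s regular modulo b, the colon ideal of (a, b) by s is (b', b); this feeds the
    two-out-of-three lemmas. *)
Lemma colon_step a b b' s : cop b s -> b' != 0 -> s != 0 -> a = s * b' ->
  (forall r, gen2 b' b r <-> gen2 a b (s * r)) * (forall p, gen2 s b p -> exists c r : S, gen2 a b c /\ p = c + s * r).
Proof.
move=> cbs _ s0 ea; split=> [r|p [q [t ->]]]; last first.
  by exists (b * t), q; split; [exists 0, t; ring|ring].
split=> [[q [t ->]]|[q [t e]]]; first by exists q, (s * t); rewrite ea; ring.
have [|u eu] := cbs (r - b' * q).
  by exists t; rewrite mulrBr e ea; ring.
by exists q, u; rewrite -eu addrC subrK.
Qed.

(** The axis y = 0 is treated as the axis x = 0 with the roles of the variables exchanged. *)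
Lemma cop_yx n : cop y (x ^+ n).
Proof.
have sw a b : wt2 j a b = wt2 i b a.
  by rewrite /wt2; have [[-> ->]|[-> ->]] := ord2_cases ij.
have ji : j != i by rewrite eq_sym.
have Hchi' : weq G chi (wt2 j c2 c1) by rewrite sw.
have HG' a b : weq G (wt2 j a b) 0 <-> exists r : int, a = r * Q /\ b = - (r * P%:Z).
  by rewrite sw HG; split=> -[r [e1 e2]]; exists (- r); lia.
apply: (cop_line Gsub (line_x Gsub ji Q0 P0 Hchi' HG') (has_weight_y Gsub ij P0 Q0 Hchi HG) (has_weight_xn Gsub ij P0 Q0 Hchi HG n)).
have -> : ('X_i ^+ n : S).@[zpt j 0 1] = 1; last exact: oner_neq0.
by rewrite rmorphXn /= mevalXU /zpt ifN // expr1n.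
Qed.

Lemma cop_xy n : cop x (y ^+ n).
Proof.
apply: (cop_line Gsub (line_x Gsub ij P0 Q0 Hchi HG) (has_weight_x Gsub ij P0 Q0 Hchi HG) (has_weight_yn Gsub ij P0 Q0 Hchi HG n)).
have -> : ('X_j ^+ n : S).@[zpt i 0 1] = 1; last exact: oner_neq0.
by rewrite rmorphXn /= mevalXU /zpt ifN 1?eq_sym // expr1n.
Qed.

End PlaneAcyclic.

(** * Products with a factor of weight x *)

Section ModeA.
Context {R : realType} (G : tpoint R -> Prop) (f : poly2 R).
Local Notation S := (poly2 R).
Hypothesis Gsub : subgroup G.
Hypothesis f0 : f != 0.
Context (i j : 'I_2) (P Q M : nat).
Hypothesis ij : i != j.
Hypotheses (P0 : (0 < P)%N) (Q0 : (0 < Q)%N) (M0 : (0 < M)%N).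
Hypothesis Hchi : weq G chi (wt2 i 1 M).
Hypothesis HG : forall a b : int, weq G (wt2 i a b) 0 <-> exists r : int, a = r * P /\ b = - (r * Q%:Z).
Implicit Types (Y : mf G f) (u v w : weight).
Local Notation x := ('X_i : S).
Local Notation y := ('X_j : S).
Local Notation wA := (wc1 i 1).
Local Notation wB := (wc2 i M).

Context (r : nat) (l : nat -> S) (z : nat -> 'I_2 -> R[i]) (dl : nat -> weight).
Hypothesis r2 : (1 < r)%N.
Hypothesis hw : forall k, has_weight G (dl k) (l k).
Hypothesis l1 : forall k, (r <= k)%N -> l k = 1.
Hypothesis d0 : forall k, (r <= k)%N -> dl k = 0.
Hypothesis hline : forall k, (k.+1 < r)%N -> line G (l k) (z k).
Hypothesis hsep : forall s t, (s.+1 < r)%N -> (s < t)%N -> (t < r)%N -> (l t).@[z s] != 0.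
Hypothesis ff : f = \prod_(0 <= k < r) l k.
Hypothesis fw : weq G (\sum_(0 <= k < r) dl k) chi.
Hypothesis dl0 : dl 0 = wt2 i 1 0.
Hypothesis dlk : forall k, (0 < k)%N -> (k.+1 < r)%N -> dl k = wt2 i 0 Q.
Hypothesis supp_0 : forall v, supp G (z 0) v <-> exists r : int, wA v = r * P /\ 0 <= wB v + r * Q.
Hypothesis supp_k : forall k, (0 < k)%N -> (k.+1 < r)%N -> forall v,
  supp G (z k) v <-> exists r : int, 0 <= wA v - r * P /\ 0 <= wB v + r * Q.
Hypothesis vl : forall k, (k < r)%N -> vanish0 (l k).
Hypothesis l0y : forall p, gen2 (l 0) y p <-> gen2 x y p.
Hypothesis lky : forall k, (0 < k)%N -> (k.+1 < r)%N -> exists q, l k = x ^+ P + y * q.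
Hypothesis ycop : forall k, (k.+1 < r)%N -> cop (l k) y.
Hypothesis last_factor :
  [/\ dl r.-1 = wt2 i 0 Q, exists q, l r.-1 = x ^+ P + y * q, cop (l r.-1) y & M = ((r - 1) * Q)%N]
  \/ [/\ dl r.-1 = wt2 i 0 1, l r.-1 = y & M = ((r - 2) * Q + 1)%N].

Local Notation gD := (gd dl).
Local Notation BB := (B Gsub hw l1 d0 ff fw).
(** This is K - M for the number K = PM + Q of weights modulo chi. It is the largest difference of
    twists that [modeA_arith0] tolerates, and just enough for [all_acyclic]. *)
Definition topA : nat := ((P - 1) * M + Q)%N.
Local Notation T := topA.

Lemma gdE k : (0 < k)%N -> (k < r)%N -> gD k = wt2 i 1 ((k - 1) * Q)%N.
Proof.
case: k => // k _; elim: k => [|k IH] kr; first by rewrite /gd big_nat1 dl0.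
rewrite /gd big_nat_recr //= -/(gD k.+1) IH ?dlk //; last exact: ltnW.
by rewrite wt2D; congr wt2; lia.
Qed.

Definition inA (d : nat * nat) : bool :=
  [&& (0 < d.1)%N, (d.1 < r)%N & (d.2 <= if d.1 == 1%N then T else Q)%N].

Lemma QT : (Q <= T)%N. Proof. exact: leq_addl. Qed.

(** At the point of l_0 the x-weight forces k = rho P, and k M + rho Q = rho K is a multiple of the
    full period. Twists within K - M then leave only rho >= 1, where a whole K is available. *)
Lemma modeA_arith0 (t t' k d mu rho K : int) :
  - (K - M%:Z) <= t' - t -> t' - t <= K - M%:Z -> 0 <= d -> d <= mu -> 0 < K -> k = rho * P ->
  K = (P * M)%:Z + Q -> k != 0 \/ t' - t < 0 \/ (t' - t = 0 /\ 0 < d) ->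
  0 <= t' - t + k * M - d + rho * Q -> 0 <= t' - t + k * M - d - (M%:Z - mu) + rho * Q.
Proof.
move=> h1 h2 d0' dm K0 ek eK hn.
have e : k * M + rho * Q = rho * K by rewrite ek eK; lia.
have [/eqP r0|[r1|r1]] : rho == 0 \/ 1 <= rho \/ rho <= -1 by lia.
- move: e hn; rewrite ek r0; lia.
- have : K <= rho * K by nia.
  lia.
have : rho * K <= - K by nia.
lia.
Qed.

(** At the other points k <= 0 would force rho <= -1, and the loss of Q outweighs the difference of
    twists. So k >= 1, and the monomial with rho = 0 supports the new weight. *)
Lemma modeA_arith1 (t t' k d mu s rho : int) :
  - Q%:Z <= t' - t -> t' - t <= Q -> 0 <= d -> 0 <= s -> d + s + Q%:Z <= mu ->
  k != 0 \/ t' - t < 0 \/ (t' - t = 0 /\ 0 < d) ->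
  0 <= k - 1 - rho * P -> 0 <= t' - t + k * M - d - s + rho * Q ->
  0 <= k - 1 /\ 0 <= t' - t + k * M - d - s - (M%:Z - mu).
Proof.
move=> h1 h2 d0' s0 dm hn e1 e2.
have [k1|k0] : 1 <= k \/ k <= 0 by lia.
  by split; [lia|have : M%:Z <= k * M by nia]; lia.
have r1 : rho <= -1 by nia.
have r2' : rho * Q <= - Q%:Z by nia.
have [k1|/eqP kz] : k <= -1 \/ k == 0 by lia.
  have kM : k * M <= - M%:Z by nia.
  lia.
by rewrite kz in hn e2 *; lia.
Qed.

Lemma modeA_hom a t b t' n : inA (a, t) -> inA (b, t') ->
  n != 0 \/ (t' < t)%N \/ (t' = t /\ (a < b)%N) ->
  hom_coh0 n (BB a (wt2 i 0 (- t%:Z))) (BB b (wt2 i 0 (- t'%:Z))).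
Proof.
rewrite /inA /= => /and3P[a0 ar ta] /and3P[b0 br tb] hn; apply: (chain_hom f0 hline hsep ar br) => k s en smin w.
have tT : (t <= T)%N by apply: leq_trans ta _; case: ifP => // _; exact: QT.
have tT' : (t' <= T)%N by apply: leq_trans tb _; case: ifP => // _; exact: QT.
have KT : (T + M = P * M + Q)%N.
  have PM : (M <= P * M)%N by rewrite leq_pmull.
  by rewrite /topA mulnBl mul1n; lia.
pose del : int := if (a < b)%N then ((b - a) * Q)%N else 0.
have em : (0 < maxn a b)%N /\ (maxn a b < r)%N by split; [lia|rewrite gtn_max ar].
have eA : wA (if (a < b)%N then gD b - gD a else 0) = 0.
  by case: ifP => _; rewrite ?gdE // !wcE; lia.
have eB : wB (if (a < b)%N then gD b - gD a else 0) = del.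
  rewrite /del; case: ifP => ab; rewrite ?gdE // !wcE //.
  have -> : ((b - 1) * Q = (b - a) * Q + (a - 1) * Q)%N by rewrite -mulnDl; congr muln; lia.
  lia.
have ewA : wA w = k - wA (gD s) by rewrite /w !wcE eA; lia.
have ewB : wB w = t' %:Z - t%:Z + k * M - del - wB (gD s) by rewrite /w !wcE eB; lia.
have ecA : wA (w - (chi - gD (maxn a b))) = wA w by rewrite (gdE em.1 em.2) !wcE; lia.
have ecB : wB (w - (chi - gD (maxn a b))) = wB w - (M%:Z - ((maxn a b - 1) * Q)%N%:Z).
  by rewrite (gdE em.1 em.2) !wcE; lia.
clearbody w; have dpos : 0 <= del by rewrite /del; case: ifP.
have dlt : (a < b)%N -> 0 < del by rewrite /del => ab; rewrite ab; nia.
have hn' : k != 0 \/ t'%:Z - t%:Z < 0 \/ (t'%:Z - t%:Z = 0 /\ 0 < del).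
  case: hn => [n0|[tt|[tt ab]]]; [left|right; left; lia|right; right; split; [lia|exact: dlt]].
  by apply: contra_neq n0 => k0; rewrite en k0 mul0r.
have dmu (c : nat) : (c < minn a b)%N -> del + (c * Q)%N%:Z <= ((maxn a b - 1) * Q)%N%:Z.
  rewrite /del => hc; case: ifP => ab; last by rewrite add0r lez_nat leq_mul2r; lia.
  by rewrite -PoszD lez_nat -mulnDl leq_mul2r; lia.
case: (posnP s) => [s0|s0].
  have g0 : gD s = 0 by rewrite s0 /gd big_geq.
  rewrite g0 !wcE subr0 in ewA ewB; rewrite s0 => /supp_0[rho [e1 e2]]; apply/supp_0; exists rho.
  rewrite ecA ecB; split=> //; rewrite ewA in e1; rewrite ewB subr0 in e2 *.
  apply: (modeA_arith0 (K := (P * M)%N%:Z + Q%:Z) _ _ dpos _ _ e1 _ hn' e2); try lia.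
  by have := dmu 0%N; rewrite mul0n addr0; apply; lia.
have sr : (s.+1 < r)%N by lia.
(* A point of index s > 0 occurs only if both indices exceed 1, and then both twists are at most
   Q. *)
have [a1 b1] : (a == 1%N) = false /\ (b == 1%N) = false by lia.
rewrite a1 in ta; rewrite b1 in tb.
have sr' : (s < r)%N by lia.
rewrite (gdE s0 sr') !wcE in ewA ewB.
move=> /(supp_k s0 sr)[rho [e1 e2]]; apply/(supp_k s0 sr); exists 0.
rewrite ecA ecB !mul0r subr0 addr0; rewrite ewA in e1 *; rewrite ewB in e2 *.
have ds := dmu s smin.
have es : (s * Q = (s - 1) * Q + Q)%N by rewrite addnC -mulSn; congr muln; lia.
rewrite es PoszD in ds; move: ((s - 1) * Q)%N ((maxn a b - 1) * Q)%N ds ewA ewB ecB e1 e2 => X Z ds ewA ewB ecB e1 e2.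
apply: (modeA_arith1 (d := del) _ _ dpos _ _ hn' e1 e2); clear -ta tb ds; lia.
Qed.

Definition listA : seq (nat * nat) :=
  [seq (1%N, t) | t <- iota 0 T.+1] ++ [seq (k, t) | k <- iota 2 (r - 2), t <- iota 0 Q.+1].

Lemma mem_listA d : (d \in listA) = inA d.
Proof.
case: d => k t; rewrite mem_cat /inA [(k, t).1]/= [(k, t).2]/=; apply/orP/and3P => [[h|h]|[h1 h2 h3]].
- by case/seq.mapP: h => t' ht [-> ->]; move: ht; rewrite mem_iota eqxx; split=> //; lia.
- case/allpairsP: h => -[k' t'] [hk ht [-> ->]].
  move: hk ht; rewrite !mem_iota => /= hk ht.
  have -> /= : (k' == 1%N) = false by clear -hk; lia.
  by split; clear -hk ht r2; lia.
have [e|ne] := eqVneq k 1%N.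
  by left; apply/seq.mapP; exists t; rewrite ?e // mem_iota; move: h3; rewrite e eqxx.
right; apply/allpairsP; exists (k, t); rewrite [(k, t).1]/= [(k, t).2]/= !mem_iota subnKC // h2 andbT; split=> //; last by move: h3; rewrite (negPf ne).
by case: k ne h1 {h2 h3} => [|[|k]].
Qed.

(** Lexicographic: smaller twist first and, for equal twists, larger index first. *)
Definition keyA (d : nat * nat) : nat := (d.2 * r + (r - d.1))%N.

Lemma keyA_lt a t b t' : (0 < a)%N -> (a < r)%N -> (0 < b)%N -> (b < r)%N ->
  (keyA (b, t') < keyA (a, t))%N -> (t' < t)%N \/ (t' = t /\ (a < b)%N).
Proof.
rewrite /keyA /= => a0 ar b0 br h; have [tt|tt|tt] := ltngtP t' t; [by left| |by right; lia].
have : (t.+1 * r <= t' * r)%N by rewrite leq_mul2r tt orbT.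
by rewrite mulSn; lia.
Qed.

Lemma gk_vanish k : (0 < k)%N -> (k < r)%N -> vanish0 (gk l k).
Proof.
move=> k0 kr; rewrite /gk big_ltn // mulrC; exact: (hidealM (vanish0_hideal G) _ (vl (ltnW r2))).
Qed.

Lemma listA_uniq : uniq [seq keyA d | d <- listA].
Proof.
rewrite map_inj_in_uniq.
  rewrite cat_uniq map_inj_uniq ?iota_uniq; last by move=> t t' [].
  rewrite allpairs_uniq ?iota_uniq // ?andbT; last by move=> [? ?] [? ?] _ _ [-> ->].
  rewrite andTb; apply/hasPn => _ /allpairsP[[k t] [hk _ ->]]; apply/seq.mapP => -[t' _ [e _]].
  by move: hk; rewrite mem_iota e.
move=> [a t] [b t']; rewrite !mem_listA /inA /= => /and3P[a0 ar _] /and3P[b0 br _] e.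
have [h|h|h] := ltngtP t' t; last by rewrite h; congr pair; move: e; rewrite /keyA /= h; lia.
  have : (t'.+1 * r <= t * r)%N by rewrite leq_mul2r h orbT.
  by move: e; rewrite /keyA /= mulSn; lia.
have : (t.+1 * r <= t' * r)%N by rewrite leq_mul2r h orbT.
by move: e; rewrite /keyA /= mulSn; lia.
Qed.

Let wdeg_chi : 0 < wdeg i 1 M P Q chi.
Proof. by rewrite /wdeg !wcE; lia. Qed.

(** The threshold P (M + Q) leaves room for M after reduction of the x-weight modulo P, the
    remainder costing less than P Q. *)
Lemma modeA_bounded a t : inA (a, t) -> bounded_from (BB a (wt2 i 0 (- t%:Z))).
Proof.
rewrite /inA /= => /and3P[a0 ar _].
apply: (chain_bounded Gsub f0 hw l1 d0 hline hsep ff fw (deg := wdeg i 1 M P Q) (D := P%:Z * (M%:Z + Q%:Z))) => //.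
  exact: wdegD.
move=> s w sa hD.
have ecA : wA (w - (chi - gD a)) = wA w by rewrite gdE // !wcE; lia.
have ecB : wB w - M%:Z <= wB (w - (chi - gD a)).
  by rewrite gdE // !wcE; move: ((a - 1) * Q)%N => X; lia.
move: hD; rewrite /wdeg => hD.
case: (posnP s) => [->|s0].
  move/supp_0 => [rho [e1 e2]]; apply/supp_0; exists rho; rewrite ecA; split=> //.
  suff : M%:Z <= wB w + rho * Q by lia.
  have : P%:Z * M <= P%:Z * (wB w + rho * Q) by rewrite e1 in hD; nia.
  by rewrite ler_pM2l //; lia.
have sr : (s.+1 < r)%N by lia.
move=> _; apply/(supp_k s0 sr); exists (wA w %/ P)%Z; rewrite ecA.
have eP := divz_eq (wA w) P; have lP := ltz_pmod (wA w) (d := P%:Z) ltac:(by []).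
have gP := modz_ge0 (wA w) (d := P%:Z) ltac:(by lia).
move: eP lP gP hD ecB; move: (wA w %/ P)%Z (wA w %% P)%Z => q e eP lP gP hD ecB; split; first lia.
suff : M%:Z <= wB w + q * Q by lia.
have : P%:Z * M <= P%:Z * (wB w + q * Q) by rewrite eP in hD; nia.
by rewrite ler_pM2l //; lia.
Qed.

(** * The right orthogonal of the collection *)

Section Detection.
Context (Y : mf G f).
Hypothesis hY : forall d, inA d -> forall m, hom_coh0 m (BB d.1 (wt2 i 0 (- d.2%:Z))) Y.

(** For k = r the ideal is (f), where exactness is automatic; this plays the part of one more
    object. *)
Let gk_acyclic k t : (0 < k)%N -> (k <= r)%N -> (t <= Q)%N -> acyclic_mod (gen1 (gk l k)) (gD k - wt2 i 0 t) Y.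
Proof.
move=> k0; rewrite leq_eqVlt => /orP[/eqP -> _|kr tQ].
  apply: (acyclic_ext (I := fun p => exists q, p = f * q)); last exact: acyclic_f.
  by move=> p; rewrite ff.
have e : wt2 i 0 (- t%:Z) + gD k = gD k - wt2 i 0 t by rewrite addrC wt2N oppr0.
rewrite -e; apply: (chain_acyclic (ff := ff) (fw := fw) (l1 := l1) (d0 := d0) (hw := hw) (Gsub := Gsub) f0) => n; apply: (hY (d := (k, t))).
by rewrite /inA /= k0 kr; case: ifP => // _; apply: leq_trans tQ QT.
Qed.

Let xi_acyclic t : (t <= T)%N -> acyclic_mod (gen1 (l 0)) (wt2 i 1 (- t%:Z)) Y.
Proof.
move=> tT; have e : wt2 i 0 (- t%:Z) + gD 1 = wt2 i 1 (- t%:Z).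
  by rewrite gdE // wt2D; congr wt2; lia.
have -> : l 0 = gk l 1 by rewrite /gk big_nat1.
rewrite -e; apply: (chain_acyclic (ff := ff) (fw := fw) (l1 := l1) (d0 := d0) (hw := hw) (Gsub := Gsub) f0) => n; apply: (hY (d := (1%N, t))).
by rewrite /inA /= r2.
Qed.

Let factor_acyclic k t : (0 < k)%N -> (k < r)%N -> (t <= Q)%N ->
  acyclic_mod (gen1 (l k)) (gD k.+1 - wt2 i 0 t) Y.
Proof.
move=> k0 kr tQ; apply: (chain_factor Gsub f0 hw l1 ff kr).
  have -> : gD k.+1 - wt2 i 0 t - dl k = gD k - wt2 i 0 t.
    by rewrite /gd big_nat_recr //= addrAC [_ + dl k - dl k]addrK.
  exact: gk_acyclic (ltnW kr) tQ.
exact: gk_acyclic.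
Qed.

Let l_div k : (k < r)%N -> gen1 (l k) f.
Proof. by move=> kr; rewrite ff (bigD1_seq k) ?iota_uniq ?mem_index_iota //=; eexists. Qed.

Let hx := has_weight_x Gsub ij P0 Q0 Hchi HG.
Let hy := has_weight_y Gsub ij P0 Q0 Hchi HG.
Let hxn n := has_weight_xn Gsub ij P0 Q0 Hchi HG n.

Let xy_acyclic t : (t < T)%N -> acyclic_mod (gen2 x y) (wt2 i 1 (- t%:Z)) Y.
Proof.
move=> tT; apply: (acyclic_ext l0y).
apply: (acyclic_cut Gsub (hw 0) hy) => //; first exact: ycop.
- exact/l_div/ltnW.
- rewrite wt2N wt2D; have -> : - t%:Z + -1 = - (t.+1)%:Z by lia.
  by rewrite oppr0 addr0; exact: xi_acyclic.
- exact/xi_acyclic/ltnW.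
Qed.

(** Modulo y the factor l_k is x^P. Its Q + 1 consecutive twists give Q consecutive weights for
    (x^P, y), and the factors together cover 1 to M. *)
Let Xy_step k n : (0 < k)%N -> (k < r)%N -> dl k = wt2 i 0 Q -> (exists q, l k = x ^+ P + y * q) ->
  cop (l k) y -> ((k - 1) * Q < n)%N -> (n <= k * Q)%N -> acyclic_mod (gen2 (x ^+ P) y) (wt2 i 1 n) Y.
Proof.
move=> k0 kr dk ek ck n1 n2; apply: (acyclic_ext (gen2_swap_ext ek)).
have eg : gD k.+1 = wt2 i 1 (k * Q)%N.
  rewrite /gd big_nat_recr //= -/(gD k) gdE // dk wt2D; congr wt2; rewrite -PoszD; congr Posz.
  by rewrite addnC -mulSn; congr muln; lia.
have kQ : (k * Q = (k - 1) * Q + Q)%N by rewrite addnC -mulSn; congr muln; lia.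
apply: (acyclic_cut Gsub (hw k) hy ck (l_div kr)).
  have -> : wt2 i 1 n - wt2 i 0 1 = gD k.+1 - wt2 i 0 (k * Q - n + 1)%N.
    by rewrite eg !wt2N !wt2D; congr wt2; lia.
  by apply: factor_acyclic => //; lia.
have -> : wt2 i 1 n = gD k.+1 - wt2 i 0 (k * Q - n)%N.
  by rewrite eg !wt2N !wt2D; congr wt2; lia.
by apply: factor_acyclic => //; lia.
Qed.

Let Xy_acyclic n : (0 < n)%N -> (n <= M)%N -> acyclic_mod (gen2 (x ^+ P) y) (wt2 i 1 n) Y.
Proof.
move=> n0 nM; pose k := ((n - 1) %/ Q).+1.
have eK := divn_eq (n - 1) Q; have lK := ltn_pmod (n - 1) Q0.
have n1 : ((k - 1) * Q < n)%N by rewrite /k subn1 /=; lia.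
have n2 : (n <= k * Q)%N by rewrite /k mulSn; lia.
have [kr|kr] := ltnP k.+1 r.
  by apply: (Xy_step (k := k)) => //; [exact: ltnW|exact: dlk|exact: lky|apply: ycop].
case: last_factor => [[dr er cr eM]|[er dr eM]].
  have ek : k = r.-1.
    suff : (k - 1 < r - 1)%N by rewrite /k in kr *; lia.
    rewrite -(ltn_pmul2r Q0); lia.
  by apply: (Xy_step (k := k)); rewrite ?ek //; lia.
have ek : (n = (r - 2) * Q + 1)%N.
  have : ((r - 2) * Q <= (k - 1) * Q)%N by rewrite leq_mul2r; lia.
  lia.
have r1r : (r.-1 < r)%N by lia.
have r10 : (0 < r.-1)%N by lia.
have eg : gD r.-1.+1 = wt2 i 1 n.
  by rewrite /gd big_nat_recr //= -/(gD r.-1) gdE // er wt2D; congr wt2; rewrite ek; have -> : (r.-1 - 1 = r - 2)%N by lia.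
have c1 : cop y (x ^+ P) by exact: (@cop_yx _ _ Gsub _ _ _ _ _ _ ij P0 Q0 Hchi HG).
have h t : (t <= Q)%N -> acyclic_mod (gen1 y) (wt2 i 1 n - wt2 i 0 t) Y.
  by move=> tQ; have := factor_acyclic r10 r1r tQ; rewrite dr eg.
apply: (acyclic_ext (I := gen2 y (x ^+ P))).
  by move=> p; split=> -[a [b ->]]; exists b, a; rewrite addrC.
apply: (acyclic_cut Gsub hy (hxn P) c1).
- by rewrite -dr; exact: l_div.
(* Multiplication by x^P lowers the weight by (P, 0), which on G is the same as (0, Q). *)
- have := h Q (leqnn Q); apply: acyclic_weq => //.
  apply/(weqE Gsub ij P0 Q0 Hchi HG); exists 1; rewrite !wcE; lia.
- by have := h 0%N isT; rewrite wt2N wt2D oppr0 !addr0.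
Qed.

Let f_in e : (e <= P)%N -> gen2 (x ^+ e) y f.
Proof.
move=> eP; have r1r : (r.-1 < r)%N by lia.
have [q eq] := l_div r1r.
have hJ := gen2_hideal Gsub (hxn e) hy.
rewrite eq mulrC; apply: (hidealM hJ).
case: last_factor => [[_ [q' ->] _ _]|[_ -> _]]; last by exists 0, 1; rewrite mulr0 mulr1 add0r.
by exists (x ^+ (P - e)), q'; rewrite -exprD subnKC.
Qed.

(** Descent from x^(e+1) to x^e; the kernel S/(x, y) appears in the weight (1 - e, n), which must
    already be known. *)
Let X_step e n : (0 < e)%N -> (e < P)%N -> (0 < n)%N -> (n <= M)%N ->
  acyclic_mod (gen2 (x ^+ e.+1) y) (wt2 i 1 n) Y -> acyclic_mod (gen2 (x ^+ e) y) (wt2 i 1 n) Y.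
Proof.
move=> e0 eP n0 nM h.
have x0 : x != 0 by exact: X_neq0.
have [h1 h2] := colon_step (cop_yx Gsub ij P0 Q0 Hchi HG (n := e)) x0 (expf_neq0 e x0) (exprSr x e).
refine (@acyclic_sum _ _ _ Gsub (gen2 (x ^+ e) y) (gen2 (x ^+ e.+1) y) (gen2 x y) (x ^+ e) (wt2 i e 0) _ Y
  (gen2_hideal Gsub (hxn e) hy) (gen2_hideal Gsub (hxn e.+1) hy) (gen2_hideal Gsub hx hy) (hxn e) (f_in eP) _ _ h2 h1 _ h).
- by move=> _ [q [t ->]]; exists (x * q), t; rewrite exprSr mulrA.
- by exists 1, 0; rewrite mulr1 mulr0 addr0.
have PM : (e * M <= (P - 1) * M)%N by rewrite leq_mul2r; lia.
have eM : (M <= e * M)%N by rewrite leq_pmull.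
(* Adding P - e copies of chi and subtracting (P, -Q) carries (1, -t) to (1 - e, n). The bounds 1 <=
   e < P and 1 <= n <= M put t between 0 and T - 1. *)
pose t := (T + M - e * M - n)%N.
have KT : (T + M = P * M + Q)%N.
  have PM' : (M <= P * M)%N by rewrite leq_pmull.
  by rewrite /topA mulnBl mul1n; lia.
have tT : (t < T)%N by rewrite /t; lia.
apply: (acyclic_move Gsub ij P0 Q0 Hchi HG (xy_acyclic tT)).
exists (P%:Z - e%:Z), (-1); rewrite !wcE; split; first lia.
have -> : (P%:Z - e%:Z) * M%:Z = (P * M)%N%:Z - (e * M)%N%:Z by lia.
by rewrite /t /topA in KT *; lia.
Qed.

Let all_acyclic w : acyclic_mod (gen2 x y) w Y.
Proof.
pose K := (P * M + Q)%N.
have KT : (T + M = K)%N.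
  have PM' : (M <= P * M)%N by rewrite leq_pmull.
  by rewrite /topA /K mulnBl mul1n; lia.
have K0 : (0 < K)%N by rewrite /K; lia.
(* Modulo chi the weight is (1, m), and m matters modulo K. The representatives from 1 - T to 0 come
   from [xy_acyclic], those from 1 to M by descent from x^P; together these are all T + M = K
   classes. *)
pose b := wB w - (wA w - 1) * M + (T%:Z - 1).
have eK := divz_eq b K; have lK := ltz_pmod b (d := K%:Z) ltac:(by []).
have gK := modz_ge0 b (d := K%:Z) ltac:(by lia).
move: (b %/ K)%Z (b %% K)%Z eK lK gK => q e eK lK gK.
have conv m : m = e - (T%:Z - 1) -> acyclic_mod (gen2 x y) (wt2 i 1 m) Y -> acyclic_mod (gen2 x y) w Y.
  move=> em h; apply: (acyclic_move Gsub ij P0 Q0 Hchi HG h).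
  exists (wA w - 1 + q * P), (- q); split; first lia.
  have : q * K%:Z = q * P * M + q * Q by rewrite /K; lia.
  by rewrite /b in eK; move: eK; rewrite mulrDl; lia.
have [m0|m0] := lerP 1 (e - (T%:Z - 1)); last first.
  apply: (conv _ erefl).
  have -> : e - (T%:Z - 1) = - (absz (e - (T%:Z - 1))%R)%:Z by lia.
  by apply: xy_acyclic; lia.
apply: (conv _ erefl); have -> : e - (T%:Z - 1) = (absz (e - (T%:Z - 1))%R)%:Z by lia.
set n := absz _; have n0 : (0 < n)%N by rewrite /n; lia.
have nM : (n <= M)%N by rewrite /n; lia.
suff h k : (k < P)%N -> acyclic_mod (gen2 (x ^+ (P - k)) y) (wt2 i 1 n) Y.
  have := h P.-1 ltac:(by lia); have -> : (P - P.-1 = 1)%N by lia.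
  by rewrite expr1.
elim: k => [|k IH] kP; first by rewrite subn0; exact: Xy_acyclic.
apply: X_step => //; try lia.
have -> : (P - k.+1).+1 = (P - k)%N by lia.
by apply: IH; lia.
Qed.

Lemma modeA_detect : contractible Y.
Proof.
apply: (plane_contractible Gsub ij P0 Q0 Hchi HG _ wdeg_chi all_acyclic).
have [q ->] := l_div (ltnW r2); rewrite mulrC; exact: (hidealM (vanish0_hideal G) _ (vl (ltnW r2))).
Qed.

End Detection.

Theorem modeA_tilting : has_tilting_of_length G f (T.+1 + (r - 2) * Q.+1).
Proof.
have -> : (T.+1 + (r - 2) * Q.+1)%N = size listA.
  by rewrite size_cat size_map size_iota size_allpairs !size_iota.
pose E (d : nat * nat) := BB d.1 (wt2 i 0 (- d.2%:Z)).
apply: (tilting_of_list Gsub (0%N, 0%N) (E := E) listA_uniq).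
- move=> [a t]; rewrite mem_listA => hd; have := hd; rewrite /inA => /and3P[/= a0 ar _].
  apply: rank1_exceptional => //.
  + by move=> c; apply: (weight0_const Gsub ij P0 Q0 Hchi HG); rewrite /wdeg !wcE; lia.
  + exact: gk_vanish.
  + by rewrite /hk big_ltn // mulrC; exact: (hidealM (vanish0_hideal G) _ (vl ar)).
  + by move=> n n0; apply: modeA_hom => //; left.
- move=> [b t'] [a t]; rewrite !mem_listA => hb ha lt n; apply: modeA_hom => //; right.
  move: hb ha; rewrite /inA /= => /and3P[b0 br _] /and3P[a0 ar _].
  exact: keyA_lt lt.
- by move=> [a t] [b t'] n; rewrite !mem_listA => ha hb n0; apply: modeA_hom => //; left.
- move=> [a t]; rewrite mem_listA => hd; apply: (plane_finite Gsub ij P0 Q0 Hchi HG wdeg_chi).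
  exact: modeA_bounded.
by move=> Y hY; apply: modeA_detect => d hd; apply: hY; rewrite mem_listA.
Qed.

End ModeA.

(** * Endomorphisms and orthogonality of a cone *)

Section ConeEnd.
Context {R : realType} (G : tpoint R -> Prop) (f : poly2 R).
Local Notation S := (poly2 R).
Hypothesis Gsub : subgroup G.
Implicit Types (X Y Z : mf G f) (n : int).
Opaque hom_d.

(** An endomorphism of the cone is governed by its effect on X[1]: as Hom^1 (Y, X) = 0 this is an
    endomorphism of X, a scalar. After subtracting it the map deforms into Y, where it is
    null-homotopic. *)
Lemma cone_end X Y (phi : 'M[S]_(rk Y, rk X)) (hphi : closed_hom 0 phi) :
  hom_coh0 1 Y X ->
  (forall a : 'M[S]_(rk X), closed_hom 0 (X := X) (Y := X) a ->
     exists c : R[i], exact_hom 0 (X := X) (Y := X) (a - (c%:MP)%:M)) ->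
  hom_coh0 0 (mf_cone hphi) Y ->
  forall th : 'M[S]_(rk (mf_cone hphi)), closed_hom 0 (X := mf_cone hphi) (Y := mf_cone hphi) th ->
  exists c : R[i], exact_hom 0 (X := mf_cone hphi) (Y := mf_cone hphi) (th - (c%:MP)%:M).
Proof.
set C := mf_cone hphi => hYX hX hCY th hth.
have ha : closed_hom 1 (X := C) (Y := X) (usubmx th : 'M_(rk X, rk C)).
  by rewrite -[1]add0r; exact: (cone_usub hth).
have [c0 hc0 ec0] := hYX _ (cone_rsub ha).
have eth := hsubmxK (usubmx th : 'M_(rk X, rk X + rk Y)).
set a : 'M_(rk X) := lsubmx (usubmx th) in eth; set b : 'M_(rk X, rk Y) := rsubmx (usubmx th) in eth ec0.
have e10 : (1 - 1 : int) = 0 by [].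
have ha2 := ha; rewrite -eth in ha2; case: ha2 => /hom_deg_row[da _].
rewrite hom_d_row -row_mx0 => /eq_row_mx[ea _].
rewrite e10 in hc0 ec0 da ea.
have hd : hom_deg G 0 X X (c0 *m phi) by have := hom_deg_mul Gsub hphi.1 hc0; rewrite addr0.
have [|g [p hp ep]] := hX (a + c0 *m phi).
  split; first exact: hom_degD.
  rewrite hom_dD hom_dM0 // -ec0; move/eqP: ea; rewrite subr_eq0 => /eqP ->.
  by rewrite /sgn expr1 scaleN1r addNr.
exists g; set th' : 'M_(rk C) := th - _.
have hth' : closed_hom 0 (X := C) (Y := C) th'.
  refine (closedB hth _); have := closed_scalar C (erefl (0 : int)) g.
  by rewrite scalemx1.
have eu : usubmx (th' : 'M_(rk X + rk Y, rk C)) = row_mx (a - (g%:MP)%:M) b.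
  have -> : th' = (th : 'M_(rk X + rk Y)) - (g%:MP)%:M by [].
  by rewrite raddfB /= -eth scalar_mx_block /block_mx col_mxKu opp_row_mx add_row_mx subr0.
have [|b' hb' hex] := @cone_to_local _ _ _ Gsub _ _ _ hphi 0 C th' hth'.
  rewrite add0r eu; exists (row_mx p c0).
    by rewrite e10; apply/hom_deg_row; split.
  by rewrite e10 hom_d_row -ep -ec0 sgn0 scale1r addrAC addrK.
rewrite -/th' -[th'](subrK (col_mx 0 b' : 'M_(rk C))); refine (exactD hex _).
exact/exact_inr/hCY.
Qed.

Lemma cone_source X Y Z (phi : 'M[S]_(rk Y, rk X)) (hphi : closed_hom 0 phi) n :
  hom_coh0 (n + 1) (mf_cone hphi) Z -> hom_coh0 n Y Z -> hom_coh0 n X Z.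
Proof.
move=> hC hY a ha; have [|psi] := hC (row_mx a 0).
  split; first by apply/hom_deg_row; rewrite addrK; split; [case: ha|exact: hom_deg0].
  by rewrite hom_d_row addrK ha.2 mul0mx scaler0 subr0 hom_d0 row_mx0.
rewrite addrK -[psi]hsubmxK => /hom_deg_row[hp hq]; rewrite hom_d_row => /eq_row_mx[ea eq].
have hr : closed_hom n (rsubmx psi : 'M_(rk Z, rk Y)) by split; [exact: hq|exact: (esym eq)].
have h1 : exact_hom n (hom_d (n - 1) (lsubmx psi : 'M_(rk Z, rk X))) by exists (lsubmx psi); [exact: hp|exact: erefl].
rewrite ea; exact: (exactB h1 (exact_sgn _ (exactM0 Gsub (hY _ hr) hphi))).
Qed.

Lemma cone_bounded X Y (phi : 'M[S]_(rk Y, rk X)) (hphi : closed_hom 0 phi) :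
  bounded_from X -> bounded_from Y -> bounded_from (mf_cone hphi).
Proof.
move=> hX hY Z; have [N1 h1] := hX Z; have [N2 h2] := hY Z.
exists (N1 + N2).+1 => n hn.
have e1 : N1%:Z <= n - 1 by clear -hn; lia.
have e2 : N2%:Z <= n by clear -hn; lia.
exact: (cone_from0 Gsub (h2 n e2) (h1 _ e1)).
Qed.

End ConeEnd.

(** * Products without such a factor *)

Lemma basisK_cases al be u (j : 'I_(rk (basisK al be u))) :
  [\/ pos j = 0 /\ wt j = u, pos j = -1 /\ wt j = u + al,
      pos j = -1 /\ wt j = u + be | pos j = - 2 /\ wt j = u + be + al].
Proof.
rewrite /=; case: split => k /=; case: split => k' /=.
- by constructor 1.
- by constructor 2.
- by constructor 3.
- by constructor 4.
Qed.

Lemma basis2_cases al u (j : 'I_(rk (basis2 al u))) :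
  (pos j = 0 /\ wt j = u) \/ (pos j = -1 /\ wt j = u + al).
Proof. by rewrite /=; case: split => k /=; [left|right]. Qed.

Lemma mult_cases (p : nat) (r : int) : r = 0 \/ p%:Z <= r * p \/ r * p <= - p%:Z.
Proof.
have [/eqP ->|[h|h]] : r == 0 \/ 1 <= r \/ r <= -1 by lia.
- by left.
- by right; left; nia.
by right; right; nia.
Qed.

Lemma small_mult (p : nat) (b r : int) : - p%:Z < b -> b < p -> b = r * p -> r = 0 /\ b = 0.
Proof.
by move=> h1 h2 e; have [r0|[h|h]] := mult_cases p r; [rewrite e r0 mul0r|lia|lia].
Qed.

Section Blocks2.
Context (K : comNzRingType) (p q r t : nat).

Lemma col_incl (a : 'M[K]_(p, r)) (b : 'M[K]_(q, r)) :
  col_mx a b = col_mx 1%:M 0 *m a + col_mx 0 1%:M *m b.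
Proof. by rewrite !mul_col_mx !mul1mx !mul0mx add_col_mx addr0 add0r. Qed.

Lemma col_mul_split (c : 'M[K]_(t, p + q)) (a : 'M[K]_(p, r)) (b : 'M[K]_(q, r)) :
  c *m col_mx a b = c *m col_mx 1%:M 0 *m a + c *m col_mx 0 1%:M *m b.
Proof. by rewrite (col_incl a b) mulmxDr !mulmxA. Qed.

Lemma row_incl (c : 'M[K]_(t, p + q)) :
  c = c *m col_mx 1%:M 0 *m row_mx 1%:M 0 + c *m col_mx 0 1%:M *m row_mx 0 1%:M.
Proof.
rewrite -!mulmxA -mulmxDr !mul_col_row !mul1mx !mulmx0 !mul0mx add_block_mx !addr0 !add0r.
by rewrite -scalar_mx_block mulmx1.
Qed.

Lemma row_col1 (c : 'M[K]_(t, p)) (a : 'M[K]_(p, r)) (b : 'M[K]_(q, r)) :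
  c *m row_mx 1%:M 0 *m col_mx a b = c *m a.
Proof. by rewrite -mulmxA mul_row_col mul1mx mul0mx addr0. Qed.

Lemma row_col2 (c : 'M[K]_(t, q)) (a : 'M[K]_(p, r)) (b : 'M[K]_(q, r)) :
  c *m row_mx 0 1%:M *m col_mx a b = c *m b.
Proof. by rewrite -mulmxA mul_row_col mul1mx mul0mx add0r. Qed.

Lemma mul_combo (b d : 'M[K]_(t, p)) (a : 'M[K]_(p, r)) (e : 'M[K]_(t, r)) :
  d *m a = (b *m a + e) - e - (b - d) *m a.
Proof. by rewrite mulmxBl addrK opprB addrC subrK. Qed.

End Blocks2.

Lemma subr_split (V : zmodType) (a b c : V) : a - b = (a - c) + (c - b).
Proof. by rewrite addrA subrK. Qed.

Lemma pair_combo (K : comNzRingType) (g h a b p q r q1 r1 : K) (c0 c1 : 'cV[K]_1) :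
  c0 0 0 = g * p + (a * q + b * r) -> c1 0 0 = a * q1 + b * r1 ->
  col_mx c0 c1 = mx_pair g h *m col_mx 0 p%:M + (a *: col_mx q%:M q1%:M + b *: col_mx r%:M r1%:M).
Proof.
move=> e0 e1; rewrite mx_pair_col !scale_col_mx !add_col_mx scaler0 add0r !scale_scalar_mx.
congr col_mx; rewrite -!raddfD /=; first by rewrite -e0; exact: mx11_scalar.
by rewrite -e1; exact: mx11_scalar.
Qed.

Section ModeB.
Context {R : realType} (G : tpoint R -> Prop) (f : poly2 R).
Local Notation S := (poly2 R).
Hypothesis Gsub : subgroup G.
Hypothesis f0 : f != 0.
Context (i j : 'I_2) (P Q m : nat).
Hypothesis ij : i != j.
Hypotheses (P1 : (1 < P)%N) (Q1 : (1 < Q)%N) (m0 : (0 < m)%N).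
Definition topB : nat := (m * Q)%N.
Local Notation M := topB.
Hypothesis Hchi : weq G chi (wt2 i 0 M).
Hypothesis HG : forall a b : int, weq G (wt2 i a b) 0 <-> exists r : int, a = r * P /\ b = - (r * Q%:Z).
Implicit Types (X Y Z W : mf G f) (u v w : weight) (n : int).
Local Notation x := ('X_i : S).
Local Notation y := ('X_j : S).
Local Notation wA := (wc1 i 0).
Local Notation wB := (wc2 i M).

Context (l : nat -> S) (z : nat -> 'I_2 -> R[i]) (dl : nat -> weight).
Hypothesis hw : forall k, has_weight G (dl k) (l k).
Hypothesis l1 : forall k, (m <= k)%N -> l k = 1.
Hypothesis d0 : forall k, (m <= k)%N -> dl k = 0.
Hypothesis hline : forall k, (k.+1 < m)%N -> line G (l k) (z k).
Hypothesis hsep : forall s t, (s.+1 < m)%N -> (s < t)%N -> (t < m)%N -> (l t).@[z s] != 0.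
Hypothesis ff : f = \prod_(0 <= k < m) l k.
Hypothesis fw : weq G (\sum_(0 <= k < m) dl k) chi.
Hypothesis dlk : forall k, (k < m)%N -> dl k = wt2 i 0 Q.
Hypothesis supp_k : forall k, (k.+1 < m)%N -> forall v,
  supp G (z k) v <-> exists r : int, 0 <= wA v - r * P /\ 0 <= wB v + r * Q.
Hypothesis vl : forall k, (k < m)%N -> vanish0 (l k).
Hypothesis lky : forall k, (k < m)%N -> forall p, gen2 (l k) y p <-> gen2 (x ^+ P) y p.
Hypothesis lkx : forall k, (k < m)%N -> exists c q, c != 0 /\ l k = c *: y ^+ Q + x * q.
Hypothesis ycop : forall k, (k < m)%N -> cop (l k) y.

Local Notation gD := (gd dl).
Local Notation BB := (B Gsub hw l1 d0 ff fw).
Let P0 : (0 < P)%N. Proof. exact: ltnW. Qed.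
Let Q0 : (0 < Q)%N. Proof. exact: ltnW. Qed.
Let hx := has_weight_x Gsub ij P0 Q0 Hchi HG.
Let hy := has_weight_y Gsub ij P0 Q0 Hchi HG.
Let hxn (n : nat) := has_weight_xn Gsub ij P0 Q0 Hchi HG n.
Let hyn (n : nat) := has_weight_yn Gsub ij P0 Q0 Hchi HG n.
Let x0 : x != 0. Proof. exact: X_neq0. Qed.
Let y0 : y != 0. Proof. exact: X_neq0. Qed.
Let QM : (Q <= M)%N. Proof. exact: leq_pmull. Qed.

Lemma gdBE k : (k <= m)%N -> gD k = wt2 i 0 (k * Q)%N.
Proof.
elim: k => [|k IH] km; first by rewrite /gd big_geq // mul0n /wt2 if_same.
rewrite /gd big_nat_recr //= -/(gD k) IH ?dlk //; last exact: ltnW.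
by rewrite wt2D; congr wt2; rewrite mulSn; lia.
Qed.

(** The x-weight is zero, so rho <= 0. A supported weight then has k >= 1, up to a boundary case
    with t = K = M', and one period M' pays for the loss M' - mu. *)
Lemma modeB_arith (t d M' mu s rho k : int) (K : int) : 0 < M' ->
  - K <= t -> t <= K -> 0 <= d -> 0 <= s -> d + s + K <= mu -> 0 < K -> K <= M' -> mu <= M' ->
  k != 0 \/ t - d < 0 -> 0 <= 0 - rho * P -> 0 <= t + k * M' - d - s + rho * K ->
  0 <= t + k * M' - d - s - (M' - mu).
Proof.
move=> M0 h1 h2 h3 h4 h5 K0 KM mM hn e1 e2.
have r0 : rho <= 0 by nia.
have r1 : rho * K <= 0 by nia.
have [k1|k1] : 1 <= k \/ k <= 0 by lia.
  have : M' <= k * M' by nia.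
  lia.
have [k2|/eqP k2] : k <= -1 \/ k == 0 by lia.
  have : k * M' <= - M' by nia.
  lia.
by rewrite k2 in hn e2 *; lia.
Qed.

Definition delB (a b : nat) : int := if (a < b)%N then ((b - a) * Q)%N else 0.

Lemma modeB_hom a t b t' n : (a < m)%N -> (b < m)%N -> (t <= Q)%N -> (t' <= Q)%N ->
  n != 0 \/ t'%:Z - t%:Z - delB a b < 0 ->
  hom_coh0 n (BB a (wt2 i 0 (- t%:Z))) (BB b (wt2 i 0 (- t'%:Z))).
Proof.
move=> ar br tQ tQ' hn; apply: (chain_hom f0 hline hsep ar br) => k s en smin w.
have em : (maxn a b < m)%N by rewrite gtn_max ar.
have eA : wA (if (a < b)%N then gD b - gD a else 0) = 0.
  by case: ifP => _; rewrite ?gdBE // ?(ltnW ar) ?(ltnW br) // !wcE; lia.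
have eB : wB (if (a < b)%N then gD b - gD a else 0) = delB a b.
  rewrite /delB; case: ifP => ab; rewrite ?gdBE ?(ltnW ar) ?(ltnW br) // !wcE //.
  have -> : (b * Q = (b - a) * Q + a * Q)%N by rewrite -mulnDl subnK // ltnW.
  lia.
have sm : (s <= m)%N by lia.
have ewA : wA w = 0 by rewrite /w !wcE eA gdBE // !wcE; lia.
have ewB : wB w = t' %:Z - t%:Z + k * M%:Z - delB a b - (s * Q)%N%:Z.
  by rewrite /w !wcE eB gdBE // !wcE; lia.
have ecA : wA (w - (chi - gD (maxn a b))) = wA w by rewrite (gdBE (ltnW em)) !wcE; lia.
have ecB : wB (w - (chi - gD (maxn a b))) = wB w - (M%:Z - (maxn a b * Q)%N%:Z).
  by rewrite (gdBE (ltnW em)) !wcE; lia.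
clearbody w; have dpos : 0 <= delB a b by rewrite /delB; case: ifP.
have hn' : k != 0 \/ t'%:Z - t%:Z - delB a b < 0.
  by case: hn => [n0|]; [left; apply: contra_neq n0 => k0; rewrite en k0 mul0r|right].
have ds : delB a b + (s * Q)%N%:Z + Q%:Z <= (maxn a b * Q)%N%:Z.
  rewrite -addrA; have -> : (s * Q)%N%:Z + Q%:Z = (s.+1 * Q)%N%:Z by rewrite mulSn; lia.
  rewrite /delB; case: ifP => ab; first by rewrite -PoszD lez_nat -mulnDl leq_mul2r; lia.
  by rewrite add0r lez_nat leq_mul2r; lia.
have mM : (maxn a b * Q)%N%:Z <= M%:Z by rewrite lez_nat /topB leq_mul2r; lia.
have sr : (s.+1 < m)%N by lia.
move=> /(supp_k sr)[rho [e1 e2]]; apply/(supp_k sr); exists 0.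
rewrite ecA ecB ewA !mul0r subr0 addr0; split=> //; rewrite ewA in e1; rewrite ewB in e2 *.
move: (s * Q)%N (maxn a b * Q)%N ds mM ewB ecB e2 => A B' ds mM ewB ecB e2.
apply: (modeB_arith (K := Q%:Z) (rho := rho) _ _ _ dpos _ ds _ _ mM hn' e1 e2); clear -tQ tQ' Q0 QM; lia.
Qed.

(** Modulo x each factor is a nonzero multiple of y^Q. This presents f inside (x, y^t) for all t <=
    M, as the Koszul factorisations require. *)
Lemma f_modx : exists c A, [/\ c != 0, has_weight G (chi - wt2 i 1 0) A & f = x * A + c *: y ^+ M].
Proof.
have [c [A [c0 e]]] : exists c A, c != 0 /\ f = x * A + c *: y ^+ M.
  rewrite ff /topB; have : forall k, (k < m)%N -> exists c q, c != 0 /\ l k = c *: y ^+ Q + x * q by [].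
  elim: (m) => [|k IH] H.
    by exists 1, 0; rewrite big_geq // mulr0 add0r mul0n expr0 scale1r oner_neq0.
  rewrite big_nat_recr //=; have [|c [A [c0 ->]]] := IH; first by move=> t tk; exact/H/ltnW.
  have [c' [q [c0' ->]]] := H k (ltnSn k).
  exists (c * c'), (A * (c' *: y ^+ Q + x * q) + c *: y ^+ (k * Q) * q); split; first exact: mulf_neq0.
  rewrite mulSn addnC exprD -!mul_mpolyC mpolyCM; ring.
exists c, A; split=> //; apply: (homog_quot Gsub x0 hx (c := f - c *: y ^+ M)); last by rewrite e addrK.
apply: has_weightD.
  have := weq_weight fw (has_weight_prod Gsub hw 0 m).
  by rewrite -ff.
by apply: has_weightN; apply: has_weightZ; apply: (weq_weight (weq_sym Hchi)); exact: hyn.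
Qed.

Context (cf : R[i]) (A0 : S).
Hypothesis cf0 : cf != 0.
Hypothesis hA0 : has_weight G (chi - wt2 i 1 0) A0.
Hypothesis fA : f = x * A0 + cf *: y ^+ M.

(** Modulo x a form is a multiple of a single power y^e, whose exponent can be read off from the
    weight. *)
Lemma in_xy v (p : S) t : has_weight G v p ->
  (forall (r : int) (e : nat), wA v = r * P -> wB v + r * Q = e -> (t <= e)%N) -> gen2 x (y ^+ t) p.
Proof.
move=> hp H; have [[q ->]|[r [e [c [q [e1 e2 ->]]]]]] := modx Gsub ij P0 Q0 Hchi HG hp.
  by exists q, 0; rewrite mulr0 addr0.
exists q, (c *: y ^+ (e - t)); rewrite addrC -scalerAr -exprD subnKC //.
exact: H e1 e2.
Qed.

Let hB t : has_weight G (chi - wt2 i 0 (minn t M)) (cf *: y ^+ (M - minn t M)).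
Proof.
apply: has_weightZ; apply: (weq_weight _ (hyn _)).
apply/(weqE Gsub ij P0 Q0 Hchi HG); exists 0; rewrite !wcE; split; first lia.
by have := geq_minr t M; lia.
Qed.

Let fK t : f = x * A0 + y ^+ minn t M * (cf *: y ^+ (M - minn t M)).
Proof. by rewrite -scalerAr -exprD subnKC ?geq_minr. Qed.

Let regK t : forall q r, y ^+ minn t M * q = x * r -> exists p, q = x * p.
Proof.
move=> q r e; apply: (@cop_xy _ _ Gsub _ _ _ _ _ _ ij P0 Q0 Hchi HG (minn t M)).
by exists r.
Qed.

(** Normalised so that the last Koszul generator has the weight (1 - a, M - Q - 1) for every t;
    detection then gives S/(x, y^t) in one and the same weight for all t. *)
Let uN a t : weight := wt2 i (- a%:Z) (M%:Z - Q%:Z - 1 - (minn t M)%:Z).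

Definition NK a t : mf G f := koszul (uN a t) hx (hyn (minn t M)) hA0 (hB t) (fK t).

(** Without the shift, the maps between neighbouring values of a would sit in degree 1; it brings
    them to degree 0. *)
Definition NN a t : mf G f := shiftn (- a%:Z) (NK a t).

Lemma NK_to n X a t (phi : 'M[S]_(rk (NK a t), rk X)) : closed_hom n (Y := NK a t) phi ->
  (forall (c : 'I_(rk X)) (k : int), pos c + n = k * 2 ->
     forall (r : int) (e : nat), wA (wt c) + a%:Z = r * P ->
       wB (wt c) - (M%:Z - Q%:Z - 1 - (minn t M)%:Z) + k * M + r * Q = e -> (minn t M <= e)%N) ->
  exact_hom n (Y := NK a t) phi.
Proof.
move=> hphi H; apply: (koszul_to Gsub x0 (@regK t) hphi) => c.
have [->|[k [ek hk]]] := (hphi.1) (lshift _ (lshift _ 0)) c; first by exists 0, 0; rewrite !mulr0 addr0.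
move: ek hk; rewrite /= !split_lshift => ek hk; apply: (in_xy hk) => r e e1 e2.
apply: (H c k _ r e); first by rewrite ek; lia.
  by rewrite -e1 !wcE; lia.
by rewrite -e2 !wcE; lia.
Qed.

(** A pure power of y in the top row would need a to be a multiple of P, excluded by 0 < a < P. *)
Lemma hom_to_NN n X a t : (0 < a)%N -> (a < P)%N -> (forall c : 'I_(rk X), wA (wt c) = 0) ->
  hom_coh0 n X (NN a t).
Proof.
move=> a0 aP hX; apply/hom_coh0_shr => phi hphi; apply: (NK_to hphi) => c k _ r e.
rewrite hX add0r => er; have r0 : 0 < r by nia.
have : P%:Z <= r * P by nia.
lia.
Qed.

Definition inN (a t : nat) := [&& (0 < a)%N, (a < P)%N, (0 < t)%N & (t < M)%N].

Lemma NN_hom n a1 t1 a2 t2 : inN a1 t1 -> inN a2 t2 ->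
  n != 0 \/ (a1 < a2)%N \/ (a1 = a2 /\ (t2 < t1)%N) -> hom_coh0 n (NN a1 t1) (NN a2 t2).
Proof.
move=> /and4P[a10 a1P t10 t1M] /and4P[a20 a2P t20 t2M] hn.
apply/hom_coh0_shl/hom_coh0_shr => phi hphi; apply: (NK_to hphi) => c k ek r e.
have e1 : minn t1 M = t1 by apply/minn_idPl/ltnW.
have e2 : minn t2 M = t2 by apply/minn_idPl/ltnW.
have kM := mult_cases M k.
(* Each of the four Koszul generators gives one numerical condition. The x-weights differ by less
   than P, so r = 0 and a2 equals a1 or a1 - 1. *)
have rP b := @small_mult P b r.
rewrite e2; have [[p1 ->]|[p1 ->]|[p1 ->]|[p1 ->]] := basisK_cases c; move: ek; rewrite p1 /uN e1 !wcE => ek ea eb.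
- have [r0 aa] : r = 0 /\ a2%:Z - a1%:Z = 0 by apply: rP; lia.
  rewrite r0 in eb; have nk : n = k * 2 by lia.
  have kn : n != 0 -> k != 0 by apply: contra_neq => k0; rewrite nk k0 mul0r.
  by case: hn => [/kn|]; lia.
- have [r0 aa] : r = 0 /\ a2%:Z - a1%:Z + 1 = 0 by apply: rP; lia.
  rewrite r0 in eb; have nk : n = k * 2 by lia.
  have kn : n != 0 -> k != 0 by apply: contra_neq => k0; rewrite nk k0 mul0r.
  by case: hn => [/kn|]; lia.
- have [r0 aa] : r = 0 /\ a2%:Z - a1%:Z = 0 by apply: rP; lia.
  by rewrite r0 in eb; lia.
have [r0 aa] : r = 0 /\ a2%:Z - a1%:Z + 1 = 0 by apply: rP; lia.
by rewrite r0 in eb; lia.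
Qed.

Let wdeg_chi : 0 < wdeg i 0 M P Q chi.
Proof. by rewrite /wdeg !wcE; nia. Qed.

Let S0 c : has_weight G 0 c -> exists a : R[i], c = a%:MP.
Proof. by apply: (weight0_const Gsub ij P0 Q0 Hchi HG); rewrite /wdeg !wcE; lia. Qed.

Let vX k : vanish0 ('X_k : S).
Proof.
rewrite /vanish0 mcoeffX; case: eqP => // /(congr1 (fun m : 'X_{1..2} => m k)).
by rewrite !mnmE eqxx.
Qed.

Let vyn (c : R[i]) (e : nat) : (0 < e)%N -> vanish0 (c *: y ^+ e).
Proof.
move=> e0; rewrite /vanish0 mcoeffZ -(prednK e0) exprS mcoeff0M.
by rewrite (vX j) mul0r mulr0.
Qed.

Lemma A0_vanish : vanish0 A0.
Proof.
have hg := wdeg_mon Gsub ij P0 Q0 Hchi HG.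
rewrite /vanish0; apply/eqP; rewrite -[_ == 0]negbK -mcoeff_msupp; apply/negP => h.
have /has_weightP/(_ _ h)/hg := hA0; rewrite !mnmE !muln0 /wdeg !wcE; nia.
Qed.

Lemma NK_not_contractible a t : inN a t ->
  ~ exact_hom 0 (X := NK a t) (Y := NK a t) 1%:M.
Proof.
move=> /and4P[a0 aP t0 tM]; have et : minn t M = t by apply/minn_idPl/ltnW.
have z0 := hideal0 (vanish0_hideal G).
have zN (p : S) : vanish0 p -> vanish0 (- p) by rewrite /vanish0 mcoeffN => ->; rewrite oppr0.
have vy : vanish0 (y ^+ minn t M) by rewrite et -[_ ^+ _]scale1r; exact: vyn.
have vB : vanish0 (cf *: y ^+ (M - minn t M)) by rewrite et; apply: vyn; rewrite subn_gt0.
have e c d : vanish0 (mx_koszul x (y ^+ minn t M) A0 (cf *: y ^+ (M - minn t M)) c d).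
  rewrite /mx_koszul /mx_pair /mx_sgn /block_mx /col_mx /row_mx !mxE.
  have vA := A0_vanish; have vx := vX i; have vyN := zN (y ^+ minn t M) vy; have vBN := zN _ vB.
  by case: split => k; rewrite mxE; case: split => k'; rewrite !mxE; case: split => k1; rewrite !mxE; case: split => k2; rewrite ?mxE ?ord1 ?eqxx ?mulr1n.
by apply: (@not_contractible _ _ _ (NK a t) (lshift _ (lshift _ 0))) => c; exact: e.
Qed.

Lemma NN_exceptional a t : inN a t -> exceptional (NN a t).
Proof.
move=> hN; have /and4P[a0 aP t0 tM] := hN; have et : minn t M = t by apply/minn_idPl/ltnW.
have sh (psi : 'M[S]_(rk (NK a t))) : exact_hom 0 (X := NN a t) (Y := NN a t) psi <-> exact_hom 0 (X := NK a t) (Y := NK a t) psi.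
  by split=> [/exact_shl/exact_shr|h]; [|apply/exact_shl/exact_shr]; rewrite sub0r opprK subrr.
split; first by move=> n n0; apply: NN_hom => //; left.
  by move=> /sh; exact: NK_not_contractible.
move=> phi hphi; have hK : closed_hom 0 (X := NK a t) (Y := NK a t) phi.
  by move: hphi => /closed_shl/closed_shr; rewrite sub0r opprK subrr.
pose o : 'I_(rk (NK a t)) := lshift _ (lshift _ 0).
have po : pos o = 0 by rewrite /= !split_lshift.
have wo : wt o = uN a t by rewrite /= !split_lshift.
have [c ec] : exists c : R[i], phi o o = c%:MP.
  apply: S0; have [->|[k [ek hk]]] := hK.1 o o; first exact: has_weight0.
  have k0 : k = 0 by move: ek; rewrite po; lia.
  by move: hk; rewrite k0 mulr0z addr0 subrr => hk.
exists c; apply/sh; pose psi : 'M[S]_(rk (NK a t)) := phi - (c%:MP)%:M.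
have hpsi : closed_hom 0 (X := NK a t) (Y := NK a t) psi.
  refine (closedB hK _); have := closed_scalar (NK a t) (erefl (0 : int)) c.
  by rewrite scalemx1.
apply: (koszul_to Gsub x0 (@regK t) hpsi) => d.
have [->|ndo] := eqVneq d o.
  have -> : psi (lshift _ (lshift _ 0)) o = 0 by rewrite !mxE eqxx mulr1n ec subrr.
  by exists 0, 0; rewrite !mulr0 addr0.
have -> : psi (lshift _ (lshift _ 0)) d = phi o d.
  by rewrite !mxE eq_sym (negPf ndo) mulr0n subr0.
have [->|[k [ek hk]]] := hK.1 o d; first by exists 0, 0; rewrite !mulr0 addr0.
move: ek hk; rewrite po wo => ek hk; apply: (in_xy hk) => r e e1 e2.
have rP b := @small_mult P b r.
have kM := mult_cases M k.
rewrite et; have [[p1 w1]|[p1 w1]|[p1 w1]|[p1 w1]] := basisK_cases d; move: ek e1 e2; rewrite p1 w1 /uN et !wcE => ek ea eb.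
- case/eqP: ndo; move: p1 w1; rewrite /=; case: splitP => k1 /=; case: splitP => k2 //= e3 e4 _ _.
  by apply: val_inj; rewrite /= e4 e3 ord1.
- have [r0 aa] : r = 0 /\ (1 : int) = 0 by apply: rP; lia.
  by [].
- have [r0 aa] : r = 0 /\ (0 : int) = 0 by apply: rP; lia.
  by rewrite r0 in eb; lia.
have [r0 aa] : r = 0 /\ (1 : int) = 0 by apply: rP; lia.
by [].
Qed.

Let wdeg_high v p t : has_weight G v p -> P%:Z * (minn t M)%:Z <= wdeg i 0 M P Q v ->
  gen2 x (y ^+ minn t M) p.
Proof.
move=> hp hD; apply: (in_xy hp) => r e e1 e2; move: hD; rewrite /wdeg e1 => hD.
have : P%:Z * (minn t M)%:Z <= P%:Z * e by rewrite -e2; lia.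
by rewrite ler_pM2l //; lia.
Qed.

Lemma NN_bounded a t : bounded_from (NN a t).
Proof.
move=> Y; have [N hN] := vec_high G f0 (wdegD i 0 M P Q) wdeg_chi (mf_basis Y) (uN a t + wt2 i 0 (minn t M) + wt2 i 1 0) (P%:Z * (minn t M)%:Z).
exists (N + 2)%N => n hn; apply/hom_coh0_shl; apply: (koszul_from Gsub x0 (@regK t)) => v hv _.
have [|q [r e]] := (vec_gen2 x (y ^+ minn t M) v).1.
  move=> k; have [|->|[w [h1 h2]]] := hN (n - - a%:Z - 1 - 1) v _ hv k; first by lia.
    by exists 0, 0; rewrite !mulr0 addr0.
  exact: wdeg_high h1 h2.
by exists 0, q, r; rewrite mulmx0 add0r.
Qed.

Lemma gk_modx k : (k <= m)%N -> exists c q, c != 0 /\ gk l k = c *: y ^+ (k * Q) + x * q.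
Proof.
elim: k => [|k IH] km.
  by exists 1, 0; rewrite /gk big_geq // mulr0 addr0 mul0n expr0 scale1r oner_neq0.
have [|c [A [c0 e]]] := IH; first exact: ltnW.
have [c' [q [c0' e']]] := lkx km.
rewrite /gk big_nat_recr //= -/(gk l k) e e'.
exists (c * c'), (A * (c' *: y ^+ Q + x * q) + c *: y ^+ (k * Q) * q); split; first exact: mulf_neq0.
rewrite mulSn addnC exprD -!mul_mpolyC mpolyCM; ring.
Qed.

Local Notation BR k s := (BB k (wt2 i 0 (- s%:Z))).

(** The case excluded by the second condition, n = 1 with k = m - 1 and s = 0, is the obstruction
    that leads to [glue]. *)
Lemma NN_hom_B n a t k s : inN a t -> (k < m)%N -> (s <= Q)%N ->
  n != 0 \/ (k.+1 = m /\ s = 0%N) -> (k.+1 < m)%N \/ (0 < s)%N \/ n != 1 ->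
  hom_coh0 n (NN a t) (BR k s).
Proof.
move=> /and4P[a0 aP t0 tM] km sQ h1 h2; have et : minn t M = t by apply/minn_idPl/ltnW.
apply/hom_coh0_shl; apply: (koszul_from Gsub x0 (@regK t)) => v; rewrite -[v]vsubmxK.
move: (usubmx v) (dsubmx v) => c0 c1 /(rank1_vec f0)[H0 H1] _.
have kQ : (k * Q + Q <= M)%N by rewrite /topB -mulSnr leq_mul2r; lia.
have kQ' : (k.+1 < m)%N -> (k * Q + Q + Q <= M)%N by move=> k2; rewrite /topB -!mulSnr leq_mul2r; lia.
have kQ0 : k.+1 = m -> (k * Q + Q = M)%N by rewrite /topB -mulSnr => ->.
have rP (r : int) : 1 - a%:Z = r * P -> r = 0 /\ 1 - a%:Z = 0 by apply: small_mult; lia.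
have [p [q [r E0]]] : exists p q r, c0 0 0 = gk l k * p + (x * q + y ^+ minn t M * r).
  case: H0 => [->|[d [ed hd]]]; first by exists 0, 0, 0; rewrite !mulr0 !addr0.
  have [[q ->]|[r [e [c [q [e1 e2 ->]]]]]] := modx Gsub ij P0 Q0 Hchi HG hd.
    by exists 0, q, 0; rewrite !mulr0 addr0 add0r.
  have dM := mult_cases M d.
  move: e1 e2; rewrite /uN et !wcE => e1 e2; have [r0 a1] : r = 0 /\ 1 - a%:Z = 0 by apply: rP; lia.
  rewrite r0 in e2; have [te|te] := leqP t e.
    exists 0, q, (c *: y ^+ (e - t)).
    by rewrite mulr0 add0r -scalerAr -exprD subnKC // addrC.
  have ke : (k * Q <= e)%N.
    have d00 : d = 0 by move: dM => [//|[]]; lia.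
    have n1 : n = 1 by lia.
    by case: h2 => [/kQ'|[]]; lia.
  have [c' [q' [c0' eg]]] := gk_modx (ltnW km).
  (* Here n = 1 and y^e is not in (x, y^t). But e >= k Q, and modulo x the form g_k is a nonzero
     multiple of y^(kQ), so y^e lies in (g_k, x). *)
  exists ((c / c') *: y ^+ (e - k * Q)), (q - (c / c') *: (q' * y ^+ (e - k * Q))), 0.
  rewrite eg mulr0 addr0 -(subnKC ke) exprD addKn -!mul_mpolyC.
  have -> : c%:MP = (c / c')%:MP * c'%:MP :> S by rewrite -mpolyCM divfK.
  ring.
have [q1 [r1 E1]] : gen2 x (y ^+ minn t M) (c1 0 0).
  case: H1 => [->|[d [ed hd]]]; first by exists 0, 0; rewrite !mulr0 !addr0.
  apply: (in_xy hd) => r' e; rewrite /uN et gdBE ?(ltnW km) // !wcE => e1 e2.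
  have dM := mult_cases M d.
  have [r0 a1] : r' = 0 /\ 1 - a%:Z = 0 by apply: rP; lia.
  rewrite r0 in e2; have nd : n = d * 2 by lia.
  case: dM => [d00|[dp|dn]]; [|lia|lia].
  case: h1 => [|[/kQ0 k1 s0]]; last lia.
  by rewrite nd d00 mul0r eqxx.
exists (col_mx 0 p%:M), (col_mx q%:M q1%:M), (col_mx r%:M r1%:M).
exact: (pair_combo (hk m l k) E0 E1).
Qed.

(** Since g_0 = 1, everything is zero modulo it. *)
Lemma B0_from n u Y : hom_coh0 n (BB 0 u) Y.
Proof.
apply: rank1_from => // v _ _; exists 0, v; rewrite mulmx0 add0r /gk big_geq //.
by rewrite scale1r.
Qed.

Lemma BR_bounded k s : (k < m)%N -> bounded_from (BR k s).
Proof.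
move=> km; apply: (chain_bounded Gsub f0 hw l1 d0 hline hsep ff fw (deg := wdeg i 0 M P Q) (D := P%:Z * (M%:Z + Q%:Z))) => //.
  exact: wdegD.
move=> t w sa hD.
have ecA : wA (w - (chi - gD k)) = wA w by rewrite (gdBE (ltnW km)) !wcE; lia.
have ecB : wB w - M%:Z <= wB (w - (chi - gD k)).
  by rewrite (gdBE (ltnW km)) !wcE; move: (k * Q)%N => X; lia.
move: hD; rewrite /wdeg => hD; have sr : (t.+1 < m)%N by lia.
move=> _; apply/(supp_k sr); exists (wA w %/ P)%Z; rewrite ecA.
have eP := divz_eq (wA w) P; have lP := ltz_pmod (wA w) (d := P%:Z) ltac:(by rewrite ltz_nat).
have gP := modz_ge0 (wA w) (d := P%:Z) ltac:(by lia).
move: eP lP gP hD ecB; move: (wA w %/ P)%Z (wA w %% P)%Z => q e eP lP gP hD ecB; split; first lia.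
suff : M%:Z <= wB w + q * Q by lia.
have : P%:Z * M <= P%:Z * (wB w + q * Q) by rewrite eP in hD; nia.
by rewrite ler_pM2l //; lia.
Qed.

Lemma BR_exceptional k s : (0 < k)%N -> (k < m)%N -> (s <= Q)%N -> exceptional (BR k s).
Proof.
move=> k0 km sQ; apply: rank1_exceptional => //.
- rewrite /gk big_ltn // mulrC; exact: (hidealM (vanish0_hideal G) _ (vl m0)).
- rewrite /hk big_ltn // mulrC; exact: (hidealM (vanish0_hideal G) _ (vl km)).
- by move=> n n0; apply: modeB_hom => //; left.
Qed.

Definition ee b a : S := \prod_(b <= t < a) l t.

Lemma delB_pos a b : (a < b)%N -> 0 < delB a b.
Proof. by rewrite /delB => ab; rewrite ab; nia. Qed.

(** * The cone that replaces the last untwisted rank-one factorisation *)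

Section Glue.
Hypothesis m2 : (1 < m)%N.
Local Notation U := (BR m.-1 0).
Local Notation V1 := (BR m.-2 0).
Local Notation V2 := (BR m.-1 1).
Local Notation V := (mf_sum V1 V2).
Let um : (m.-1 < m)%N. Proof. by rewrite prednK. Qed.
Let vm : (m.-2 < m)%N. Proof. by lia. Qed.

Let mc a b s t c (ba : (b <= a)%N) (am : (a < m)%N) :
  has_weight G (wt2 i 0 (- s%:Z) - wt2 i 0 (- t%:Z)) c ->
  closed_hom 0 (X := BR a s) (Y := BR b t) (dmx c (c * ee b a)).
Proof. exact: (mult_closed Gsub f0 _ _ _ _ _ _ (gk_split l ba) (hk_split l ba (ltnW am))). Qed.

Let mof a b s t (ba : (b <= a)%N) (am : (a < m)%N) (phi : 'M[S]_(rk (BR b t), rk (BR a s))) :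
  closed_hom 0 (X := BR a s) (Y := BR b t) phi ->
  exists c, has_weight G (wt2 i 0 (- s%:Z) - wt2 i 0 (- t%:Z)) c /\
    exact_hom 0 (X := BR a s) (Y := BR b t) (phi - dmx c (c * ee b a)).
Proof. exact: (mult_of Gsub f0 (gk_split l ba) (hk_split l ba (ltnW am))). Qed.

Let mex a b s t c (ba : (b <= a)%N) (am : (a < m)%N) :
  has_weight G (wt2 i 0 (- s%:Z) - wt2 i 0 (- t%:Z)) c -> gen2 (gk l b) (hk m l a) c ->
  exact_hom 0 (X := BR a s) (Y := BR b t) (dmx c (c * ee b a)).
Proof. exact: (mult_exact Gsub f0 _ _ _ _ _ _ (gk_split l ba) (hk_split l ba (ltnW am))). Qed.

Let mexi a b s t c (ba : (b <= a)%N) (am : (a < m)%N) :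
  exact_hom 0 (X := BR a s) (Y := BR b t) (dmx c (c * ee b a)) -> gen2 (gk l b) (hk m l a) c.
Proof. exact: (mult_exact_inv f0 (gk_split l ba) (hk_split l ba (ltnW am))). Qed.

Let w11 : has_weight G (wt2 i 0 (- 0%N%:Z) - wt2 i 0 (- 0%N%:Z)) 1.
Proof. by rewrite subrr; exact: has_weight1. Qed.

Let wy : has_weight G (wt2 i 0 (- 0%N%:Z) - wt2 i 0 (- 1%N%:Z)) y.
Proof. by rewrite wt2N wt2D; exact: hy. Qed.

Let phi1 : 'M[S]_(rk V1, rk U) := dmx 1 (1 * ee m.-2 m.-1).
Let phi2 : 'M[S]_(rk V2, rk U) := dmx y (y * ee m.-1 m.-1).
Let vu : (m.-2 <= m.-1)%N. Proof. by lia. Qed.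

Definition gphi : 'M[S]_(rk V, rk U) := col_mx phi1 phi2.

Lemma gphi_closed : closed_hom 0 (X := U) (Y := V) gphi.
Proof.
have [_ _ i1 i2] := sum_incl_proj V1 V2.
rewrite /gphi col_incl.
exact: (closedD (closed0M Gsub i1 (mc vu um w11)) (closed0M Gsub i2 (mc (leqnn _) um wy))).
Qed.

(* Hom^1 (NN a t, U) need not vanish, so that U = BR m.-1 0 itself cannot belong to
   a strong collection. It is replaced by the cone of (1, y) : U -> V1 (+) V2. *)
Definition glue : mf G f := mf_cone gphi_closed.

Definition notU k s := (k.+1 < m)%N \/ (0 < s)%N.

Lemma to_U n k s : (k < m)%N -> (s <= Q)%N -> notU k s -> hom_coh0 n (BR k s) U.
Proof.
move=> km sQ h; apply: modeB_hom => //; right.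
have dp : 0 <= delB k m.-1 by rewrite /delB; case: ifP.
have [s0|s0] := posnP s; last by clear -s0 dp; lia.
case: h => [k1|]; last by rewrite s0.
have : 0 < delB k m.-1 by apply: delB_pos; lia.
by rewrite s0; lia.
Qed.

Lemma from_V n k s : (k < m)%N -> (s <= Q)%N -> n != 0 -> hom_coh0 n V (BR k s).
Proof. by move=> km sQ n0; apply/sum_from => //; split; apply: modeB_hom => //; try lia; left. Qed.

(** For s = 0 the map passes through V1. For s > 0 it is multiplication by some c in (y, l_(m-1)):
    the y-part passes through V2, and the other part is exact since h_(m-1) = l_(m-1). *)
Lemma gphi_factor k s (Y := BR k s) (a' : 'M[S]_(rk Y, rk U)) : (k < m)%N -> (s <= Q)%N -> notU k s ->
  closed_hom 0 (X := U) (Y := Y) a' ->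
  exists2 b' : 'M[S]_(rk Y, rk V), closed_hom 0 (X := V) (Y := Y) b'
    & exact_hom 0 (X := U) (Y := Y) (a' - b' *m gphi).
Proof.
move=> km sQ nU ha; have km1 : (k <= m.-1)%N by lia.
have [p1 p2 _ _] := sum_incl_proj V1 V2.
have [c [hc ec]] := mof km1 um ha.
have [s0|s0] := posnP s.
  have k1 : (k <= m.-2)%N by case: nU; lia.
  exists (dmx c (c * ee k m.-2) *m row_mx 1%:M 0); first by exact: (closedM0 Gsub (mc k1 vm hc) p1).
  rewrite /gphi row_col1 dmxM mulr1 mul1r -mulrA.
  by have -> : ee k m.-2 * ee m.-2 m.-1 = ee k m.-1 by rewrite /ee -big_cat_nat.
(* Modulo y the last factor is x^P up to a constant. A monomial of weight (0, s) with s > 0 contains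
   either y or x^P. *)
have [d [r er]] : gen2 y (l m.-1) c.
  have H : gen2 y (x ^+ P) c; last first.
    have sw (u v p : S) : gen2 u v p -> gen2 v u p by move=> [d [r ->]]; exists r, d; rewrite addrC.
    exact/sw/(lky um)/sw.
  have hJ := gen2_hideal Gsub hy (hxn P).
  rewrite [c]mpolyE big_seq; apply: (big_ind (gen2 y (x ^+ P))); [exact: (hideal0 hJ)|exact: (hidealD hJ)|].
  move=> t ht; rewrite -mul_mpolyC; apply: (hidealM hJ).
  have /has_weightP/(_ t ht)/(mon_weightE Gsub ij P0 Q0 Hchi HG)[r] := hc.
  rewrite !wcE => -[e1 e2]; rewrite (monE ij t) monX.
  have [tj|tj] := posnP (t j); last first.
    by exists (x ^+ t i * y ^+ (t j).-1), 0; rewrite mulr0 addr0 mulrCA -exprS prednK.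
  have Pt : (P <= t i)%N by have := mult_cases P r; have := mult_cases Q r; lia.
  by exists 0, (x ^+ (t i - P) * y ^+ t j); rewrite mulr0 add0r mulrA -exprD subnKC.
pose d' := wproj G (wt2 i 0 (- 1%N%:Z) - wt2 i 0 (- s%:Z)) d.
have hd' : has_weight G (wt2 i 0 (- 1%N%:Z) - wt2 i 0 (- s%:Z)) d' by exact: wproj_weight.
have [r' er'] : exists r', c = y * d' + l m.-1 * r'.
  exists (wproj G (wt2 i 0 (- 0%N%:Z) - wt2 i 0 (- s%:Z) - dl m.-1) r).
  rewrite -(wprojMl Gsub _ _ hy) -(wprojMl Gsub _ _ (hw m.-1)).
  have -> : wt2 i 0 1 + (wt2 i 0 (- 1%N%:Z) - wt2 i 0 (- s%:Z)) = wt2 i 0 (- 0%N%:Z) - wt2 i 0 (- s%:Z).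
    by rewrite !wt2N !wt2D; congr wt2; lia.
  by rewrite [dl _ + _]addrC subrK -linearD -er; apply/esym/wprojE.
exists (dmx d' (d' * ee k m.-1) *m row_mx 0 1%:M); first by exact: (closedM0 Gsub (mc km1 um hd') p2).
rewrite /gphi row_col2 dmxM.
have e1 : ee m.-1 m.-1 = 1 by rewrite /ee big_geq.
rewrite e1 mulr1.
have hcd : has_weight G (wt2 i 0 (- 0%N%:Z) - wt2 i 0 (- s%:Z)) (c - d' * y).
  apply: has_weightD => //; apply: has_weightN; rewrite mulrC.
  have -> : wt2 i 0 (- 0%N%:Z) - wt2 i 0 (- s%:Z) = wt2 i 0 1 + (wt2 i 0 (- 1%N%:Z) - wt2 i 0 (- s%:Z)).
    by rewrite !wt2N !wt2D; congr wt2; lia.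
  exact: (has_weightM Gsub).
rewrite (subr_split a' _ (dmx c (c * ee k m.-1))) dmxB.
have -> : c * ee k m.-1 - d' * ee k m.-1 * y = (c - d' * y) * ee k m.-1 by ring.
refine (exactD ec (mex km1 um hcd _)).
exists 0, r'; rewrite mulr0 add0r er' /hk big_ltn // big_geq ?prednK // mulr1.
by ring.
Qed.

Lemma glue_to n k s : (k < m)%N -> (s <= Q)%N -> notU k s -> n != 0 -> hom_coh0 n glue (BR k s).
Proof.
move=> km sQ nU n0; have [->|n1] := eqVneq n 1.
  refine (@cone_from R G f Gsub U V gphi gphi_closed 1 (BR k s) (from_V (n := 1) km sQ isT) _).
  have -> : (1 - 1 : int) = 0 by [].
  by move=> a' ha'; exact: (gphi_factor km sQ nU ha').
have n1' : n - 1 != 0 by rewrite subr_eq0.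
exact: (@cone_from0 R G f Gsub U V gphi gphi_closed n (BR k s) (from_V km sQ n0)
  (modeB_hom um km (leq0n Q) sQ (or_introl n1'))).
Qed.

Let row_gphi Y (b : 'M[S]_(rk Y, rk V)) :
  b *m gphi = b *m col_mx 1%:M 0 *m phi1 + b *m col_mx 0 1%:M *m phi2.
Proof. exact: col_mul_split. Qed.

Let glue_to0 Y : hom_coh0 (0 - 1) U Y ->
  (forall b : 'M[S]_(rk Y, rk V), closed_hom 0 (X := V) (Y := Y) b ->
     exact_hom 0 (X := U) (Y := Y) (b *m gphi) -> exact_hom 0 (X := V) (Y := Y) b) ->
  hom_coh0 0 glue Y.
Proof.
move=> hU hV th hth; have hb := cone_rsub hth.
have eth := hsubmxK (th : 'M_(rk Y, rk U + rk V)).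
have hth' := hth; rewrite -eth in hth'.
have ex : exact_hom 0 (X := U) (Y := Y) (rsubmx (th : 'M_(rk Y, rk U + rk V)) *m gphi).
  case: hth' => /hom_deg_row[da _]; rewrite hom_d_row -row_mx0 => /eq_row_mx[e _].
  exists (lsubmx (th : 'M_(rk Y, rk U + rk V))); first exact: da.
  by move/eqP: e; rewrite sgn0 scale1r subr_eq0 => /eqP.
have hloc (a' : 'M[S]_(rk Y, rk U)) : closed_hom (0 - 1) (X := U) (Y := Y) a' ->
    exists2 b' : 'M[S]_(rk Y, rk V), closed_hom (0 - 1) (X := V) (Y := Y) b'
      & exact_hom (0 - 1) (X := U) (Y := Y) (a' - b' *m gphi).
  by move=> ha'; exists 0; [exact: closed0|rewrite mul0mx subr0; exact: hU].
rewrite -eth; exact: (cone_from_local Gsub hth' (hV _ hb ex) hloc).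
Qed.

Let row_split Y (b : 'M[S]_(rk Y, rk V)) :
  b = b *m col_mx 1%:M 0 *m row_mx 1%:M 0 + b *m col_mx 0 1%:M *m row_mx 0 1%:M.
Proof. exact: row_incl. Qed.

Let glue_to0' k s : (k < m)%N -> (s <= Q)%N ->
  (forall b1 : 'M[S]_(rk (BR k s), rk V1), closed_hom 0 (X := V1) (Y := BR k s) b1 ->
   forall b2 : 'M[S]_(rk (BR k s), rk V2), closed_hom 0 (X := V2) (Y := BR k s) b2 ->
   exact_hom 0 (X := U) (Y := BR k s) (b1 *m phi1 + b2 *m phi2) ->
   exact_hom 0 (X := V1) (Y := BR k s) b1 /\ exact_hom 0 (X := V2) (Y := BR k s) b2) ->
  hom_coh0 0 glue (BR k s).
Proof.
move=> km sQ H; apply: glue_to0; first by apply: modeB_hom => //; left.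
have [p1 p2 i1 i2] := sum_incl_proj V1 V2.
move=> b hb; rewrite row_gphi => hex.
have [h1 h2] := H _ (closedM0 Gsub hb i1) _ (closedM0 Gsub hb i2) hex.
by rewrite (row_split b); refine (exactD (exactM0 Gsub h1 p1) (exactM0 Gsub h2 p2)).
Qed.

(** The power y^(t-1) is nonzero modulo (x, y^t); this is how a scalar is recognised to vanish. *)
Let xyQ_c (c : R[i]) t : (0 < t)%N -> (t <= Q)%N -> gen2 x (y ^+ t) (c%:MP * y ^+ t.-1) -> c = 0.
Proof.
move=> t0 tQ [q [r e]].
have [|d ed] := @cop_xy _ _ Gsub _ _ _ _ _ _ ij P0 Q0 Hchi HG t.-1 (c%:MP - y * r).
  by exists q; rewrite mulrBr mulrA -exprSr prednK // mulrC e addrK.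
have : vanish0 (c%:MP - y * r) by rewrite ed mulrC; exact: (hidealM (vanish0_hideal G) _ (vX i)).
rewrite /vanish0 mcoeffB mcoeffC eqxx mulr1 mcoeff0M.
by have := vX j; rewrite /vanish0 => ->; rewrite mul0r subr0.
Qed.

Let gh_xyQ k a c : (0 < k)%N -> (k < m)%N -> (a < m)%N -> gen2 (gk l k) (hk m l a) c -> gen2 x (y ^+ Q) c.
Proof.
move=> k0 km am; have hJ := gen2_hideal Gsub hx (hyn Q).
have hl t : (t < m)%N -> gen2 x (y ^+ Q) (l t).
  by move=> tm; have [c' [q [_ ->]]] := lkx tm; exists q, c'%:MP; rewrite -mul_mpolyC; ring.
have h1 : gen2 x (y ^+ Q) (gk l k) by rewrite /gk big_ltn // mulrC; apply: (hidealM hJ); exact: hl.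
have h2 : gen2 x (y ^+ Q) (hk m l a) by rewrite /hk big_ltn // mulrC; apply: (hidealM hJ); exact: hl.
by move=> [q [r ->]]; apply: (hidealD hJ); rewrite mulrC; exact: (hidealM hJ).
Qed.

(** A map from V whose composite with [gphi] is exact must be exact: its V2-component always is, and
    its V1-component is a scalar multiple of a map that stays nonzero on U. *)
Lemma glue_to_first n k : (k.+1 < m)%N -> hom_coh0 n glue (BR k 0).
Proof.
move=> k1; have km : (k < m)%N by exact: ltnW.
have [->|n0] := eqVneq n 0; last by apply: glue_to => //; left.
case: (posnP k) => [k0|k0].
  rewrite k0; have h0 a n' : (a < m)%N -> forall s, hom_coh0 n' (BR a s) (BR 0 0).
    by move=> am s; apply: (chain_hom f0 hline hsep am m0) => ? ? _; rewrite minn0.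
  have hV : hom_coh0 0 V (BR 0 0) by apply/sum_from => //; split; exact: h0.
  exact: (@cone_from0 R G f Gsub U V gphi gphi_closed 0 (BR 0 0) hV (h0 _ _ um 0%N)).
refine (glue_to0' km (leq0n Q) _) => b1 hb1 b2 hb2 hex.
have h2 : exact_hom 0 (X := V2) (Y := BR k 0) b2.
  have dp : 0 <= delB m.-1 k by rewrite /delB; case: ifP.
  have lt : 0%N%:Z - 1%N%:Z - delB m.-1 k < 0 by clear -dp; lia.
  exact: (modeB_hom um km Q0 (leq0n Q) (or_intror lt) hb2).
refine (conj _ h2); have kv : (k <= m.-2)%N by lia.
have [c [hc ec]] := mof kv vm hb1.
have [d ed] : exists d : R[i], c = d%:MP by apply: S0; move: hc; rewrite subrr.
have h12 : exact_hom 0 (X := V1) (Y := BR k 0) (b1 - dmx c (c * ee k m.-2)) := ec.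
have hk2 : exact_hom 0 (X := U) (Y := BR k 0) (dmx c (c * ee k m.-1)).
  have -> : dmx c (c * ee k m.-1) = dmx c (c * ee k m.-2) *m phi1.
    rewrite dmxM mulr1 mul1r -mulrA; congr (dmx c (c * _)); rewrite /ee -big_cat_nat //; lia.
  rewrite (mul_combo b1 _ phi1 (b2 *m phi2)).
  refine (exactB (exactB hex _) _).
    exact: (exactM0 Gsub h2 (mc (leqnn _) um wy)).
  exact: (exactM0 Gsub h12 (mc vu um w11)).
have km1 : (k <= m.-1)%N by lia.
have := gh_xyQ k0 km um (mexi km1 um hk2); rewrite ed => hg.
(* Both g_k and h_(m-1) lie in (x, y^Q), which contains no nonzero constant. *)
have d0' : d = 0.
  have hv : gen2 x (y ^+ 1) (d%:MP * y ^+ 0).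
    case: hg => q [r e]; exists q, (y ^+ Q.-1 * r); rewrite expr0 mulr1 e expr1 mulrA -exprS prednK //.
  exact: (xyQ_c (t := 1%N)) hv.
move: h12; rewrite ed d0' mpolyC0 mul0r /dmx !raddf0 block_mx0 subr0; exact.
Qed.

(** As for [glue_to_first], with the components exchanged. The scalar now multiplies y, which is not
    in (x, y^Q); here Q > 1 is decisive. *)
Lemma glue_to_V2 n : hom_coh0 n glue V2.
Proof.
have [->|n0] := eqVneq n 0; last by apply: (glue_to um Q0 _ n0); right.
refine (glue_to0' um Q0 _) => b1 hb1 b2 hb2 hex.
have h1 : exact_hom 0 (X := V1) (Y := V2) b1.
  have lt : 1%N%:Z - 0%N%:Z - delB m.-2 m.-1 < 0.
    have v_u : (m.-2 < m.-1)%N by lia.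
    have e1 : (m.-1 - m.-2 = 1)%N by lia.
    by rewrite /delB v_u e1 mul1n; clear -Q1; lia.
  exact: (modeB_hom vm um (leq0n Q) Q0 (or_intror lt) hb1).
refine (conj h1 _).
have [c [hc ec]] := mof (leqnn _) um hb2.
have [d ed] : exists d : R[i], c = d%:MP by apply: S0; move: hc; rewrite subrr.
have e1 : ee m.-1 m.-1 = 1 by rewrite /ee big_geq.
have hk2 : exact_hom 0 (X := U) (Y := V2) (dmx (c * y) (c * y * ee m.-1 m.-1)).
  have -> : dmx (c * y) (c * y * ee m.-1 m.-1) = dmx c (c * ee m.-1 m.-1) *m phi2.
    by rewrite dmxM e1 !mulr1.
  rewrite (mul_combo b2 _ phi2 (b1 *m phi1)) [b2 *m phi2 + _]addrC.
  refine (exactB (exactB hex _) _).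
    exact: (exactM0 Gsub h1 (mc vu um w11)).
  exact: (exactM0 Gsub ec (mc (leqnn _) um wy)).
have um0 : (0 < m.-1)%N by lia.
have := gh_xyQ um0 um um (mexi (leqnn _) um hk2); rewrite ed => hg.
have d0' : d = 0.
  have hv : gen2 x (y ^+ 2) (d%:MP * y ^+ 1).
    case: hg => q [r e]; exists q, (y ^+ (Q - 2) * r); rewrite expr1 e mulrA -exprD subnKC //.
  exact: (xyQ_c (t := 2%N)) hv.
move: ec; rewrite ed d0' mpolyC0 mul0r /dmx !raddf0 block_mx0 subr0; exact.
Qed.

Lemma from_glue n k s : (k < m)%N -> (s <= Q)%N -> notU k s -> n != 0 -> hom_coh0 n (BR k s) glue.
Proof.
move=> km sQ nU n0.
refine (@cone_to R G f Gsub U V gphi gphi_closed n (BR k s) (to_U km sQ nU) _).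
by refine (sum_to Gsub _ _); [exact: (modeB_hom km vm sQ (leq0n Q) (or_introl n0))|exact: (modeB_hom km um sQ Q0 (or_introl n0))].
Qed.

Lemma from_glue_later n k s : (k < m)%N -> (s <= Q)%N -> (0 < s)%N -> (1 < s)%N \/ (k.+1 < m)%N ->
  hom_coh0 n (BR k s) glue.
Proof.
move=> km sQ s0 h.
refine (@cone_to R G f Gsub U V gphi gphi_closed n (BR k s) (to_U km sQ (or_intror s0)) _).
have dp b : 0 <= delB k b by rewrite /delB; case: ifP.
have l1' : 0%N%:Z - s%:Z - delB k m.-2 < 0 by have := dp m.-2; clear -s0; lia.
have l2 : 1%N%:Z - s%:Z - delB k m.-1 < 0.
  case: h => h; first by have := dp m.-1; clear -h; lia.
  have : 0 < delB k m.-1 by apply: delB_pos; lia.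
  clear -s0; lia.
by refine (sum_to Gsub _ _); [exact: (modeB_hom km vm sQ (leq0n Q) (or_intror l1'))|exact: (modeB_hom km um sQ Q0 (or_intror l2))].
Qed.

(** The factor U enters in degree n + 1, so its bad degree 1 now corresponds to n = 0, where maps
    are allowed. *)
Lemma NN_glue n a t : inN a t -> n != 0 -> hom_coh0 n (NN a t) glue.
Proof.
move=> hN n0; have n1 : n + 1 != 1 by rewrite -subr_eq0 addrK.
have e1 : m.-1.+1 = m by lia.
have e2 : (m.-2.+1 < m)%N by lia.
refine (@cone_to R G f Gsub U V gphi gphi_closed n (NN a t) _ _).
  exact: (NN_hom_B hN um (leq0n Q) (or_intror (conj e1 erefl)) (or_intror (or_intror n1))).
refine (sum_to Gsub _ _).
  exact: (NN_hom_B hN vm (leq0n Q) (or_introl n0) (or_introl e2)).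
exact: (NN_hom_B hN um Q0 (or_introl n0) (or_intror (or_introl isT))).
Qed.

Let glue_V n : hom_coh0 n glue V.
Proof. by refine (sum_to Gsub _ _); [apply: glue_to_first; lia|exact: glue_to_V2]. Qed.

Lemma glue_self n : n != 0 -> hom_coh0 n glue glue.
Proof.
move=> n0; refine (@cone_to R G f Gsub U V gphi gphi_closed n glue _ (@glue_V n)).
refine (@cone_from0 R G f Gsub U V gphi gphi_closed (n + 1) U _ _).
  have e2 : (m.-2.+1 < m)%N by lia.
  by apply/sum_from => //; split; [exact: (to_U vm (leq0n Q) (or_introl e2))|exact: (to_U um Q0 (or_intror isT))].
by rewrite addrK; exact: (modeB_hom um um (leq0n Q) (leq0n Q) (or_introl n0)).
Qed.

Lemma glue_not_contractible : ~ exact_hom 0 (X := glue) (Y := glue) 1%:M.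
Proof.
have um0 : (0 < m.-1)%N by lia.
have z0 := hideal0 (vanish0_hideal G).
have vg : vanish0 (gk l m.-1) by rewrite /gk big_ltn // mulrC; exact: (hidealM (vanish0_hideal G) _ (vl m0)).
have vh : vanish0 (hk m l m.-1) by rewrite /hk big_ltn // mulrC; exact: (hidealM (vanish0_hideal G) _ (vl um)).
have vy := vX j.
have vye : vanish0 (y * ee m.-1 m.-1) by rewrite mulrC; exact: (hidealM (vanish0_hideal G)).
have v2 c d : vanish0 (phi2 c d).
  rewrite /phi2 /dmx /block_mx /col_mx /row_mx !mxE.
  by case: split => k; rewrite mxE; case: split => k'; rewrite !mxE ?ord1 ?eqxx ?mulr1n.
have vd c d : vanish0 (mx_pair (gk l m.-1) (hk m l m.-1) c d).
  rewrite /mx_pair /block_mx /col_mx /row_mx !mxE.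
  by case: split => k; rewrite mxE; case: split => k'; rewrite !mxE ?ord1 ?eqxx ?mulr1n.
(* The generator is taken in V2, where all entries vanish at the origin; the component of [gphi] in
   V1 contains the unit 1. *)
apply: (@not_contractible _ _ _ glue (rshift _ (rshift _ (lshift 1 0)))) => d.
  rewrite [mf_d glue]/= /block_mx col_mxEd mxE; case: split => k; first by rewrite /gphi col_mxEd.
  by rewrite col_mxEd mxE; case: split => k'; [rewrite mxE|exact: vd].
rewrite [mf_d glue]/= block_mxEh row_mxEr mxE; case: split => k; first by rewrite mxE.
by rewrite block_mxEh row_mxEr mxE; case: split => k'; [rewrite mxE|exact: vd].
Qed.

Lemma glue_exceptional : exceptional glue.
Proof.
split; [exact: glue_self|exact: glue_not_contractible|].
have e2 : (m.-2.+1 < m)%N by lia.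
refine (cone_end Gsub _ _ (@glue_V 0)).
  by apply/sum_from => //; split; [exact: (to_U vm (leq0n Q) (or_introl e2))|exact: (to_U um Q0 (or_intror isT))].
by move=> a; exact: (rank1_end Gsub f0 S0).
Qed.

Lemma glue_wA (c : 'I_(rk glue)) : wA (wt c) = 0.
Proof.
have h k s (d : 'I_(rk (BR k s))) : (k < m)%N -> wA (wt d) = 0.
  by move=> km; case: (basis2_cases d) => -[_ ->]; rewrite ?gdBE ?(ltnW km) // !wcE.
by rewrite /=; case: split => k; [exact: h|rewrite /=; case: split => k'; exact: h].
Qed.

Lemma glue_bounded : bounded_from glue.
Proof.
refine (cone_bounded Gsub _ (BR_bounded 0 um) _) => Z.
have [N1 h1] := BR_bounded 0 vm Z; have [N2 h2] := BR_bounded 1 um Z.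
exists (N1 + N2)%N => n hn; apply/sum_from => //.
have e1 : N1%:Z <= n by clear -hn; lia.
have e2 : N2%:Z <= n by clear -hn; lia.
by split; [exact: h1|exact: h2].
Qed.

Lemma glue_detect Y : (forall n, hom_coh0 n glue Y) ->
  (forall n, hom_coh0 n V1 Y) -> (forall n, hom_coh0 n V2 Y) -> forall n, hom_coh0 n U Y.
Proof.
move=> hg h1 h2 n; refine (cone_source Gsub (hg (n + 1)) _).
by apply/sum_from.
Qed.

End Glue.

(** * The whole collection and its order *)

Section Assembly.
Context (Gl : mf G f).
(** [glue] makes sense only for m > 1, and for m = 1 no label refers to it; an abstract object
    covers both cases. *)
Hypothesis HGl : forall m2 : (1 < m)%N, Gl = glue m2.
Implicit Types (d : nat * (nat * nat)).

Definition listB : seq (nat * (nat * nat)) :=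
  [seq (0%N, p) | p <- [seq (a, t) | a <- iota 1 (P - 1), t <- iota 1 (M - 1)]] ++
  [seq (1%N, p) | p <- [seq (k, s) | k <- iota 1 (m - 1), s <- iota 0 Q.+1]].

Definition isG (p : nat * nat) := (p.1 == m.-1) && (p.2 == 0%N).

Definition objB d : mf G f :=
  if d.1 == 0%N then NN d.2.1 d.2.2 else if isG d.2 then Gl else BR d.2.1 d.2.2.

(** Koszul objects come first, by decreasing a. The doubled keys of the rank-one objects leave odd
    gaps; 2 m + 1 puts the cone immediately after V2, whose key is 2 m. *)
Definition keyB d : nat :=
  if d.1 == 0%N then ((P - d.2.1) * M + d.2.2)%N
  else (P * M + if isG d.2 then (2 * m).+1 else 2 * (d.2.2 * m + (m.-1 - d.2.1)))%N.

Variant inB_spec d : Prop :=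
| InN a t of d = (0%N, (a, t)) & inN a t & objB d = NN a t & keyB d = ((P - a) * M + t)%N
| InG of (1 < m)%N & d = (1%N, (m.-1, 0%N)) & objB d = Gl & keyB d = (P * M + (2 * m).+1)%N
| InR k s of d = (1%N, (k, s)) & (0 < k)%N & (k < m)%N & (s <= Q)%N & notU k s
    & objB d = BR k s & keyB d = (P * M + 2 * (s * m + (m.-1 - k)))%N.

Lemma inB_cases d : d \in listB -> inB_spec d.
Proof.
rewrite mem_cat => /orP[] /seq.mapP[_ /allpairsP[[a t] [ha ht ->]] ->]; move: ha ht; rewrite !mem_iota [(a, t).1]/= [(a, t).2]/= => ha ht.
  apply: (@InN _ a t) => //; rewrite /inN; apply/and4P; split; clear -ha ht m0 Q1 P1; lia.
have am : (0 < a)%N /\ (a < m)%N by clear -ha m0; lia.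
have tQ : (t <= Q)%N by clear -ht; lia.
have [/andP[/eqP /= e1 /eqP /= e2]|nG] := boolP (isG (a, t)).
  rewrite e1 e2 in am *; apply: InG; rewrite /objB /keyB /isG /= ?eqxx //.
  by clear -am; lia.
apply: (@InR _ a t); rewrite /objB /keyB /= ?(negPf nG) //; try by case: am.
move: nG; rewrite /isG /notU /= negb_and -lt0n; case: (ltnP a.+1 m) => h; first by left.
have -> : a = m.-1 by clear -h am; lia.
by rewrite eqxx /=; right.
Qed.

Lemma listB_N a t : inN a t -> (0%N, (a, t)) \in listB.
Proof.
move=> /and4P[a0 aP t0 tM]; rewrite mem_cat; apply/orP; left; apply/seq.mapP; exists (a, t) => //.
apply/allpairsP; exists (a, t); rewrite [(a, t).1]/= [(a, t).2]/= !mem_iota; split=> //; clear -a0 aP t0 tM; lia.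
Qed.

Lemma listB_R k s : (0 < k)%N -> (k < m)%N -> (s <= Q)%N -> (1%N, (k, s)) \in listB.
Proof.
move=> k0 km sQ; rewrite mem_cat; apply/orP; right; apply/seq.mapP; exists (k, s) => //.
apply/allpairsP; exists (k, s); rewrite [(k, s).1]/= [(k, s).2]/= !mem_iota; split=> //; clear -k0 km sQ; lia.
Qed.

Lemma lexi (b c b' c' K : nat) : (c < K)%N -> (c' < K)%N -> (b * K + c <= b' * K + c')%N ->
  (b < b')%N \/ b = b' /\ (c <= c')%N.
Proof.
move=> cK cK' h; have [bb|bb|bb] := ltngtP b b'; [by left| |by right; rewrite bb in h; split=> //; lia].
have : (b'.+1 * K <= b * K)%N by rewrite leq_mul2r bb orbT.
by rewrite mulSn; lia.
Qed.

Lemma keyN_lt a t : inN a t -> ((P - a) * M + t < P * M)%N.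
Proof.
move=> /and4P[a0 aP t0 tM].
have : ((P - a).+1 * M <= P * M)%N by rewrite leq_mul2r; apply/orP; right; clear -a0 aP; lia.
by rewrite mulSn; lia.
Qed.

Lemma keyN_le a t a' t' : inN a t -> inN a' t' -> ((P - a') * M + t' <= (P - a) * M + t)%N ->
  (a < a')%N \/ a = a' /\ (t' <= t)%N.
Proof.
move=> /and4P[a0 aP t0 tM] /and4P[a0' aP' t0' tM'] /(lexi tM' tM); clear -a0 aP a0' aP'; lia.
Qed.

Lemma keyR_le k s k' s' : (k < m)%N -> (k' < m)%N ->
  (s' * m + (m.-1 - k') <= s * m + (m.-1 - k))%N -> (s' < s)%N \/ s' = s /\ (k <= k')%N.
Proof.
move=> km km' h; have : (s' < s)%N \/ s' = s /\ (m.-1 - k' <= m.-1 - k)%N.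
  by apply: (lexi _ _ h); clear -km km'; lia.
by clear -km km'; lia.
Qed.

Lemma listB_uniq : uniq [seq keyB d | d <- listB].
Proof.
rewrite map_inj_in_uniq.
  rewrite cat_uniq !map_inj_uniq ?allpairs_uniq ?iota_uniq //; try by [move=> ? ? []|move=> [? ?] [? ?] _ _ [-> ->]].
  rewrite andTb andbT; apply/hasPn => _ /seq.mapP[p _ ->]; apply/seq.mapP => -[p' _ ]; by case.
have odd2 a b : (2 * a)%N <> (2 * b).+1 by lia.
move=> d e /inB_cases [a t -> hN _ ->|m2 -> _ ->|k s -> k0 km sQ nU _ ->]
  /inB_cases [a' t' -> hN' _ ->|m2' -> _ ->|k' s' -> k0' km' sQ' nU' _ ->] // ek.
- have [h|[ea h]] := keyN_le hN hN' (eq_leq (esym ek)).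
    have [h'|[ee' h']] := keyN_le hN' hN (eq_leq ek); exfalso; first by clear -h h'; lia.
    by clear -h ee'; lia.
  have [h'|[ee' h']] := keyN_le hN' hN (eq_leq ek); first by exfalso; clear -ea h'; lia.
  by rewrite ee'; have -> : t = t' by clear -h h'; lia.
- by have := keyN_lt hN; rewrite ek; clear; lia.
- by have := keyN_lt hN; rewrite ek; clear; lia.
- by have := keyN_lt hN'; rewrite -ek; clear; lia.
- by case: (odd2 (s' * m + (m.-1 - k'))%N m); clear -ek; lia.
- by have := keyN_lt hN'; rewrite -ek; clear; lia.
- by case: (odd2 (s * m + (m.-1 - k))%N m); clear -ek; lia.
have ek' : (s * m + (m.-1 - k) = s' * m + (m.-1 - k'))%N by clear -ek; lia.
have := keyR_le km km' (eq_leq (esym ek')); have := keyR_le km' km (eq_leq ek'); clear => h h'.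
have [-> ->] : s = s' /\ k = k' by lia.
by [].
Qed.

Lemma BR_wA k s (c : 'I_(rk (BR k s))) : (k < m)%N -> wA (wt c) = 0.
Proof. by move=> km; case: (basis2_cases c) => -[_ ->]; rewrite ?gdBE ?(ltnW km) // !wcE. Qed.

Lemma objB_strong d e n : d \in listB -> e \in listB -> n != 0 -> hom_coh0 n (objB d) (objB e).
Proof.
move=> /inB_cases [a t _ hN -> _|m2 _ -> _|k s _ k0 km sQ nU -> _]
  /inB_cases [a' t' _ hN' -> _|m2' _ -> _|k' s' _ k0' km' sQ' nU' -> _] n0.
- by apply: NN_hom => //; left.
- by rewrite (HGl m2'); exact: NN_glue.
- by apply: (NN_hom_B hN' km' sQ' (or_introl n0)) || apply: (NN_hom_B hN km' sQ' (or_introl n0)); case: nU'; [left|right; left].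
- by have /and4P[a0 aP _ _] := hN'; apply: (hom_to_NN a0 aP); rewrite (HGl m2); exact: glue_wA.
- by rewrite (HGl m2); exact: glue_self.
- by rewrite (HGl m2); exact: glue_to.
- by have /and4P[a0 aP _ _] := hN'; apply: (hom_to_NN a0 aP) => c; exact: BR_wA.
- by rewrite (HGl m2'); exact: from_glue.
by apply: modeB_hom => //; left.
Qed.

Lemma objB_ordered d e n : d \in listB -> e \in listB -> (keyB d < keyB e)%N -> hom_coh0 n (objB e) (objB d).
Proof.
move=> /inB_cases [a t _ hN -> ->|m2 _ -> ->|k s _ k0 km sQ nU -> ->]
  /inB_cases [a' t' _ hN' -> ->|m2' _ -> ->|k' s' _ k0' km' sQ' nU' -> ->] lt.
- apply: (NN_hom hN' hN); right; have := keyN_le hN' hN (ltnW lt); clear -lt => -[h|[h1 h2]]; [by left|right].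
  by rewrite h1 in lt *; split=> //; lia.
- by have /and4P[a0 aP _ _] := hN; apply: (hom_to_NN a0 aP); rewrite (HGl m2'); exact: glue_wA.
- by have /and4P[a0 aP _ _] := hN; apply: (hom_to_NN a0 aP) => c; exact: BR_wA.
- by have := keyN_lt hN'; clear -lt; lia.
- by clear -lt; lia.
- rewrite (HGl m2); have h : (m < s' * m + (m.-1 - k'))%N by clear -lt; lia.
  have s0 : (0 < s')%N by case: s' {sQ' nU' lt} h => //; clear; lia.
  apply: (from_glue_later km' sQ' s0); case: s' {nU' lt sQ'} h s0 => [|[|s']] // h _; last by left.
  by right; clear -h; lia.
- by have := keyN_lt hN'; clear -lt; lia.
- rewrite (HGl m2'); have h : (s * m + (m.-1 - k) <= m)%N by clear -lt; lia.
  case: s sQ nU h {lt} => [|[|s]] sQ nU h.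
  + by case: nU => // k1; exact: glue_to_first.
  + have -> : k = m.-1 by clear -h km; lia.
    exact: glue_to_V2.
  by move: h; rewrite !mulSn; clear -m0 km; lia.
apply: (modeB_hom km' km sQ' sQ); right; have h : (s * m + (m.-1 - k) < s' * m + (m.-1 - k'))%N by clear -lt; lia.
have dp : 0 <= delB k' k by rewrite /delB; case: ifP.
have [h1|[h1 h2]] := keyR_le km' km (ltnW h); first by clear -h1 dp; lia.
have : 0 < delB k' k by apply: delB_pos; rewrite h1 in h; clear -h; lia.
by rewrite h1; clear; lia.
Qed.

(** * The right orthogonal of the assembled collection *)

Section DetectionB.
Context (Y : mf G f).
Hypothesis hY : forall d, d \in listB -> forall n, hom_coh0 n (objB d) Y.

Let hR k s : (0 < k)%N -> (k < m)%N -> (s <= Q)%N -> notU k s -> forall n, hom_coh0 n (BR k s) Y.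
Proof.
move=> k0 km sQ nU n; have := hY (listB_R k0 km sQ) (n := n); rewrite /objB /=.
have -> : isG (k, s) = false; last by [].
apply/negP => /andP[/eqP /= e1 /eqP /= e2]; case: nU; last by rewrite e2.
by rewrite e1 prednK // ltnn.
Qed.

(** Orthogonality to the cone, V1 and V2 gives orthogonality to U, so all rank-one objects are
    available again; those with k = 0 are contractible. *)
Let hBR k s n : (k < m)%N -> (s <= Q)%N -> hom_coh0 n (BR k s) Y.
Proof.
move=> km sQ; have [->|k0] := posnP k; first exact: B0_from.
have [/andP[/eqP /= e1 /eqP /= e2]|nG] := boolP (isG (k, s)); last first.
  apply: hR => //; move: nG; rewrite /isG /notU /= negb_and -lt0n; case: (ltnP k.+1 m) => h; first by left.
  have -> : k = m.-1 by clear -h km; lia.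
  by rewrite eqxx /=; right.
rewrite e1 e2; have m2 : (1 < m)%N by clear -k0 km; lia.
have um0 : (0 < m.-1)%N by clear -m2; lia.
have um : (m.-1 < m)%N by clear -m2; lia.
have vm : (m.-2.+1 < m)%N by clear -m2; lia.
apply: (glue_detect (m2 := m2)) => n'.
- have := hY (listB_R um0 um (leq0n Q)) (n := n'); rewrite /objB /isG /= !eqxx /=.
  by rewrite (HGl m2).
- have [->|v0] := posnP m.-2; first exact: B0_from.
  by apply: hR => //; [exact: ltnW|left].
by apply: (hR um0 um Q0); right.
Qed.

Let gk_acyclic k t : (k <= m)%N -> (t <= Q)%N -> acyclic_mod (gen1 (gk l k)) (gD k - wt2 i 0 t) Y.
Proof.
rewrite leq_eqVlt => /orP[/eqP -> _|km tQ].
  apply: (acyclic_ext (I := fun p => exists q, p = f * q)); last exact: acyclic_f.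
  by move=> p; rewrite ff.
have e : wt2 i 0 (- t%:Z) + gD k = gD k - wt2 i 0 t by rewrite addrC wt2N oppr0.
rewrite -e; apply: (chain_acyclic (ff := ff) (fw := fw) (l1 := l1) (d0 := d0) (hw := hw) (Gsub := Gsub) f0) => n.
exact: hBR.
Qed.

Let factor_acyclic k t : (k < m)%N -> (t <= Q)%N ->
  acyclic_mod (gen1 (l k)) (gD k.+1 - wt2 i 0 t) Y.
Proof.
move=> km tQ; apply: (chain_factor Gsub f0 hw l1 ff km); last exact: gk_acyclic.
have -> : gD k.+1 - wt2 i 0 t - dl k = gD k - wt2 i 0 t.
  by rewrite /gd big_nat_recr //= addrAC [_ + dl k - dl k]addrK.
exact: gk_acyclic (ltnW km) tQ.
Qed.

Let l_div k : (k < m)%N -> gen1 (l k) f.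
Proof. by move=> kr; rewrite ff (bigD1_seq k) ?iota_uniq ?mem_index_iota //=; eexists. Qed.

Let Xy_acyclic (n : int) : acyclic_mod (gen2 (x ^+ P) y) (wt2 i 0 n) Y.
Proof.
have M0 : (0 < M)%N by rewrite /topB muln_gt0 m0 Q0.
suff H (n' : nat) : (0 < n')%N -> (n' <= M)%N -> acyclic_mod (gen2 (x ^+ P) y) (wt2 i 0 n') Y.
  have eM := divz_eq (n - 1) M; have lM := ltz_pmod (n - 1) (d := M%:Z) ltac:(by rewrite ltz_nat).
  have gM := modz_ge0 (n - 1) (d := M%:Z) ltac:(by clear -M0; lia).
  move: ((n - 1) %/ M)%Z ((n - 1) %% M)%Z eM lM gM => q e eM lM gM.
  apply: (acyclic_move Gsub ij P0 Q0 Hchi HG (H (absz (e + 1)) _ _)); try by clear -gM lM; lia.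
  by exists q, 0; rewrite !wcE; move: (q * M%:Z) eM => qM eM; clear -eM gM; lia.
move=> n0 nM; pose k := ((n' - 1) %/ Q)%N.
have eK := divn_eq (n' - 1) Q; have lK := ltn_pmod (n' - 1) Q0.
have km : (k < m)%N by rewrite /k ltn_divLR //; rewrite /topB in nM; clear -n0 nM; lia.
have n1 : (k * Q < n')%N by rewrite /k; clear -eK n0; lia.
have n2 : (n' <= k.+1 * Q)%N by rewrite /k mulSn; clear -eK lK n0; lia.
clearbody k; clear eK lK; have eg : gD k.+1 = wt2 i 0 (k.+1 * Q)%N by exact: gdBE.
apply: (acyclic_ext (lky km)).
apply: (acyclic_cut Gsub (hw k) hy (ycop km) (l_div km)).
  have -> : wt2 i 0 n' - wt2 i 0 1 = gD k.+1 - wt2 i 0 (k.+1 * Q - n' + 1)%N.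
    by rewrite eg !wt2N !wt2D; congr wt2; move: (k.+1 * Q)%N n2 => X n2; clear -n2; lia.
  by apply: factor_acyclic => //; rewrite mulSn; move: (k * Q)%N n1 => X n1; clear -n1 Q1; lia.
have -> : wt2 i 0 n' = gD k.+1 - wt2 i 0 (k.+1 * Q - n')%N.
  by rewrite eg !wt2N !wt2D; congr wt2; move: (k.+1 * Q)%N n2 => X n2; clear -n2; lia.
by apply: factor_acyclic => //; rewrite mulSn; move: (k * Q)%N n1 => X n1; clear -n1 Q1; lia.
Qed.

Let f_in e : (e <= P)%N -> gen2 (x ^+ e) y f.
Proof.
move=> eP; have [q eq] := l_div m0.
have [|q1 [q2 e1]] := (lky m0 (l 0)).1; first by exists 1, 0; rewrite mulr1 mulr0 addr0.
exists (x ^+ (P - e) * q1 * q), (q2 * q).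
by rewrite eq e1 mulrDl !mulrA -exprD subnKC.
Qed.

Let f_in_y t : (t <= M)%N -> gen2 x (y ^+ t) f.
Proof. by move=> tM; exists A0, (cf *: y ^+ (M - t)); rewrite -scalerAr -exprD subnKC. Qed.

(** The Koszul objects cover 0 < t < M. At t = 0 the ideal is everything and at t = M it is (x, f),
    so both ends are automatic; this is why M - 1 objects suffice for M weights. *)
Let col_t a t : (0 < a)%N -> (a < P)%N -> (t <= M)%N ->
  acyclic_mod (gen2 x (y ^+ t)) (wt2 i (1 - a%:Z) (M%:Z - Q%:Z - 1)) Y.
Proof.
move=> a0 aP tM; have [->|t0] := posnP t.
  apply: (acyclic_ext (I := fun=> True)); last exact: acyclic_all.
  by move=> p; split=> // _; exists 0, p; rewrite mulr0 add0r expr0 mul1r.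
have [te|tlt] := leqP M t.
  have -> : t = M by apply/eqP; rewrite eqn_leq tM.
  apply: (acyclic_ext (I := fun p => exists q r, p = x * q + f * r)).
    move=> p; split=> -[q [r ->]].
      by exists (q + A0 * r), (cf%:MP * r); rewrite fA -mul_mpolyC; ring.
    exists (q - A0 * (cf^-1%:MP * r)), (cf^-1%:MP * r); rewrite fA -mul_mpolyC.
    have e : cf%:MP * cf^-1%:MP = 1 :> S by rewrite -mpolyCM divff.
    transitivity (x * q + (cf%:MP * cf^-1%:MP) * (y ^+ M * r)); last by ring.
    by rewrite e mul1r.
  apply: acyclic_f2 => // p q e.
  apply: (@cop_xy _ _ Gsub _ _ _ _ _ _ ij P0 Q0 Hchi HG M p).
  exists (cf^-1%:MP * (q - A0 * p)).
  have e1 : cf^-1%:MP * cf%:MP = 1 :> S by rewrite -mpolyCM mulVf.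
  have e2 : (cf%:MP * y ^+ M) * p = x * (q - A0 * p) by rewrite mulrBr -e fA -mul_mpolyC; ring.
  transitivity (cf^-1%:MP * ((cf%:MP * y ^+ M) * p)); last by rewrite e2; ring.
  transitivity ((cf^-1%:MP * cf%:MP) * (y ^+ M * p)); last by ring.
  by rewrite e1 mul1r mulrC.
have hN : inN a t by apply/and4P.
have et : minn t M = t by exact/minn_idPl/ltnW.
have h n : hom_coh0 n (NK a t) Y.
  have := hY (listB_N hN) (n := n - a%:Z); rewrite /objB /= => /hom_coh0_shl.
  by rewrite opprK subrK.
have := koszul_acyclic Gsub x0 (expf_neq0 (minn t M) y0) (@regK t) h.
rewrite /uN et !wt2D; have -> // : wt2 i (- a%:Z + 0 + 1) (M%:Z - Q%:Z - 1 - t%:Z + t%:Z + 0) = wt2 i (1 - a%:Z) (M%:Z - Q%:Z - 1).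
by congr wt2; clear; lia.
Qed.

(** The quotient of S/(x, y^(t+1)) by the image of y^t is S/(x, y^t), with kernel term S/(x, y) in a
    weight lowered by t. For t from 0 to M - 1 these are all classes modulo M. *)
Let col a (n : int) : (0 < a)%N -> (a < P)%N -> acyclic_mod (gen2 x y) (wt2 i (1 - a%:Z) n) Y.
Proof.
move=> a0 aP; have M0 : (0 < M)%N by rewrite /topB muln_gt0 m0 Q0.
suff H (t : nat) : (t < M)%N -> acyclic_mod (gen2 x y) (wt2 i (1 - a%:Z) (M%:Z - Q%:Z - 1 - t%:Z)) Y.
  pose b := M%:Z - Q%:Z - 1 - n.
  have eM := divz_eq b M; have lM := ltz_pmod b (d := M%:Z) ltac:(by rewrite ltz_nat).
  have gM := modz_ge0 b (d := M%:Z) ltac:(by clear -M0; lia).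
  move: (b %/ M)%Z (b %% M)%Z eM lM gM => q e eM lM gM.
  apply: (acyclic_move Gsub ij P0 Q0 Hchi HG (H (absz e) _)); first by clear -gM lM; lia.
  exists (- q), 0; rewrite !wcE !mulNr; rewrite /b in eM; move: (q * M%:Z) eM => qM eM; clear -eM gM; lia.
move=> tM; rewrite -[wt2 i _ _](_ : wt2 i (1 - a%:Z) (M%:Z - Q%:Z - 1) - wt2 i 0 t = _); last first.
  by rewrite wt2N wt2D; congr wt2; clear; lia.
have [h1 h2] := colon_step (@cop_xy _ _ Gsub _ _ _ _ _ _ ij P0 Q0 Hchi HG t) y0 (expf_neq0 t y0) (exprSr y t).
have sw b (p : S) : gen2 b x p <-> gen2 x b p by split=> -[q [r ->]]; exists r, q; rewrite addrC.
apply: (@acyclic_colon _ _ _ Gsub (gen2 x (y ^+ t)) (gen2 x (y ^+ t.+1)) (gen2 x y) (y ^+ t) (wt2 i 0 t) _ Y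
  (gen2_hideal Gsub hx (hyn t)) (gen2_hideal Gsub hx (hyn t.+1)) (hyn t) (f_in_y tM) _ _ _ _ (col_t a0 aP tM) (col_t a0 aP (ltnW tM))).
- by move=> _ [q [r ->]]; exists q, (y * r); rewrite exprSr mulrA.
- by exists 0, 1; rewrite mulr0 mulr1 add0r.
- by move=> p /sw /h2 [c [r [/sw hc ->]]]; exists c, r.
by move=> r; rewrite -(sw y r) -(sw (y ^+ t.+1)); exact: h1.
Qed.

Let X_ext e (n : int) : (0 < e)%N -> (e < P)%N -> acyclic_mod (gen2 (x ^+ e) y) (wt2 i 0 n) Y.
Proof.
elim: e => // e IH _ eP; have [->|e0] := posnP e.
  by rewrite expr1; have := @col 1%N n isT P1; rewrite subrr.
have [h1 h2] := colon_step (cop_yx Gsub ij P0 Q0 Hchi HG (n := e)) x0 (expf_neq0 e x0) (exprSr x e).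
apply: (@acyclic_extend _ _ _ Gsub (gen2 (x ^+ e) y) (gen2 (x ^+ e.+1) y) (gen2 x y) (x ^+ e) (wt2 i e 0) _ Y
  (gen2_hideal Gsub (hxn e) hy) (gen2_hideal Gsub (hxn e.+1) hy) (hxn e) (f_in (ltnW eP)) _ h2 h1 _ (IH e0 (ltnW eP))).
  by move=> _ [q [t ->]]; exists (x * q), t; rewrite exprSr mulrA.
have -> : wt2 i 0 n - wt2 i e 0 = wt2 i (1 - e.+1%:Z) n by rewrite wt2N wt2D; congr wt2; clear; lia.
exact: col.
Qed.

Let all_acyclic w : acyclic_mod (gen2 x y) w Y.
Proof.
suff H (c : nat) (n : int) : (c < P)%N -> acyclic_mod (gen2 x y) (wt2 i (- c%:Z) n) Y.
  have eP := divz_eq (- wA w) P; have lP := ltz_pmod (- wA w) (d := P%:Z) ltac:(by rewrite ltz_nat ltnW).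
  have gP := modz_ge0 (- wA w) (d := P%:Z) ltac:(by clear -P1; lia).
  move: (- wA w %/ P)%Z (- wA w %% P)%Z eP lP gP => q e eP lP gP.
  apply: (acyclic_move Gsub ij P0 Q0 Hchi HG (H (absz e) (wB w - q * Q) _)); first by clear -gP lP; lia.
  exists 0, (- q); rewrite !mulNr; move: (q * P%:Z) eP => qP eP; clear -eP gP; lia.
move=> cP; have [c1|c1] := leqP c.+2 P.
  have -> : - c%:Z = 1 - c.+1%:Z by clear; lia.
  exact: col.
(* The column not reached by Koszul objects: S/(x, y) is the kernel term of S/(x^P, y) over
   S/(x^(P-1), y), the former known from the rank-one objects, the latter built up from the other
   columns. *)
have ec : c = P.-1 by clear -cP c1; lia.
have p0 : (0 < P.-1)%N by clear -P1; lia.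
have pP : (P.-1 < P)%N by clear -P1; lia.
have eP : P = P.-1.+1 by clear -P1; lia.
have [h1 h2] := colon_step (cop_yx Gsub ij P0 Q0 Hchi HG (n := P.-1)) x0 (expf_neq0 P.-1 x0) (exprSr x P.-1).
rewrite -eP in h1 h2.
have -> : wt2 i (- c%:Z) n = wt2 i 0 n - wt2 i P.-1 0 by rewrite wt2N wt2D ec; congr wt2; clear; lia.
apply: (@acyclic_colon _ _ _ Gsub (gen2 (x ^+ P.-1) y) (gen2 (x ^+ P) y) (gen2 x y) (x ^+ P.-1) (wt2 i P.-1 0) _ Y
  (gen2_hideal Gsub (hxn P.-1) hy) (gen2_hideal Gsub (hxn P) hy) (hxn P.-1) (f_in (leqnn P)) _ _ h2 h1 (@Xy_acyclic n) (@X_ext P.-1 n p0 pP)).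
  by move=> _ [q [t ->]]; exists (x * q), t; rewrite {1}eP exprSr mulrA.
by exists 1, 0; rewrite mulr1 mulr0 addr0.
Qed.

Lemma modeB_detect : contractible Y.
Proof.
apply: (plane_contractible Gsub ij P0 Q0 Hchi HG _ wdeg_chi all_acyclic).
have [q ->] := l_div m0; rewrite mulrC; exact: (hidealM (vanish0_hideal G) _ (vl m0)).
Qed.

End DetectionB.

Lemma modeB_tilting_aux : has_tilting_of_length G f ((P - 1) * (M - 1) + (m - 1) * Q.+1).
Proof.
have -> : ((P - 1) * (M - 1) + (m - 1) * Q.+1)%N = size listB.
  by rewrite size_cat !size_map !size_allpairs !size_iota.
apply: (tilting_of_list Gsub (0%N, (0%N, 0%N)) (E := objB) listB_uniq).
- move=> d /inB_cases [a t _ hN -> _|m2 _ -> _|k s _ k0 km sQ nU -> _].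
  + exact: NN_exceptional.
  + by rewrite (HGl m2); exact: glue_exceptional.
  exact: BR_exceptional.
- by move=> d e hd he lt n; exact: objB_ordered.
- by move=> d e n hd he n0; exact: objB_strong.
- move=> d hd; apply: (plane_finite Gsub ij P0 Q0 Hchi HG wdeg_chi).
  case: (inB_cases hd) => [a t _ hN -> _|m2 _ -> _|k s _ k0 km sQ nU -> _].
  + exact: NN_bounded.
  + by rewrite (HGl m2); exact: glue_bounded.
  exact: BR_bounded.
by move=> Y hY; apply: modeB_detect => d hd n; exact: hY.
Qed.

End Assembly.

Lemma modeB_tilting : has_tilting_of_length G f ((P - 1) * (M - 1) + (m - 1) * Q.+1).
Proof.
have [m2|m1] := boolP (1 < m)%N.
  by apply: (@modeB_tilting_aux (glue m2)) => m2'; rewrite (bool_irrelevance m2 m2').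
by apply: (@modeB_tilting_aux mf_zero) => m2; rewrite m2 in m1.
Qed.

End ModeB.

(** * Symmetry groups *)

Lemma prim_root_exists (C : numClosedFieldType) n : (0 < n)%N -> exists z : C, n.-primitive_root z.
Proof.
move=> n0; have [r er] := closed_field_poly_normal ('X^n - 1 : {poly C}).
rewrite (monicP _) ?monicXnsubC // scale1r in er.
have hr : all n.-unity_root r by apply/allP => z; rewrite -root_prod_XsubC -er.
have sr : size r = n by apply/succn_inj; rewrite -(size_prod_XsubC r id) -er size_XnsubC.
have ur : uniq r by rewrite -separable_prod_XsubC -er separable_Xn_sub_1 // pnatr_eq0 -lt0n.
have /hasP[z _ hz] := has_prim_root n0 hr ur (eq_leq (esym sr)).
by exists z.
Qed.

Lemma nth_root_exists (C : numClosedFieldType) n (c : C) : (0 < n)%N -> exists z, z ^+ n = c.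
Proof. by move=> n0; exists (n.-root c); exact: rootCK. Qed.

Section GroupData.
Context {R : realType} (A : 'M[nat]_2) (d1 d2 h l : nat) (G : tpoint R -> Prop).
Context (i j r0 r1 : 'I_2).
Hypotheses (ij : i != j) (r01 : r0 != r1).
Hypotheses (d1_gt0 : (0 < d1)%N) (d2_gt0 : (0 < d2)%N).
Local Notation p := (A r0 i).
Local Notation b := (A r0 j).
Local Notation a := (A r1 i).
Local Notation q := (A r1 j).
Hypotheses (ap : (a < p)%N) (bq : (b < q)%N).
Hypothesis HA : admissible A d1 d2 h G.
Hypothesis Hl : has_index (max_symmetry_group A) G l.
Local Notation C := R[i].

Definition pnt (u v w : C) : tpoint R := if i == 0 then (u, v, w) else (v, u, w).
Definition cA (t : tpoint R) : C := if i == 0 then t.1.1 else t.1.2.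
Definition cB (t : tpoint R) : C := if i == 0 then t.1.2 else t.1.1.

Lemma pntE t : t = pnt (cA t) (cB t) t.2.
Proof. by case: t => [[t1 t2] t3]; rewrite /pnt /cA /cB; case: (i == 0). Qed.

Lemma pntM u v w u' v' w' : pnt u v w * pnt u' v' w' = pnt (u * u') (v * v') (w * w').
Proof. by rewrite /pnt; case: (i == 0). Qed.

Lemma pnt1 : 1 = pnt 1 1 1.
Proof. by rewrite /pnt; case: (i == 0). Qed.

Lemma pnt_inj u v w u' v' w' : pnt u v w = pnt u' v' w' -> [/\ u = u', v = v' & w = w'].
Proof. by rewrite /pnt; case: (i == 0) => -[-> -> ->]. Qed.

Lemma pnt_unit u v w : pnt u v w \is a GRing.unit <-> [/\ u != 0, v != 0 & w != 0].
Proof.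
have nz (y z : C) : y * z = 1 -> y != 0.
  by move=> e; apply: contra_eq_neq e => ->; rewrite mul0r eq_sym oner_neq0.
split=> [/mulrV|[hu hv hw]].
  by rewrite [_^-1]pntE pntM pnt1 => /pnt_inj[/nz h1 /nz h2 /nz h3].
by apply/unitrPr; exists (pnt u^-1 v^-1 w^-1); rewrite pntM !mulfV // -pnt1.
Qed.

Lemma eval_pnt al be u v w : eval_weight (wt2 i al be) (pnt u v w) = u ^ al * v ^ be.
Proof. by rewrite /eval_weight /wt2 /pnt; case: (i == 0); rewrite /= expr0z mulr1 // mulrC. Qed.

Lemma maxP u v w : max_symmetry_group A (pnt u v w) <->
  [/\ [/\ u != 0, v != 0 & w != 0], u ^+ p * v ^+ b = w & u ^+ a * v ^+ q = w].
Proof.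
rewrite /max_symmetry_group /pnt; have [[ei ej]|[ei ej]] := ord2_cases ij; have [[er er']|[er er']] := ord2_cases r01;
  rewrite ei ej er er' /=; move: (@pnt_unit u v w); rewrite /pnt ei /= => U.
- by split=> -[/U h1 h2 h3]; exact: And3 h1 h2 h3.
- by split=> -[/U h1 h2 h3]; exact: And3 h1 h3 h2.
- split=> -[/U h1]; [rewrite mulrC => h2; rewrite mulrC => h3|rewrite mulrC => h2; rewrite mulrC => h3]; exact: And3 h1 h2 h3.
split=> -[/U h1]; [rewrite mulrC => h2; rewrite mulrC => h3|rewrite mulrC => h2; rewrite mulrC => h3]; exact: And3 h1 h3 h2.
Qed.

Definition di := if i == 0 then d1 else d2.
Definition dj := if i == 0 then d2 else d1.

Lemma circ u : u != 0 -> G (pnt (u ^+ di) (u ^+ dj) (u ^+ h)).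
Proof. by move=> u0; have [_ _ /(_ u u0)] := HA; rewrite /pnt /di /dj; case: (i == 0). Qed.

Let Gsub : subgroup G. Proof. by case: HA. Qed.

Lemma Gmax u v w : G (pnt u v w) -> [/\ [/\ u != 0, v != 0 & w != 0], u ^+ p * v ^+ b = w & u ^+ a * v ^+ q = w].
Proof. by have [_ hm _] := HA; move=> /hm /maxP. Qed.

Let di0 : (0 < di)%N. Proof. by rewrite /di; case: ifP. Qed.
Let dj0 : (0 < dj)%N. Proof. by rewrite /dj; case: ifP. Qed.
Local Notation ph := (p - a)%N.
Local Notation qh := (q - b)%N.
Let ph0 : (0 < ph)%N. Proof. by rewrite subn_gt0. Qed.
Let qh0 : (0 < qh)%N. Proof. by rewrite subn_gt0. Qed.

Lemma degrees : (di * ph = dj * qh)%N.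
Proof.
have n2 : (2%:R : C) != 0 by rewrite pnatr_eq0.
have [_ <-] := Gmax (circ n2); rewrite -!exprM -!exprD => /eqP.
rewrite -!natrX eqr_nat eqn_exp2l // => /eqP e.
have ep : p = (ph + a)%N by rewrite subnK // ltnW.
have eq : q = (qh + b)%N by rewrite subnK // ltnW.
by rewrite {1}eq {1}ep !mulnDr in e; lia.
Qed.

Context (tau : C).
Hypothesis Htau : ph.-primitive_root tau.

(** The points of the maximal group whose second coordinate is 1; with the one-parameter subgroup
    they generate it. *)
Definition sk (k : nat) : tpoint R := pnt (tau ^+ k) 1 (tau ^+ (k * a)).

Let prim_neq0 n (z : C) : (0 < n)%N -> n.-primitive_root z -> z != 0.
Proof.
move=> n0 hz; apply/eqP => e; have := prim_expr_order hz.
by rewrite e expr0n eqn0Ngt n0 /= => /eqP; rewrite eq_sym oner_eq0.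
Qed.

Let tau0 : tau != 0. Proof. exact: (prim_neq0 ph0 Htau). Qed.

Lemma tau_ph : tau ^+ ph = 1. Proof. exact: prim_expr_order. Qed.

Lemma skM k k' : sk k * sk k' = sk (k + k').
Proof. by rewrite /sk pntM mulr1 -!exprD mulnDl. Qed.

Lemma sk0 : sk 0 = 1.
Proof. by rewrite /sk mul0n !expr0 /pnt; case: ifP. Qed.

Lemma sk_max k : max_symmetry_group A (sk k).
Proof.
apply/maxP; split; first by split; rewrite ?oner_neq0 ?expf_neq0.
  rewrite expr1n mulr1 -exprM; apply/eqP; rewrite (eq_prim_root_expr Htau).
  by rewrite -[in (k * p)%N](subnK (ltnW ap)) mulnDr modnMDl.
by rewrite expr1n mulr1 -exprM.
Qed.

Lemma sk_eq k k' : (k = k' %[mod ph])%N -> sk k = sk k'.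
Proof.
move=> e; rewrite /sk !exprM; have -> // : tau ^+ k = tau ^+ k'.
by apply/eqP; rewrite (eq_prim_root_expr Htau) e.
Qed.

Lemma sk_ph : sk ph = 1.
Proof. by rewrite -sk0; apply: sk_eq; rewrite modnn mod0n. Qed.

Let G1 : G 1. Proof. by case: Gsub. Qed.
Let Gd s t : G s -> G t -> G (s / t). Proof. by case: Gsub => _ _; apply. Qed.
Let Gm s t : G s -> G t -> G (s * t).
Proof.
move=> hs ht; have [hu _ _] := Gsub; rewrite -[t]invrK; apply: Gd => //.
by rewrite -[t^-1]mul1r; exact: Gd.
Qed.
Let Gv t : G t -> G t^-1. Proof. by rewrite -[t^-1]mul1r => ?; apply: Gd. Qed.

Lemma sk_unit k : sk k \is a GRing.unit.
Proof. by apply/pnt_unit; split; rewrite ?oner_neq0 ?expf_neq0. Qed.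

Lemma delta_exists : exists k, `[< (0 < k)%N /\ G (sk k) >].
Proof. by exists ph; apply/asboolP; rewrite sk_ph. Qed.

Definition delta := ex_minn delta_exists.

Lemma delta_gt0 : (0 < delta)%N.
Proof. by rewrite /delta; case: ex_minnP => k /asboolP[]. Qed.

Lemma sk_delta n : G (sk (n * delta)).
Proof.
have hd : G (sk delta) by rewrite /delta; case: ex_minnP => k /asboolP[].
by elim: n => [|n IH]; rewrite ?mul0n ?sk0 // mulSn -skM; exact: Gm.
Qed.

Lemma G_sk k : G (sk k) <-> (delta %| k)%N.
Proof.
split=> [hk|/dvdnP[n ->]]; last exact: sk_delta.
rewrite /dvdn; apply: contraT; rewrite -lt0n => k0.
have hm : G (sk (k %% delta)).
  have -> : sk (k %% delta) = sk k / sk (k %/ delta * delta).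
    by apply: (mulIr (sk_unit (k %/ delta * delta))); rewrite divrK ?sk_unit // skM addnC -divn_eq.
  by apply: Gd => //; exact: sk_delta.
have := ltn_pmod k delta_gt0; rewrite {2}/delta; case: ex_minnP => d _ hd lt.
have : (d <= k %% delta)%N by apply: hd; apply/asboolP.
by rewrite leqNgt lt.
Qed.

Lemma delta_ph : (delta %| ph)%N.
Proof. by apply/G_sk; rewrite sk_ph. Qed.

(* Moving along the one-parameter subgroup normalises the second coordinate to 1. *)
Lemma max_split t : max_symmetry_group A t -> exists (u : C) (k : nat),
  [/\ u != 0, (k < ph)%N & t = pnt (u ^+ di) (u ^+ dj) (u ^+ h) * sk k].
Proof.
rewrite [t]pntE => /maxP[[hu hv hw] e1 e2].
have [u eu] := nth_root_exists (cB t) dj0.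
have u0 : u != 0 by apply: contraNneq hv => u0; rewrite -eu u0 expr0n eqn0Ngt dj0.
have [_ c1 c2] := Gmax (circ u0).
have [v ev] : exists v, cA t = u ^+ di * v.
  by exists (cA t / u ^+ di); rewrite mulrC divfK // expf_neq0.
have v0 : v != 0 by apply: contraNneq hu => v0; rewrite ev v0 mulr0.
have uh : u ^+ h != 0 by rewrite expf_neq0.
have e3 : t.2 = u ^+ h * v ^+ a by rewrite -e2 ev -eu exprMn -c2 mulrAC.
have e4 : v ^+ p = v ^+ a.
  apply: (mulfI uh); by rewrite -e3 -e1 ev -eu exprMn -c1 mulrAC.
have vph : v ^+ ph = 1.
  by apply: (mulIf (expf_neq0 a v0)); rewrite -exprD subnK ?mul1r // ltnW.
have [k ek] := prim_rootP Htau vph.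
exists u, k; split=> //; rewrite /sk pntM ev e3 eu mulr1.
by rewrite ek mulnC [(a * k)%N]mulnC -exprM.
Qed.

(** The points sk 0, ..., sk (delta - 1) represent the cosets of G. Matching them with the given
    representatives is injective in both directions. *)
Lemma index_delta : l = delta.
Proof.
case: Hl => r [hr huniq].
have G_cancel s t w : t \is a GRing.unit -> G (s / t) -> G (w / t) -> G (s / w).
  move=> ut h1 h2; have [hu _ _] := Gsub; have := Gd h1 h2.
  have uw : w \is a GRing.unit by have := hu _ h2; rewrite unitrMl ?unitrV.
  by rewrite invrM ?unitrV // invrK mulrA divrK.
have unit_r k : r k \is a GRing.unit by case: (hr k).
have rk k : exists s : 'I_delta, G (r k / sk s).
  have [u [n [u0 _ er]]] := max_split (hr k).
  exists (Ordinal (ltn_pmod n delta_gt0)); rewrite er /=.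
  have -> : sk n = sk (n %/ delta * delta) * sk (n %% delta) by rewrite skM -divn_eq.
  rewrite mulrA mulrK ?sk_unit //; apply: Gm; [exact: circ|exact: sk_delta].
have kr (s : 'I_delta) : exists k, G (sk s / r k).
  by have [k [hk _]] := huniq _ (sk_max s); exists k.
have [F hF] := choice rk; have [F' hF'] := choice kr.
apply/eqP; rewrite eqn_leq -[X in (X <= _)%N && _]card_ord -[X in (_ <= X)%N && _]card_ord.
rewrite -[X in _ && (X <= _)%N]card_ord -[X in _ && (_ <= X)%N]card_ord; apply/andP; split.
  apply: (@leq_card _ _ F) => k k' e.
  have := hF k'; rewrite -e => /(G_cancel _ _ _ (sk_unit (F k)) (hF k)) hkk.
  have [k0 [_ hk0]] := huniq _ (hr k).
  have e1 := hk0 _ hkk; have e2 : k0 = k by apply: hk0; rewrite divrr.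
  exact: etrans (esym e2) e1.
apply: (@leq_card _ _ F') => s s' e; have := hF' s'; rewrite -e => h2.
have hG := G_cancel _ _ _ (unit_r _) (hF' s) h2.
wlog lt : s s' e h2 hG / (s' <= s)%N.
  move=> W; have [hle|hle] := leqP s' s; first exact: W.
  have h3 : G (sk s / r (F' s')) by rewrite -e; exact: hF'.
  have h4 : G (sk s' / sk s) := G_cancel _ _ _ (unit_r _) h2 (hF' s).
  exact: (esym (W s' s (esym e) h3 h4 (ltnW hle))).
move: hG; have -> : sk s / sk s' = sk (s - s').
  by apply: (mulIr (sk_unit s')); rewrite divrK ?sk_unit // skM subnK.
move=> /G_sk hd; apply: val_inj => /=; have : (s - s' < delta)%N by rewrite (leq_ltn_trans (leq_subr _ _)).
by move: hd; case: (posnP (s - s')) => [hz _ _|hz /(dvdn_leq hz)]; lia.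
Qed.

(** For e the gcd of both differences, sk e lies on the one-parameter subgroup: a suitable root of
    unity of order dividing dj has second coordinate 1 and first coordinate tau^e. Hence delta
    divides e. *)
Lemma delta_qh : (delta %| qh)%N.
Proof.
have [om hom] := prim_root_exists C dj0.
have om0 := prim_neq0 dj0 hom.
have := exp_prim_root hom di; set n' := (dj %/ gcdn di dj)%N => hn'.
set e := gcdn ph qh.
have en : (e * n' = ph)%N.
  have g0 : (0 < gcdn di dj)%N by rewrite gcdn_gt0 di0.
  apply/eqP; rewrite -(eqn_pmul2r g0) -mulnA [(n' * _)%N]divnK ?dvdn_gcdr //.
  by rewrite muln_gcdr [(ph * di)%N]mulnC degrees [(ph * dj)%N]mulnC -muln_gcdr gcdnC mulnC.
have te : (tau ^+ e) ^+ n' = 1 by rewrite -exprM en tau_ph.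
have [k ek] := prim_rootP hn' te.
apply: (dvdn_trans (n := e)); last exact: dvdn_gcdr.
apply/G_sk; have := circ (expf_neq0 k om0) => hG.
have [_ _ c2] := Gmax hG; move: hG.
have e1 : (om ^+ k) ^+ dj = 1 by rewrite -exprM mulnC exprM (prim_expr_order hom) expr1n.
have e2 : (om ^+ k) ^+ di = tau ^+ e by rewrite ek -!exprM mulnC.
by rewrite -c2 e1 e2 expr1n mulr1 /sk exprM.
Qed.

(** A character is trivial on G if and only if it is trivial on the one-parameter subgroup and on sk
    delta; these two conditions cut out the multiples of (P, -Q). *)
Theorem group_data_aux : exists P Q : nat, [/\ ph = (l * P)%N, qh = (l * Q)%N, (0 < l)%N,
  weq G chi (wt2 i a (b + l * Q)%N)
  & forall al be : int, weq G (wt2 i al be) 0 <-> exists r : int, al = r * P /\ be = - (r * Q%:Z)].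
Proof.
rewrite index_delta; have dl0 := delta_gt0.
have eP : (ph = delta * (ph %/ delta))%N by rewrite mulnC divnK // delta_ph.
have eQ : (qh = delta * (qh %/ delta))%N by rewrite mulnC divnK // delta_qh.
exists (ph %/ delta)%N, (qh %/ delta)%N; split=> //.
  move=> t Gt; rewrite -eQ addnC subnK ?(ltnW bq) //.
  move: Gt; rewrite [t]pntE => /Gmax[_ _ e]; rewrite eval_pnt -!exprnP e.
  by rewrite /eval_weight /= !expr0z !mul1r expr1z /pnt; case: ifP.
have e0 t : eval_weight (0 : weight) t = 1 by rewrite /eval_weight /= !expr0z !mulr1.
set P := (ph %/ delta)%N in eP *; set Q := (qh %/ delta)%N in eQ *.
have dg := degrees; rewrite eP eQ in dg.
have dgi : di%:Z * P = dj%:Z * Q.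
  have : (delta * (di * P) = delta * (dj * Q))%N by rewrite mulnCA dg mulnCA.
  by move/eqP; rewrite eqn_pmul2l // => /eqP; lia.
clearbody P Q; move=> al be; split=> [H|[r [-> ->]] t Gt]; last first.
  have Gmx : max_symmetry_group A t by case: HA => _ hm _; exact: hm.
  have [u [k [u0 _ et]]] := max_split Gmx.
  have hk : G (sk k).
    have -> : sk k = (pnt (u ^+ di) (u ^+ dj) (u ^+ h))^-1 * t.
      by rewrite et mulKr //; case: Gsub => hu _ _; exact/hu/circ.
    by apply: Gm => //; exact/Gv/circ.
  have /dvdnP[n en] := (G_sk k).1 hk.
  have u1 : u ^+ dj != 0 by rewrite expf_neq0.
  have ek : (u ^+ di * tau ^+ k) ^+ P = (u ^+ dj) ^+ Q.
    have -> : (u ^+ di * tau ^+ k) ^+ P = (u ^+ di) ^+ P * (tau ^+ k) ^+ P by rewrite exprMn.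
    have -> : (tau ^+ k) ^+ P = 1 by rewrite -exprM en -mulnA -eP mulnC exprM tau_ph expr1n.
    rewrite mulr1 -!exprM; congr (u ^+ _); move: dgi; lia.
  rewrite e0 et /sk pntM eval_pnt mulr1 [r * P]mulrC -mulNr [(- r) * Q]mulrC -!exprz_exp -!exprnP ek.
  by rewrite -expfzDr ?subrr ?expr0z // expf_neq0.
have abs1 (z : C) (n : int) : z ^ n = 1 -> z ^+ `|n| = 1.
  by case: n => n // /eqP; rewrite NegzE abszN -invr_expz invr_eq1 => /eqP.
(* The number 2 has infinite order, so its point on the one-parameter subgroup gives the integer
   equation di al + dj be = 0. *)
have n2 : (2%:R : C) != 0 by rewrite pnatr_eq0.
have := H _ (circ n2); rewrite e0 eval_pnt !exprnP !exprz_exp -expfzDr // => /abs1 /eqP.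
rewrite -natrX -[1]/(1%:R) eqr_nat -[1%N in X in _ == X](expn0 2) eqn_exp2l // absz_eq0 => /eqP ed.
(* The value tau^(delta al) = 1 means that delta P divides delta al. *)
have := H _ (sk_delta 1); rewrite mul1n e0 eval_pnt exp1rz mulr1 => /abs1 /eqP.
rewrite -exprM -(prim_order_dvd Htau) eP dvdn_pmul2l // => /dvdnP[n en].
have [r er] : exists r : int, al = r * P.
  by case: (intP al) en => [|m|m] en; [exists 0; rewrite mul0r|exists n; lia|exists (- n%:Z); lia].
exists r; split=> //; have : dj%:Z * (be + r * Q) = 0.
  by rewrite mulrDr mulrCA -dgi mulrCA addrC -er.
move/eqP; rewrite mulf_eq0 => /orP[/eqP|/eqP]; first by have := dj0; lia.
by move/eqP; rewrite addr_eq0 => /eqP.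
Qed.

End GroupData.

Lemma group_data {R : realType} (A : 'M[nat]_2) (d1 d2 h l : nat) (G : tpoint R -> Prop) (i j r0 r1 : 'I_2) :
  i != j -> r0 != r1 -> (0 < d1)%N -> (0 < d2)%N -> (A r1 i < A r0 i)%N -> (A r0 j < A r1 j)%N ->
  admissible A d1 d2 h G -> has_index (max_symmetry_group A) G l ->
  exists P Q : nat, [/\ (A r0 i - A r1 i = l * P)%N, (A r1 j - A r0 j = l * Q)%N, (0 < l)%N,
    weq G chi (wt2 i (A r1 i) (A r0 j + l * Q)%N)
    & forall al be : int, weq G (wt2 i al be) 0 <-> exists r : int, al = r * P /\ be = - (r * Q%:Z)].
Proof.
move=> ij r01 d10 d20 ap bq HA Hl.
have [|tau htau] := prim_root_exists R[i] (n := (A r0 i - A r1 i)%N); first by rewrite subn_gt0.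
exact: (group_data_aux ij r01 d10 d20 ap bq HA Hl htau).
Qed.

(** * Exponent matrices *)

Local Notation o0 := (0 : 'I_2).
Local Notation o1 := (1 : 'I_2).

Section TwoMonomials.
Context {R : realType} (A : 'M[nat]_2).
Local Notation C := R[i].
Local Notation S := (poly2 R).
Implicit Types (r k : 'I_2) (u v : C).

Let ij01 : (0 : 'I_2) != 1. Proof. by []. Qed.
Definition rowm r : 'X_{1..2} := mon o0 o1 (A r o0) (A r o1).

Lemma rowm0 r : rowm r o0 = A r o0. Proof. exact: mon_i. Qed.
Lemma rowm1 r : rowm r o1 = A r o1. Proof. exact: mon_j. Qed.

Lemma poly_of_matrixE : poly_of_matrix R A = 'X_[rowm 0] + 'X_[rowm 1].
Proof.
rewrite /poly_of_matrix !big_ord_recl !big_ord0 addr0 !mulr1 /rowm !monX.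
have -> : lift ord0 ord0 = 1 :> 'I_2 by apply: val_inj.
by [].
Qed.

Definition ev r u v : C := u ^+ A r o0 * v ^+ A r o1.
Definition dev k r u v : C :=
  (u ^+ (A r o0 - (k == o0)) * v ^+ (A r o1 - (k == o1))) *+ A r k.

Lemma rowmE r k : rowm r k = A r k.
Proof. by have [->|->] := ord2P k ij01; rewrite ?rowm0 ?rowm1. Qed.

Lemma mderiv_row k r u v : (('X_[rowm r] : S)^`M(k)).@[zpt 0 u v] = dev k r u v.
Proof.
rewrite mderivX mevalZ (zpt_mon ij01) /dev !mnmBE !rowmE !mnm1E mulr_natl.
by have [->|->] := ord2P k ij01.
Qed.

Lemma singularE u v : singular_at (poly_of_matrix R A) (zpt 0 u v) <->
  ev 0 u v + ev 1 u v = 0 /\ forall k, dev k 0 u v + dev k 1 u v = 0.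
Proof.
rewrite /singular_at poly_of_matrixE mevalD !(zpt_mon ij01) !rowm0 !rowm1 /ev.
have e k : (('X_[rowm 0] + 'X_[rowm 1] : S)^`M(k)).@[zpt 0 u v] = dev k 0 u v + dev k 1 u v.
  by rewrite mderivD mevalD !mderiv_row.
by split=> -[h1 h2]; split=> // k; [rewrite -e|rewrite e].
Qed.

Lemma zpt_eta (z : 'I_2 -> C) : z = zpt 0 (z 0) (z 1).
Proof. by apply/funext => k; rewrite /zpt; have [->|->] := ord2P k ij01. Qed.

Lemma origin_zpt : @origin R = zpt 0 0 0.
Proof. by apply/funext => k; rewrite /zpt /origin if_same. Qed.

Hypothesis Hiso : isolated_singularity (poly_of_matrix R A) (origin R).

(** A constant or linear monomial would make the polynomial or one of its derivatives nonzero at the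
    origin; the row sums are checked case by case. *)
Lemma row_sum_ge2 r : (2 <= A r o0 + A r o1)%N.
Proof.
have [/= hs _] := Hiso; move: hs; rewrite origin_zpt => /singularE[h0 hd].
have nz (n : nat) : (n%:R : C) = 0 -> n = 0%N by move=> /eqP; rewrite pnatr_eq0 => /eqP.
have e0 r' : ev r' 0 0 = ((A r' o0 == 0) * (A r' o1 == 0))%N%:R by rewrite /ev !expr0n natrM.
have ek k r' : dev k r' 0 0 = ((A r' o0 - (k == o0) == 0) * (A r' o1 - (k == o1) == 0) * A r' k)%N%:R.
  by rewrite /dev !expr0n -natrM -mulr_natr -natrM.
move: h0; rewrite !e0 -natrD => /nz h0.
have hx := hd 0; have hy := hd 1; move: hx hy; rewrite !ek -!natrD => /nz hx /nz hy.
move: h0 hx hy; rewrite /=; have [->|->] := ord2P r ij01.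
  move: (A o0 o0) (A o0 o1) (A o1 o0) (A o1 o1) => [|[|a]] [|[|b]] c d //=; lia.
move: (A o0 o0) (A o0 o1) (A o1 o0) (A o1 o1) => c d [|[|a]] [|[|b]] //=; lia.
Qed.

Lemma col_small k : (A o0 k <= 1)%N || (A o1 k <= 1)%N.
Proof.
apply/contraT; rewrite negb_or -!ltnNge => /andP[h0 h1].
have [_ [ra ra0 hr]] := Hiso.
pose c := ra / 2%:R; have c0 : 0 < c by rewrite divr_gt0 // ltr0n.
have cr : `|c| < ra by rewrite gtr0_norm // ltr_pdivrMr ?ltr0n // ltr_pMr // ltr1n.
(* If both monomials are divisible by the square of one variable, the whole axis where it vanishes
   is singular; this point of it lies within the radius. *)
pose z : 'I_2 -> C := if k == o0 then zpt 0 0 c else zpt 0 c 0.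
have hz0 (r : 'I_2) : (1 < A r k)%N by have [->|->] := ord2P r ij01.
have [n0 n1 n2] : [/\ forall r, (A r k == 0)%N = false, forall r, (A r k - 1 == 0)%N = false & true].
  by split=> // r; have := hz0 r; clear; case: (A r k) => [|[|n]].
have sz : singular_at (poly_of_matrix R A) z.
  rewrite /z; have [ek|ek] := ord2P k ij01; rewrite ek /= in n0 n1 *; apply/singularE; split=> [|k'].
  - by rewrite /ev !expr0n !n0 !mul0r addr0.
  - have [->|->] := ord2P k' ij01; rewrite /dev /= !expr0n ?n1 ?subn0 ?n0 !mul0r !mul0rn addr0 //.
  - by rewrite /ev !expr0n !n0 !mulr0 addr0.
  have [->|->] := ord2P k' ij01; rewrite /dev /= !expr0n ?n1 ?subn0 ?n0 !mulr0 !mul0rn addr0 //.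
have /hr/(_ _) hz : singular_at (poly_of_matrix R A) z := sz.
have : z (if k == o0 then o1 else o0) = 0.
  rewrite hz // => t; rewrite /origin subr0 /z; case: ifP => _; rewrite /zpt; case: ifP => _ //; by rewrite normr0.
rewrite /z; case: (k == o0); rewrite /zpt /= => e; by rewrite e ltxx in c0.
Qed.

(** The weighted action of the scalars preserves singular points and contracts them into any
    neighbourhood of the origin. *)
Lemma only_isolated (d1 d2 h : nat) : (0 < d1)%N -> (0 < d2)%N ->
  (forall r, d1 * A r o0 + d2 * A r o1 = h)%N -> only_isolated_singularity_origin (poly_of_matrix R A).
Proof.
move=> d10 d20 hd; split=> // z; rewrite (zpt_eta z); move: (z 0) (z 1) => a b hs.
have [_ [ra ra0 hr]] := Hiso.
(* The contraction factor ra / D is at most 1 and moves both coordinates inside the radius, D being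
   larger than either of them. *)
pose D := ra + 1 + `|a| + `|b|; have D0 : 0 < D by rewrite /D; do 2!apply: ltr_wpDr => //; rewrite addr_gt0.
pose u := ra / D; have u0 : 0 < u by rewrite divr_gt0.
have u1 : u <= 1 by rewrite ler_pdivrMr // mul1r /D -!addrA lerDl !addr_ge0.
have small (c : C) (d : nat) : (0 < d)%N -> `|c| < D -> `|u ^+ d * c| < ra.
  move=> dp cD; rewrite normrM normrX (gtr0_norm u0).
  apply: le_lt_trans (_ : u * `|c| < ra).
    apply: ler_wpM2r => //; rewrite -(prednK dp) exprS ler_piMr ?(ltW u0) //.
    by apply: exprn_ile1 => //; exact: ltW.
  by rewrite /u mulrAC ltr_pdivrMr // ltr_pM2l.
have aD : `|a| < D by rewrite /D addrAC -[ltLHS]add0r ltr_leD // ltr_wpDr // ?addr_gt0.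
have bD : `|b| < D by rewrite /D -[ltLHS]add0r ltr_leD // ltr_wpDr // ?addr_gt0.
have un0 : u != 0 by rewrite gt_eqF.
clearbody u.
have sh1 (r1 r2 r3 v w : C) : r1 * ((r2 * v) * (r3 * w)) = (r1 * r2) * r3 * (v * w) by ring.
have sh2 (r1 r2 r3 v w : C) : r1 * ((r2 * v) * (r3 * w)) = r2 * (r1 * r3) * (v * w) by ring.
have scale k r : u ^+ (if k == o0 then d1 else d2) * dev k r (u ^+ d1 * a) (u ^+ d2 * b) = u ^+ h * dev k r a b.
  rewrite /dev !mulrnAr; have [->|Ak] := posnP (A r k); first by rewrite !mulr0n.
  congr (_ *+ _); rewrite !exprMn -!exprM -(hd r).
  have [ek|ek] := ord2P k ij01; rewrite ek /= ?subn0 in Ak *.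
    have -> : (d1 * A r o0 = d1 + d1 * (A r o0 - 1))%N by rewrite -mulnS subn1 prednK.
    rewrite !exprD; exact: sh1.
  have -> : (d2 * A r o1 = d2 + d2 * (A r o1 - 1))%N by rewrite -mulnS subn1 prednK.
  rewrite !exprD; exact: sh2.
have /hr hz : singular_at (poly_of_matrix R A) (zpt 0 (u ^+ d1 * a) (u ^+ d2 * b)).
  move/singularE: hs => [e0 ed]; apply/singularE; split=> [|k].
    have ee r : ev r (u ^+ d1 * a) (u ^+ d2 * b) = u ^+ h * ev r a b.
      by rewrite /ev -(hd r) exprD !exprM !exprMn mulrACA.
    by rewrite !ee -mulrDr e0 mulr0.
  apply: (mulfI (expf_neq0 (if k == o0 then d1 else d2) un0)).
  by rewrite mulrDr !scale -mulrDr ed !mulr0.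
have hz' k : zpt 0 (u ^+ d1 * a) (u ^+ d2 * b) k = 0.
  apply: hz => t; rewrite /origin subr0 /zpt; case: ifP => _; exact: small.
move=> k; rewrite /origin /zpt; have := hz' 0; have := hz' 1; rewrite /zpt /=.
by move=> /eqP; rewrite mulf_eq0 expf_eq0 (negPf un0) andbF => /eqP -> /eqP; rewrite mulf_eq0 expf_eq0 (negPf un0) andbF => /eqP ->; rewrite if_same.
Qed.

End TwoMonomials.

Lemma row_degrees {R : realType} (A : 'M[nat]_2) d1 d2 h (G : tpoint R -> Prop) :
  admissible A d1 d2 h G -> forall r, (d1 * A r o0 + d2 * A r o1 = h)%N.
Proof.
move=> [_ hm hc] r; have n2 : (2%:R : R[i]) != 0 by rewrite pnatr_eq0.
have [_ h0 h1] := hm _ (hc _ n2).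
have hh (a b : nat) : (2%:R ^+ d1 : R[i]) ^+ a * (2%:R ^+ d2) ^+ b = 2%:R ^+ h -> (d1 * a + d2 * b = h)%N.
  by rewrite -!exprM -exprD -!natrX => /eqP; rewrite eqr_nat eqn_exp2l // => /eqP.
by have [->|->] := ord2P r (isT : (0 : 'I_2) != 1); apply: hh.
Qed.

Lemma exponents_large (p b a q d1 d2 : nat) : (0 < d1)%N -> (0 < d2)%N ->
  (d1 * p + d2 * b = d1 * a + d2 * q)%N -> ~ (p = a /\ b = q) ->
  (2 <= p + b)%N -> (2 <= a + q)%N -> (2 <= p + a)%N -> (2 <= b + q)%N -> (a <= 1)%N -> (b <= 1)%N ->
  (2 <= p)%N /\ (2 <= q)%N.
Proof.
move=> d10 d20 e ne h1 h2 h3 h4 a1 b1.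
case: (leqP 2 p) => hp; case: (leqP 2 q) => hq //; exfalso.
- have [eq [ea eb]] : q = 1%N /\ a = 1%N /\ b = 1%N by lia.
  by subst; apply: ne; split=> //; apply/eqP; rewrite -(eqn_pmul2l d10); apply/eqP; lia.
- have [ep [ea eb]] : p = 1%N /\ a = 1%N /\ b = 1%N by lia.
  by subst; apply: ne; split=> //; apply/eqP; rewrite -(eqn_pmul2l d20); apply/eqP; lia.
by apply: ne; lia.
Qed.

(** Singularity bounds each row and column sum from below, isolation forces a small entry in each
    column, for the matrix and its transpose. Up to the order of the rows only Fermat, chain and
    loop shapes survive. *)
Lemma classification {R : realType} (A : 'M[nat]_2) d1 d2 h (G : tpoint R -> Prop) :
  invertible_polynomial R A -> (0 < d1)%N -> (0 < d2)%N -> admissible A d1 d2 h G ->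
  exists r0 r1 : 'I_2, [/\ r0 != r1, (A r1 o0 <= 1)%N, (A r0 o1 <= 1)%N, (2 <= A r0 o0)%N & (2 <= A r1 o1)%N].
Proof.
move=> [hdet hi ht] d10 d20 /row_degrees hd.
have ne : ~ (A o0 o0 = A o1 o0 /\ A o0 o1 = A o1 o1).
  move=> [e1 e2]; move: hdet; rewrite unitmxE (@determinant_alternate _ _ _ 0 1) ?unitr0 // => k.
  by rewrite !mxE; have [->|->] := ord2P k (isT : (0 : 'I_2) != 1); rewrite ?e1 ?e2.
have hr r := row_sum_ge2 hi r; have hc r := row_sum_ge2 ht r.
have c0 := col_small hi 0; have c1 := col_small hi 1.
have t0 := col_small ht 0; have t1 := col_small ht 1.
have hc0 := hc 0; have hc1 := hc 1; have hr0 := hr 0; have hr1 := hr 1; have hd0 := hd 0; have hd1 := hd 1.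
rewrite !mxE in hc0 hc1 t0 t1.
have [/andP[s1 s2]|nd] := boolP ((A o1 o0 <= 1)%N && (A o0 o1 <= 1)%N).
  have [|p2 q2] := exponents_large d10 d20 _ ne hr0 hr1 hc0 hc1 s1 s2; first by rewrite hd0 hd1.
  by exists 0, 1.
have [s1 s2] : (A o0 o0 <= 1)%N /\ (A o1 o1 <= 1)%N by move: nd c0 c1 t0 t1; clear; lia.
have ne' : ~ (A o1 o0 = A o0 o0 /\ A o1 o1 = A o0 o1) by move=> [e1 e2]; apply: ne.
rewrite addnC in hc0; rewrite addnC in hc1.
have [|p2 q2] := exponents_large d10 d20 _ ne' hr1 hr0 hc0 hc1 s1 s2; first by rewrite hd0 hd1.
by exists 1, 0.
Qed.

(** * Milnor numbers *)

Section MilnorCount.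
Context {R : realType} (i j : 'I_2).
Hypothesis ij : i != j.
Local Notation S := (poly2 R).
Local Notation K := R[i].
Local Notation x := ('X_i : S).
Local Notation y := ('X_j : S).
Local Notation "'M' s t" := (x ^+ s * y ^+ t : S) (at level 10, s at level 8, t at level 8).

Lemma mdeg_ij (m : 'X_{1..2}) : mdeg m = (m i + m j)%N.
Proof.
have [[-> ->]|[-> ->]] := ord2_cases ij; rewrite mdegE !big_ord_recl big_ord0 addn0; last rewrite addnC.
  by congr (_ + m _)%N; apply: val_inj.
by congr (m _ + _)%N; apply: val_inj.
Qed.

Lemma split0 (q : S) : exists al be, q = (q@_0)%:MP + (x * al + y * be).
Proof.
elim/mpolyind: q => [|c m q _ _ [al [be eq]]].
  by exists 0, 0; rewrite mcoeff0 mpolyC0 !mulr0 !addr0.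
have [al' [be' em]] : exists al' be', c *: 'X_[m] = ((c *: 'X_[m] : S)@_0)%:MP + (x * al' + y * be').
  rewrite mcoeffZ mcoeffX; have [->|m0] := eqVneq m 0%MM.
    by exists 0, 0; rewrite mulr1 !mulr0 !addr0 mpolyX0 -mul_mpolyC mulr1.
  have -> : c * (false : nat)%:R = 0 :> K by rewrite mulr0.
  rewrite mpolyC0 [m](monE ij) monX; have [e|e] := posnP (m i).
    exists 0, (c *: y ^+ (m j).-1); rewrite add0r e expr0 mul1r mulr0 add0r -scalerAr -exprS prednK //.
    rewrite lt0n; apply: contraNneq m0 => e'; rewrite [m](monE ij) e e'.
    by apply/eqP/mnmP => k; rewrite mnm0E; have [->|->] := ord2P k ij; rewrite ?mon_i ?mon_j.
  exists (c *: (x ^+ (m i).-1 * y ^+ m j)), 0.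
  by rewrite add0r mulr0 addr0 -scalerAr mulrA -exprS prednK.
exists (al' + al), (be' + be); rewrite mcoeffD mpolyCD {1}em {1}eq; ring.
Qed.

Lemma eval_origin (q : S) : q.@[origin R] = q@_0.
Proof.
have [al [be {1}->]] := split0 q.
by rewrite !mevalD !mevalM !mevalXU mevalC /origin !mul0r !addr0.
Qed.

Context (F : S).
Local Notation J := (gen2 F^`M(i) F^`M(j)).

Lemma J0 : J 0. Proof. by exists 0, 0; rewrite !mulr0 addr0. Qed.
Lemma JD p q : J p -> J q -> J (p + q).
Proof. by move=> [a [b ->]] [a' [b' ->]]; exists (a + a'), (b + b'); ring. Qed.
Lemma JM p q : J q -> J (p * q).
Proof. by move=> [a [b ->]]; exists (p * a), (p * b); ring. Qed.
Lemma JN p : J p -> J (- p).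
Proof. by rewrite -mulN1r; exact: JM. Qed.
Lemma JZ c p : J p -> J (c *: p).
Proof. by rewrite -mul_mpolyC; exact: JM. Qed.

Context (g : nat -> nat -> S) (k : nat).
Hypothesis gk0 : forall s t, (k <= s + t)%N -> g s t = 0.

(** Reduction to a normal form: [g s t] is a proposed remainder of the monomial modulo the Jacobian
    ideal. If it kills the ideal and differs from the monomial by an element of it, the fixed
    monomials form a basis. *)
Definition nf (p : S) : S := \sum_(m : 'X_{1..2 < k}) p@_m *: g (m i) (m j).

Lemma nf_linear : linear nf.
Proof.
move=> c p q; rewrite /nf scaler_sumr -big_split /=; apply: eq_bigr => m _.
by rewrite mcoeffD mcoeffZ scalerDl scalerA.
Qed.
HB.instance Definition _ := GRing.isLinear.Build K S S _ nf nf_linear.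

Lemma nfD p q : nf (p + q) = nf p + nf q.
Proof. exact: linearD. Qed.

Lemma nfX s t : nf (M s t) = g s t.
Proof.
rewrite /nf -monX; have dm : mdeg (mon i j s t) = (s + t)%N by rewrite mdeg_ij mon_i // mon_j.
have [h|h] := ltnP (mdeg (mon i j s t)) k.
  rewrite (bigD1 (BMultinom h)) //= mcoeffX eqxx scale1r mon_i // mon_j // big1 ?addr0 // => m ne.
  rewrite mcoeffX; case: eqP => [e|_]; last by rewrite scale0r.
  by case/eqP: ne; apply: val_inj; rewrite /= e.
rewrite big1 ?gk0 -?dm // => m _; rewrite mcoeffX; case: eqP => [e|_]; last by rewrite scale0r.
by have := bmdeg m; rewrite -e ltnNge h.
Qed.

Lemma nfXZ s t c u v : nf (M s t * (c *: M u v)) = c *: g (s + u)%N (t + v)%N.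
Proof.
rewrite -scalerAr linearZ /=; congr (_ *: _); rewrite -nfX; congr nf.
by rewrite !exprD; ring.
Qed.

Lemma nf_two (D : S) (c c' : K) (u v u' v' s t : nat) : D = c *: M u v + c' *: M u' v' ->
  nf (M s t * D) = c *: g (s + u)%N (t + v)%N + c' *: g (s + u')%N (t + v')%N.
Proof. by move=> ->; rewrite mulrDr nfD !nfXZ. Qed.

Hypothesis nfi : forall s t, nf (M s t * F^`M(i)) = 0.
Hypothesis nfj : forall s t, nf (M s t * F^`M(j)) = 0.
Hypothesis gJ : forall s t, J (M s t - g s t).

Lemma nf_mul0 (d p : S) : (forall s t, nf (M s t * d) = 0) -> nf (p * d) = 0.
Proof.
move=> h; rewrite [p]mpolyE mulr_suml linear_sum big1 // => m _.
by rewrite -scalerAl linearZ /= [m](monE ij) monX h scaler0.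
Qed.

Lemma nfJ p : J p -> nf p = 0.
Proof. by move=> [a [b ->]]; rewrite linearD /= (mulrC _ a) (mulrC _ b) (nf_mul0 a nfi) (nf_mul0 b nfj) addr0. Qed.

Lemma sub_nf p : J (p - nf p).
Proof.
have -> : p - nf p = \sum_(m <- msupp p) (p@_m *: 'X_[m] - nf (p@_m *: 'X_[m])).
  by rewrite sumrB; congr (_ - _); [exact: mpolyE|rewrite {1}(mpolyE p) linear_sum].
apply: (big_ind J); [exact: J0|exact: JD|] => m _.
rewrite linearZ /= -scalerBr; apply: JZ; rewrite [m](monE ij) monX nfX; exact: gJ.
Qed.

Lemma high_J s t : (k <= s + t)%N -> J (M s t).
Proof. by move=> h; have := gJ s t; rewrite gk0 // subr0. Qed.

Lemma pow_J (al be : S) n p : (forall s t, (s + t)%N = n -> J (M s t * p)) -> J ((x * al + y * be) ^+ n * p).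
Proof.
elim: n p => [|n IH] p h; first by have := h 0%N 0%N erefl; rewrite !expr0 mulr1.
rewrite exprSr -mulrA; apply: IH => s t e.
have -> : M s t * ((x * al + y * be) * p) = al * (M s.+1 t * p) + be * (M s t.+1 * p).
  by rewrite !exprSr; ring.
by apply: JD; apply: JM; apply: h; rewrite ?addnS ?addSn e.
Qed.

(** Monomials of degree at least k lie in J, so a geometric series inverts every polynomial with
    nonzero constant term modulo J. *)
Lemma inv_mod (q : S) : q.@[origin R] != 0 -> exists u r, J r /\ u * q = 1 + r.
Proof.
rewrite eval_origin => q0; have [al [be eq]] := split0 q; move: (q@_0) q0 eq => c c0 eq.
pose t := x * (- c^-1 *: al) + y * (- c^-1 *: be).
have e1 : c^-1%:MP * c%:MP = 1 :> S by rewrite -mpolyCM mulVf // mpolyC1.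
have et : c^-1%:MP * q = 1 - t.
  rewrite eq mulrDr e1 /t -!mul_mpolyC mpolyCN; ring.
exists ((\sum_(n < k) t ^+ n) * c^-1%:MP), (- t ^+ k); split.
  by apply: JN; rewrite -[_ ^+ _]mulr1; apply: pow_J => s u e; rewrite mulr1; apply: high_J; rewrite e.
by rewrite -mulrA et -opprB mulrN mulrC -subrX1 opprB.
Qed.

Definition LJ (v : {fraction S}) := local_jacobian_ideal F (origin R) v.
Local Notation tf := (@tofrac S).

Lemma sum_ij (V : zmodType) (a : 'I_2 -> V) : \sum_(t < 2) a t = a i + a j.
Proof.
rewrite !big_ord_recl big_ord0 addr0; have -> : lift ord0 ord0 = 1 :> 'I_2 by apply: val_inj.
by have [[-> ->]|[-> ->]] := ord2_cases ij; rewrite // addrC.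
Qed.

Lemma LJP v : LJ v <-> exists a b, [/\ local_ring (origin R) a, local_ring (origin R) b
  & v = a * tf F^`M(i) + b * tf F^`M(j)].
Proof.
split=> [[a [h ->]]|[a [b [ha hb ->]]]]; first by exists (a i), (a j); rewrite sum_ij.
exists (fun t => if t == i then a else b); split=> [t|]; first by case: ifP.
by rewrite sum_ij eqxx eq_sym (negPf ij).
Qed.

Lemma one0 : (1 : S).@[origin R] != 0. Proof. by rewrite meval1 oner_neq0. Qed.

Lemma local_tf p : local_ring (origin R) (tf p).
Proof. by exists p, 1; split; [exact: one0|rewrite tofrac1 divr1]. Qed.

Lemma localM a b : local_ring (origin R) a -> local_ring (origin R) b -> local_ring (origin R) (a * b).
Proof.
move=> [p [q [q0 ->]]] [p' [q' [q0' ->]]]; exists (p * p'), (q * q'); split.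
  by rewrite mevalM mulf_neq0.
by rewrite !tofracM mulf_div.
Qed.

Lemma tf_neq0 q : q.@[origin R] != 0 -> tf q != 0.
Proof. by move=> h; rewrite tofrac_eq0; apply: contraNneq h => ->; rewrite meval0. Qed.

Lemma localD a b : local_ring (origin R) a -> local_ring (origin R) b -> local_ring (origin R) (a + b).
Proof.
move=> [p [q [q0 ->]]] [p' [q' [q0' ->]]]; exists (p * q' + p' * q), (q * q'); split.
  by rewrite mevalM mulf_neq0.
by rewrite addf_div ?tf_neq0 // tofracD !tofracM.
Qed.

Lemma LJ_J a p : local_ring (origin R) a -> J p -> LJ (a * tf p).
Proof.
move=> ha [u [v ->]]; apply/LJP; exists (a * tf u), (a * tf v).
split; try by apply: localM => //; exact: local_tf.
by rewrite tofracD !tofracM mulrDr !mulrA ![_ * tf u]mulrAC ![_ * tf v]mulrAC.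
Qed.

Lemma LJD v w : LJ v -> LJ w -> LJ (v + w).
Proof.
move=> /LJP[a [b [ha hb ->]]] /LJP[a' [b' [ha' hb' ->]]]; apply/LJP.
by exists (a + a'), (b + b'); split; try exact: localD; rewrite !mulrDl addrACA.
Qed.

Lemma LJZ a v : local_ring (origin R) a -> LJ v -> LJ (a * v).
Proof.
move=> ha /LJP[b [c [hb hc ->]]]; apply/LJP; exists (a * b), (a * c); split; try exact: localM.
by rewrite mulrDr !mulrA.
Qed.

Lemma frac_clear (L : fieldType) (a b c d u v : L) : c != 0 -> u != 0 ->
  (a / c * b + d / u * v) * (c * u) = b * (a * u) + v * (d * c).
Proof. by move=> c0 u0; field; rewrite c0 u0. Qed.

(** Denominators are units modulo J, so the local ideal contracts to J and the local count can be
    made with polynomials. *)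
Lemma LJ_tf p : LJ (tf p) -> J p.
Proof.
move=> /LJP[_ [_ [[p0 [q0 [h0 ->]]] [p1 [q1 [h1 ->]]] e]]].
have n0 := tf_neq0 h0; have n1 := tf_neq0 h1.
have e' : p * (q0 * q1) = F^`M(i) * (p0 * q1) + F^`M(j) * (p1 * q0).
  apply/eqP; rewrite -tofrac_eq; apply/eqP; rewrite tofracD !tofracM e.
  exact: (@frac_clear _ (tf p0) (tf F^`M(i)) (tf q0) (tf p1) (tf q1) (tf F^`M(j)) n0 n1).
have hq : (q0 * q1).@[origin R] != 0 by rewrite mevalM mulf_neq0.
have [u [r [hr eu]]] := inv_mod hq.
have -> : p = u * (p * (q0 * q1)) - p * r.
  by rewrite mulrCA eu; ring.
apply: JD; last by apply: JN; exact: JM.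
by apply: JM; exists (p0 * q1), (p1 * q0).
Qed.

Context (bs : seq (nat * nat)).
Hypothesis bs_uniq : uniq bs.
Hypothesis gb : forall d, d \in bs -> g d.1 d.2 = M d.1 d.2.
Hypothesis gs : forall s t, g s t = 0 \/ exists c d, d \in bs /\ g s t = c *: M d.1 d.2.

Let bas (t : 'I_(size bs)) : nat * nat := nth (0%N, 0%N) bs t.
Let MM (t : 'I_(size bs)) : S := M (bas t).1 (bas t).2.

Let bas_in t : bas t \in bs. Proof. exact: mem_nth. Qed.

Let nf_span p : exists c : 'I_(size bs) -> K, nf p = \sum_t c t *: MM t.
Proof.
rewrite /nf; apply: (big_ind (fun p => exists c : 'I_(size bs) -> K, p = \sum_t c t *: MM t)).
- by exists (fun=> 0); rewrite big1 // => t _; rewrite scale0r.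
- move=> _ _ [c ->] [c' ->]; exists (fun t => c t + c' t).
  by rewrite -big_split; apply: eq_bigr => t _; rewrite scalerDl.
move=> m _; have [->|[c [d [hd ->]]]] := gs (m i) (m j).
  by exists (fun=> 0); rewrite scaler0 big1 // => t _; rewrite scale0r.
have hi : (index d bs < size bs)%N by rewrite index_mem.
exists (fun t => if t == Ordinal hi then p@_m * c else 0).
rewrite (bigD1 (Ordinal hi)) //= eqxx big1 ?addr0; last by move=> t /negPf ->; rewrite scale0r.
by rewrite scalerA /MM /bas /= nth_index.
Qed.

Let MM_indep (c : 'I_(size bs) -> K) : \sum_t c t *: MM t = 0 -> forall t, c t = 0.
Proof.
move=> e t; have := congr1 (mcoeff (mon i j (bas t).1 (bas t).2)) e.
rewrite mcoeff0 raddf_sum (bigD1 t) //= mcoeffZ /MM -monX mcoeffX eqxx mulr1 big1 ?addr0 // => t' ne.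
rewrite mcoeffZ -monX mcoeffX; case: eqP => [em|_]; last by rewrite mulr0.
case/eqP: ne; apply: val_inj; apply/eqP; rewrite -(nth_uniq (0%N, 0%N) (ltn_ord t') (ltn_ord t) bs_uniq); apply/eqP.
have e1 : (bas t').1 = (bas t).1 by have := congr1 (fun m : 'X_{1..2} => m i) em; rewrite !mon_i.
have e2 : (bas t').2 = (bas t).2 by have := congr1 (fun m : 'X_{1..2} => m j) em; rewrite !mon_j.
by rewrite -/(bas t') -/(bas t) (surjective_pairing (bas t')) e1 e2 -surjective_pairing.
Qed.

Let scl (c : K) (v : {fraction S}) := tf c%:MP * v.

Let tf_sum n (c : 'I_n -> K) (p : 'I_n -> S) : \sum_t scl (c t) (tf (p t)) = tf (\sum_t c t *: p t).
Proof. by rewrite raddf_sum; apply: eq_bigr => t _; rewrite /= -mul_mpolyC tofracM. Qed.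

Lemma milnor_basis : subquot_basis scl (local_ring (origin R)) LJ (fun t => tf (MM t)).
Proof.
split=> [t|v [p [q [q0 ->]]]|c].
- exact: local_tf.
- have [u [r [hr eu]]] := inv_mod q0; have [c ec] := nf_span (u * p).
  exists c; rewrite tf_sum -ec.
  have -> : tf p / tf q - tf (nf (u * p)) = (- (tf p / tf q)) * tf r + 1 * tf (u * p - nf (u * p)).
    have n0 := tf_neq0 q0; have -> : r = u * q - 1 by rewrite eu addrAC subrr add0r.
    rewrite !tofracB !tofracM tofrac1 mul1r mulNr mulrBr mulr1 opprB.
    rewrite [tf u * tf q]mulrC mulrA divfK // [tf p * tf u]mulrC.
    by rewrite addrA -[_ - _ + _ in RHS]addrA addNr addr0.
  apply: LJD; apply: LJ_J => //; last exact: sub_nf.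
    by rewrite -mulN1r; apply: localM; [rewrite -tofrac1 -tofracN; exact: local_tf|exists p, q].
  by rewrite -tofrac1; exact: local_tf.
rewrite tf_sum => /LJ_tf/nfJ h; apply: MM_indep; rewrite -[RHS]h linear_sum.
by apply: eq_bigr => t _; rewrite linearZ /MM /= nfX gb.
Qed.

(** More elements than a spanning family would have a coefficient matrix with nonzero kernel, hence
    a relation. *)
Let basis_le (m n : nat) (b : 'I_m -> {fraction S}) (b' : 'I_n -> {fraction S}) :
  subquot_basis scl (local_ring (origin R)) LJ b -> subquot_basis scl (local_ring (origin R)) LJ b' -> (n <= m)%N.
Proof.
move=> [_ hs _] [hz _ hi]; have /choice[C hC] : forall t, exists c : 'I_m -> K, LJ (b' t - \sum_s scl (c s) (b s)).
  by move=> t; exact: hs.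
pose A : 'M[K]_(n, m) := \matrix_(t, s) C t s.
rewrite leqNgt; apply/negP => lt.
have kn : kermx A != 0.
  by rewrite -mxrank_eq0 mxrank_ker -lt0n subn_gt0 (leq_ltn_trans (rank_leq_col A)).
have [r hr] : exists r, row r (kermx A) != 0.
  apply: contrapT => no; case/eqP: kn; apply/row_matrixP => r; rewrite row0.
  by apply/eqP; apply: contrapT => h; apply: no; exists r; apply/negP.
set v := row r (kermx A) in hr.
have vA : v *m A = 0 by apply/sub_kermxP; exact: row_sub.
have hv : LJ (\sum_t scl (v 0 t) (b' t)).
  have z0 : \sum_t scl (v 0 t) (\sum_s scl (C t s) (b s)) = 0.
    rewrite (eq_bigr (fun t => \sum_s scl (v 0 t) (scl (C t s) (b s)))); last first.
      by move=> t _; rewrite /scl mulr_sumr.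
    rewrite exchange_big big1 // => s _.
    have -> : \sum_t scl (v 0 t) (scl (C t s) (b s)) = scl ((v *m A) 0 s) (b s).
      rewrite mxE /scl raddf_sum [tofrac _]raddf_sum mulr_suml; apply: eq_bigr => t _.
      by rewrite /= [A _ _]mxE mpolyCM tofracM mulrA.
    by rewrite vA mxE /scl mpolyC0 tofrac0 mul0r.
  have -> : \sum_t scl (v 0 t) (b' t) = \sum_t scl (v 0 t) (b' t - \sum_s scl (C t s) (b s)).
    have e t : scl (v 0 t) (b' t - \sum_s scl (C t s) (b s)) = scl (v 0 t) (b' t) - scl (v 0 t) (\sum_s scl (C t s) (b s)).
      by rewrite /scl mulrBr.
    by rewrite (eq_bigr _ (fun t _ => e t)) sumrB z0 subr0.
  apply: (big_ind LJ); [|exact: LJD|by move=> t _; apply: LJZ => //; exact: local_tf].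
  apply/LJP; exists 0, 0; rewrite !mul0r addr0 -tofrac0; split=> //; exact: local_tf.
case/negP: hr; apply/eqP/rowP => t; rewrite [RHS]mxE.
exact: (hi (fun t => v 0 t) hv t).
Qed.

Lemma milnor_count mu : is_milnor_number F (origin R) mu -> mu = size bs.
Proof.
move=> [b hb]; apply/eqP; rewrite eqn_leq.
by rewrite (basis_le milnor_basis hb) (basis_le hb milnor_basis).
Qed.

End MilnorCount.

Section MilnorValue.
Context {R : realType}.
Local Notation S := (poly2 R).
Local Notation K := R[i].

Section Plane2.
Context (i j : 'I_2).
Hypothesis ij : i != j.
Local Notation x := ('X_i : S).
Local Notation y := ('X_j : S).
Local Notation "'M' s t" := (x ^+ s * y ^+ t : S) (at level 10, s at level 8, t at level 8).

Lemma derivx (u v : nat) : (M u v)^`M(i) = u%:R *: M (u - 1)%N v.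
Proof.
rewrite -(monX i j) mderivX mon_i //; congr (_ *: _); rewrite -(monX i j); congr 'X_[_].
apply/mnmP => k; rewrite mnmBE mnm1E; have [->|->] := ord2P k ij; rewrite ?mon_i ?mon_j // ?eqxx //.
by rewrite (negPf ij) subn0.
Qed.

Lemma derivy (u v : nat) : (M u v)^`M(j) = v%:R *: M u (v - 1)%N.
Proof.
rewrite -(monX i j) mderivX mon_j //; congr (_ *: _); rewrite -(monX i j); congr 'X_[_].
apply/mnmP => k; rewrite mnmBE mnm1E; have [->|->] := ord2P k ij; rewrite ?mon_i ?mon_j // ?eqxx //.
by rewrite eq_sym (negPf ij) subn0.
Qed.

Context (p q : nat).
Hypotheses (p2 : (2 <= p)%N) (q2 : (2 <= q)%N).
Let pK : (p%:R : K) != 0. Proof. by rewrite pnatr_eq0; case: (p) p2. Qed.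
Let qK : (q%:R : K) != 0. Proof. by rewrite pnatr_eq0; case: (q) q2. Qed.

Definition box (a b : nat) : seq (nat * nat) := [seq (s, t) | s <- iota 0 a, t <- iota 0 b].

Lemma mem_box a b d : (d \in box a b) = (d.1 < a)%N && (d.2 < b)%N.
Proof.
case: d => s t; apply/allpairsP/andP => [[[s' t'] [h1 h2 [-> ->]]]|[h1 h2]].
  by move: h1 h2; rewrite !mem_iota.
by exists (s, t); rewrite !mem_iota.
Qed.

Lemma box_uniq a b : uniq (box a b).
Proof. by rewrite allpairs_uniq ?iota_uniq // => -[? ?] [? ?] _ _ [-> ->]. Qed.

Lemma size_box a b : size (box a b) = (a * b)%N.
Proof. by rewrite size_allpairs !size_iota. Qed.

Lemma milnor_fermat mu : is_milnor_number (x ^+ p + y ^+ q) (origin R) mu -> mu = ((p - 1) * (q - 1))%N.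
Proof.
have eF : x ^+ p + y ^+ q = M p 0 + M 0 q by rewrite !expr0 mulr1 mul1r.
rewrite eF; set F := (X in is_milnor_number X).
have di : F^`M(i) = p%:R *: M (p - 1)%N 0 by rewrite mderivD !derivx scale0r addr0.
have dj : F^`M(j) = q%:R *: M 0 (q - 1)%N by rewrite mderivD !derivy scale0r add0r.
pose g s t : S := if (s < p - 1)%N && (t < q - 1)%N then M s t else 0.
have gz s t : (p - 1 <= s)%N \/ (q - 1 <= t)%N -> g s t = 0.
  by move=> h; rewrite /g; case: ifP => //; lia.
have Jx s t : (p - 1 <= s)%N -> gen2 F^`M(i) F^`M(j) (M s t).
  move=> h; exists (p%:R^-1 *: M (s - (p - 1))%N t), 0; rewrite mulr0 addr0 di -scalerAl -scalerAr scalerA divff // scale1r.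
  by rewrite expr0 mulr1 mulrA -exprD subnKC.
have Jy s t : (q - 1 <= t)%N -> gen2 F^`M(i) F^`M(j) (M s t).
  move=> h; exists 0, (q%:R^-1 *: M s (t - (q - 1))%N); rewrite mulr0 add0r dj -scalerAl -scalerAr scalerA divff // scale1r.
  by rewrite expr0 mul1r mulrCA -exprD subnKC.
move=> hmu; rewrite -(size_box (p - 1) (q - 1)).
apply: (milnor_count (g := g) (k := (p + q)%N) ij _ _ _ _ _ _ _ hmu).
- by move=> s t h; apply: gz; lia.
- by move=> s t; rewrite di nfXZ // ?gz ?scaler0 //; [left; lia|move=> ? ? ?; apply: gz; lia].
- by move=> s t; rewrite dj nfXZ // ?gz ?scaler0 //; [right; lia|move=> ? ? ?; apply: gz; lia].
- move=> s t; rewrite /g; case: ifP => h; first by rewrite subrr; exact: J0.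
  rewrite subr0; have [h1|h1] := leqP (p - 1) s; first exact: Jx.
  by apply: Jy; move: h; rewrite h1 /= ltnNge => /negbFE.
- exact: box_uniq.
- by move=> [s t]; rewrite mem_box /g => ->.
move=> s t; rewrite /g; case: ifP => h; [right|by left].
by exists 1, (s, t); rewrite mem_box scale1r.
Qed.

Lemma milnor_chain mu : is_milnor_number (x ^+ p + x * y ^+ q) (origin R) mu -> mu = (p * (q - 1) + 1)%N.
Proof.
have eF : x ^+ p + x * y ^+ q = M p 0 + M 1 q by rewrite !expr0 mulr1 expr1.
rewrite eF; set F := (X in is_milnor_number X).
have di : F^`M(i) = p%:R *: M (p - 1)%N 0 + 1 *: M 0 q by rewrite mderivD !derivx.
have dj : F^`M(j) = q%:R *: M 1 (q - 1)%N by rewrite mderivD !derivy scale0r add0r.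
(* The basis is a box and one extra power of y. Pure powers y^t with q <= t < 2q - 1 reduce by F_x;
   larger ones reach x y^(q-1), a multiple of F_y. *)
pose c1 s t := (s < p)%N && (t < q - 1)%N || (s == 0%N) && (t == (q - 1)%N).
pose c2 s t := (s == 0%N) && (q <= t)%N && (t < 2 * q - 1)%N.
pose g s t : S := if c1 s t then M s t else if c2 s t then - p%:R *: M (p - 1)%N (t - q)%N else 0.
have g1 s t : c1 s t -> g s t = M s t by rewrite /g => ->.
have g2 t : (q <= t)%N -> (t < 2 * q - 1)%N -> g 0%N t = - p%:R *: M (p - 1)%N (t - q)%N.
  by move=> h h'; rewrite /g ifF ?ifT // /c1 /c2; lia.
have gz s t : ~~ c1 s t -> ~~ c2 s t -> g s t = 0 by rewrite /g => /negPf -> /negPf ->.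
have gk0 s t : (p + 2 * q <= s + t)%N -> g s t = 0 by move=> h; apply: gz; rewrite /c1 /c2; lia.
have MM s t u v : M s t * M u v = M (s + u)%N (t + v)%N by rewrite !exprD; ring.
have nfx s t : nf i j g (p + 2 * q) (M s t * F^`M(i)) = 0.
  rewrite (nf_two ij gk0 s t di) scale1r !addn0.
  have [s0|s0] := posnP s; last by rewrite (gz (s + _)%N) ?(gz s) ?scaler0 ?addr0 // /c1 /c2; lia.
  rewrite s0 add0n; have [h1|h1] := ltnP t (q - 1).
    rewrite g1 ?g2 ?scaleNr; try by rewrite /c1 /c2; lia.
    by rewrite addnK subrr.
  by rewrite (gz (p - 1)%N) ?(gz 0%N) ?scaler0 ?addr0 // /c1 /c2; lia.
have nfy s t : nf i j g (p + 2 * q) (M s t * F^`M(j)) = 0.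
  by rewrite dj nfXZ // gz ?scaler0 // /c1 /c2; lia.
have Jy s t : (0 < s)%N -> (q - 1 <= t)%N -> gen2 F^`M(i) F^`M(j) (M s t).
  move=> h h'; exists 0, (q%:R^-1 *: M (s - 1)%N (t - (q - 1))%N).
  by rewrite mulr0 add0r dj -scalerAl -scalerAr scalerA divff // scale1r MM !subnKC.
have Jx s t : gen2 F^`M(i) F^`M(j) (p%:R *: M (s + (p - 1))%N t + M s (t + q)%N).
  exists (M s t), 0; rewrite mulr0 addr0 di scale1r mulrDl -scalerAl !MM.
  by rewrite !add0n [(p - 1 + s)%N]addnC [(q + t)%N]addnC.
have Jp s t : (p <= s)%N -> gen2 F^`M(i) F^`M(j) (M s t).
  move=> h; have h1 := Jx (s - (p - 1))%N t; rewrite subnK in h1; last by lia.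
  have h2 : gen2 F^`M(i) F^`M(j) (M (s - (p - 1))%N (t + q)%N) by apply: Jy; lia.
  have -> : M s t = p%:R^-1 *: ((p%:R *: M s t + M (s - (p - 1))%N (t + q)%N) - M (s - (p - 1))%N (t + q)%N).
    by rewrite addrK scalerA mulVf // scale1r.
  by apply: JZ; apply: JD => //; exact: JN.
have -> : (p * (q - 1) + 1)%N = size (box p (q - 1) ++ [:: (0%N, (q - 1)%N)]) by rewrite size_cat size_box.
move=> hmu; apply: (milnor_count (g := g) ij gk0 nfx nfy _ _ _ _ hmu).
- move=> s t; have [h1|h1] := boolP (c1 s t); first by rewrite g1 // subrr; exact: J0.
  have [h2|h2] := boolP (c2 s t).
    move: h2; rewrite /c2 => /andP[/andP[/eqP s0 h2] h3]; rewrite s0 g2 // scaleNr opprK.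
    by have := Jx 0%N (t - q)%N; rewrite subnK // add0n addrC.
  rewrite gz // subr0; have [h3|h3] := leqP p s; first exact: Jp.
  have [s0|s0] := posnP s; last by apply: Jy => //; move: h1; rewrite /c1; lia.
  have ht : (2 * q - 1 <= t)%N by move: h1 h2; rewrite /c1 /c2; lia.
  have h4 := Jx 0%N (t - q)%N; rewrite subnK in h4; last by lia.
  rewrite s0; rewrite -[M 0 t](addKr (p%:R *: M (0 + (p - 1))%N (t - q)%N)).
  by apply: JD => //; apply: JN; apply: JZ; apply: Jy; lia.
- rewrite cat_uniq box_uniq andbT /= orbF mem_box /=; lia.
- move=> [s t]; rewrite mem_cat mem_box inE /= => h; apply: g1; rewrite /c1.
  by case/orP: h => [->//|/eqP[-> ->]]; rewrite !eqxx orbT.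
move=> s t; have [h1|h1] := boolP (c1 s t).
  by right; exists 1, (s, t); rewrite g1 // scale1r mem_cat mem_box inE /=; split.
have [h2|h2] := boolP (c2 s t); last by left; exact: gz.
move: h2; rewrite /c2 => /andP[/andP[/eqP s0 h2] h3]; rewrite s0 g2 //; right.
exists (- p%:R), ((p - 1)%N, (t - q)%N); split=> //.
by rewrite mem_cat mem_box /=; apply/orP; left; lia.
Qed.

Lemma milnor_loop mu : is_milnor_number (x ^+ p * y + x * y ^+ q) (origin R) mu -> mu = (p * q)%N.
Proof.
have eF : x ^+ p * y + x * y ^+ q = M p 1 + M 1 q by rewrite !expr1.
rewrite eF; set F := (X in is_milnor_number X).
have di : F^`M(i) = p%:R *: M (p - 1)%N 1 + 1 *: M 0 q by rewrite mderivD !derivx.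
have dj : F^`M(j) = 1 *: M p 0 + q%:R *: M 1 (q - 1)%N by rewrite mderivD !derivy.
pose c1 s t := (s < p)%N && (t < q)%N.
pose c2 s t := (s == 0%N) && (q <= t)%N && (t < 2 * q - 1)%N.
pose c3 s t := (t == 0%N) && (p <= s)%N && (s < 2 * p - 1)%N.
(* Only the two axes need a rewriting rule, by F_x along y and by F_y along x; every other monomial
   outside the box lies in the ideal. *)
pose g s t : S := if c1 s t then M s t else if c2 s t then - p%:R *: M (p - 1)%N (t - q + 1)%N
  else if c3 s t then - q%:R *: M (s - p + 1)%N (q - 1)%N else 0.
have g1 s t : c1 s t -> g s t = M s t by rewrite /g => ->.
have g2 t : (q <= t)%N -> (t < 2 * q - 1)%N -> g 0%N t = - p%:R *: M (p - 1)%N (t - q + 1)%N.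
  by move=> h h'; rewrite /g ifF ?ifT // /c1 /c2; lia.
have g3 s : (p <= s)%N -> (s < 2 * p - 1)%N -> g s 0%N = - q%:R *: M (s - p + 1)%N (q - 1)%N.
  move=> h h'; have n1 : c1 s 0%N = false by rewrite /c1; lia.
  have n2 : c2 s 0%N = false by rewrite /c2; lia.
  have n3 : c3 s 0%N by rewrite /c3; lia.
  by rewrite /g n1 n2 n3.
have gz s t : ~~ c1 s t -> ~~ c2 s t -> ~~ c3 s t -> g s t = 0 by rewrite /g => /negPf -> /negPf -> /negPf ->.
have gk0 s t : (2 * p + 2 * q <= s + t)%N -> g s t = 0 by move=> h; apply: gz; rewrite /c1 /c2 /c3; lia.
have MM s t u v : M s t * M u v = M (s + u)%N (t + v)%N by rewrite !exprD; ring.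
have nfx s t : nf i j g (2 * p + 2 * q) (M s t * F^`M(i)) = 0.
  rewrite (nf_two ij gk0 s t di) scale1r addn0.
  have [s0|s0] := posnP s; last by rewrite (gz (s + _)%N) ?(gz s) ?scaler0 ?addr0 // /c1 /c2 /c3; lia.
  rewrite s0 add0n; have [h1|h1] := ltnP (t + 1) q.
    rewrite g1 ?g2 ?scaleNr; try by rewrite /c1 /c2; lia.
    by rewrite addnK subrr.
  by rewrite (gz (p - 1)%N) ?(gz 0%N) ?scaler0 ?addr0 // /c1 /c2 /c3; lia.
have nfy s t : nf i j g (2 * p + 2 * q) (M s t * F^`M(j)) = 0.
  rewrite (nf_two ij gk0 s t dj) scale1r addn0.
  have [t0|t0] := posnP t; last by rewrite (gz (s + p)%N) ?(gz (s + 1)%N) ?scaler0 ?addr0 // /c1 /c2 /c3; lia.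
  rewrite t0 add0n; have [h1|h1] := ltnP (s + 1) p.
    rewrite (g1 (s + 1)%N) ?g3 ?scaleNr; try by rewrite /c1 /c2; lia.
    by rewrite addnK addNr.
  by rewrite (gz (s + p)%N) ?(gz (s + 1)%N) ?scaler0 ?addr0 // /c1 /c2 /c3; lia.
have Jx s t : gen2 F^`M(i) F^`M(j) (p%:R *: M (s + (p - 1))%N (t + 1)%N + M s (t + q)%N).
  exists (M s t), 0; rewrite mulr0 addr0 di scale1r mulrDl -scalerAl !MM.
  by rewrite add0n [(p - 1 + s)%N]addnC [(1 + t)%N]addnC [(q + t)%N]addnC.
have Jy s t : gen2 F^`M(i) F^`M(j) (M (s + p)%N t + q%:R *: M (s + 1)%N (t + (q - 1))%N).
  exists 0, (M s t); rewrite mulr0 add0r dj scale1r mulrDl -scalerAl !MM.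
  by rewrite add0n [(p + s)%N]addnC [(1 + s)%N]addnC [(q - 1 + t)%N]addnC.
have pq1 : (p%:R * q%:R - 1 : K) != 0.
  by rewrite -natrM -[1]/(1%:R) subr_eq0 eqr_nat; nia.
(* x F_x and y F_y are independent combinations of x^p y and x y^q, as p q <> 1. *)
have Jxy s t : gen2 F^`M(i) F^`M(j) (M (s + p)%N (t + 1)%N) /\ gen2 F^`M(i) F^`M(j) (M (s + 1)%N (t + q)%N).
  have h1 := Jx (s + 1)%N t; have h2 := Jy s (t + 1)%N.
  have e1 : (s + 1 + (p - 1) = s + p)%N by lia.
  have e2 : (t + 1 + (q - 1) = t + q)%N by lia.
  rewrite e1 in h1; rewrite e2 in h2; move: h1 h2; move: (M (s + p)%N (t + 1)%N) (M (s + 1)%N (t + q)%N) => a b h1 h2; split.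
    have e3 : q%:R *: (p%:R *: a + b) - (a + q%:R *: b) = (p%:R * q%:R - 1) *: a.
      by rewrite scalerDr scalerA opprD addrACA subrr addr0 scalerBl scale1r mulrC.
    have -> : a = (p%:R * q%:R - 1)^-1 *: (q%:R *: (p%:R *: a + b) - (a + q%:R *: b)).
      by rewrite e3 scalerA mulVf // scale1r.
    by apply: JZ; apply: JD; [exact: JZ|exact: JN].
  have e4 : p%:R *: (a + q%:R *: b) - (p%:R *: a + b) = (p%:R * q%:R - 1) *: b.
    by rewrite scalerDr scalerA opprD addrACA subrr add0r scalerBl scale1r.
  have -> : b = (p%:R * q%:R - 1)^-1 *: (p%:R *: (a + q%:R *: b) - (p%:R *: a + b)).
    by rewrite e4 scalerA mulVf // scale1r.
  by apply: JZ; apply: JD; [exact: JZ|exact: JN].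
have Jp s t : (p <= s)%N -> (0 < t)%N -> gen2 F^`M(i) F^`M(j) (M s t).
  by move=> h h'; have := (Jxy (s - p)%N (t - 1)%N).1; rewrite !subnK.
have Jq s t : (0 < s)%N -> (q <= t)%N -> gen2 F^`M(i) F^`M(j) (M s t).
  by move=> h h'; have := (Jxy (s - 1)%N (t - q)%N).2; rewrite !subnK.
rewrite -(size_box p q) => hmu; apply: (milnor_count (g := g) ij gk0 nfx nfy _ _ _ _ hmu).
- move=> s t; have [h1|h1] := boolP (c1 s t); first by rewrite g1 // subrr; exact: J0.
  have [h2|h2] := boolP (c2 s t).
    move: h2; rewrite /c2 => /andP[/andP[/eqP s0 h2] h3]; rewrite s0 g2 // scaleNr opprK.
    by have := Jx 0%N (t - q)%N; rewrite subnK // add0n addrC.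
  have [h3|h3] := boolP (c3 s t).
    move: h3; rewrite /c3 => /andP[/andP[/eqP t0 h3] h4]; rewrite t0 g3 // scaleNr opprK.
    by have := Jy (s - p)%N 0%N; rewrite subnK // add0n.
  rewrite gz // subr0; have [t0|t0] := posnP t.
    have hs : (2 * p - 1 <= s)%N by move: h1 h3; rewrite /c1 /c3; lia.
    have h4 := Jy (s - p)%N 0%N; rewrite subnK in h4; last by lia.
    rewrite t0 -[M s 0](addrK (q%:R *: M (s - p + 1)%N (0 + (q - 1))%N)).
    by apply: JD => //; apply: JN; apply: JZ; apply: Jp; lia.
  have [s0|s0] := posnP s; last by have [h4|h4] := leqP p s; [exact: Jp|apply: Jq => //; move: h1; rewrite /c1; lia].
  have ht : (2 * q - 1 <= t)%N by move: h1 h2; rewrite /c1 /c2; lia.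
  have h4 := Jx 0%N (t - q)%N; rewrite subnK in h4; last by lia.
  rewrite s0 -[M 0 t](addKr (p%:R *: M (0 + (p - 1))%N (t - q + 1)%N)).
  by apply: JD => //; apply: JN; apply: JZ; apply: Jq; lia.
- exact: box_uniq.
- by move=> [s t]; rewrite mem_box => h; exact: g1.
move=> s t; have [h1|h1] := boolP (c1 s t).
  by right; exists 1, (s, t); rewrite g1 // scale1r mem_box.
have [h2|h2] := boolP (c2 s t).
  move: h2; rewrite /c2 => /andP[/andP[/eqP s0 h2] h3]; rewrite s0 g2 //; right.
  exists (- p%:R), ((p - 1)%N, (t - q + 1)%N); split=> //.
  by rewrite mem_box /=; lia.
have [h3|h3] := boolP (c3 s t); last by left; exact: gz.
move: h3; rewrite /c3 => /andP[/andP[/eqP t0 h3] h4]; rewrite t0 g3 //; right.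
exists (- q%:R), ((s - p + 1)%N, (q - 1)%N); split=> //.
by rewrite mem_box /=; lia.
Qed.

End Plane2.

(** One formula for all three shapes, arranged without subtraction of the result; the differences p
    - a and q - b are the l P and l Q of the group. *)
Lemma milnor_value (i j : 'I_2) (p q a b mu : nat) : i != j -> (2 <= p)%N -> (2 <= q)%N -> (a <= 1)%N -> (b <= 1)%N ->
  is_milnor_number ('X_i ^+ p * 'X_j ^+ a + 'X_i ^+ b * 'X_j ^+ q : S) (origin R) mu ->
  (mu + (p - a) + (q - b) = (p - a) * (q - b) + (a + b) * (p - a + (q - b)) + 1)%N.
Proof.
move=> ij p2 q2 a1 b1; have ji : j != i by rewrite eq_sym.
case: a a1 => [|[|//]] _; case: b b1 => [|[|//]] _.
- rewrite !expr0 mulr1 mul1r => /(milnor_fermat ij p2 q2) ->.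
  case: p p2 => // p _; case: q q2 => // q _; rewrite !subn1 !subn0 /=; lia.
- rewrite expr0 expr1 mulr1 => /(milnor_chain ij p2 q2) ->.
  case: q q2 => // q _; rewrite !subn1 !subn0 /=; lia.
- rewrite expr0 expr1 mul1r addrC ['X_i ^+ p * _]mulrC => /(milnor_chain ji q2 p2) ->.
  case: p p2 => // p _; rewrite !subn1 !subn0 /=; lia.
rewrite !expr1 => /(milnor_loop ij p2 q2) ->.
case: p p2 => // p _; case: q q2 => // q _; rewrite !subn1 /=; lia.
Qed.

End MilnorValue.

(** * Homogeneous forms *)

Section LinearFactors.
Context {R : realType} (G : tpoint R -> Prop).
Local Notation S := (poly2 R).
Local Notation K := R[i].
Hypothesis Gsub : subgroup G.
Context (i j : 'I_2) (P Q : nat).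
Hypothesis ij : i != j.
Hypotheses (P0 : (0 < P)%N) (Q0 : (0 < Q)%N).
Hypothesis HG : forall a b : int, weq G (wt2 i a b) 0 <-> exists r : int, a = r * P /\ b = - (r * Q%:Z).
Local Notation x := ('X_i : S).
Local Notation y := ('X_j : S).

Definition lam (c : K) : S := x ^+ P - c *: y ^+ Q.
Lemma lamE c : lam c = x ^+ P - c *: y ^+ Q. Proof. by []. Qed.
(** A point of the curve [lam c] off the axes; the values of the other factors there are differences
    of parameters, which separates them. *)
Definition lpt (c : K) : 'I_2 -> K := zpt i (P.-root c) 1.

Lemma X_zpt (u v : K) : (x.@[zpt i u v] = u) * (y.@[zpt i u v] = v).
Proof. by rewrite !mevalXU /zpt eqxx eq_sym (negPf ij). Qed.

Lemma lam_zpt c u v : (lam c).@[zpt i u v] = u ^+ P - c * v ^+ Q.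
Proof. by rewrite /lam mevalB mevalZ !rmorphXn /= !X_zpt. Qed.

Lemma lam_lpt c d : (lam c).@[lpt d] = d - c.
Proof. by rewrite lam_zpt rootCK // expr1n mulr1. Qed.

Lemma lam_gen2 c p : gen2 (lam c) y p <-> gen2 (x ^+ P) y p.
Proof.
apply: gen2_swap_ext; exists (- c *: y ^+ Q.-1).
by rewrite /lam -scalerAr -exprS prednK // scaleNr.
Qed.

Lemma gen2_scale (c : K) (u v p : S) : c != 0 -> gen2 (c *: u) v p <-> gen2 u v p.
Proof.
move=> c0; split=> -[q [r ->]]; first by exists (c *: q), r; rewrite -scalerAl -scalerAr.
by exists (c^-1 *: q), r; rewrite -scalerAl -scalerAr scalerA divff // scale1r.
Qed.

Lemma vanish0_lam c : vanish0 (lam c).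
Proof.
have v0 k (n : nat) : (0 < n)%N -> vanish0 ('X_k ^+ n : S).
  move=> n0; rewrite /vanish0 -(prednK n0) exprS mcoeff0M mcoeffX.
  case: eqP => [/(congr1 (fun m : 'X_{1..2} => m k))|]; last by rewrite mul0r.
  by rewrite !mnmE eqxx.
by rewrite /vanish0 /lam mcoeffB mcoeffZ !v0 // mulr0 subrr.
Qed.

Section WithChi.
Context (c1 c2 : int).
Hypothesis Hchi : weq G chi (wt2 i c1 c2).

Lemma lam_weight c : has_weight G (wt2 i 0 Q) (lam c).
Proof.
have w := has_weight_mon Gsub ij P0 Q0 Hchi HG.
apply: has_weightD; last apply/has_weightN/has_weightZ.
  by rewrite -[x ^+ P]mulr1 -[X in _ * X](expr0 y); apply: (w _ _ _ (-1)); rewrite !wcE; lia.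
by rewrite -[y ^+ Q]mul1r -[X in X * _](expr0 x); apply: (w _ _ _ 0); rewrite !wcE; lia.
Qed.

Lemma lam_line c : c != 0 -> line G (lam c) (lpt c).
Proof.
move=> c0; apply: (line_lam Gsub ij P0 Q0 Hchi HG); last exact: rootCK.
by rewrite rootC_eq0.
Qed.

Lemma lam_supp c v : c != 0 -> supp G (lpt c) v <->
  exists r : int, 0 <= wc1 i c1 v - r * P /\ 0 <= wc2 i c2 v + r * Q.
Proof. by move=> c0; apply: (supp_gen Gsub ij P0 Q0 Hchi HG); rewrite rootC_eq0. Qed.

Lemma lam_ycop c : c != 0 -> cop (lam c) y.
Proof.
move=> c0; apply: (cop_line Gsub (lam_line c0) (lam_weight c) (has_weight_y Gsub ij P0 Q0 Hchi HG)).
by rewrite X_zpt oner_neq0.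
Qed.

End WithChi.

Lemma wt2_sum n (u : weight) : \sum_(0 <= k < n) u = u *+ n.
Proof. by rewrite sumr_const_nat subn0. Qed.

(** * Products with a factor xi of the weight of x, either x itself or a curve linear in x *)

Section ModeAChain.
Context (xi : S) (rho : K) (s : seq K) (e : bool) (M : nat).
Hypothesis eM : M = (size s * Q + e)%N.
Hypothesis Hchi : weq G chi (wt2 i 1 M).
Hypothesis ne : (0 < size s + e)%N.
Hypothesis s_uniq : uniq s.
Hypothesis s0 : 0 \notin s.
Hypothesis sr : rho ^+ P \notin s.
Hypothesis xi_weight : has_weight G (wt2 i 1 0) xi.
Hypothesis xi_line : line G xi (zpt i rho 1).
Hypothesis xi_supp : forall v, supp G (zpt i rho 1) v <-> exists r : int, wc1 i 1 v = r * P /\ 0 <= wc2 i M v + r * Q.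
Hypothesis xi_van : vanish0 xi.
Hypothesis xi_y : forall p, gen2 xi y p <-> gen2 x y p.

Let n := size s.
Let r := (n.+1 + e)%N.
Let l k : S := if k == 0%N then xi else if (k <= n)%N then lam s`_(k.-1) else if (k < r)%N then y else 1.
Let dl k : weight := if k == 0%N then wt2 i 1 0 else if (k <= n)%N then wt2 i 0 Q else if (k < r)%N then wt2 i 0 1 else 0.
Let z k : 'I_2 -> K := if k == 0%N then zpt i rho 1 else lpt s`_(k.-1).

Let s_in k : (0 < k)%N -> (k <= n)%N -> s`_(k.-1) \in s.
Proof. by move=> k0 kn; rewrite mem_nth // prednK. Qed.
Let s_neq0 k : (0 < k)%N -> (k <= n)%N -> s`_(k.-1) != 0.
Proof. by move=> k0 kn; apply: contraNneq s0 => <-; exact: s_in. Qed.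
Let l_mid k : (0 < k)%N -> (k <= n)%N -> l k = lam s`_(k.-1).
Proof. by rewrite /l => k0 ->; rewrite eqn0Ngt k0. Qed.
Let dl_mid k : (0 < k)%N -> (k <= n)%N -> dl k = wt2 i 0 Q.
Proof. by rewrite /dl => k0 ->; rewrite eqn0Ngt k0. Qed.
Let z_mid k : (0 < k)%N -> z k = lpt s`_(k.-1).
Proof. by rewrite /z => k0; rewrite eqn0Ngt k0. Qed.
Let mid k : (k.+1 < r)%N -> (k <= n)%N. Proof. by rewrite /r; case: e => /=; lia. Qed.
Let l_last k : (n < k)%N -> l k = if (k < r)%N then y else 1.
Proof. by rewrite /l => h; rewrite leqNgt h; case: k h. Qed.
Let dl_last k : (n < k)%N -> dl k = if (k < r)%N then wt2 i 0 1 else 0.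
Proof. by rewrite /dl => h; rewrite leqNgt h; case: k h. Qed.

Let r_e : r = if e then n.+2 else n.+1.
Proof. by rewrite /r; case: (e); rewrite ?addn1 ?addn0. Qed.

Lemma chainA_prod : \prod_(0 <= k < r) l k = xi * \prod_(c <- s) lam c * y ^+ e.
Proof.
have h : \prod_(0 <= k < n.+1) l k = xi * \prod_(c <- s) lam c.
  have eq1 : \prod_(0 <= k < n) l k.+1 = \prod_(0 <= k < n) lam s`_k.
    by apply: eq_big_nat => k /andP[_ kn]; rewrite l_mid.
  transitivity (l 0%N * \prod_(0 <= k < n) l k.+1); first by rewrite big_nat_recl.
  rewrite eq1 [in RHS](big_nth 0); exact: erefl.
have ll := @l_last n.+1 (ltnSn n); have re := r_e.
case: (e) re => /= re; rewrite re; last by rewrite h expr0 mulr1.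
by rewrite big_nat_recr //= h ll re ltnSn expr1.
Qed.

Lemma chainA_weight : \sum_(0 <= k < r) dl k = wt2 i 1 M.
Proof.
have h : \sum_(0 <= k < n.+1) dl k = wt2 i 1 (n * Q)%N.
  rewrite big_nat_recl // (eq_big_nat _ _ (F2 := fun=> wt2 i 0 Q)).
    by rewrite wt2_sum pmulrn wt2Z wt2D; congr wt2; lia.
  by move=> k /andP[_ kn]; rewrite dl_mid.
have ll := @dl_last n.+1 (ltnSn n); have re := r_e; rewrite eM.
case: (e) re => /= re; rewrite re; last by rewrite h addn0.
by rewrite big_nat_recr //= h ll re ltnSn wt2D; congr wt2; rewrite /n; lia.
Qed.

Lemma chainA_tilting : has_tilting_of_length G (xi * \prod_(c <- s) lam c * y ^+ e)
  ((topA P Q M).+1 + (r - 2) * Q.+1).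
Proof.
have ly := lam_ycop Hchi; have r2 : (1 < r)%N by rewrite /r /n; lia.
have M0 : (0 < M)%N by rewrite eM; move: ne; case: (size s) => [|k]; case: e => //=; rewrite ?mulSn; lia.
have xn c : (xi.@[zpt i rho 1] = 0) by case: xi_line.
have xi_ycop : cop xi y.
  apply: (cop_line Gsub xi_line xi_weight (has_weight_y Gsub ij P0 Q0 Hchi HG)).
  by rewrite X_zpt oner_neq0.
have nz : xi * \prod_(c <- s) lam c * y ^+ e != 0.
  have lz c : c \in s -> lam c != 0.
    move=> cs; apply: contraNneq (oner_neq0 K) => h; have := lam_zpt c 1 0.
    by rewrite h meval0 expr1n expr0n eqn0Ngt Q0 mulr0 subr0 => <-.
  have xz : xi != 0.
    apply/eqP => h; have [a [b ey]] := (xi_y x).2 (ex_intro _ 1 (ex_intro _ 0 (etrans (esym (addr0 x)) (congr2 +%R (esym (mulr1 x)) (esym (mulr0 y)))))).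
    have := congr1 (fun p : S => p.@[zpt i 1 0]) ey; rewrite h mul0r add0r mevalM !X_zpt mul0r.
    by move/eqP; rewrite oner_eq0.
  rewrite !mulf_neq0 // ?expf_neq0 ?X_neq0 //.
  by rewrite prodf_seq_neq0; apply/allP => c /lz ->.
apply: (@modeA_tilting _ _ _ Gsub nz i j P Q M ij P0 Q0 M0 Hchi HG r l z dl r2).
- move=> k; have [k0|k0] := posnP k; first by rewrite k0.
  have [kn|kn] := leqP k n; first by rewrite l_mid // dl_mid //; exact: (lam_weight Hchi).
  rewrite l_last // dl_last //; case: ifP => _; last exact: has_weight1.
  exact: (has_weight_y Gsub ij P0 Q0 Hchi HG).
- by move=> k kr; rewrite l_last ?[(k < r)%N]ltnNge ?kr //; apply: leq_trans kr; exact: leq_addr.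
- by move=> k kr; rewrite dl_last ?[(k < r)%N]ltnNge ?kr //; apply: leq_trans kr; exact: leq_addr.
- move=> k /mid kn; have [k0|k0] := posnP k; first by rewrite k0.
  by rewrite l_mid // z_mid //; apply: (lam_line Hchi); exact: s_neq0.
- move=> a b ar ab br; have an := mid ar.
  have zy k : y.@[z k] = 1 by rewrite /z; case: ifP => _; rewrite X_zpt.
  have [bn|bn] := leqP b n; last by rewrite l_last // br zy oner_neq0.
  have b0 : (0 < b)%N by lia.
  rewrite l_mid //; have [a0|a0] := posnP a.
    rewrite a0 /z /= lam_zpt expr1n mulr1 subr_eq0; apply: contraNneq sr => ->; exact: s_in.
  rewrite z_mid // lam_lpt subr_eq0 nth_uniq //; rewrite -/n; lia.
- by rewrite chainA_prod.
- by rewrite chainA_weight; apply: weq_sym.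
- by [].
- by move=> k k0 /mid kn; rewrite dl_mid.
- exact: xi_supp.
- by move=> k k0 /mid kn v; rewrite z_mid //; apply: (lam_supp Hchi); exact: s_neq0.
- move=> k kr; have [k0|k0] := posnP k; first by rewrite k0.
  have [kn|kn] := leqP k n; first by rewrite l_mid //; exact: vanish0_lam.
  rewrite l_last // kr /vanish0 mcoeffX.
  by case: eqP => // /(congr1 (fun m : 'X_{1..2} => m j)); rewrite !mnmE eqxx.
- exact: xi_y.
- move=> k k0 /mid kn; rewrite l_mid // /lam; exists (- s`_(k.-1) *: y ^+ Q.-1).
  by rewrite -scalerAr -exprS prednK // scaleNr.
- move=> k /mid kn; have [k0|k0] := posnP k; first by rewrite k0.
  by rewrite l_mid //; apply: ly; exact: s_neq0.
case ee: e; [right|left].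
  have er : r.-1 = n.+1 by rewrite /r ee; lia.
  have lt : (n.+1 < r)%N by rewrite /r ee; lia.
  by rewrite er l_last // dl_last // lt; split=> //; rewrite eM ee /r ee -/n; congr (_ * _ + _)%N; lia.
have er : r.-1 = n by rewrite /r ee; lia.
have n0 : (0 < n)%N by move: ne; rewrite ee addn0.
rewrite er l_mid // dl_mid //; split=> //.
- by exists (- s`_(n.-1) *: y ^+ Q.-1); rewrite /lam -scalerAr -exprS prednK // scaleNr.
- by apply: ly; exact: s_neq0.
by rewrite eM ee /r ee addn0 -/n; congr (_ * _)%N; lia.
Qed.

End ModeAChain.

(** * Products of curves [lam c] alone *)

Section ModeBChain.
Context (cc : K) (s : seq K).
Hypotheses (P1 : (1 < P)%N) (Q1 : (1 < Q)%N) (n0 : (0 < size s)%N).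
Hypothesis Hchi : weq G chi (wt2 i 0 (size s * Q)%N).
Hypothesis s_uniq : uniq s.
Hypothesis s0 : 0 \notin s.
Hypothesis cc0 : cc != 0.

Let m := size s.
(** The leading constant is absorbed into the first factor, so that f is literally a product. *)
Let const k : K := if k == 0%N then cc else 1.
Let const0 k : const k != 0. Proof. by rewrite /const; case: ifP; rewrite ?oner_neq0. Qed.
Let l k : S := if (k < m)%N then const k *: lam s`_k else 1.
Let dl k : weight := if (k < m)%N then wt2 i 0 Q else 0.
Let lE k : (k < m)%N -> l k = const k *: lam s`_k. Proof. by rewrite /l => ->. Qed.
Let s_neq0 k : (k < m)%N -> s`_k != 0.
Proof. by move=> kn; apply: contraNneq s0 => <-; exact: mem_nth. Qed.

Lemma chainB_prod : \prod_(0 <= k < m) l k = cc *: \prod_(c <- s) lam c.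
Proof.
have m0 : (0 < m)%N := n0.
rewrite [in RHS](big_nth 0) -/m; transitivity (l 0%N * \prod_(1 <= k < m) l k); first exact: big_ltn.
transitivity (cc *: (lam s`_0 * \prod_(1 <= k < m) lam s`_k)); last first.
  by congr (_ *: _); apply/esym; exact: big_ltn.
have -> : l 0%N = cc *: lam s`_0 by rewrite lE.
have -> : \prod_(1 <= k < m) l k = \prod_(1 <= k < m) lam s`_k.
  by apply: eq_big_nat => k /andP[k1 km]; rewrite lE // /const eqn0Ngt k1 scale1r.
by rewrite scalerAl.
Qed.

Lemma chainB_tilting : has_tilting_of_length G (cc *: \prod_(c <- s) lam c)
  ((P - 1) * (m * Q - 1) + (m - 1) * Q.+1).
Proof.
have lz c : lam c != 0.
  apply: contraNneq (oner_neq0 K) => h; have := lam_zpt c 1 0.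
  by rewrite h meval0 expr1n expr0n eqn0Ngt Q0 mulr0 subr0 => <-.
have nz : cc *: \prod_(c <- s) lam c != 0.
  by rewrite -mul_mpolyC mulf_neq0 ?mpolyC_eq0 // prodf_seq_neq0; apply/allP => c _; exact: lz.
have hw k : has_weight G (dl k) (l k).
  rewrite /dl /l; case: ifP => _; last exact: has_weight1.
  by apply: has_weightZ; exact: (lam_weight Hchi).
have l1 k : (m <= k)%N -> l k = 1 by rewrite /l ltnNge => ->.
have d0 k : (m <= k)%N -> dl k = 0 by rewrite /dl ltnNge => ->.
have zl (c : K) (p : S) v : c != 0 -> ((c *: p).@[v] == 0) = (p.@[v] == 0).
  by move=> c0; rewrite mevalZ mulf_eq0 (negPf c0).
have g1 (c : K) (p q : S) : c != 0 -> gen1 p q -> gen1 (c *: p) q.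
  by move=> c0 [t ->]; exists (c^-1 *: t); rewrite -scalerAl -scalerAr scalerA divff // scale1r.
have g1' (c : K) (p q : S) : gen1 (c *: p) q -> gen1 p q.
  by move=> [t ->]; exists (c *: t); rewrite -scalerAl -scalerAr.
have hline k : (k.+1 < m)%N -> line G (l k) (lpt s`_k).
  move=> km; have km' := ltnW km; rewrite lE //; have [h1 h2] := lam_line Hchi (s_neq0 km').
  split; first by apply/eqP; rewrite zl // h1.
  by move=> v p hp pz; apply: g1 => //; exact: h2 hp pz.
have hsep a b : (a.+1 < m)%N -> (a < b)%N -> (b < m)%N -> (l b).@[lpt s`_a] != 0.
  move=> am ab bm; rewrite lE // zl // lam_lpt subr_eq0 nth_uniq //; rewrite -/m; lia.
have ff : cc *: \prod_(c <- s) lam c = \prod_(0 <= k < m) l k by rewrite chainB_prod.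
have fw : weq G (\sum_(0 <= k < m) dl k) chi.
  rewrite (eq_big_nat _ _ (F2 := fun=> wt2 i 0 Q)) => [|k /andP[_ km]]; last by rewrite /dl km.
  apply: weq_sym; rewrite wt2_sum pmulrn wt2Z mul0r -PoszM mulnC; exact: Hchi.
have dlk k : (k < m)%N -> dl k = wt2 i 0 Q by rewrite /dl => ->.
have supp_k k : (k.+1 < m)%N -> forall v, supp G (lpt s`_k) v <->
    exists r : int, 0 <= wc1 i 0 v - r * P /\ 0 <= wc2 i (topB Q m) v + r * Q.
  by move=> km v; apply: (lam_supp Hchi); apply: s_neq0; exact: ltnW.
have vl k : (k < m)%N -> vanish0 (l k).
  by move=> km; rewrite lE // /vanish0 mcoeffZ vanish0_lam mulr0.
have lky k : (k < m)%N -> forall p, gen2 (l k) y p <-> gen2 (x ^+ P) y p.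
  by move=> km p; rewrite lE //; apply: iff_trans (lam_gen2 _ _); exact: gen2_scale.
have lkx k : (k < m)%N -> exists c q, c != 0 /\ l k = c *: y ^+ Q + x * q.
  move=> km; exists (- (const k * s`_k)), (const k *: x ^+ P.-1); split.
    by rewrite oppr_eq0 mulf_neq0 // s_neq0.
  by rewrite lE // /lam scalerBr scalerA -scalerAr -exprS prednK // scaleNr addrC.
have ycop k : (k < m)%N -> cop (l k) y.
  move=> km; rewrite lE // => c /g1' h; apply: g1 => //; exact: (lam_ycop Hchi (s_neq0 km) h).
have [cf [A0 [cf0 hA0 fA]]] := @f_modx _ _ _ Gsub i j P Q m ij P1 Q1 Hchi HG l dl hw ff fw lkx.
exact: (@modeB_tilting _ _ _ Gsub nz i j P Q m ij P1 Q1 n0 Hchi HG l _ dl hw l1 d0 hline hsep ff fw dlk supp_k vl lky lkx ycop cf A0 cf0 hA0 fA).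
Qed.

End ModeBChain.

End LinearFactors.

(** * Binary forms from polynomials in one variable *)

Section Homogenize.
Context (C : comNzRingType) (A : comAlgType C) (X Y : A).

Definition homogenize (D : nat) (p : {poly C}) : A := \sum_(r < D.+1) p`_r *: (X ^+ r * Y ^+ (D - r)).

Lemma homogenizeZ D c p : homogenize D (c *: p) = c *: homogenize D p.
Proof. by rewrite /homogenize scaler_sumr; apply: eq_bigr => r _; rewrite coefZ scalerA. Qed.

Lemma homogenize_XsubC D z (p : {poly C}) : (size p <= D.+1)%N ->
  homogenize D.+1 (p * ('X - z%:P)) = homogenize D p * (X - z *: Y).
Proof.
move=> sp; rewrite /homogenize.
have -> : \sum_(r < D.+2) (p * ('X - z%:P))`_r *: (X ^+ r * Y ^+ (D.+1 - r)) =
    \sum_(r < D.+2) (p * 'X)`_r *: (X ^+ r * Y ^+ (D.+1 - r)) - \sum_(r < D.+2) (p`_r * z) *: (X ^+ r * Y ^+ (D.+1 - r)).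
  by rewrite -sumrB; apply: eq_bigr => r _; rewrite mulrBr coefB coefMC scalerBl.
rewrite [in RHS]mulrBr; congr (_ - _).
  rewrite big_ord_recl coefMX eqxx scale0r add0r mulr_suml; apply: eq_bigr => r _.
  rewrite lift0 coefMX /= subSS -scalerAl; congr (_ *: _).
  by rewrite exprSr mulrAC.
rewrite big_ord_recr /= nth_default // mul0r scale0r addr0 mulr_suml; apply: eq_bigr => r _.
rewrite subSn; last by rewrite -ltnS.
by rewrite -scalerAl -scalerAr scalerA exprSr mulrA.
Qed.

Lemma homogenize_prod D (s : seq C) : (size s <= D)%N ->
  homogenize D (\prod_(z <- s) ('X - z%:P)) = Y ^+ (D - size s) * \prod_(z <- s) (X - z *: Y).
Proof.
elim: s D => [|z s IH] D /=.
  move=> _; rewrite !big_nil mulr1 subn0 /homogenize big_ord_recl coef1 eqxx scale1r subn0 mul1r.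
  by rewrite big1 ?addr0 // => r _; rewrite coef1 lift0 scale0r.
case: D => // D sD; rewrite !big_cons mulrC homogenize_XsubC ?size_prod_XsubC // IH //.
by rewrite subSS [X in _ = _ * X]mulrC mulrA.
Qed.

End Homogenize.

Lemma prod_zeros (C : fieldType) (A : comAlgType C) (X Y : A) (s : seq C) :
  \prod_(z <- s) (X - z *: Y) = X ^+ (count_mem 0 s) * \prod_(z <- [seq z <- s | z != 0]) (X - z *: Y).
Proof.
elim: s => [|z s IH] /=; first by rewrite !big_nil mulr1.
rewrite big_cons IH; have [->|z0] /= := eqVneq z 0.
  by rewrite scale0r subr0 exprS mulrA.
by rewrite big_cons add0n mulrCA.
Qed.

Lemma prod_not_uniq (C : eqType) (A : comNzRingType) (F : C -> A) (s : seq C) :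
  ~~ uniq s -> exists z g, z \in s /\ \prod_(c <- s) F c = F z ^+ 2 * g.
Proof.
elim: s => // c s IH; rewrite /= negb_and negbK => /orP[cs|/IH[z [g [zs e]]]].
  exists c, (\prod_(d <- rem c s) F d); rewrite mem_head; split=> //.
  by rewrite big_cons (perm_big _ (perm_to_rem cs)) big_cons mulrA.
by exists z, (F c * g); rewrite inE zs orbT big_cons e mulrCA.
Qed.

(** All first derivatives of u^2 g are multiples of u; so a repeated factor is singular along its
    whole zero set. *)
Lemma singular_square {R : realType} (u g : poly2 R) z : u.@[z] = 0 -> singular_at (u ^+ 2 * g) z.
Proof.
move=> uz; split=> [|k]; rewrite expr2; first by rewrite !mevalM uz !mul0r.
by rewrite !mderivM mevalD !mevalM mevalD !mevalM uz !(mul0r, mulr0) !addr0 mul0r.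
Qed.

(** * Forms of the weight of w as products *)

Section Factorization.
Context {R : realType} (G : tpoint R -> Prop).
Local Notation S := (poly2 R).
Local Notation K := R[i].
Hypothesis Gsub : subgroup G.

Section OneSide.
Context (i j : 'I_2) (P Q : nat) (l a b : nat).
Hypothesis ij : i != j.
Hypotheses (P0 : (0 < P)%N) (Q0 : (0 < Q)%N) (l0 : (0 < l)%N) (a1 : (a <= 1)%N) (b1 : (b <= 1)%N).
Hypotheses (p2 : (2 <= a + l * P)%N) (q2 : (2 <= b + l * Q)%N).
Hypothesis Hchi : weq G chi (wt2 i a (b + l * Q)%N).
Hypothesis HG : forall a b : int, weq G (wt2 i a b) 0 <-> exists r : int, a = r * P /\ b = - (r * Q%:Z).
Context (f : S).
Hypothesis hf : has_weight G chi f.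
Hypothesis iso : only_isolated_singularity_origin f.
Local Notation x := ('X_i : S).
Local Notation y := ('X_j : S).
Local Notation lam := (@lam R i j P Q).

(** As a <= 1, the quotient of a by P is nonzero only for P = 1. Then x is itself an x^P and is
    counted among the D factors; likewise for y. *)
Let e1 := (a %% P)%N.
Let e2 := (b %% Q)%N.
Let D := (l + a %/ P + b %/ Q)%N.
Let mr (r : nat) := mon i j (e1 + r * P) (e2 + (D - r) * Q).

Let mr_inj r r' : mr r = mr r' -> r = r'.
Proof.
move=> /(congr1 (fun m : 'X_{1..2} => m i)); rewrite !mon_i // => /addnI /eqP.
by rewrite eqn_pmul2r // => /eqP.
Qed.

Let f_mon m : m \in msupp f -> exists2 r, (r <= D)%N & m = mr r.
Proof.
move/has_weightP: hf => h /h/(mon_weightE Gsub ij P0 Q0 Hchi HG)[r]; rewrite !wcE => -[ea eb].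
have da := divn_eq a P; have db := divn_eq b Q.
have lp := ltn_pmod a P0; have lq := ltn_pmod b Q0.
have [r' er] : exists r' : nat, r' = (a %/ P)%:Z - r :> int.
  exists (absz ((a %/ P)%:Z - r)%R); have : 0 <= (a %/ P)%:Z - r; last by lia.
  rewrite leNgt; apply/negP => lt.
  have : (r - (a %/ P)%:Z) * P >= P%:Z by rewrite ler_peMl; lia.
  rewrite mulrBl; move: da; rewrite -/e1 in lp *; lia.
have hD : (r' <= D)%N.
  rewrite leqNgt; apply/negP => lt.
  have : (r'%:Z - D%:Z) * Q >= Q%:Z by rewrite ler_peMl; lia.
  rewrite er /D !PoszD !mulrBl !mulrDl; rewrite -/e2 in lq; move: db eb; rewrite -/e2 !PoszD; lia.
exists r' => //; rewrite [m](monE ij); congr mon.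
  have : (m i)%:Z = e1%:Z + r'%:Z * P by rewrite er mulrBl; move: da ea; rewrite -/e1; lia.
  by lia.
have eDr : (D - r')%:Z = D%:Z - r'%:Z by lia.
have : (m j)%:Z = e2%:Z + (D - r')%:Z * Q.
  by rewrite eDr er /D !PoszD !mulrBl !mulrDl; move: db eb; rewrite -/e2; lia.
by lia.
Qed.

Let f_sum : f = x ^+ e1 * y ^+ e2 * homogenize (x ^+ P) (y ^+ Q) D (\poly_(r < D.+1) f@_(mr r)).
Proof.
rewrite /homogenize mulr_sumr.
have -> : \sum_(r < D.+1) x ^+ e1 * y ^+ e2 * ((\poly_(r < D.+1) f@_(mr r))`_r *: ((x ^+ P) ^+ r * (y ^+ Q) ^+ (D - r)))
   = \sum_(r < D.+1) f@_(mr r) *: 'X_[mr r].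
  apply: eq_bigr => r _; rewrite coef_poly ltn_ord -scalerAr; congr (_ *: _).
  by rewrite /mr monX !exprD -!exprM mulrACA [(P * r)%N]mulnC [(Q * _)%N]mulnC.
apply/mpolyP => m; rewrite raddf_sum /=.
have [[r [rD em]]|no] := pselect (exists r, (r <= D)%N /\ m = mr r).
  rewrite (bigD1 (Ordinal (rD : (r < D.+1)%N))) //= mcoeffZ mcoeffX em eqxx mulr1 big1 ?addr0 // => r' ne.
  rewrite mcoeffZ mcoeffX; case: eqP => [/mr_inj e|_]; last by rewrite mulr0.
  by case/eqP: ne; apply: val_inj.
rewrite big1 => [|r _].
  by apply/eqP/negPn/negP; rewrite -mcoeff_msupp => /f_mon[r rD em]; apply: no; exists r.
rewrite mcoeffZ mcoeffX; case: eqP => [em|_]; last by rewrite mulr0.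
by case: no; exists r; rewrite -ltnS em.
Qed.

Lemma only_singular z : singular_at f z -> z i = 0 /\ z j = 0.
Proof. by move=> h; have [_ ho] := iso; rewrite !(ho _ h). Qed.

Lemma factorization : exists (c : K) (s : seq K) (m0 m1 : nat),
  [/\ [/\ c != 0, uniq s & 0 \notin s], (e1 + m0 * P <= 1)%N, (e2 + m1 * Q <= 1)%N,
      D = (size s + m0 + m1)%N
    & f = c *: (x ^+ (e1 + m0 * P) * y ^+ (e2 + m1 * Q) * \prod_(t <- s) lam t)].
Proof.
have [rs er] := closed_field_poly_normal (\poly_(r < D.+1) f@_(mr r)).
set c := lead_coef _ in er.
have f0 : f != 0.
  apply/eqP => e; have h : singular_at f (zpt i 1 1) by rewrite e; split=> [|k]; rewrite ?mderiv0 meval0.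
  have [] := only_singular h; rewrite /zpt eqxx => /eqP; by rewrite oner_eq0.
have c0 : c != 0.
  apply: contra_neq f0 => e; rewrite f_sum er e scale0r /homogenize big1 ?mulr0 // => r _.
  by rewrite coef0 scale0r.
have sD : (size rs <= D)%N.
  have := size_poly (D.+1) (fun r => f@_(mr r)); rewrite er size_scale // size_prod_XsubC.
  by rewrite ltnS.
(* Roots at zero contribute powers of x^P, a drop of the degree below D contributes powers of y^Q,
   and the other roots are the parameters of the curves. *)
set s := [seq z <- rs | z != 0]; set m0 := count_mem 0 rs; set m1 := (D - size rs)%N.
have ef : f = c *: (x ^+ (e1 + m0 * P) * y ^+ (e2 + m1 * Q) * \prod_(t <- s) lam t).
  rewrite {1}f_sum er homogenizeZ homogenize_prod // prod_zeros -scalerAr; congr (_ *: _).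
  rewrite -/m0 -/m1 -/s !exprD -!exprM [(P * _)%N]mulnC [(Q * _)%N]mulnC /lam; ring.
have sq (u g : S) z : f = u ^+ 2 * g -> u.@[z] = 0 -> z i = 0 /\ z j = 0.
  by move=> e uz; apply: only_singular; rewrite e; exact: singular_square.
have zi u v : zpt i u v i = u :> K by rewrite /zpt eqxx.
have zj u v : zpt i u v j = v :> K by rewrite /zpt eq_sym (negPf ij).
have one := oner_neq0 K.
have two (N : nat) (u g : S) : (1 < N)%N -> u ^+ N * g = u ^+ 2 * (u ^+ (N - 2) * g).
  by move=> N2; rewrite mulrA -exprD subnKC.
exists c, s, m0, m1; split=> //.
- split=> //; last by rewrite mem_filter eqxx.
  apply: contraT => /(prod_not_uniq lam)[z [g [zs e]]].
  have [] := sq (lam z) (c *: (x ^+ (e1 + m0 * P) * y ^+ (e2 + m1 * Q) * g)) (lpt i P z).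
  + by rewrite {1}ef e -!mul_mpolyC; ring.
  + by rewrite (lam_lpt _ ij P0) subrr.
  by rewrite /lpt zj => _ /eqP; rewrite (negPf one).
- rewrite leqNgt; apply/negP => h.
  have [] := sq x (c *: (x ^+ (e1 + m0 * P - 2) * y ^+ (e2 + m1 * Q) * \prod_(t <- s) lam t)) (zpt i 0 1).
  + by rewrite {1}ef -scalerAr -!mulrA (two _ _ _ h) expr2 -!mulrA.
  + by rewrite mevalXU zi.
  by rewrite zj => _ /eqP; rewrite (negPf one).
- rewrite leqNgt; apply/negP => h.
  have [] := sq y (c *: (x ^+ (e1 + m0 * P) * y ^+ (e2 + m1 * Q - 2) * \prod_(t <- s) lam t)) (zpt i 1 0).
  + by rewrite {1}ef -scalerAr -!mulrA (two _ _ _ h) mulrCA expr2 -!mulrA.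
  + by rewrite mevalXU zj.
  by rewrite zi => /eqP; rewrite (negPf one).
have hc : (m0 + count (fun z : K => z != 0)%R rs = size rs)%N := count_predC (pred1 0) rs.
by rewrite /m1 /s size_filter [(count _ _ + m0)%N]addnC hc subnKC.
Qed.

End OneSide.
End Factorization.

(** * Choice of the construction for each product *)

Section NormalForm.
Context {R : realType} (G : tpoint R -> Prop).
Local Notation S := (poly2 R).
Local Notation K := R[i].
Hypothesis Gsub : subgroup G.

Lemma line_scale (c : K) (u : S) z : c != 0 -> line G u z -> line G (c *: u) z.
Proof.
move=> c0 [h1 h2]; split; first by rewrite mevalZ h1 mulr0.
move=> v p hp /(h2 _ _ hp)[t ->]; exists (c^-1 *: t).
by rewrite -scalerAl -scalerAr scalerA divff // scale1r.
Qed.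

Section Side.
Context (i j : 'I_2) (P Q : nat).
Hypothesis ij : i != j.
Hypotheses (P0 : (0 < P)%N) (Q0 : (0 < Q)%N).
Hypothesis HG : forall a b : int, weq G (wt2 i a b) 0 <-> exists r : int, a = r * P /\ b = - (r * Q%:Z).
Context (c : K) (s : seq K) (N : nat).
Hypotheses (c0 : c != 0) (s_uniq : uniq s) (s0 : 0 \notin s).
Local Notation x := ('X_i : S).
Local Notation y := ('X_j : S).
Local Notation lamji := (@lam R j i Q P).
Local Notation lam := (@lam R i j P Q).

Lemma tilting_x (e : bool) : weq G chi (wt2 i 1 (size s * Q + e)%N) -> (0 < size s + e)%N ->
  (N + (P + Q) = size s * (P * Q + 1) + (1 + e) * (P + Q))%N ->
  has_tilting_of_length G (c *: (x * y ^+ e * \prod_(t <- s) lam t)) N.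
Proof.
move=> Hchi ne eN.
have -> : c *: (x * y ^+ e * \prod_(t <- s) lam t) = (c *: x) * \prod_(t <- s) lam t * y ^+ e.
  by rewrite -mulrA [y ^+ e * _]mulrC mulrA -!scalerAl.
have -> : N = ((topA P Q (size s * Q + e)).+1 + ((size s).+1 + e - 2) * Q.+1)%N.
  have [k ek] : exists k, (size s + e = k.+1)%N by exists (size s + e).-1; rewrite prednK.
  have -> : ((size s).+1 + e - 2 = k)%N by clear -ek; lia.
  rewrite /topA; case: (P) P0 eN => // P' _; rewrite subn1 /= => eN.
  have [[-> es]|[-> es]] : (nat_of_bool e = 1%N /\ size s = k) \/ (nat_of_bool e = 0%N /\ size s = k.+1).
    by move: ek; case: (e) => /= ek; [left|right]; lia.
    by move: eN; case: (e) es ek => /= es ek; rewrite ?es; lia.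
  by move: eN; case: (e) es ek => /= es ek; rewrite ?es; lia.
apply: (chainA_tilting Gsub ij P0 Q0 HG (xi := c *: x) (rho := 0) erefl Hchi ne s_uniq s0).
- by rewrite expr0n eqn0Ngt P0.
- exact/has_weightZ/(has_weight_x Gsub ij P0 Q0 Hchi HG).
- exact: (line_scale c0 (line_x Gsub ij P0 Q0 Hchi HG)).
- exact: (supp_x Gsub ij P0 Q0 Hchi HG).
- rewrite /vanish0 mcoeffZ mcoeffX; case: eqP => [/(congr1 (fun m : 'X_{1..2} => m i))|]; last by rewrite mulr0.
  by rewrite !mnmE eqxx.
by move=> p; exact: gen2_scale.
Qed.

(** For P = 1 the curve x - t y^Q has the weight of x, so one of the factors can take the place of
    xi. *)
Lemma tilting_linear : P = 1%N -> weq G chi (wt2 i 0 (size s * Q)%N) -> (1 < size s)%N ->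
  (N + (P + Q) = size s * (P * Q + 1))%N ->
  has_tilting_of_length G (c *: \prod_(t <- s) lam t) N.
Proof.
move=> P1 Hchi; case: s s_uniq s0 Hchi => // t s' /= /andP[ts us]; rewrite inE negb_or => /andP[t0 s0'] Hchi n2 eN.
have t0' : t != 0 by rewrite eq_sym.
rewrite big_cons scalerAl -[_ * _]mulr1 -[X in _ * X](expr0 y).
(* On G the weight (0, Q) equals (1, 0) when P = 1; exchanging one of them presents chi as (1,
   M). *)
have Hchi' : weq G chi (wt2 i 1 (size s' * Q + 0)%N).
  apply/(weqE Gsub ij P0 Q0 Hchi HG); exists (-1); rewrite !wcE P1 mulSn; lia.
have -> : N = ((topA P Q (size s' * Q + 0)).+1 + ((size s').+1 + 0 - 2) * Q.+1)%N.
  move: n2 eN; rewrite /topA P1; case: (size s') => // n _; rewrite ?addn0 !subSS ?subn0; lia.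
apply: (chainA_tilting Gsub ij P0 Q0 HG (xi := c *: lam t) (rho := t) (e := false) erefl Hchi' _ us s0').
- by rewrite addn0.
- by rewrite P1 expr1.
- apply/has_weightZ/(weq_weight _ (lam_weight Gsub ij P0 Q0 HG Hchi t)).
  apply/(weqE Gsub ij P0 Q0 Hchi HG); exists (-1); rewrite !wcE P1; lia.
- apply: (line_scale c0); apply: (line_lam Gsub ij P0 Q0 Hchi HG t0').
  by rewrite P1 expr1.
- move=> v; apply: (iff_trans (supp_gen Gsub ij P0 Q0 Hchi' HG v t0')).
  rewrite P1; split=> -[r [h1 h2]]; last by exists r; rewrite h1 subrr.
  exists (wc1 i 1 v); rewrite mulr1; split=> //; apply: le_trans h2 _.
  by rewrite lerD2l; apply: ler_wpM2r => //; rewrite mulr1 subr_ge0 in h1.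
- by rewrite /vanish0 mcoeffZ vanish0_lam // mulr0.
move=> p; apply: (iff_trans (gen2_scale _ _ _ c0)).
have e : x ^+ P = x by rewrite P1 expr1.
by rewrite -[X in _ <-> gen2 X _ _]e; exact: lam_gen2.
Qed.

Lemma lam_swap t : t != 0 -> lam t = - t *: (lamji t^-1).
Proof.
move=> t0; rewrite !lamE scalerBr scalerA mulNr divff // scaleN1r opprK scaleNr.
by rewrite addrC.
Qed.

Lemma prod_lam_swap : exists2 d : K, d != 0 &
  \prod_(t <- s) lam t = d *: \prod_(t <- [seq t^-1 | t <- s]) (lamji t).
Proof.
elim: s s0 => [|t s' IH]; first by exists 1; rewrite ?oner_neq0 // !big_nil scale1r.
rewrite inE negb_or => /andP[t0 /IH[d d0 e]]; have t0' : t != 0 by rewrite eq_sym.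
exists (- t * d); first by rewrite mulf_neq0 ?oppr_eq0.
by rewrite /= !big_cons e lam_swap // -scalerAl -scalerAr scalerA.
Qed.

Lemma inv_uniq : uniq [seq t^-1 | t <- s].
Proof. by rewrite map_inj_uniq //; exact: invr_inj. Qed.

Lemma inv_nz : 0 \notin [seq t^-1 | t <- s].
Proof.
apply/negP => /seq.mapP[t ts /eqP]; rewrite eq_sym invr_eq0 => /eqP e.
by move: s0; rewrite -e ts.
Qed.

End Side.

Lemma wt2_swap (i j : 'I_2) a b : i != j -> wt2 j a b = wt2 i b a.
Proof. by move=> ij; rewrite /wt2; have [[-> ->]|[-> ->]] := ord2_cases ij. Qed.

Theorem normal_form_tilting (i j : 'I_2) (P Q : nat) (c : K) (s : seq K) (al be N : nat) :
  i != j -> (0 < P)%N -> (0 < Q)%N ->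
  (forall a b : int, weq G (wt2 i a b) 0 <-> exists r : int, a = r * P /\ b = - (r * Q%:Z)) ->
  c != 0 -> uniq s -> 0 \notin s -> (al <= 1)%N -> (be <= 1)%N ->
  weq G chi (wt2 i al (size s * Q + be)%N) ->
  (al = 1 -> 0 < size s + be)%N -> (be = 1 -> 0 < size s + al)%N ->
  (al = 0 -> be = 0 -> [/\ 0 < size s, P = 1 -> 1 < size s & Q = 1 -> 1 < size s])%N ->
  (N + (P + Q) = size s * (P * Q + 1) + (al + be) * (P + Q))%N ->
  has_tilting_of_length G (c *: ('X_i ^+ al * 'X_j ^+ be * \prod_(t <- s) @lam R i j P Q t)) N.
Proof.
move=> ij P0 Q0 HG c0 us s0 al1 be1 Hchi hal hbe h00 eN.
have ji : j != i by rewrite eq_sym.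
have HG' (a b : int) : weq G (wt2 j a b) 0 <-> exists r : int, a = r * Q /\ b = - (r * P%:Z).
  rewrite (wt2_swap _ _ ij) HG; split=> -[r [-> ->]]; exists (- r); rewrite !mulNr ?opprK //.
have Hchi' : weq G chi (wt2 j be (size s * P + al)%N).
  rewrite (wt2_swap _ _ ij); apply/(weqE Gsub ij P0 Q0 Hchi HG); exists (- (size s)%:Z); rewrite !wcE; lia.
(* Exchanging x and y inverts the parameters; this reduces a factor y without x, or Q = 1, to the
   cases already treated. *)
have [d d0 ed] := prod_lam_swap i j P Q s0.
have szi : size [seq t^-1 | t <- s] = size s by rewrite size_map.
have eN' : (N + (Q + P) = size s * (Q * P + 1) + (al + be) * (Q + P))%N by rewrite [(Q + P)%N]addnC [(Q * P)%N]mulnC.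
have ui := inv_uniq us; have ni := inv_nz s0.
have cd0 : c * d != 0 by rewrite mulf_neq0.
case: al al1 Hchi Hchi' hal hbe h00 eN eN' => [|[|//]] _ Hchi Hchi' hal hbe h00 eN eN'.
  case: be be1 Hchi Hchi' hal hbe h00 eN eN' => [|[|//]] _ Hchi Hchi' hal hbe h00 eN eN'.
    have [n0 hP hQ] := h00 erefl erefl; rewrite !expr0 !mul1r.
    rewrite addn0 in Hchi; rewrite addn0 in Hchi'; rewrite mul0n addn0 in eN; rewrite mul0n addn0 in eN'.
    have [P1|P1] := eqVneq P 1%N; first exact: (tilting_linear ij P0 Q0 HG c0 us s0 P1 Hchi (hP P1) eN).
    have [Q1|Q1] := eqVneq Q 1%N.
      by rewrite ed scalerA; apply: (tilting_linear ji Q0 P0 HG' cd0 ui ni Q1); rewrite ?szi //; exact: hQ.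
    have P2 : (1 < P)%N by lia.
    have Q2 : (1 < Q)%N by lia.
    have -> : N = ((P - 1) * (size s * Q - 1) + (size s - 1) * Q.+1)%N.
      move: eN n0; case: (size s) => // n; case: (P) P0 => // P' _; case: (Q) Q0 => // Q' _ eN _.
      have -> : (n.+1 * Q'.+1 - 1 = n * Q'.+1 + Q')%N by rewrite mulSn; lia.
      rewrite !subn1 /=; lia.
    exact: (chainB_tilting Gsub ij P0 Q0 HG P2 Q2 n0 Hchi us s0 c0).
  rewrite ed expr0 mul1r expr1 -scalerAr scalerA.
  have := @tilting_x j i Q P ji Q0 P0 HG' (c * d) [seq t^-1 | t <- s] N cd0 ui ni false.
  rewrite szi expr0 mulr1; apply; [exact: Hchi'|by rewrite addn0 -[size s]addn0; exact: hbe|].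
  by move: eN'; clear; lia.
have := @tilting_x i j P Q ij P0 Q0 HG c s N c0 us s0 (be == 1%N).
have -> : (be == 1%N : nat) = be by case: (be) be1 => [|[|]].
by rewrite expr1; apply=> //; exact: hal.
Qed.

Theorem homogeneous_tilting (i j : 'I_2) (P Q l a b N : nat) (f : S) :
  i != j -> (0 < P)%N -> (0 < Q)%N -> (0 < l)%N -> (a <= 1)%N -> (b <= 1)%N ->
  (2 <= a + l * P)%N -> (2 <= b + l * Q)%N -> weq G chi (wt2 i a (b + l * Q)%N) ->
  (forall a b : int, weq G (wt2 i a b) 0 <-> exists r : int, a = r * P /\ b = - (r * Q%:Z)) ->
  has_weight G chi f -> only_isolated_singularity_origin f ->
  (N + (P + Q) = l * (P * Q + 1) + (a + b) * (P + Q))%N ->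
  has_tilting_of_length G f N.
Proof.
move=> ij P0 Q0 l0 a1 b1 p2 q2 Hchi HG hf iso eN.
have [c [s [m0 [m1 [[c0 us s0] hal hbe eD ->]]]]] := factorization Gsub ij P0 Q0 l0 a1 b1 p2 q2 Hchi HG hf iso.
have da := divn_eq a P; have db := divn_eq b Q.
have la := ltn_pmod a P0; have lb := ltn_pmod b Q0.
(* Either P = 1, where x may be traded for another linear factor in a deformation, or P > 1, where
   the exponent of x is that of w and m0 = 0. *)
have hP : P = 1%N /\ (a %/ P = a)%N /\ (a %% P = 0)%N \/ (1 < P)%N /\ (a %/ P = 0)%N /\ (a %% P = a)%N /\ m0 = 0%N.
  have [P1|P1] := eqVneq P 1%N; first by left; rewrite P1 divn1 modn1.
  right; have P2 : (1 < P)%N by lia.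
  have aP : (a < P)%N by clear -P2 a1; lia.
  have -> : m0 = 0%N by move: hal; case: (m0) => // m; rewrite mulSn; clear -P2; lia.
  by rewrite divn_small ?modn_small.
have hQ : Q = 1%N /\ (b %/ Q = b)%N /\ (b %% Q = 0)%N \/ (1 < Q)%N /\ (b %/ Q = 0)%N /\ (b %% Q = b)%N /\ m1 = 0%N.
  have [Q1|Q1] := eqVneq Q 1%N; first by left; rewrite Q1 divn1 modn1.
  right; have Q2 : (1 < Q)%N by lia.
  have aP : (b < Q)%N by clear -Q2 b1; lia.
  have -> : m1 = 0%N by move: hbe; case: (m1) => // m; rewrite mulSn; clear -Q2; lia.
  by rewrite divn_small ?modn_small.
move: (a %/ P)%N (a %% P)%N (b %/ Q)%N (b %% Q)%N da db la lb hP hQ hal hbe eD => da' ea db' eb da db la lb hP hQ hal hbe eD.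
have eDP := congr1 (muln^~ P) eD; have eDQ := congr1 (muln^~ Q) eD.
apply: normal_form_tilting => //.
- apply/(weqE Gsub ij P0 Q0 Hchi HG); exists (da'%:Z - m0%:Z); rewrite !wcE !mulrBl.
  by clear -da db eDQ; split; lia.
- clear -hP hQ p2 q2 l0 eD; case: hP => [[P1 [h1 h2]]|[P1 [h1 [h2 h3]]]]; case: hQ => [[Q1 [h4 h5]]|[Q1 [h4 [h5 h6]]]]; subst; lia.
- clear -hP hQ p2 q2 l0 eD; case: hP => [[P1 [h1 h2]]|[P1 [h1 [h2 h3]]]]; case: hQ => [[Q1 [h4 h5]]|[Q1 [h4 [h5 h6]]]]; subst; lia.
- clear -hP hQ p2 q2 l0 eD; case: hP => [[P1 [h1 h2]]|[P1 [h1 [h2 h3]]]]; case: hQ => [[Q1 [h4 h5]]|[Q1 [h4 [h5 h6]]]]; subst => e1 e2; split; lia.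
rewrite eN; clear -hP hQ eD eDP eDQ.
by case: hP => [[P1 [h1 h2]]|[P1 [h1 [h2 h3]]]]; case: hQ => [[Q1 [h4 h5]]|[Q1 [h4 [h5 h6]]]]; subst; nia.
Qed.

End NormalForm.

Lemma poly_of_matrix_rows {R : realType} (A : 'M[nat]_2) (r0 r1 : 'I_2) : r0 != r1 ->
  poly_of_matrix R A = 'X_0 ^+ A r0 0 * 'X_1 ^+ A r0 1 + 'X_0 ^+ A r1 0 * 'X_1 ^+ A r1 1.
Proof.
by move=> r01; rewrite poly_of_matrixE /rowm !monX; have [[-> ->]|[-> ->]] := ord2_cases r01; rewrite // addrC.
Qed.

(** Substituting mu in (mu - 1) / l + l cancels the factor l and leaves l (P Q + 1) + (a + b - 1) (P
    + Q), a nonnegative integer. *)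
Lemma tilting_length (P Q l a b mu : nat) : (0 < P)%N -> (0 < Q)%N -> (0 < l)%N -> (2 <= a + l * P)%N -> (2 <= b + l * Q)%N ->
  (mu + l * P + l * Q = l * P * (l * Q) + (a + b) * (l * P + l * Q) + 1)%N ->
  exists n : nat, n%:R = (mu%:R - 1) / l%:R + l%:R :> rat /\ (n + (P + Q) = l * (P * Q + 1) + (a + b) * (P + Q))%N.
Proof.
move=> P0 Q0 l0 p2 q2 emu.
have le : (P + Q <= l * (P * Q + 1) + (a + b) * (P + Q))%N.
  case: (a + b)%N => [|k]; last by rewrite mulSn; lia.
  by rewrite mul0n addn0; nia.
exists (l * (P * Q + 1) + (a + b) * (P + Q) - (P + Q))%N; rewrite subnK //; split=> //.
have l0' : (l%:R : rat) != 0 by rewrite pnatr_eq0 -lt0n.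
have e1 : (mu%:R + l%:R * P%:R + l%:R * Q%:R = l%:R * P%:R * (l%:R * Q%:R) + (a%:R + b%:R) * (l%:R * P%:R + l%:R * Q%:R) + 1 :> rat).
  by rewrite -!natrM -!natrD -!natrM -!natrD emu natrD.
rewrite natrB // !natrD !natrM !natrD natrM.
have -> : mu%:R = l%:R * P%:R * (l%:R * Q%:R) + (a%:R + b%:R) * (l%:R * P%:R + l%:R * Q%:R) + 1 - l%:R * P%:R - l%:R * Q%:R :> rat.
  by rewrite -e1; ring.
by field.
Qed.

Theorem corollary1 (R : realType) (A : 'M[nat]_2) (d1 d2 h : nat)
    (G : tpoint R -> Prop) (l mu : nat) :
  invertible_polynomial R A ->
  quasi_homogeneous (poly_of_matrix R A) d1 d2 h ->
  admissible A d1 d2 h G ->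
  has_index (max_symmetry_group A) G l ->
  is_milnor_number (poly_of_matrix R A^T) (origin R) mu ->
  exists n : nat,
    n%:R = (mu%:R - 1) / l%:R + l%:R :> rat /\
    has_tilting_of_length G (poly_of_matrix R A) n /\
    forall (N : nat) (g : 'I_N -> 'X_{1..2}) (eps : 'I_N -> R[i]),
      jacobian_monomials G (poly_of_matrix R A) g ->
      let w_eps := poly_of_matrix R A + \sum_(i < N) eps i *: 'X_[g i] in
      only_isolated_singularity_origin w_eps ->
      has_tilting_of_length G w_eps n.
Proof.
move=> hinv [d10 d20 _] hadm hidx hmu.
have [r0 [r1 [r01 a1 b1 p2 q2]]] := classification hinv d10 d20 hadm.
have ap := leq_ltn_trans a1 p2; have bq := leq_ltn_trans b1 q2.
have ij : o0 != o1 by [].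
have [P [Q [eP eQ l0 Hchi HG]]] := group_data ij r01 d10 d20 ap bq hadm hidx.
have P0 : (0 < P)%N by move: eP ap; case: (P) => //; rewrite muln0; lia.
have Q0 : (0 < Q)%N by move: eQ bq; case: (Q) => //; rewrite muln0; lia.
have ep : A r0 o0 = (A r1 o0 + l * P)%N by rewrite -eP subnKC // ltnW.
have eq : A r1 o1 = (A r0 o1 + l * Q)%N by rewrite -eQ subnKC // ltnW.
have Gsub : subgroup G by case: hadm.
have deg := row_degrees hadm.
have emu : (mu + l * P + l * Q = l * P * (l * Q) + (A r1 o0 + A r0 o1) * (l * P + l * Q) + 1)%N.
  have r10 : r1 != r0 by rewrite eq_sym.
  rewrite -eP -eQ; apply: (milnor_value (R := R) r01 p2 q2 a1 b1); move: hmu.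
  rewrite (poly_of_matrix_rows A^T ij) !mxE.
  have [[-> ->]|[-> ->]] := ord2_cases r01; first by [].
  by rewrite ['X_0 ^+ A o0 o0 * _]mulrC ['X_0 ^+ A o0 o1 * _]mulrC.
have [n [en eN]] := tilting_length P0 Q0 l0 (leq_trans p2 (eq_leq ep)) (leq_trans q2 (eq_leq eq)) emu.
(* The length depends only on P, Q, l and the exponents a, b, so the same n serves w and all of its
   deformations. *)
have tilt f : has_weight G chi f -> only_isolated_singularity_origin f -> has_tilting_of_length G f n.
  move=> h1 h2; have p2' := leq_trans p2 (eq_leq ep); have q2' := leq_trans q2 (eq_leq eq).
  exact: (homogeneous_tilting Gsub ij P0 Q0 l0 a1 b1 p2' q2' Hchi HG h1 h2 eN).
have hw : has_weight G chi (poly_of_matrix R A).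
  have w := has_weight_mon Gsub ij P0 Q0 Hchi HG.
  rewrite (poly_of_matrix_rows A r01) ep eq; apply: has_weightD.
    by apply: (w _ _ _ (- l%:Z)); rewrite !wcE; lia.
  by apply: (w _ _ _ 0); rewrite !wcE; lia.
exists n; split=> //; split.
  have hi : isolated_singularity (poly_of_matrix R A) (origin R) by case: hinv.
  exact: (tilt _ hw (only_isolated hi d10 d20 deg)).
move=> N g eps [hg _ _] w_eps hiso; apply: (tilt _ _ hiso).
by apply: has_weightD => //; apply: has_weight_sum => k _; apply: has_weightZ; exact: hg.
Qed.
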